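(* Let $\mathcal{A}$ be a $\sigma$-unital simple separable C*-algebra with real rank zero, stable rank one, and strict comparison of projections, and assume that $T(\mathcal{A})$ has a finite number of extremal points. Then an element $a\in\mathcal{A}$ is a linear combination of projections in $\mathcal{A}$ if and only if $\bar\tau(R_a)<\infty$ for all $\tau\in T(\mathcal{A})$.
   Context: If $\mathcal{A}$ is unital, $T(\mathcal{A})$ is the set of tracial states of $\mathcal{A}$ with the weak* topology. If $\mathcal{A}$ is simple, $\sigma$-unital, not unital, of real rank zero, let $\widetilde T(\mathcal{A})$ be the set of nonzero lower semicontinuous, semifinite (densely defined) tracial weights $\tau:\mathcal{A}_+\to[0,\infty]$, i.e. $\tau$ is additive, positively homogeneous, $\tau(xx^* )=\tau(x^*x)$ for all $x\in\mathcal{A}$, and $\{a\in\mathcal{A}:\tau(a^*a)<\infty\}$ is dense in $\mathcal{A}$. Such weights are faithful and finite on projections. For every nonzero projection $e\in\mathcal{A}$, every tracial state of $e\mathcal{A}e$ extends uniquely to an element of $\widetilde T(\mathcal{A})$, so that the tracial simplex $T(e\mathcal{A}e)$ is identified with $\{\tau/\tau(e):\tau\in\widetilde T(\mathcal{A})\}$. One fixes such an $e$ and writes $T(\mathcal{A})$ for the compact convex set $T(e\mathcal{A}e)$, viewing its elements as weights on $\mathcal{A}$ (the conditions used here do not depend on the choice of $e$). For projections $p,q\in\mathcal{A}$, $p\prec q$ means that $p$ is Murray-von Neumann equivalent to a proper subprojection of $q$. $\mathcal{A}$ has strict comparison of projections if $T(\mathcal{A})\neq\emptyset$ and, for any projections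 $p,q\in\mathcal{A}$, $\tau(p)<\tau(q)$ for all $\tau\in T(\mathcal{A})$ implies $p\prec q$. For $\tau\in T(\mathcal{A})$, $\bar\tau$ denotes the unique extension of $\tau$ to a normal (tracial) weight on the enveloping von Neumann algebra $\mathcal{A}^{**}$. For $a\in\mathcal{A}$, $R_a\in\mathcal{A}^{**}$ denotes the range projection of $a$. *)

(* Defs.v *)
From HB Require Import structures.
From mathcomp Require Import all_boot all_order all_algebra.
From mathcomp Require Import complex ring.
From mathcomp Require Import all_classical all_reals all_analysis.

Set Implicit Arguments.
Unset Strict Implicit.
Unset Printing Implicit Defensive.

Import Order.TTheory GRing.Theory Num.Theory.
Import numFieldNormedType.Exports.

Local Open Scope classical_set_scope.
Local Open Scope ring_scope.
Local Open Scope complex_scope.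

(* MathComp rings are unital, so the (possibly missing-unit) product of a      *)
(* C*-algebra is a separate operation.  The structure below carries only the   *)
(* operations, so that projections, positivity, weights, etc. are defined      *)
(* once for a C*-algebra, its unitization and its bidual.                      *)
HB.mixin Record hasMulStar (V : Type) := {
  amul : V -> V -> V;
  astar : V -> V }.

#[short(type="starLmodType")]
HB.structure Definition StarLmodule (K : pzRingType) :=
  { V of GRing.Lmodule K V & hasMulStar V }.

Notation "x · y" := (amul x y) (at level 40, left associativity) : ring_scope.
Notation "x ^†" := (astar x) (at level 2, format "x ^†") : ring_scope.

HB.mixin Record isCStarAlgebra (R : realType) A
    of CompleteNormedModule R[i] A & hasMulStar A := {
  amulA : forall x y z : A, x · (y · z) = (x · y) · z;
  amulDl : forall x y z : A, (x + y) · z = x · z + y · z;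
  amulDr : forall x y z : A, x · (y + z) = x · y + x · z;
  amulZl : forall (k : R[i]) (x y : A), (k *: x) · y = k *: (x · y);
  amulZr : forall (k : R[i]) (x y : A), x · (k *: y) = k *: (x · y);
  astarK : forall x : A, x^†^† = x;
  astarD : forall x y : A, (x + y)^† = x^† + y^†;
  astarZ : forall (k : R[i]) (x : A), (k *: x)^† = k^* *: x^†;
  astarM : forall x y : A, (x · y)^† = y^† · x^†;
  amul_normM : forall x y : A, `|x · y| <= `|x| * `|y|;
  astar_norm : forall x : A, `|x^† · x| = `|x| ^+ 2 }.

#[short(type="cstarAlgType")]
HB.structure Definition CStarAlgebra (R : realType) :=
  { A of CompleteNormedModule R[i] A & hasMulStar A & isCStarAlgebra R A }.

Section StarNotions.
Context {R : realType} {B : starLmodType R[i]}.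
Implicit Types x y p q u : B.

Definition is_unit u := forall x, u · x = x /\ x · u = x.
Definition invertible u x := exists y, x · y = u /\ y · x = u.
Definition selfadjoint x := x^† = x.
Definition positive x := exists y, x = y^† · y.
Definition ale x y := positive (y - x).
Definition projection p := p^† = p /\ p · p = p.
Definition subprojection p q := [/\ projection p, projection q & q · p = p].
Definition mvn_equiv p q := exists v, v^† · v = p /\ v · v^† = q.
Definition mvn_prec p q := exists r, [/\ subprojection r q, r != q & mvn_equiv p r].

Definition combination_of_projections x :=
  exists (n : nat) (c : 'I_n -> R[i]) (p : 'I_n -> B),
    (forall i, projection (p i)) /\ x = \sum_(i < n) c i *: p i.

Definition is_range_projection x p :=
  [/\ projection p, p · x = x
    & forall q, projection q -> q · x = x -> subprojection p q].

(* A weight lives on the positive cone; as a total function it is given the    *)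
(* value 0 off the cone, so that equality of functions is equality of weights. *)
Definition tracial_weight (w : B -> \bar R) :=
  [/\ forall x, positive x -> (0 <= w x)%E,
      forall x, ~ positive x -> w x = 0%E,
      forall x y, positive x -> positive y -> w (x + y) = (w x + w y)%E,
      forall (t : R) x, 0 <= t -> positive x -> w (t%:C *: x) = (t%:E * w x)%E
    & forall x, w (x · x^†) = w (x^† · x)].

Definition is_lub (D : set B) x :=
  (forall d, D d -> ale d x) /\
  (forall y, (forall d, D d -> ale d y) -> ale x y).

Definition up_directed (D : set B) :=
  forall x y, D x -> D y -> exists z, [/\ D z, ale x z & ale y z].

Definition normal_weight (w : B -> \bar R) :=
  forall (D : set B) x, D !=set0 -> D `<=` positive -> up_directed D ->
    is_lub D x -> w x = ereal_sup (w @` D).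

Definition norm_dense (N : B -> R) (S T : set B) :=
  forall x, T x -> forall eps : R, 0 < eps -> exists2 y, S y & N (x - y) < eps.

End StarNotions.

(* The norms of the library on a complex normed space take values in R[i]. *)
Definition rnorm {R : realType} {V : normedZmodType R[i]} (x : V) : R :=
  complex.Re `|x|.

Section RNormTheory.
Context {R : realType} {V : normedZmodType R[i]}.

Lemma rnormE (x : V) : `|x| = (rnorm x)%:C.
Proof. by rewrite /rnorm RRe_real // ger0_real. Qed.

Lemma rnorm_ge0 (x : V) : 0 <= rnorm x.
Proof. by rewrite -lecR -rnormE rmorph0. Qed.

Lemma rnorm0 : rnorm (0 : V) = 0.
Proof. by rewrite /rnorm normr0. Qed.

Lemma rnormD (x y : V) : rnorm (x + y) <= rnorm x + rnorm y.
Proof. by rewrite -lecR rmorphD /= -!rnormE ler_normD. Qed.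

End RNormTheory.

Lemma rnormM {R : realType} (x y : R[i]) : rnorm (x * y) = rnorm x * rnorm y.
Proof. by apply: complexI; rewrite rmorphM /= -!rnormE normrM. Qed.

Lemma rnormZ {R : realType} (V : normedModType R[i]) (k : R[i]) (x : V) :
  rnorm (k *: x) = rnorm k * rnorm x.
Proof. by apply: complexI; rewrite rmorphM /= -!rnormE normrZ. Qed.

Definition op_norm {R : realType} {V : Type} {W : normedZmodType R[i]}
    (N : V -> R) (f : V -> W) : R :=
  sup [set rnorm (f x) | x in [set x | N x <= 1]].

Section Functionals.
Context {R : realType} {V : lmodType R[i]} (N : V -> R).

Definition bounded_functional (f : V -> R[i]) :=
  (forall (k : R[i]) x y, f (k *: x + y) = k * f x + f y) /\
  (exists M : R, forall x, rnorm (f x) <= M * N x).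

Definition bounded_functional_pred : {pred V -> R[i]} :=
  fun f => `[< bounded_functional f >].

Lemma bounded_functional_submod : submod_closed bounded_functional_pred.
Proof.
split=> [|k f g].
  rewrite unfold_in; apply/asboolP; split=> [k x y|].
    by rewrite [RHS](_ : _ = k * 0 + 0) // mulr0 addr0.
  by exists 0 => x; rewrite [leLHS](_ : _ = rnorm (0 : R[i])) // rnorm0 mul0r.
rewrite !unfold_in => /asboolP[lf [M Mf]] /asboolP[lg [M' Mg]].
apply/asboolP; have E x : (k *: f + g) x = k * f x + g x by [].
split=> [l x y|]; first by rewrite !E lf lg; ring.
exists (rnorm k * M + M') => x; rewrite E mulrDl -mulrA.
rewrite (le_trans (rnormD _ _)) // lerD // rnormM.
by rewrite ler_wpM2l ?rnorm_ge0.
Qed.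

HB.instance Definition _ :=
  GRing.isSubmodClosed.Build _ _ bounded_functional_pred bounded_functional_submod.

Record functional :=
  Functional { fval :> V -> R[i]; _ : fval \in bounded_functional_pred }.

HB.instance Definition _ := [isSub for fval].
HB.instance Definition _ := [Choice of functional by <:].
HB.instance Definition _ := [SubChoice_isSubLmodule of functional by <:].

Lemma functionalP (F : functional) : bounded_functional F.
Proof. by case: F => f /= /asboolP. Qed.

End Functionals.

Section FunctionalTheory.
Context {R : realType} {V : lmodType R[i]} (N : V -> R).
Hypothesis N_ge0 : forall x, 0 <= N x.
Implicit Types f : functional N.

Lemma functionalD f x y : f (x + y) = f x + f y.
Proof. by have [lf _] := functionalP f; rewrite -[x]scale1r lf mul1r scale1r. Qed.

Lemma functional0 f : f 0 = 0.
Proof. by apply: (addrI (f 0)); rewrite -functionalD !addr0. Qed.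

Lemma functionalZ f k x : f (k *: x) = k * f x.
Proof.
by have [lf _] := functionalP f; rewrite -[k *: x]addr0 lf functional0 addr0.
Qed.

Lemma functional_bound f :
  exists2 M, 0 <= M & forall x, rnorm (f x) <= M * N x.
Proof.
have [_ [M Mf]] := functionalP f; exists `|M| => // x.
by rewrite (le_trans (Mf x)) // ler_wpM2r // ler_norm.
Qed.

Lemma op_norm_ub f x : N x <= 1 -> rnorm (f x) <= op_norm N f.
Proof.
move=> Nx; have [M M0 Mf] := functional_bound f.
apply: ub_le_sup; last by exists x.
exists M => _ [y /= Ny <-]; rewrite (le_trans (Mf y)) //.
by rewrite -[leRHS]mulr1 ler_wpM2l.
Qed.

Lemma op_norm_ge0 (f : V -> R[i]) : 0 <= op_norm N f.
Proof.
rewrite /op_norm; set S := (X in sup X).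
have [hS|hS] := pselect (has_sup S); last by rewrite sup_out.
have [[_ [x Nx _]] ub] := hS.
by apply: (le_trans (rnorm_ge0 (f x))); apply: ub_le_sup => //; exists x.
Qed.

Lemma op_norm_le (f : V -> R[i]) K : 0 <= K ->
  (forall x, N x <= 1 -> rnorm (f x) <= K) -> op_norm N f <= K.
Proof.
move=> K0 fK; rewrite /op_norm; set S := (X in sup X).
have [->|/set0P ne] := eqVneq S set0; first by rewrite sup0.
by apply: ge_sup => // _ [y /= Ny <-]; exact: fK.
Qed.

End FunctionalTheory.

Lemma functional_addE {R : realType} {V : lmodType R[i]} {N : V -> R}
  (f g : functional N) x : (f + g) x = f x + g x.
Proof. by []. Qed.

Lemma functional_scaleE {R : realType} {V : lmodType R[i]} {N : V -> R}
  k (f : functional N) x : (k *: f) x = k * f x.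
Proof. by []. Qed.

Section CStarTheory.
Context {R : realType} {A : cstarAlgType R}.
Implicit Types x y : A.

Lemma amul_rnormM x y : rnorm (x · y) <= rnorm x * rnorm y.
Proof. by rewrite -lecR rmorphM /= -!rnormE amul_normM. Qed.

Lemma astar_rnorm x : rnorm x^† <= rnorm x.
Proof.
have [->|x0] := eqVneq (rnorm x^†) 0; first exact: rnorm_ge0.
have xp : 0 < rnorm x^† by rewrite lt_neqAle eq_sym x0 rnorm_ge0.
have : rnorm (x^†^† · x^†) = rnorm x^† ^+ 2.
  by apply: complexI; rewrite rmorphXn /= -!rnormE astar_norm.
rewrite astarK => E; rewrite -(ler_pM2r xp) -expr2 -E.
exact: amul_rnormM.
Qed.

End CStarTheory.

Definition dual {R : realType} (A : cstarAlgType R) := functional (@rnorm R A).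
HB.instance Definition _ R A := GRing.Lmodule.on (@dual R A).

Definition dual_norm {R : realType} {A : cstarAlgType R} (f : dual A) : R :=
  op_norm rnorm f.

(* The enveloping von Neumann algebra A** of a C*-algebra A, as the Banach     *)
(* space bidual of A with the (first) Arens product.                           *)
Definition bidual {R : realType} (A : cstarAlgType R) :=
  functional (@dual_norm R A).
HB.instance Definition _ R A := GRing.Lmodule.on (@bidual R A).

Section Arens.
Context {R : realType} {A : cstarAlgType R}.
Implicit Types (a b : A) (f : dual A) (F G : bidual A).

Let rn0 (x : A) : 0 <= rnorm x. Proof. exact: rnorm_ge0. Qed.
Let dn0 f : 0 <= dual_norm f. Proof. exact: op_norm_ge0. Qed.

Let dual_mulr_subproof f a :
  (fun b => f (a · b)) \in bounded_functional_pred (@rnorm R A).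
Proof.
apply/asboolP; split=> [k x y|].
  by rewrite amulDr amulZr functionalD functionalZ.
have [M M0 Mf] := functional_bound rn0 f.
exists (M * rnorm a) => x; rewrite (le_trans (Mf _)) // -mulrA.
by rewrite ler_wpM2l // amul_rnormM.
Qed.

(* (f a)(b) = f(ab) *)
Definition dual_mulr f a : dual A := Functional (dual_mulr_subproof f a).

Let dual_mulr_lin f k x y :
  dual_mulr f (k *: x + y) = k *: dual_mulr f x + dual_mulr f y.
Proof.
apply/val_inj/funext => b; rewrite /= amulDl amulZl functionalD functionalZ.
by [].
Qed.

Let dual_mulr_linf k f g x :
  dual_mulr (k *: f + g) x = k *: dual_mulr f x + dual_mulr g x.
Proof. exact/val_inj/funext. Qed.

Let dual_mulr_norm f a M : 0 <= M -> (forall x, rnorm (f x) <= M * rnorm x) ->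
  dual_norm (dual_mulr f a) <= M * rnorm a.
Proof.
move=> M0 Mf; apply: op_norm_le => [|b b1 /=]; first by rewrite mulr_ge0.
rewrite (le_trans (Mf _)) // ler_wpM2l // (le_trans (amul_rnormM _ _)) //.
by rewrite -[leRHS]mulr1 ler_wpM2l.
Qed.

Let dual_mulr_norm1 f a : rnorm a <= 1 ->
  dual_norm (dual_mulr f a) <= dual_norm f.
Proof.
move=> a1; apply: op_norm_le => // b b1 /=; apply: op_norm_ub => //.
by rewrite (le_trans (amul_rnormM _ _)) // mulr_ile1.
Qed.

Let bidual_act_subproof G f :
  (fun a => G (dual_mulr f a)) \in bounded_functional_pred (@rnorm R A).
Proof.
apply/asboolP; split=> [k x y|].
  by rewrite dual_mulr_lin functionalD functionalZ.
have [M M0 Mf] := functional_bound rn0 f.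
have [K K0 KG] := functional_bound dn0 G.
exists (K * M) => x; rewrite (le_trans (KG _)) // -mulrA ler_wpM2l //.
exact: dual_mulr_norm.
Qed.

(* (G f)(a) = G(f a) *)
Definition bidual_act G f : dual A := Functional (bidual_act_subproof G f).

Let arens_subproof F G :
  (fun f => F (bidual_act G f)) \in bounded_functional_pred (@dual_norm R A).
Proof.
apply/asboolP; split=> [k f g|].
  rewrite [bidual_act _ _](_ : _ = k *: bidual_act G f + bidual_act G g).
    by rewrite functionalD functionalZ.
  apply/val_inj/funext => a.
  by rewrite /= dual_mulr_linf functionalD functionalZ.
have [M M0 MF] := functional_bound dn0 F.
have [K K0 KG] := functional_bound dn0 G.
exists (M * K) => f; rewrite (le_trans (MF _)) // -mulrA ler_wpM2l //.
apply: op_norm_le => [|a a1]; first by rewrite mulr_ge0.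
by rewrite (le_trans (KG _)) // ler_wpM2l // dual_mulr_norm1.
Qed.

(* (F G)(f) = F(G f) *)
Definition arens F G : bidual A := Functional (arens_subproof F G).

Let dual_star_subproof f :
  (fun a => (f a^†)^*) \in bounded_functional_pred (@rnorm R A).
Proof.
apply/asboolP; split=> [k x y|].
  rewrite astarD astarZ functionalD functionalZ rmorphD rmorphM /=.
  by rewrite conjcK.
have [M M0 Mf] := functional_bound rn0 f; exists M => x.
rewrite [leLHS](_ : _ = rnorm (f x^†)); last by rewrite /rnorm norm_conjC.
by rewrite (le_trans (Mf _)) // ler_wpM2l // astar_rnorm.
Qed.

Definition dual_star f : dual A := Functional (dual_star_subproof f).

Let bidual_star_subproof F :
  (fun f => (F (dual_star f))^*) \in bounded_functional_pred (@dual_norm R A).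
Proof.
apply/asboolP; split=> [k f g|].
  rewrite [dual_star _](_ : _ = k^* *: dual_star f + dual_star g).
    by rewrite functionalD functionalZ rmorphD rmorphM /= conjcK.
  by apply/val_inj/funext => a; rewrite /= rmorphD rmorphM.
have [M M0 MF] := functional_bound dn0 F; exists M => f.
rewrite [leLHS](_ : _ = rnorm (F (dual_star f))); last by rewrite /rnorm norm_conjC.
rewrite (le_trans (MF _)) // ler_wpM2l //; apply: op_norm_le => // a a1 /=.
rewrite [leLHS](_ : _ = rnorm (f a^†)); last by rewrite /rnorm norm_conjC.
by apply: op_norm_ub => //; rewrite (le_trans (astar_rnorm _)).
Qed.

Definition bidual_star F : bidual A := Functional (bidual_star_subproof F).

HB.instance Definition _ := hasMulStar.Build (bidual A) arens bidual_star.

Let bidual_embed_subproof a :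
  (fun f : dual A => f a) \in bounded_functional_pred (@dual_norm R A).
Proof.
apply/asboolP; split=> // ; exists (rnorm a) => f.
have [a0|a0] := eqVneq (rnorm a) 0.
  rewrite a0 mul0r; have [M M0 Mf] := functional_bound rn0 f.
  by rewrite (le_trans (Mf _)) // a0 mulr0.
have ap : 0 < rnorm a by rewrite lt_neqAle eq_sym a0 rn0.
have rC (t : R) : 0 <= t -> rnorm t%:C = t by move=> t0; rewrite /rnorm ger0_norm // lecR.
have ai : 0 <= (rnorm a)^-1 by rewrite invr_ge0.
have := @op_norm_ub _ _ _ rn0 f ((rnorm a)^-1%:C *: a).
rewrite rnormZ functionalZ rnormM rC // mulVf // lexx => /(_ isT).
by rewrite -(ler_pM2l ap) mulrA divff // mul1r.
Qed.

Definition bidual_embed a : bidual A := Functional (bidual_embed_subproof a).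

End Arens.

Lemma bidual_embedM {R : realType} (A : cstarAlgType R) (a b : A) :
  bidual_embed (a · b) = bidual_embed a · bidual_embed b.
Proof. exact/val_inj/funext. Qed.

Lemma bidual_embed_star {R : realType} (A : cstarAlgType R) (a : A) :
  bidual_embed a^† = (bidual_embed a)^†.
Proof. by apply/val_inj/funext => f /=; rewrite conjcK. Qed.

(* The unitization A + C of A; its C*-norm below is that of the left           *)
(* multiplication operators on A, and is a norm only when A is not unital.     *)
Definition unitization {R : realType} (A : cstarAlgType R) := (A * R[i])%type.
HB.instance Definition _ R A := GRing.Lmodule.on (@unitization R A).

Section Unitization.
Context {R : realType} {A : cstarAlgType R}.
Implicit Types x y : unitization A.

Definition unitization_mul x y : unitization A :=
  (x.1 · y.1 + x.2 *: y.1 + y.2 *: x.1, x.2 * y.2).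
Definition unitization_star x : unitization A := (x.1^†, x.2^*).

HB.instance Definition _ :=
  hasMulStar.Build (unitization A) unitization_mul unitization_star.

Definition unitization_one : unitization A := (0, 1).
Definition unitization_norm x : R :=
  op_norm rnorm (fun b : A => x.1 · b + x.2 *: b).

End Unitization.

Section CStarProperties.
Context {R : realType} (A : cstarAlgType R).

Definition unital := exists u : A, is_unit u.

Definition closed_ideal (I : set A) :=
  [/\ closed I, I 0,
      forall x y, I x -> I y -> I (x + y),
      forall (k : R[i]) x, I x -> I (k *: x)
    & forall a x, I x -> I (a · x) /\ I (x · a)].

Definition simple_cstar :=
  (exists x : A, x != 0) /\
  (forall I, closed_ideal I -> I = [set 0] \/ I = setT).

Definition separable := exists D : set A, countable D /\ dense D.

Definition sigma_unital := exists u : nat -> A,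
  [/\ forall n, positive (u n) /\ `|u n| <= 1,
      forall n, ale (u n) (u n.+1)
    & forall x, (u n · x @[n --> \oo] --> x) /\ (x · u n @[n --> \oo] --> x)].

Definition real_rank_zero :=
  (forall u : A, is_unit u ->
     norm_dense rnorm [set x | selfadjoint x /\ invertible u x] selfadjoint) /\
  (~ unital ->
     norm_dense (@unitization_norm R A)
       [set x | selfadjoint x /\ invertible unitization_one x] selfadjoint).

Definition stable_rank_one :=
  (forall u : A, is_unit u -> norm_dense rnorm (invertible u) setT) /\
  (~ unital ->
     norm_dense (@unitization_norm R A) (invertible unitization_one) setT).

End CStarProperties.

Section Traces.
Context {R : realType} {A : cstarAlgType R}.
Implicit Types (e p q : A) (phi : A -> R[i]) (tau : A -> \bar R).

(* The projection e with respect to which T(A) is taken to be T(eAe): an       *)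
(* arbitrary nonzero projection in general, the unit if A is unital.           *)
Definition reference_projection e :=
  [/\ projection e, e != 0 & forall u, is_unit u -> e = u].

Definition corner e : set A := [set x | e · x · e = x].

(* Tracial states of eAe; as a total function on A a functional on eAe is      *)
(* given the value 0 off eAe.                                                  *)
Definition tracial_states e : set (A -> R[i]) := [set phi |
  [/\ forall x, ~ corner e x -> phi x = 0,
      forall (k : R[i]) x y, corner e x -> corner e y ->
        phi (k *: x + y) = k * phi x + phi y,
      forall x, corner e x -> 0 <= phi (x^† · x),
      phi e = 1
    & forall x y, corner e x -> corner e y -> phi (x · y) = phi (y · x)]].

Definition extreme_points (S : set (A -> R[i])) : set (A -> R[i]) := [set phi |
  S phi /\ forall phi1 phi2 (t : R), S phi1 -> S phi2 -> 0 < t < 1 ->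
    phi = t%:C *: phi1 + (1 - t)%:C *: phi2 -> phi1 = phi /\ phi2 = phi].

(* Lower semicontinuity is that of the restriction of tau to the positive cone *)
(* (points off the cone are isolated in the subspace topology).                *)
Definition semifinite_tracial_weights : set (A -> \bar R) := [set tau |
  [/\ tracial_weight tau,
      exists2 x, positive x & tau x != 0%E,
      lower_semicontinuous (tau : subspace (positive : set A) -> \bar R)
    & dense [set a | (tau (a^† · a) < +oo)%E]]].

(* The unique extension of a tracial state of eAe to a weight on A. *)
Definition weight_of e phi : A -> \bar R :=
  xget (fun=> 0%E) [set tau | semifinite_tracial_weights tau /\
    forall x, corner e x -> positive x -> tau x = (complex.Re (phi x))%:E].

(* The unique extension of tau to a normal tracial weight on A**. *)
Definition normal_extension tau : bidual A -> \bar R :=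
  xget (fun=> 0%E) [set w | [/\ tracial_weight w, normal_weight w
    & forall a, positive a -> w (bidual_embed a) = tau a]].

Definition range_projection (a : A) : bidual A :=
  xget 0 [set p | is_range_projection (bidual_embed a) p].

Definition strict_comparison e :=
  tracial_states e !=set0 /\
  (forall p q, projection p -> projection q ->
    (forall phi, tracial_states e phi ->
       (weight_of e phi p < weight_of e phi q)%E) ->
    mvn_prec p q).

End Traces.

(* Main.v *)
From HB Require Import structures.
From mathcomp Require Import all_boot all_order all_algebra.
From mathcomp Require Import complex ring lra.
From mathcomp Require Import all_classical all_reals all_analysis.
Require Import Defs.

Set Implicit Arguments.
Unset Strict Implicit.
Unset Printing Implicit Defensive.

Import Order.TTheory GRing.Theory Num.Theory.
Import numFieldNormedType.Exports.

Local Open Scope classical_set_scope.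
Local Open Scope ring_scope.
Local Open Scope complex_scope.

(* Projections p of the form a y increase to the range projection of a in A**,
   so its trace is the supremum of the traces of these p.  If a is a combination
   of projections q_i, then each p is cut into pieces subequivalent to the q_i,
   whence tau(p) <= sum tau(q_i).

   Conversely, let V be the span of the projections.  V contains (1 - r) A r for
   every projection r, hence [A, V], and hence every sum of finitely many
   commutators x y - y x with x in (1 - r) A r.  If the trace of the range of a is
   finite, comparison moves a tail of the range under a finite part, so that a is,
   modulo V, in a corner.  In a corner, an element corrected by V so that the
   finitely many extreme traces vanish on it is halved repeatedly: by real rank
   zero and comparison it is matched, up to a remainder of half the norm moved into
   a smaller orthogonal corner, by boundedly many commutators, and by orthogonality
   the resulting series of commutators sums to finitely many commutators.

   The second dual is handled without representations.  Positive functionals span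
   the dual, which gives regularity of the Arens product, and an element that is
   nonnegative on positive functionals is a square, by the power series of
   sqrt (1 - H).  The normal extension of a trace is x |-> sum_k x(psi_k) for
   functionals psi_k(b) = sum_i phi(z_ki b z_ki^† ) with sum z_ki^† z_ki = 1. *)

(** * Identities in noncommutative algebras *)

(** Three obstacles shape the proof. [A] may lack a unit, so all computations take place in a
    unitization with a C*-norm, where [A] is a closed ideal; projections and spans always refer to
    this ideal. Next, V need not be closed, so a series of commutators need not stay in it. The one
    that occurs does, because the factors of stage k have norm of order 2^-k and supports orthogonal
    to those of the other stages, and because the number of commutators and the projections making
    their factors off-diagonal are the same at all stages. This is why remainders are measured by
    d^2 when the factors have norm of order d, and why the chain of orthogonal corners r_k lies
    inside one small projection [rho] that has many orthogonal copies. Finally, halving needs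
    projections of arbitrarily small trace, so a minimal projection, whose corner consists of
    scalars, is treated apart. Finiteness of the set of extreme traces makes the tail of a
    convergent trace small for all of them at once, and makes the correction of traces a question
    about the rank of a matrix. *)

(* A reflexive decision procedure for identities in a (noncommutative) algebra:
   both sides are expanded into monomials, and the coefficients, which lie in
   the commutative ring of scalars, are compared by [ring].                     *)
Section NoncommutativeRing.
Variables (K : comNzRingType) (U : algType K).

Inductive nexp := NX of nat | N0 | N1 | NAdd of nexp & nexp | NOpp of nexp
  | NMul of nexp & nexp | NScale of K & nexp.

Fixpoint nlook (env : list U) (n : nat) : U :=
  match env, n with
  | nil, _ => 0 | cons x _, O => x | cons _ s, S m => nlook s m
  end.

Fixpoint neval (env : list U) (e : nexp) : U :=
  match e with
  | NX n => nlook env n | N0 => 0 | N1 => 1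
  | NAdd a b => neval env a + neval env b
  | NOpp a => - neval env a
  | NMul a b => neval env a * neval env b
  | NScale k a => k *: neval env a
  end.

Definition nmon := (K * list nat)%type.

Fixpoint napp (T : Type) (a b : list T) : list T :=
  match a with nil => b | cons x s => cons x (napp s b) end.
Fixpoint nscal (k : K) (a : list nmon) : list nmon :=
  match a with nil => nil | cons (c, m) s => cons (k * c, m) (nscal k s) end.
Fixpoint nopp (a : list nmon) : list nmon :=
  match a with nil => nil | cons (c, m) s => cons (- c, m) (nopp s) end.
Fixpoint nmul1 (k : K) (l : list nat) (a : list nmon) : list nmon :=
  match a with
  | nil => nil | cons (c, m) s => cons (k * c, napp l m) (nmul1 k l s)
  end.
Fixpoint nmul (a b : list nmon) : list nmon :=
  match a with nil => nil | cons (c, m) s => napp (nmul1 c m b) (nmul s b) end.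
Fixpoint nnorm (e : nexp) : list nmon :=
  match e with
  | NX n => cons (1, cons n nil) nil | N0 => nil | N1 => cons (1, nil) nil
  | NAdd a b => napp (nnorm a) (nnorm b)
  | NOpp a => nopp (nnorm a)
  | NMul a b => nmul (nnorm a) (nnorm b)
  | NScale k a => nscal k (nnorm a)
  end.
Fixpoint neqn (a b : nat) : bool :=
  match a, b with O, O => true | S x, S y => neqn x y | _, _ => false end.
Fixpoint neql (a b : list nat) : bool :=
  match a, b with
  | nil, nil => true
  | cons x s, cons y t => if neqn x y then neql s t else false
  | _, _ => false
  end.
Fixpoint nins (c : K) (m : list nat) (a : list nmon) : list nmon :=
  match a with
  | nil => cons (c, m) nil
  | cons (d, l) s => if neql m l then cons (c + d, l) s
                     else cons (d, l) (nins c m s)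
  end.
Fixpoint ncoll (a : list nmon) : list nmon :=
  match a with nil => nil | cons (c, m) s => nins c m (ncoll s) end.
Fixpoint nallz (a : list nmon) : Prop :=
  match a with nil => True | cons (c, m) s => c = 0 /\ nallz s end.

Fixpoint nmev (env : list U) (m : list nat) : U :=
  match m with nil => 1 | cons n s => nlook env n * nmev env s end.
Fixpoint nlev (env : list U) (a : list nmon) : U :=
  match a with nil => 0 | cons (c, m) s => c *: nmev env m + nlev env s end.

Lemma nmev_app env l m : nmev env (napp l m) = nmev env l * nmev env m.
Proof. by elim: l => [|n s IH] /=; rewrite ?mul1r // IH mulrA. Qed.
Lemma nlev_app env a b : nlev env (napp a b) = nlev env a + nlev env b.
Proof. by elim: a => [|[c m] s IH] /=; rewrite ?add0r // IH addrA. Qed.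
Lemma nlev_scal env k a : nlev env (nscal k a) = k *: nlev env a.
Proof. by elim: a => [|[c m] s IH] /=; rewrite ?scaler0 // IH scalerDr scalerA. Qed.
Lemma nlev_opp env a : nlev env (nopp a) = - nlev env a.
Proof. by elim: a => [|[c m] s IH] /=; rewrite ?oppr0 // IH scaleNr opprD. Qed.
Lemma nlev_mul1 env k l a :
  nlev env (nmul1 k l a) = k *: nmev env l * nlev env a.
Proof.
elim: a => [|[c m] s IH] /=; rewrite ?mulr0 // IH mulrDr nmev_app.
by rewrite -!scalerAl -!scalerAr scalerA.
Qed.
Lemma nlev_mul env a b : nlev env (nmul a b) = nlev env a * nlev env b.
Proof.
elim: a => [|[c m] s IH] /=; rewrite ?mul0r //.
by rewrite nlev_app nlev_mul1 IH mulrDl.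
Qed.
Lemma nlev_norm env e : nlev env (nnorm e) = neval env e.
Proof.
elim: e => [n|||a IHa b IHb|a IHa|a IHa b IHb|k a IHa] //=.
- by rewrite scale1r mulr1 addr0.
- by rewrite scale1r addr0.
- by rewrite nlev_app IHa IHb.
- by rewrite nlev_opp IHa.
- by rewrite nlev_mul IHa IHb.
- by rewrite nlev_scal IHa.
Qed.
Lemma neqnP a b : neqn a b -> a = b.
Proof. by elim: a b => [|a IH] [|b] //= /IH ->. Qed.
Lemma neqlP a b : neql a b -> a = b.
Proof.
elim: a b => [|x s IH] [|y t] //=; case E: (neqn x y) => // /IH ->.
by rewrite (neqnP E).
Qed.
Lemma nlev_ins env c m a : nlev env (nins c m a) = c *: nmev env m + nlev env a.
Proof.
elim: a => [|[d l] s IH] //=; case E: (neql m l) => /=.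
  by rewrite (neqlP E) scalerDl addrA.
by rewrite IH addrCA.
Qed.
Lemma nlev_coll env a : nlev env (ncoll a) = nlev env a.
Proof. by elim: a => [|[c m] s IH] //=; rewrite nlev_ins IH. Qed.

Lemma nring_correct env e1 e2 :
  nallz (ncoll (nnorm (NAdd e1 (NOpp e2)))) -> neval env e1 = neval env e2.
Proof.
move=> h; apply/eqP; rewrite -subr_eq0; apply/eqP.
rewrite -[LHS]/(neval env (NAdd e1 (NOpp e2))) -nlev_norm -nlev_coll.
by elim: (ncoll _) h => [|[c m] s IH] //= [-> /IH ->]; rewrite scale0r addr0.
Qed.

End NoncommutativeRing.

(* Atoms are compared up to the structure that the involution is taken in. *)
Ltac nr_eq x y :=
  lazymatch x with
  | y => constr:(true)
  | @astar _ _ ?a => lazymatch y with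
                   | @astar _ _ a => constr:(true) | _ => constr:(false) end
  | _ => constr:(false)
  end.
Ltac nr_in x l :=
  lazymatch l with
  | nil => constr:(false)
  | cons ?y ?s =>
      let b := nr_eq x y in
      lazymatch b with true => constr:(true) | false => nr_in x s end
  end.
Ltac nr_idx x l :=
  lazymatch l with
  | cons ?y ?s =>
      let b := nr_eq x y in
      lazymatch b with
      | true => constr:(O) | false => let n := nr_idx x s in constr:(S n)
      end
  end.
Ltac nr_atoms t l :=
  lazymatch t with
  | (?a + ?b)%R => let l1 := nr_atoms a l in nr_atoms b l1
  | (- ?a)%R => nr_atoms a l
  | (?a * ?b)%R => let l1 := nr_atoms a l in nr_atoms b l1
  | (_ *: ?a)%R => nr_atoms a l
  | 0%R => l
  | 1%R => l
  | _ => let b := nr_in t l in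
         lazymatch b with true => l | false => constr:(cons t l) end
  end.
Ltac nr_reif K t l :=
  lazymatch t with
  | (?a + ?b)%R =>
      let x := nr_reif K a l in let y := nr_reif K b l in
      constr:(NAdd x y)
  | (- ?a)%R => let x := nr_reif K a l in constr:(NOpp x)
  | (?a * ?b)%R =>
      let x := nr_reif K a l in let y := nr_reif K b l in
      constr:(NMul x y)
  | (?k *: ?a)%R => let x := nr_reif K a l in constr:(NScale k x)
  | 0%R => constr:(@N0 K)
  | 1%R => constr:(@N1 K)
  | _ => let n := nr_idx t l in constr:(@NX K n)
  end.
Ltac nring :=
  lazymatch goal with
  | |- @eq ?T ?a ?b =>
    let K := lazymatch type of (fun (K : comNzRingType) (V : algType K) => V) with
             | _ => open_constr:(_ : comNzRingType) end in
    let U := open_constr:(_ : algType K) in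
    let _ := lazymatch goal with _ => constr:(erefl : (GRing.Algebra.sort U : Type) = T) end in
    let l0 := constr:(@nil T) in
    let l1 := nr_atoms a l0 in
    let l := nr_atoms b l1 in
    let e1 := nr_reif K a l in
    let e2 := nr_reif K b l in
    refine (@nring_correct K U l e1 e2 _);
    cbv beta iota zeta delta [nallz ncoll nnorm nins neql neqn nmul nmul1 nopp nscal napp];
    repeat split; ring
  end.

(** * Unital Banach and C*-algebras *)

(** The norm is real-valued and completeness is an axiom on sequences, with no topology: the same
    theory of limits and series then serves the unitization and the second dual, for the latter of
    which only a Banach algebra norm is established. *)
HB.mixin Record isUnitalBanach (R : realType) U of GRing.Algebra R[i] U := {
  nrm : U -> R;
  nrm_eq0 : forall x : U, nrm x = 0 -> x = 0;
  nrmD : forall x y : U, nrm (x + y) <= nrm x + nrm y;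
  nrmZ : forall (k : R[i]) (x : U), nrm (k *: x) = rnorm k * nrm x;
  nrmM : forall x y : U, nrm (x * y) <= nrm x * nrm y;
  nrm1 : nrm (1 : U) <= 1;
  nrm_complete : forall u : nat -> U,
    (forall e, 0 < e -> exists n, forall m, (n <= m)%N -> nrm (u m - u n) <= e) ->
    exists l, forall e, 0 < e -> exists n, forall m, (n <= m)%N -> nrm (u m - l) <= e }.

#[short(type="ubanachType")]
HB.structure Definition UnitalBanach (R : realType) :=
  { U of GRing.Algebra R[i] U & isUnitalBanach R U }.

Section RealNorm.
Context {R : realType}.
Implicit Types t : R.

Lemma rnormC t : rnorm (t%:C : R[i]) = `|t|.
Proof. by apply: complexI; rewrite -rnormE normc_def /= expr0n addr0 sqrtr_sqr. Qed.
Lemma rnormC_ge0 t : 0 <= t -> rnorm (t%:C : R[i]) = t.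
Proof. by move=> t0; rewrite rnormC ger0_norm. Qed.
Lemma rnorm1 : rnorm (1 : R[i]) = 1.
Proof. by rewrite (rnormC 1) normr1. Qed.
Lemma rnormN1 : rnorm (-1 : R[i]) = 1.
Proof. by rewrite /rnorm normrN1. Qed.
Lemma rnorm_i : rnorm ('i%C : R[i]) = 1.
Proof. by rewrite /rnorm normc_def /= expr0n expr1n add0r sqrtr1. Qed.
Lemma rnorm_conj (k : R[i]) : rnorm k^* = rnorm k.
Proof. by rewrite /rnorm norm_conjC. Qed.
Lemma rnorm_eq0 (V : normedZmodType R[i]) (x : V) : rnorm x = 0 -> x = 0.
Proof. by move=> h; apply/eqP; rewrite -normr_eq0 rnormE h. Qed.
Lemma rnormN (V : normedZmodType R[i]) (x : V) : rnorm (- x) = rnorm x.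
Proof. by rewrite /rnorm normrN. Qed.
Lemma rnormB (V : normedZmodType R[i]) (x y : V) : rnorm (x - y) = rnorm (y - x).
Proof. by rewrite -rnormN opprB. Qed.

Lemma invS_small (e : R) : 0 < e ->
  exists n, forall m, (n <= m)%N -> m.+1%:R^-1 <= e.
Proof.
move=> e0; exists (Num.truncn e^-1) => m nm.
rewrite invf_ple ?posrE ?ltr0n // ltW // (lt_le_trans (truncnS_gt _)) //.
by rewrite ler_nat ltnS.
Qed.

Lemma monotone_cauchy (u : nat -> R) b : (forall n, u n <= u n.+1) ->
  (forall n, u n <= b) ->
  forall e, 0 < e -> exists n, forall m, (n <= m)%N -> u m - u n <= e.
Proof.
move=> uS ub e e0.
have hs : has_sup (range u).
  by split; [exists (u 0%N); exists 0%N | exists b => _ [n _ <-]].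
have [_ [n _ <-] hn] := sup_adherent e0 hs; exists n => m _.
have : u m <= sup (range u) by apply: ub_le_sup; [exact: hs.2 | exists m].
lra.
Qed.

End RealNorm.

Section UnitalBanachTheory.
Context {R : realType} {U : ubanachType R}.
Implicit Types (x y z : U) (u v : nat -> U) (t : R).

Lemma nrm0 : nrm (0 : U) = 0.
Proof. by rewrite -(scale0r (0 : U)) nrmZ rnorm0 mul0r. Qed.
Lemma nrmN x : nrm (- x) = nrm x.
Proof. by rewrite -scaleN1r nrmZ rnormN1 mul1r. Qed.
Lemma nrm_ge0 x : 0 <= nrm x.
Proof. by have := nrmD x (- x); rewrite subrr nrm0 nrmN; lra. Qed.
Lemma nrmC x y : nrm (x - y) = nrm (y - x).
Proof. by rewrite -nrmN opprB. Qed.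
Lemma nrmB x y : nrm (x - y) <= nrm x + nrm y.
Proof. by rewrite -(nrmN y) nrmD. Qed.
Lemma nrm_tri z x y : nrm (x - y) <= nrm (x - z) + nrm (z - y).
Proof. by rewrite (_ : x - y = (x - z) + (z - y)) ?nrmD //; nring. Qed.
Lemma nrm_subl x y : nrm x <= nrm y + nrm (x - y).
Proof. by rewrite -[X in nrm X <= _](subrK y) addrC nrmD. Qed.
Lemma nrmZr t x : 0 <= t -> nrm (t%:C *: x) = t * nrm x.
Proof. by move=> t0; rewrite nrmZ rnormC_ge0. Qed.
Lemma nrmX x n : nrm (x ^+ n) <= nrm x ^+ n.
Proof.
elim: n => [|n IH]; first by rewrite !expr0 nrm1.
by rewrite !exprS (le_trans (nrmM _ _)) // ler_wpM2l ?nrm_ge0.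
Qed.
Lemma nrm_sum (I : Type) (r : seq I) (P : pred I) (F : I -> U) :
  nrm (\sum_(i <- r | P i) F i) <= \sum_(i <- r | P i) nrm (F i).
Proof.
elim/big_rec2: _ => [|i y x _ h]; first by rewrite nrm0.
by rewrite (le_trans (nrmD _ _)) // lerD.
Qed.
Lemma nrm_mulr2 x y c d : nrm x <= c -> nrm y <= d -> nrm (x * y) <= c * d.
Proof. by move=> hx hy; rewrite (le_trans (nrmM _ _)) // ler_pM ?nrm_ge0. Qed.

Definition nlim u x :=
  forall e, 0 < e -> exists n, forall m, (n <= m)%N -> nrm (u m - x) <= e.
Definition ncauchy u :=
  forall e, 0 < e -> exists n, forall m, (n <= m)%N -> nrm (u m - u n) <= e.

Lemma ncauchyP u : ncauchy u -> exists x, nlim u x.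
Proof. exact: nrm_complete. Qed.

Lemma nlim_cst x : nlim (fun=> x) x.
Proof. by move=> e e0; exists 0%N => m _; rewrite subrr nrm0 ltW. Qed.

Lemma nlim_dom c u v x y : (forall n, nrm (v n - y) <= c * nrm (u n - x)) ->
  nlim u x -> nlim v y.
Proof.
move=> h hu e e0; have c0 : 0 < `|c| + 1 by rewrite ltr_pwDr.
have [n hn] := hu (e / (`|c| + 1)) (divr_gt0 e0 c0).
exists n => m /hn; rewrite ler_pdivlMr // mulrC => h1.
apply: le_trans h1; apply: (le_trans (h m)); apply: ler_wpM2r; first exact: nrm_ge0.
by rewrite (le_trans (ler_norm c)) // lerDl.
Qed.

Lemma nlimD u v x y : nlim u x -> nlim v y -> nlim (fun n => u n + v n) (x + y).
Proof.
move=> hu hv e e0; have e2 : 0 < e / 2 by rewrite divr_gt0.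
have [n hn] := hu _ e2; have [m hm] := hv _ e2.
exists (maxn n m) => k; rewrite geq_max => /andP[/hn h1 /hm h2].
rewrite (_ : _ - _ = (u k - x) + (v k - y)); last by nring.
by rewrite (le_trans (nrmD _ _)) // [leRHS](splitr e) lerD.
Qed.

Lemma nlimZ k u x : nlim u x -> nlim (fun n => k *: u n) (k *: x).
Proof. by apply: (@nlim_dom (rnorm k)) => n; rewrite -scalerBr nrmZ. Qed.

Lemma nlimN u x : nlim u x -> nlim (fun n => - u n) (- x).
Proof. by apply: (@nlim_dom 1) => n; rewrite -opprD nrmN mul1r. Qed.

Lemma nlimB u v x y : nlim u x -> nlim v y -> nlim (fun n => u n - v n) (x - y).
Proof. by move=> hu hv; apply: nlimD => //; apply: nlimN. Qed.

Lemma nlimMl y u x : nlim u x -> nlim (fun n => y * u n) (y * x).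
Proof. by apply: (@nlim_dom (nrm y)) => n; rewrite -mulrBr nrmM. Qed.

Lemma nlimMr y u x : nlim u x -> nlim (fun n => u n * y) (x * y).
Proof. by apply: (@nlim_dom (nrm y)) => n; rewrite -mulrBl mulrC nrmM. Qed.

Lemma nlimM u v x y : nlim u x -> nlim v y -> nlim (fun n => u n * v n) (x * y).
Proof.
move=> hu hv e e0; pose c := nrm x + nrm y + 1.
have c0 : 0 < c by rewrite ltr_wpDl // addr_ge0 ?nrm_ge0.
have d0 : 0 < Num.min 1 (e / (2 * c)).
  by rewrite lt_min ltr01 /= divr_gt0 // mulr_gt0.
have [n hn] := hu _ d0; have [m hm] := hv _ d0.
exists (maxn n m) => k; rewrite geq_max => /andP[/hn h1 /hm h2].
move: h1 h2; rewrite !le_min !ler_pdivlMr ?mulr_gt0 //.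
move=> /andP[h1 h1'] /andP[h2 h2'].
rewrite (_ : _ - _ = (u k - x) * v k + x * (v k - y)); last by nring.
rewrite (le_trans (nrmD _ _)) //.
have := nrmM (u k - x) (v k); have := nrmM x (v k - y).
have hv1 := nrm_subl (v k) y.
have h3 : nrm (u k - x) * nrm (v k) <= nrm (u k - x) * c.
  by rewrite ler_wpM2l ?nrm_ge0 // /c; have := nrm_ge0 x; lra.
have h4 : nrm x * nrm (v k - y) <= c * nrm (v k - y).
  by rewrite ler_wpM2r ?nrm_ge0 // /c; have := nrm_ge0 y; lra.
by lra.
Qed.

Lemma nlim_uniq u x y : nlim u x -> nlim u y -> x = y.
Proof.
move=> hx hy; apply/eqP; rewrite -subr_eq0; apply/eqP/nrm_eq0/eqP.
rewrite eq_le nrm_ge0 andbT; apply/ler_addgt0Pl => e e0.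
have e2 : 0 < e / 2 by rewrite divr_gt0.
have [n hn] := hx _ e2; have [m hm] := hy _ e2.
have h1 := hn _ (leq_maxl n m); have h2 := hm _ (leq_maxr n m).
rewrite addr0 (le_trans (nrm_tri (u (maxn n m)) x y)) // nrmC [leRHS]splitr.
by rewrite lerD.
Qed.

Lemma nlim_ext u v x : u =1 v -> nlim u x -> nlim v x.
Proof. by move=> /funext ->. Qed.

Lemma nlim_shift u x : nlim u x -> nlim (fun n => u n.+1) x.
Proof.
move=> h e e0; have [n hn] := h _ e0.
by exists n => m nm; apply: hn; rewrite (leq_trans nm).
Qed.

Lemma nlim_nrm_le u x c : (forall n, nrm (u n) <= c) -> nlim u x -> nrm x <= c.
Proof.
move=> hc hu; apply/ler_addgt0Pr => e e0; have [n hn] := hu _ e0.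
by have := hn _ (leqnn n); have := nrm_subl x (u n); rewrite nrmC; have := hc n; lra.
Qed.

Lemma nlim_approx (P : U -> Prop) x :
  (forall e, 0 < e -> exists2 y, P y & nrm (x - y) <= e) ->
  exists2 u, nlim u x & forall n, P (u n).
Proof.
move=> h; have h' n : exists y, P y /\ nrm (x - y) <= n.+1%:R^-1.
  by have [|y py hy] := h n.+1%:R^-1; [rewrite invr_gt0 ltr0n | exists y].
have [u hu] := choice h'; exists u => [|n]; last exact: (hu n).1.
move=> e e0; have [n hn] := invS_small e0; exists n => m /hn h2.
by rewrite nrmC (le_trans (hu m).2).
Qed.

End UnitalBanachTheory.

(* The iteration y := (H + y^2) / 2 converges to 1 - sqrt (1 - H).  Its terms are
   polynomials in H with nonnegative coefficients and bounded value at 1, so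
   power-boundedness of H is enough.                                           *)
Section SquareRoot.
Context {R : realType}.

Fixpoint sqrt_poly n : {poly R} :=
  if n is m.+1 then (2^-1)%:P * ('X + sqrt_poly m ^+ 2) else 0.

Definition nncoef (p : {poly R}) := forall i, 0 <= p`_i.

Lemma nncoefD p q : nncoef p -> nncoef q -> nncoef (p + q).
Proof. by move=> hp hq i; rewrite coefD addr_ge0. Qed.
Lemma nncoefM p q : nncoef p -> nncoef q -> nncoef (p * q).
Proof. by move=> hp hq i; rewrite coefM sumr_ge0 // => j _; rewrite mulr_ge0. Qed.
Lemma nncoefC c : 0 <= c -> nncoef c%:P.
Proof. by move=> c0 i; rewrite coefC; case: ifP. Qed.

Lemma nncoef_sqrt_poly n : nncoef (sqrt_poly n).
Proof.
elim: n => [|n IH] /=; first exact: nncoefC.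
apply: nncoefM; first by apply: nncoefC; rewrite invr_ge0.
by apply: nncoefD; [move=> i; rewrite coefX | rewrite expr2; exact: nncoefM].
Qed.

(** Two consecutive steps differ by half the product of the previous difference with a sum, so
    nonnegativity of the coefficients propagates. *)
Lemma nncoef_sqrt_polyS n : nncoef (sqrt_poly n.+1 - sqrt_poly n).
Proof.
elim: n => [|n IH].
  by rewrite /= subr0; exact: (nncoef_sqrt_poly 1).
rewrite [X in nncoef X](_ : _ = (2^-1)%:P *
  ((sqrt_poly n.+1 - sqrt_poly n) * (sqrt_poly n.+1 + sqrt_poly n))); last first.
  transitivity ((2^-1)%:P * ('X + sqrt_poly n.+1 ^+ 2) -
    (2^-1)%:P * ('X + sqrt_poly n ^+ 2)) => //.
  by move: (sqrt_poly n.+1) (sqrt_poly n) => p q; ring.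
apply: nncoefM; first by apply: nncoefC; rewrite invr_ge0.
by apply: nncoefM => //; apply: nncoefD; exact: nncoef_sqrt_poly.
Qed.

Lemma nncoef_sqrt_polyB n m : (n <= m)%N -> nncoef (sqrt_poly m - sqrt_poly n).
Proof.
move=> /subnK <-; elim: (m - n)%N => [|k IH].
  by rewrite add0n subrr; exact: nncoefC.
rewrite addSn -[X in nncoef X](subrKA (sqrt_poly (k + n))).
by apply: nncoefD => //; exact: nncoef_sqrt_polyS.
Qed.

(** At 1 the recursion is t |-> (1 + t^2) / 2, which maps [0, 1] to itself. *)
Lemma sqrt_poly1_le n : (sqrt_poly n).[1] <= 1.
Proof.
elim: n => [|n IH] /=; first by rewrite horner0.
have h : 0 <= (sqrt_poly n).[1].
  rewrite horner_coef sumr_ge0 // => i _.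
  by rewrite expr1n mulr1 nncoef_sqrt_poly.
rewrite !hornerE; have : (sqrt_poly n).[1] ^+ 2 <= 1 by rewrite expr_le1.
by lra.
Qed.

Context {U : ubanachType R}.
Implicit Types x y H : U.

Definition real_eval H (p : {poly R}) : U :=
  horner_alg H (map_poly (real_complex R) p).

Lemma real_evalD H p q : real_eval H (p + q) = real_eval H p + real_eval H q.
Proof. by rewrite /real_eval !rmorphD. Qed.
Lemma real_evalB H p q : real_eval H (p - q) = real_eval H p - real_eval H q.
Proof. by rewrite /real_eval !rmorphB. Qed.
Lemma real_evalM H p q : real_eval H (p * q) = real_eval H p * real_eval H q.
Proof. by rewrite /real_eval !rmorphM. Qed.
Lemma real_evalX H : real_eval H 'X = H.
Proof. by rewrite /real_eval map_polyX horner_algX. Qed.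
Lemma real_evalC H c : real_eval H c%:P = c%:C *: 1.
Proof. by rewrite /real_eval map_polyC horner_algC. Qed.

Lemma real_eval_sqrt_poly H n : real_eval H (sqrt_poly n.+1) =
  (2^-1)%:C *: (H + real_eval H (sqrt_poly n) * real_eval H (sqrt_poly n)).
Proof.
by rewrite /= real_evalM real_evalD real_evalC real_evalX expr2 real_evalM; nring.
Qed.

(** With nonnegative coefficients the triangle inequality adds up to the value of [p] at 1, times
    the bound [C] on the powers of [H]. *)
Lemma nrm_real_eval H C p : (forall n, nrm (H ^+ n) <= C) -> nncoef p ->
  nrm (real_eval H p) <= C * p.[1].
Proof.
move=> hC hp; rewrite /real_eval -{1}[p]coefK poly_def !raddf_sum /=.
rewrite (le_trans (nrm_sum _ _ _)) // horner_coef mulr_sumr.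
apply: ler_sum => i _; rewrite map_polyZ map_polyXn linearZ /= rmorphXn /=.
rewrite horner_algX expr1n mulr1 -scalerAl mul1r nrmZr //.
by rewrite mulrC ler_wpM2r.
Qed.

Lemma sqrt_iteration H C : (forall n, nrm (H ^+ n) <= C) ->
  exists2 y, nlim (fun n => real_eval H (sqrt_poly n)) y & y + y = H + y * y.
Proof.
move=> hC; have C0 : 0 <= C by apply: le_trans (hC 0%N); exact: nrm_ge0.
(* The differences of the iterates have nonnegative coefficients, so their norms are controlled by
   the bounded increasing numbers [(sqrt_poly n).[1]]. *)
have [|y hy] := @ncauchyP _ _ (fun n => real_eval H (sqrt_poly n)).
  move=> e e0; have C1 : 0 < C + 1 by rewrite ltr_wpDl.
  have mono n : (sqrt_poly n).[1] <= (sqrt_poly n.+1).[1].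
    rewrite -subr_ge0 -hornerN -hornerD horner_coef sumr_ge0 // => i _.
    by rewrite expr1n mulr1 nncoef_sqrt_polyS.
  have [n hn] := monotone_cauchy mono sqrt_poly1_le (divr_gt0 e0 C1).
  exists n => m nm; rewrite -real_evalB.
  rewrite (le_trans (nrm_real_eval hC (nncoef_sqrt_polyB nm))) //.
  have := hn _ nm; rewrite ler_pdivlMr // hornerD hornerN.
  have : (sqrt_poly n).[1] <= (sqrt_poly m).[1].
    rewrite -subr_ge0 -hornerN -hornerD horner_coef sumr_ge0 // => i _.
    by rewrite expr1n mulr1 nncoef_sqrt_polyB.
  nra.
exists y => //.
have h1 := nlimZ 2 (nlim_shift hy).
have h2 := nlimD (nlim_cst H) (nlimM hy hy).
have := nlim_uniq (nlim_ext _ h1) h2.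
rewrite scaler_nat mulr2n; apply => n /=.
rewrite real_eval_sqrt_poly scalerA (_ : 2 * _ = 1) ?scale1r //.
by rewrite -(rmorph_nat (real_complex R) 2) -rmorphM /= divff // pnatr_eq0.
Qed.

End SquareRoot.

HB.mixin Record isUnitalCStar (R : realType) U
    of UnitalBanach R U & hasMulStar U := {
  mulE : forall x y : U, x · y = x * y;
  starK : forall x : U, x^†^† = x;
  starD : forall x y : U, (x + y)^† = x^† + y^†;
  starZ : forall (k : R[i]) (x : U), (k *: x)^† = conjc k *: x^†;
  starM : forall x y : U, (x * y)^† = y^† * x^†;
  nrm_starM : forall x : U, nrm (x^† * x) = nrm x ^+ 2 }.

#[short(type="ucstarType")]
HB.structure Definition UnitalCStar (R : realType) :=
  { U of UnitalBanach R U & hasMulStar U & isUnitalCStar R U }.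

Section UnitalCStarTheory.
Context {R : realType} {U : ucstarType R}.
Implicit Types (x y z h k g : U) (s t e : R).

(** Squares of selfadjoint elements. That every y^† y is of this form is [pos_starM], which is
    reached only at the end of the order theory. *)
Definition pos x := exists2 h, selfadjoint h & x = h * h.

Lemma star0 : (0 : U)^† = 0.
Proof. by rewrite -[X in X^†](scale0r (0 : U)) starZ rmorph0 scale0r. Qed.
Lemma starN x : (- x)^† = - x^†.
Proof. by apply/eqP; rewrite -addr_eq0 -starD addNr star0. Qed.
Lemma starB x y : (x - y)^† = x^† - y^†.
Proof. by rewrite starD starN. Qed.
Lemma star1 : (1 : U)^† = 1.
Proof. by rewrite -[LHS]mulr1 -{2}(starK 1) -starM mulr1 starK. Qed.
Lemma conjcR t : conjc (t%:C : R[i]) = t%:C.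
Proof. by rewrite conjc_real. Qed.
Lemma starZr t x : (t%:C *: x)^† = t%:C *: x^†.
Proof. by rewrite starZ conjcR. Qed.
Lemma conj_i : conjc ('i%C : R[i]) = - 'i%C.
Proof. by apply/eqP; rewrite eq_complex /= oppr0 !eqxx. Qed.
Lemma mulii : 'i%C * 'i%C = -1 :> R[i].
Proof. by rewrite -expr2 sqr_i. Qed.
Lemma sqrt_mul t : 0 <= t -> Num.sqrt t * Num.sqrt t = t.
Proof. by move=> t0; rewrite -expr2 sqr_sqrtr. Qed.
Lemma star_sum (I : Type) (r : seq I) (P : pred I) (F : I -> U) :
  (\sum_(i <- r | P i) F i)^† = \sum_(i <- r | P i) (F i)^†.
Proof. by apply: (big_morph (fun x : U => x^†)); [exact: starD | exact: star0]. Qed.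

Lemma nrm_star x : nrm x^† = nrm x.
Proof.
suff h y : nrm y <= nrm y^† by apply/eqP; rewrite eq_le -{2}(starK x) !h.
have [->|y0] := eqVneq (nrm y) 0; first exact: nrm_ge0.
have yp : 0 < nrm y by rewrite lt_neqAle eq_sym y0 nrm_ge0.
by rewrite -(ler_pM2r yp) -expr2 -nrm_starM nrmM.
Qed.

Lemma nrm_mulstar x : nrm (x * x^†) = nrm x ^+ 2.
Proof. by rewrite -{1}(starK x) nrm_starM nrm_star. Qed.

Lemma nrm_sqr h : selfadjoint h -> nrm (h * h) = nrm h ^+ 2.
Proof. by move=> sh; rewrite -{1}sh nrm_starM. Qed.

Lemma starM_eq0 x : x^† * x = 0 -> x = 0.
Proof.
move=> h; apply: nrm_eq0; apply/eqP.
by rewrite -sqrf_eq0 -nrm_starM h nrm0.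
Qed.

Lemma sa0 : selfadjoint (0 : U). Proof. exact: star0. Qed.
Lemma sa1 : selfadjoint (1 : U). Proof. exact: star1. Qed.
Lemma saD x y : selfadjoint x -> selfadjoint y -> selfadjoint (x + y).
Proof. by move=> hx hy; rewrite /selfadjoint starD hx hy. Qed.
Lemma saN x : selfadjoint x -> selfadjoint (- x).
Proof. by move=> hx; rewrite /selfadjoint starN hx. Qed.
Lemma saB x y : selfadjoint x -> selfadjoint y -> selfadjoint (x - y).
Proof. by move=> hx hy; rewrite /selfadjoint starB hx hy. Qed.
Lemma saZ t x : selfadjoint x -> selfadjoint (t%:C *: x).
Proof. by move=> hx; rewrite /selfadjoint starZr hx. Qed.
Lemma saM x y : selfadjoint x -> selfadjoint y -> x * y = y * x ->
  selfadjoint (x * y).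
Proof. by move=> hx hy c; rewrite /selfadjoint starM hx hy. Qed.
Lemma sa_conj x z : selfadjoint x -> selfadjoint (z^† * x * z).
Proof. by move=> hx; rewrite /selfadjoint !starM hx starK mulrA. Qed.

Lemma nlim_star (u : nat -> U) x : nlim u x -> nlim (fun n => (u n)^†) x^†.
Proof. by apply: (@nlim_dom _ _ 1) => n; rewrite -starB nrm_star mul1r. Qed.

Lemma sa_approx x : (forall e, 0 < e -> exists2 y, selfadjoint y & nrm (x - y) <= e) ->
  selfadjoint x.
Proof.
move=> h; have [u hu su] := nlim_approx h.
apply: (nlim_uniq (nlim_star hu)); apply: nlim_ext hu => n; exact/esym/su.
Qed.

(* The square root is the limit of polynomials in H without constant term, hence
   commutes with whatever commutes with H.                                      *)
Lemma sqrt_one_sub H : selfadjoint H -> nrm H <= 1 ->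
  exists s : U, [/\ selfadjoint s, s * s = 1 - H, nrm (1 - s) <= 1
    & forall z, z * H = H * z -> z * s = s * z].
Proof.
move=> sH H1; have hH n : nrm (H ^+ n) <= 1.
  by rewrite (le_trans (nrmX _ _)) // exprn_ile1 ?nrm_ge0.
have [y hy yE] := sqrt_iteration hH; exists (1 - y); split.
- apply: saB; first exact: sa1.
  apply: (nlim_uniq (nlim_star hy)); apply: nlim_ext hy.
  elim=> [|n IH]; first by rewrite /= real_evalC scale0r star0.
  by rewrite real_eval_sqrt_poly starZr starD starM -IH sH.
- rewrite (_ : _ * _ = 1 - (y + y) + y * y); last by nring.
  by rewrite yE; nring.
- rewrite (_ : 1 - (1 - y) = y); last by nring.
  apply: nlim_nrm_le hy => n.
  rewrite (le_trans (nrm_real_eval hH (@nncoef_sqrt_poly R n))) //.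
  by rewrite mul1r sqrt_poly1_le.
- move=> z zH; rewrite mulrBr mulrBl mulr1 mul1r; congr (_ - _).
  apply: (nlim_uniq (nlimMl z hy)); apply: nlim_ext (nlimMr z hy).
  elim=> [|n IH]; first by rewrite /= real_evalC scale0r mulr0 mul0r.
  rewrite real_eval_sqrt_poly -scalerAl -scalerAr; congr (_ *: _).
  by rewrite mulrDl mulrDr zH -mulrA IH !mulrA IH.
Qed.

(* u + i sqrt(1 - u^2) is unitary. *)
Lemma nrm_one_sub_sqr h : selfadjoint h -> nrm h <= 1 -> nrm (1 - h * h) <= 1.
Proof.
move=> sh h1; have hh1 : nrm (h * h) <= 1 by rewrite nrm_sqr // expr_le1 ?nrm_ge0.
have [s [ss sE _ sC]] := sqrt_one_sub (saM sh sh erefl) hh1.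
have hs : h * s = s * h by apply: sC; rewrite mulrA.
pose v := h + 'i%C *: s.
have vS : v^† = h - 'i%C *: s by rewrite /v starD starZ sh ss conj_i scaleNr.
have v1 : nrm v <= 1.
  have : nrm v ^+ 2 <= 1.
    rewrite -nrm_starM vS (_ : _ * v = h * h + s * s); last first.
      rewrite /v mulrDl !mulrDr !mulNr -!scalerAl -!scalerAr hs scalerA.
      by rewrite mulii scaleN1r; nring.
    by rewrite sE addrC subrK nrm1.
  by move=> h2; rewrite -(@expr_le1 _ 2) // nrm_ge0.
have s2 : s = (2^-1)%:C *: (- 'i%C *: (v - v^†)).
  rewrite vS /v (_ : _ - _ = (2 : R)%:C *: ('i%C *: s)); last first.
    by rewrite rmorph_nat scaler_nat mulr2n; nring.
  rewrite !scalerA mulrACA -rmorphM /= mulVf ?pnatr_eq0 // mul1r mulNr.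
  by rewrite mulii opprK scale1r.
have s1 : nrm s <= 1.
  rewrite s2 nrmZr ?invr_ge0 // nrmZ rnormN rnorm_i mul1r.
  by have := nrmB v v^†; rewrite nrm_star; lra.
by rewrite -sE nrm_sqr // expr_le1 ?nrm_ge0.
Qed.

Lemma pos_sa x : pos x -> selfadjoint x.
Proof. by move=> [h sh ->]; apply: saM. Qed.

Lemma pos_sqr h : selfadjoint h -> pos (h * h). Proof. by exists h. Qed.

Lemma pos0 : pos 0. Proof. by exists 0; [exact: sa0 | rewrite mul0r]. Qed.
Lemma pos1 : pos 1. Proof. by exists 1; [exact: sa1 | rewrite mul1r]. Qed.

Lemma nrmZ1 t : 0 <= t -> nrm (t%:C *: (1 : U)) <= t.
Proof. by move=> t0; rewrite nrmZr // ler_piMr // nrm1. Qed.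

Lemma posZ t x : 0 <= t -> pos x -> pos (t%:C *: x).
Proof.
move=> t0 [h sh ->]; exists ((Num.sqrt t)%:C *: h); first exact: saZ.
by rewrite -scalerAl -scalerAr scalerA -rmorphM /= sqrt_mul.
Qed.

(** With its converse [nrm_pos] this replaces the spectrum: positivity of a selfadjoint x becomes
    the convex condition ‖t - x‖ <= t, from which sums and limits of positive elements are
    positive. *)
Lemma pos_nrm t x : pos x -> nrm x <= t -> nrm (t%:C *: 1 - x) <= t.
Proof.
move=> [h sh ->] ht; have t0 : 0 <= t := le_trans (nrm_ge0 _) ht.
have [t00|t00] := eqVneq t 0.
  by move: ht; rewrite t00 scale0r sub0r nrmN.
have tp : 0 < t by rewrite lt_neqAle eq_sym t00.
have sp : 0 < Num.sqrt t by rewrite sqrtr_gt0.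
pose w := ((Num.sqrt t)^-1)%:C *: h.
have ww : t%:C *: 1 - h * h = t%:C *: (1 - w * w).
  rewrite /w -scalerAl -scalerAr scalerA -rmorphM /= -invfM sqrt_mul //.
  by rewrite scalerBr scalerA -rmorphM /= divff ?gt_eqF // scale1r.
have w1 : nrm w <= 1.
  rewrite nrmZr ?invr_ge0 ?sqrtr_ge0 // ler_pdivrMl // mulr1.
  rewrite -(@ler_pXn2r _ 2) ?nnegrE ?nrm_ge0 ?sqrtr_ge0 // sqr_sqrtr //.
  by rewrite -nrm_sqr.
by rewrite ww nrmZr // ler_piMr // nrm_one_sub_sqr //; exact: saZ.
Qed.

Lemma nrm_sqrt t x : selfadjoint x -> nrm (t%:C *: 1 - x) <= t ->
  exists h, [/\ selfadjoint h, x = h * h,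
    nrm ((Num.sqrt t)%:C *: 1 - h) <= Num.sqrt t
    & forall z, z * x = x * z -> z * h = h * z].
Proof.
move=> sx hx; have t0 : 0 <= t := le_trans (nrm_ge0 _) hx.
have [t00|tp] := eqVneq t 0.
  move: hx; rewrite t00 scale0r sub0r nrmN => hx.
  have x0 : x = 0 by apply: nrm_eq0; apply/eqP; rewrite eq_le hx nrm_ge0.
  exists 0; rewrite x0 sqrtr0 scale0r subrr nrm0 mulr0; split; [exact: sa0|by []|by []|].
  by move=> z _; rewrite mulr0 mul0r.
have {}tp : 0 < t by rewrite lt_neqAle eq_sym tp.
clear t0; have t0 := ltW tp.
pose H := 1 - (t^-1)%:C *: x.
have sH : selfadjoint H by apply: saB; [exact: sa1 | exact: saZ].
have HE : t%:C *: (1 - H) = x.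
  by rewrite /H opprB addrC subrK scalerA -rmorphM /= divff ?gt_eqF // scale1r.
have H1 : nrm H <= 1.
  rewrite -(ler_pM2l tp) -nrmZr // mulr1.
  by rewrite (_ : t%:C *: H = t%:C *: 1 - x) // -HE; nring.
have [s [ss sE s1 sC]] := sqrt_one_sub sH H1.
exists ((Num.sqrt t)%:C *: s); split => //.
- exact: saZ.
- by rewrite -scalerAl -scalerAr scalerA -rmorphM /= sqrt_mul // sE HE.
- by rewrite -scalerBr nrmZr ?sqrtr_ge0 // ler_piMr // sqrtr_ge0.
- move=> z zx; rewrite -scalerAl -scalerAr; congr (_ *: _); apply: sC.
  by rewrite /H mulrBl mulrBr mul1r mulr1 -scalerAl -scalerAr zx.
Qed.

Lemma nrm_pos t x : selfadjoint x -> nrm (t%:C *: 1 - x) <= t -> pos x.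
Proof. by move=> sx /(nrm_sqrt sx) [h [sh -> _ _]]; exists h. Qed.

Lemma pos_sqrt x : pos x -> exists h,
  [/\ pos h, x = h * h & forall z, z * x = x * z -> z * h = h * z].
Proof.
move=> px; have [h [sh hE hn hC]] := nrm_sqrt (pos_sa px) (pos_nrm px (lexx _)).
by exists h; split=> //; exact: nrm_pos hn.
Qed.

Lemma posD x y : pos x -> pos y -> pos (x + y).
Proof.
move=> px py; apply: (@nrm_pos (nrm x + nrm y)).
  by apply: saD; exact: pos_sa.
rewrite (_ : _ - _ = ((nrm x)%:C *: 1 - x) + ((nrm y)%:C *: 1 - y)).
  by rewrite (le_trans (nrmD _ _)) // lerD // pos_nrm.
by rewrite rmorphD /= scalerDl; nring.
Qed.

Lemma pos_sum (I : Type) (r : seq I) (P : pred I) (F : I -> U) :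
  (forall i, P i -> pos (F i)) -> pos (\sum_(i <- r | P i) F i).
Proof. by move=> h; elim/big_ind: _ => //; [exact: pos0 | exact: posD]. Qed.

Lemma pos_approx x :
  (forall e, 0 < e -> exists2 y, pos y & nrm (x - y) <= e) -> pos x.
Proof.
move=> h; have sx : selfadjoint x.
  by apply: sa_approx => e /h [y /pos_sa sy hy]; exists y.
apply: (@nrm_pos (nrm x + 1)) => //; apply/ler_addgt0Pr => e e0.
have [|y py hy] := h (Num.min 1 e); first by rewrite lt_min ltr01.
move: hy; rewrite le_min => /andP[hy1 hye].
have hyn : nrm y <= nrm x + 1.
  by rewrite (le_trans (nrm_subl y x)) // lerD2l nrmC.
by rewrite (le_trans (nrm_tri y _ _)) // lerD // ?pos_nrm // nrmC.
Qed.

Lemma pos_commM x y : pos x -> pos y -> x * y = y * x -> pos (x * y).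
Proof.
move=> px py c; have [h [ph hE hC]] := pos_sqrt px.
have [k [pk kE kC]] := pos_sqrt py.
have hk : h * k = k * h by apply: kC; apply/esym/hC/esym.
exists (h * k); first by apply: saM => //; exact: pos_sa.
by rewrite hE kE -!mulrA; congr (_ * _); rewrite !mulrA hk.
Qed.

Lemma star_cart h k : selfadjoint h -> selfadjoint k -> h * k = k * h ->
  (h + 'i%C *: k)^† * (h + 'i%C *: k) = h * h + k * k.
Proof.
move=> sh sk c; rewrite starD starZ sh sk conj_i.
rewrite mulrDl !mulrDr -!scalerAl -!scalerAr c scalerA mulNr mulii opprK.
by rewrite scale1r; nring.
Qed.

(** If x = h^2 and - x = k^2, then h and k commute, and h + i k has modulus squared x - x = 0. *)
Lemma pos_anti x : pos x -> pos (- x) -> x = 0.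
Proof.
move=> px pnx; have [h [/pos_sa sh hE hC]] := pos_sqrt px.
have [k [/pos_sa sk kE kC]] := pos_sqrt pnx.
have hk : h * k = k * h.
  by apply/esym/hC; rewrite -[x]opprK kE mulrN mulNr mulrA.
have := star_cart sh sk hk; rewrite -hE -kE subrr => /starM_eq0 h0.
have : (h + 'i%C *: k)^† = 0 by rewrite h0 star0.
rewrite starD starZ sh sk conj_i => h1.
have : (2 : R)%:C *: h = 0.
  rewrite -[RHS](addr0 (0 : U)) -{1}h0 -h1 rmorph_nat scaler_nat mulr2n scaleNr.
  by nring.
move=> /eqP; rewrite scaler_eq0 rmorph_nat pnatr_eq0 /= => /eqP h2.
by rewrite hE h2 mul0r.
Qed.

(** With x = h^2 and s - x = k^2, the element h + i k has modulus squared s, and h is the mean of it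
    and its adjoint. *)
Lemma pos_le_nrm x s : 0 <= s -> pos x -> pos (s%:C *: 1 - x) -> nrm x <= s.
Proof.
move=> s0 px pnx; have [h [/pos_sa sh hE hC]] := pos_sqrt px.
have [k [/pos_sa sk kE kC]] := pos_sqrt pnx.
have hk : h * k = k * h.
  apply/esym/hC; have : x = s%:C *: 1 - k * k by rewrite -kE; nring.
  by move=> ->; nring.
have h1 : nrm (h + 'i%C *: k) ^+ 2 <= s.
  by rewrite -nrm_starM star_cart // -hE -kE addrC subrK nrmZ1.
have h2 : nrm (h - 'i%C *: k) = nrm (h + 'i%C *: k).
  by rewrite -nrm_star starB starZ sh sk conj_i scaleNr opprK.
have h3 : nrm h <= nrm (h + 'i%C *: k).
  have : h = (2^-1)%:C *: ((h + 'i%C *: k) + (h - 'i%C *: k)).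
    rewrite (_ : _ + _ = (2 : R)%:C *: h).
      by rewrite scalerA -rmorphM /= mulVf ?pnatr_eq0 // scale1r.
    by rewrite rmorph_nat scaler_nat mulr2n; nring.
  move=> {1}->; rewrite nrmZr ?invr_ge0 //.
  by have := nrmD (h + 'i%C *: k) (h - 'i%C *: k); rewrite h2; lra.
rewrite hE nrm_sqr // (le_trans _ h1) // ler_pXn2r ?nnegrE ?nrm_ge0 //.
Qed.

End UnitalCStarTheory.

Notation "x ⊑ y" := (pos (y - x)) (at level 70, no associativity) : ring_scope.

(** * Absolutely convergent series and inverses *)

Section Inverses.
Context {R : realType} {U : ubanachType R}.
Implicit Types (x y z H g : U) (e t : R).

Lemma nsum_cvg (x : nat -> U) (c : nat -> R) b : (forall n, nrm (x n) <= c n) ->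
  (forall n, \sum_(i < n) c i <= b) ->
  exists l, nlim (fun n => \sum_(i < n) x i) l.
Proof.
move=> xc cb; apply: ncauchyP => e e0.
have cS n : \sum_(i < n) c i <= \sum_(i < n.+1) c i.
  by rewrite big_ord_recr lerDl (le_trans (nrm_ge0 _) (xc n)).
have [n hn] := monotone_cauchy cS cb e0; exists n => m nm.
have := hn m nm; apply: le_trans.
rewrite -(big_mkord xpredT x) -(big_mkord xpredT c) (big_cat_nat (leq0n n) nm) //=.
rewrite -(big_mkord xpredT c) (big_cat_nat (leq0n n) nm) //= -(big_mkord xpredT x).
rewrite [X in nrm X]addrAC subrr add0r [leRHS]addrAC subrr add0r (le_trans (nrm_sum _ _ _)) //.
by apply: ler_sum => i _.
Qed.

Definition inverses x g := x * g = 1 /\ g * x = 1.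

Lemma inverses_comm x g z : inverses x g -> z * x = x * z -> z * g = g * z.
Proof.
move=> [xg gx] zx; rewrite -[LHS]mul1r -gx -mulrA (mulrA x) -zx.
by rewrite -(mulrA z) xg mulr1.
Qed.

Lemma inverses_uniq x g k : inverses x g -> k * x = 1 -> k = g.
Proof. by move=> [xg gx] kx; rewrite -[LHS]mulr1 -xg mulrA kx mul1r. Qed.

Lemma sum_geo_le (r : R) n : 0 <= r -> r < 1 ->
  \sum_(i < n) r ^+ i <= (1 - r)^-1.
Proof.
move=> r0 r1; have r1' : 0 < 1 - r by rewrite subr_gt0.
rewrite -(ler_pM2l r1') divff ?gt_eqF // -[1 - r]opprB mulNr -subrX1 opprB.
by rewrite gerBl exprn_ge0.
Qed.

Lemma neumann H : nrm H < 1 -> exists g, inverses (1 - H) g.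
Proof.
move=> H1; have [l hl] := @nsum_cvg (fun n => H ^+ n) (fun n => nrm H ^+ n) _
  (fun n => nrmX H n) (fun n => sum_geo_le n (nrm_ge0 H) H1).
have hS := nlimB (nlim_shift hl) (nlim_cst 1).
exists l; split; rewrite ?mulrBl ?mulrBr ?mul1r ?mulr1.
- rewrite (_ : H * l = l - 1) ?subKr //.
  apply: (nlim_uniq (nlimMl H hl)); apply: nlim_ext hS => n.
  rewrite big_ord_recl expr0 addrC addKr mulr_sumr.
  by apply: eq_bigr => i _; rewrite -exprS.
- rewrite (_ : l * H = l - 1) ?subKr //.
  apply: (nlim_uniq (nlimMr H hl)); apply: nlim_ext hS => n.
  rewrite big_ord_recl expr0 addrC addKr mulr_suml.
  by apply: eq_bigr => i _; rewrite -exprSr.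
Qed.

End Inverses.

(** * The order of a C*-algebra: inverses, absolute values, positivity of y^† y *)

Section Positivity.
Context {R : realType} {U : ucstarType R}.
Implicit Types (x y z a b h k g : U) (s t e : R).

Lemma sa_inverses x g : selfadjoint x -> inverses x g -> selfadjoint g.
Proof.
by move=> sx hg; apply: (inverses_uniq hg); rewrite -{1}sx -starM hg.1 star1.
Qed.

Lemma pos_inverses x g : pos x -> inverses x g -> pos g.
Proof.
move=> px hg; have sg := sa_inverses (pos_sa px) hg.
have [h [ph hE hC]] := pos_sqrt px.
have gh : g * h = h * g by apply: hC; rewrite hg.1 hg.2.
exists (g * h); first by apply: saM => //; exact: pos_sa.
transitivity (g * (h * h) * g); first by rewrite -hE hg.2 mul1r.
by rewrite -!mulrA gh.
Qed.

(** Divided by t = ‖x - e‖ + e, x is at distance less than 1 from the unit, so a Neumann series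
    inverts it. The bound on the inverse k comes from 1/e - k = (1/e) k (x - e), a product of
    commuting positive elements. *)
Lemma pos_invertible x e : 0 < e -> e%:C *: 1 ⊑ x ->
  exists g, [/\ pos g, inverses x g & nrm g <= e^-1].
Proof.
move=> e0 px; pose t := nrm (x - e%:C *: 1) + e.
have t0 : 0 < t by rewrite ltr_wpDl // nrm_ge0.
pose H := 1 - (t^-1)%:C *: x.
have tH : t%:C *: H = (nrm (x - e%:C *: 1))%:C *: 1 - (x - e%:C *: 1).
  rewrite /H scalerBr scalerA -rmorphM /= divff ?gt_eqF // scale1r /t rmorphD /=.
  by rewrite scalerDl; nring.
have H1 : nrm H < 1.
  rewrite -(ltr_pM2l t0) -nrmZr ?ltW // mulr1 tH.
  by rewrite (le_lt_trans (pos_nrm px (lexx _))) // /t ltrDl.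
have [g [g1 g2]] := neumann H1.
have HE : x = t%:C *: (1 - H).
  by rewrite /H opprB addrC subrK scalerA -rmorphM /= divff ?gt_eqF // scale1r.
have ti : t%:C * (t^-1)%:C = 1 :> R[i] by rewrite -rmorphM /= divff // gt_eqF.
have hg : inverses x ((t^-1)%:C *: g).
  split; first by rewrite HE -scalerAl -scalerAr scalerA ti scale1r.
  by rewrite HE -scalerAl -scalerAr scalerA mulrC ti scale1r.
have px0 : pos x.
  rewrite -[x](subrK (e%:C *: 1)); apply: posD => //.
  by apply: posZ; [exact: ltW | exact: pos1].
have pg := pos_inverses px0 hg.
exists ((t^-1)%:C *: g); split => //; move: (_ *: g) hg pg => k hg pg.
apply: pos_le_nrm => //; first by rewrite invr_ge0 ltW.
rewrite (_ : _ - k = (e^-1)%:C *: (k * (x - e%:C *: 1))).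
  apply: posZ; first by rewrite invr_ge0 ltW.
  apply: pos_commM => //.
  by rewrite mulrBl mulrBr hg.1 hg.2 -scalerAl -scalerAr mul1r mulr1.
rewrite mulrBr hg.2 -scalerAr mulr1 scalerBr scalerA -rmorphM /= mulVf ?gt_eqF //.
by rewrite scale1r.
Qed.

(** Here k is |a|. For c = k + a one has c^2 = y c with y = 2 k, so formally c = c y^-1 c.
    Regularizing the inverse gives positive elements c (y + e)^-1 c, which differ from c by e c (y +
    e)^-1, of norm at most e. *)
Lemma pos_absD a k : selfadjoint a -> pos k -> k * k = a * a -> k * a = a * k ->
  pos (k + a).
Proof.
move=> sa pk kk ka; have sk := pos_sa pk; set c := k + a.
have sc : selfadjoint c by exact: saD.
have kc : k * c = c * k by rewrite /c mulrDl mulrDr ka.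
have cc : c * c = (2 : R)%:C *: (k * c).
  rewrite rmorph_nat scaler_nat mulr2n /c !mulrDl !mulrDr kk ka.
  by nring.
pose y := (2 : R)%:C *: k; have py : pos y by apply: posZ.
have cy : c * y = y * c by rewrite /y -scalerAl -scalerAr kc.
have cyc : c * c = y * c by rewrite cc /y -scalerAl.
clearbody c y; apply: pos_approx => e e0.
have [|g [pg hg gn]] := @pos_invertible (y + e%:C *: 1) e e0; first by rewrite addrK.
have cg : c * g = g * c.
  apply: (inverses_comm hg).
  by rewrite mulrDl mulrDr cy -scalerAl -scalerAr mul1r mulr1.
have yg : y * g = g * y.
  apply: (inverses_comm hg).
  by rewrite mulrDl mulrDr -scalerAl -scalerAr mul1r mulr1.
have ygE : y * g = 1 - e%:C *: g.
  by rewrite -hg.1 mulrDl -scalerAl mul1r addrK.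
have yg1 : nrm (y * g) <= 1.
  apply: pos_le_nrm => //; first exact: pos_commM.
  rewrite ygE scale1r opprB addrC subrK; apply: posZ => //; exact: ltW.
(* (c g)^2 = (y g) (c g) with ‖y g‖ <= 1, so ‖c g‖^2 <= ‖c g‖. *)
have cg1 : nrm (c * g) <= 1.
  have [->|n0] := eqVneq (nrm (c * g)) 0; first exact: ler01.
  have n1 : 0 < nrm (c * g) by rewrite lt_neqAle eq_sym n0 nrm_ge0.
  rewrite -(ler_pM2r n1) mul1r -expr2 -nrm_sqr; last first.
    by apply: saM => //; exact: pos_sa.
  rewrite (_ : _ * _ = (y * g) * (c * g)).
    rewrite (le_trans (nrmM _ _)) // -[leRHS]mul1r.
    by apply: ler_wpM2r => //; exact: nrm_ge0.
  have e2 w : w * g * (c * g) = w * c * (g * g).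
    by rewrite -mulrA (mulrA g c g) -cg !mulrA.
  by rewrite !e2 cyc.
exists (c * g * c).
  have [r [/pos_sa sr rE rC]] := pos_sqrt pg.
  have cr : c * r = r * c by apply: rC.
  exists (c * r); first exact: saM.
  by rewrite rE -!mulrA -cr.
rewrite (_ : c - _ = e%:C *: (c * g)).
  by rewrite nrmZr; [rewrite ler_piMr // ltW | exact: ltW].
by rewrite -mulrA -cg mulrA cyc -mulrA cg mulrA ygE mulrBl mul1r opprB addrC
  subrK -scalerAl.
Qed.

Lemma pos_abs a : selfadjoint a -> exists p n : U,
  [/\ pos p, pos n, a = p - n, p * n = 0 & n * p = 0].
Proof.
move=> sa; have [k [pk kE kC]] := pos_sqrt (pos_sqr sa).
have ak : a * k = k * a by apply: kC; rewrite mulrA.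
have half : (2^-1)%:C + (2^-1)%:C = 1 :> R[i].
  by rewrite -rmorphD /= (_ : 2^-1 + 2^-1 = 1) //; lra.
exists ((2^-1)%:C *: (k + a)), ((2^-1)%:C *: (k - a)); split.
- by apply: posZ; rewrite ?invr_ge0 //; apply: pos_absD.
- apply: posZ; rewrite ?invr_ge0 //; apply: pos_absD => //; first exact: saN.
    by rewrite -kE mulrN mulNr opprK.
  by rewrite mulrN mulNr ak.
- by rewrite -[LHS]scale1r -half; nring.
- rewrite -scalerAl -scalerAr mulrDl !mulrBr ak -kE (_ : _ + _ = 0) ?scaler0 //.
  by nring.
- rewrite -scalerAl -scalerAr mulrBl !mulrDr ak -kE (_ : _ - _ = 0) ?scaler0 //.
  by nring.
Qed.

Lemma pos_sqrD y : pos (y^† * y + y * y^†).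
Proof.
pose h := y + y^†; pose k := 'i%C *: (y - y^†).
have sh : selfadjoint h by rewrite /h /selfadjoint starD starK addrC.
have sk : selfadjoint k.
  by rewrite /k /selfadjoint starZ starB starK conj_i scaleNr -scalerN opprB.
rewrite (_ : _ + _ = (2^-1)%:C *: (h * h + k * k)).
  apply: posZ; rewrite ?invr_ge0 //.
  by apply: posD; exact: pos_sqr.
rewrite /k -scalerAl -scalerAr scalerA mulii scaleN1r /h.
rewrite [X in _ = _ *: X](_ : _ = (2 : R)%:C *: (y^† * y + y * y^†)).
  by rewrite scalerA -rmorphM /= mulVf ?pnatr_eq0 // scale1r.
by rewrite rmorph_nat scaler_nat mulr2n; nring.
Qed.

Lemma sa_ule_nrm a t : selfadjoint a -> nrm a <= t -> a ⊑ t%:C *: 1.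
Proof.
move=> sa hn; apply: (@nrm_pos _ _ t).
  by apply: saB => //; apply: saZ; exact: sa1.
by rewrite opprB addrC subrK.
Qed.
Lemma pos_ule_nrm a : pos a -> a ⊑ (nrm a)%:C *: 1.
Proof. by move=> pa; apply: sa_ule_nrm => //; exact: pos_sa. Qed.

(** An inverse r of ‖b‖ - b would bound it below by 1/‖r‖, whence ‖b‖ <= ‖b‖ - 1/‖r‖. In other
    words, the norm of b lies in its spectrum. *)
Lemma pos_nrm_not_invertible (b x r : U) : x = (nrm b)%:C *: 1 - b ->
  pos b -> 0 < nrm b -> ~ inverses x r.
Proof.
move=> xE pb t0 hr; set t := nrm b in xE t0.
have px : pos x by rewrite xE; exact: pos_ule_nrm.
have pr := pos_inverses px hr.
have r0 : 0 < nrm r.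
  rewrite lt_neqAle nrm_ge0 andbT eq_sym; apply/eqP => /nrm_eq0 r0.
  by have := hr.1; rewrite r0 mulr0 => /esym/eqP; rewrite oner_eq0.
have p1 : pos ((nrm r)%:C *: x - 1).
  have -> : (nrm r)%:C *: x - 1 = x * ((nrm r)%:C *: 1 - r).
    by rewrite mulrBr hr.1 -scalerAr mulr1.
  apply: pos_commM => //; first exact: pos_ule_nrm.
  by rewrite mulrBl mulrBr hr.1 hr.2 -scalerAl -scalerAr mul1r mulr1.
have : nrm b <= t - (nrm r)^-1.
  have rt : 1 <= nrm r * t.
    have h1 := pos_nrm pb (lexx _); rewrite -/t -xE in h1.
    have := nrmM x r; rewrite hr.1 => h2.
    have h3 : 1 <= nrm (1 : U).
      have n1 : 0 < nrm (1 : U).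
        rewrite lt_neqAle nrm_ge0 andbT eq_sym; apply/eqP => /nrm_eq0/eqP.
        by rewrite oner_eq0.
      by rewrite -(ler_pM2r n1) mul1r -{1}[X in nrm X](mulr1 (1 : U)) nrmM.
    rewrite (le_trans h3) // (le_trans h2) // mulrC ler_wpM2l //; exact: ltW.
  apply: pos_le_nrm => //.
    by rewrite subr_ge0 -(ler_pM2l r0) divff ?gt_eqF.
  rewrite (_ : _ - b = ((nrm r)^-1)%:C *: ((nrm r)%:C *: x - 1)).
    by apply: posZ => //; rewrite invr_ge0 ltW.
  rewrite scalerBr scalerA -rmorphM /= mulVf ?gt_eqF // scale1r rmorphB /= scalerBl.
  by rewrite xE; nring.
by have := r0; rewrite -/t -invr_gt0; lra.
Qed.

(* The spectra of w^*w and ww^* agree away from 0. *)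
Lemma pos_starM_opp (w : U) : pos (- (w^† * w)) -> w = 0.
Proof.
move=> pb; set b := - (w^† * w) in pb.
have pB : pos (w * w^†).
  have -> : w * w^† = (w^† * w + w * w^†) + b by rewrite /b; nring.
  by apply: posD => //; exact: pos_sqrD.
suff b0 : b = 0.
  by apply: starM_eq0; rewrite -[LHS]opprK -/b b0 oppr0.
apply: nrm_eq0; apply/eqP; apply: contraT => n0.
have {}n0 : 0 < nrm b by rewrite lt_neqAle eq_sym n0 nrm_ge0.
set t := nrm b in n0.
have [|g [pg [g1 g2] _]] := @pos_invertible (w * w^† + t%:C *: 1) t n0.
  by rewrite addrK.
(* The resolvent identity: an inverse of t + w^† w obtained from the inverse g of t + w w^†. *)
pose r := (t^-1)%:C *: (1 - w^† * g * w).
have ti : t%:C * (t^-1)%:C = 1 :> R[i] by rewrite -rmorphM /= divff // gt_eqF.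
have wg : w * w^† * g = 1 - t%:C *: g by rewrite -g1 mulrDl -scalerAl mul1r addrK.
have gw : g * (w * w^†) = 1 - t%:C *: g by rewrite -g2 mulrDr -scalerAr mulr1 addrK.
have hr : inverses (t%:C *: 1 - b) r.
  rewrite /b opprK; split; rewrite /r -?scalerAl -?scalerAr.
    rewrite (_ : _ * _ = t%:C *: 1 - t%:C *: (w^† * g * w) + w^† * w -
                           w^† * (w * w^† * g) * w); last by nring.
    rewrite wg (_ : _ - w^† * _ * w = t%:C *: 1); last by nring.
    by rewrite scalerA mulrC ti scale1r.
  rewrite (_ : _ * _ = t%:C *: 1 - t%:C *: (w^† * g * w) + w^† * w -
                           w^† * (g * (w * w^†)) * w); last by nring.
  rewrite gw (_ : _ - w^† * _ * w = t%:C *: 1); last by nring.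
  by rewrite scalerA mulrC ti scale1r.
by case: (@pos_nrm_not_invertible b _ r erefl pb n0).
Qed.

(** If n is the negative part of y^† y, then (y n)^† (y n) = - n^3, so [pos_starM_opp] gives y n =
    0, hence n^3 = 0 and n = 0. *)
Lemma pos_starM y : pos (y^† * y).
Proof.
have sa : selfadjoint (y^† * y) by rewrite /selfadjoint starM starK.
have [p [n [pp pn E pn0 np0]]] := pos_abs sa.
have sn := pos_sa pn.
have wE : (y * n)^† * (y * n) = - (n * (n * n)).
  by rewrite starM sn -!mulrA (mulrA y^†) E mulrBl pn0 sub0r !mulrN.
have : y * n = 0.
  apply: pos_starM_opp; rewrite wE opprK; apply: pos_commM => //; last by rewrite mulrA.
  exact: pos_sqr.
move=> yn; have : n * (n * n) = 0 by rewrite -[LHS]opprK -wE yn mulr0 oppr0.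
move=> n3; have n2 : n * n = 0.
  by apply: starM_eq0; rewrite starM sn -mulrA n3 mulr0.
have n0 : n = 0 by apply: starM_eq0; rewrite sn.
by rewrite E n0 subr0.
Qed.

Lemma pos_conj x z : pos x -> pos (z^† * x * z).
Proof.
move=> [h sh ->]; have := pos_starM (h * z).
by rewrite starM sh !mulrA.
Qed.
Lemma pos_conjr x z : pos x -> pos (z * x * z^†).
Proof. by move=> px; have := pos_conj z^† px; rewrite starK. Qed.
Lemma pos_mulstar x : pos (x * x^†).
Proof. by have := pos_starM x^†; rewrite starK. Qed.

Lemma ule_trans y x z : x ⊑ y -> y ⊑ z -> x ⊑ z.
Proof. by move=> h1 h2; have := posD h2 h1; rewrite addrA subrK. Qed.
Lemma uleD x y z w : x ⊑ y -> z ⊑ w -> x + z ⊑ y + w.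
Proof. by move=> h1 h2; rewrite opprD addrACA; exact: posD. Qed.
Lemma ule_conj x y z : x ⊑ y -> z^† * x * z ⊑ z^† * y * z.
Proof. by move=> h; rewrite -mulrBl -mulrBr; exact: pos_conj. Qed.
Lemma uleZ t x y : 0 <= t -> x ⊑ y -> t%:C *: x ⊑ t%:C *: y.
Proof. by move=> t0 h; rewrite -scalerBr; exact: posZ. Qed.
Lemma uleZr s t x : s <= t -> pos x -> s%:C *: x ⊑ t%:C *: x.
Proof. by move=> st px; rewrite -scalerBl -rmorphB; apply: posZ; rewrite ?subr_ge0. Qed.
Lemma ule_anti x y : x ⊑ y -> y ⊑ x -> x = y.
Proof.
move=> h1 h2; apply/eqP; rewrite -subr_eq0; apply/eqP/pos_anti => //.
by rewrite opprB.
Qed.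

Lemma nrm_mono a b : pos a -> a ⊑ b -> nrm a <= nrm b.
Proof.
move=> pa ab; have pb : pos b by rewrite -(subrK a b); apply: posD.
by apply: pos_le_nrm (ule_trans ab (pos_ule_nrm pb)); rewrite ?nrm_ge0.
Qed.

Lemma sa_nrm_le a t : selfadjoint a -> 0 <= t ->
  a ⊑ t%:C *: 1 -> - (t%:C *: 1) ⊑ a -> nrm a <= t.
Proof.
move=> sa t0 h1 h2; rewrite -(@ler_pXn2r _ 2) ?nnegrE ?nrm_ge0 // -nrm_sqr //.
apply: pos_le_nrm; [exact: sqr_ge0 | exact: pos_sqr |].
rewrite opprK addrC in h2.
rewrite (_ : _ - _ = (t%:C *: 1 - a) * (t%:C *: 1 + a)).
  by apply: pos_commM => //; nring.
by rewrite rmorphXn /= expr2; nring.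
Qed.

End Positivity.

(** * The unitization *)

Section Completeness.
Context {R : realType}.

Lemma complexR_gt0 (e : R[i]) : 0 < e -> e = (complex.Re e)%:C /\ 0 < complex.Re e.
Proof. by case: e => a b; rewrite ltcE /= => /andP[/eqP -> ->]. Qed.

Lemma rnorm_complete (V : completeNormedModType R[i]) (u : nat -> V) :
  (forall e, 0 < e -> exists n, forall m, (n <= m)%N -> rnorm (u m - u n) <= e) ->
  exists l, forall e, 0 < e -> exists n, forall m, (n <= m)%N -> rnorm (u m - l) <= e.
Proof.
move=> hu; have cu : cvg (u n @[n --> \oo]).
  apply/cauchy_cvgP/cauchy_exP => e /complexR_gt0 [eE e0].
  have [|n hn] := hu (complex.Re e / 2); first by rewrite divr_gt0.
  exists (u n); exists n => // m /= nm; rewrite -ball_normE /= eE rnormE ltcR rnormB.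
  by rewrite (le_lt_trans (hn m nm)) // gtr_pMr // invf_lt1 // ltr1n.
exists (lim (u n @[n --> \oo])) => e e0.
have /cvgrPdist_le/(_ e%:C) := cu; rewrite ltcR => /(_ e0) [n _ hn].
by exists n => m /= /hn /=; rewrite rnormE lecR rnormB.
Qed.

Lemma real_complete (u : nat -> R) :
  (forall e, 0 < e -> exists n, forall m, (n <= m)%N -> `|u m - u n| <= e) ->
  exists l, forall e, 0 < e -> exists n, forall m, (n <= m)%N -> `|u m - l| <= e.
Proof.
move=> hu; have cu : cvg (u n @[n --> \oo]).
  apply/cauchy_cvgP/cauchy_exP => e e0.
  have [|n hn] := hu (e / 2); first by rewrite divr_gt0.
  exists (u n); exists n => // m /= nm; rewrite -ball_normE /= distrC.
  by rewrite (le_lt_trans (hn m nm)) // gtr_pMr // invf_lt1 // ltr1n.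
exists (lim (u n @[n --> \oo])) => e e0.
have /cvgrPdist_le/(_ e e0) [n _ hn] := cu.
by exists n => m /= /hn /=; rewrite distrC.
Qed.

Lemma normr_Re_le (z : R[i]) : `|complex.Re z| <= rnorm z.
Proof.
by rewrite /rnorm normc_def /= -[leLHS]sqrtr_sqr ler_wsqrtr // lerDl sqr_ge0.
Qed.
Lemma normr_Im_le (z : R[i]) : `|complex.Im z| <= rnorm z.
Proof.
by rewrite /rnorm normc_def /= -[leLHS]sqrtr_sqr ler_wsqrtr // lerDr sqr_ge0.
Qed.
Lemma rnorm_le_ReIm (z : R[i]) : rnorm z <= `|complex.Re z| + `|complex.Im z|.
Proof.
have -> : z = (complex.Re z)%:C + 'i%C * (complex.Im z)%:C by exact: complexE.
rewrite (le_trans (rnormD _ _)) // rnormM rnorm_i mul1r !rnormC.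
by case: z => a b /=; rewrite !(mul0r, mul1r, addr0, add0r, subr0, mulr0).
Qed.

Lemma complex_complete (u : nat -> R[i]) :
  (forall e, 0 < e -> exists n, forall m, (n <= m)%N -> rnorm (u m - u n) <= e) ->
  exists l, forall e, 0 < e -> exists n, forall m, (n <= m)%N -> rnorm (u m - l) <= e.
Proof.
move=> hu.
have [|a ha] := @real_complete (fun n => complex.Re (u n)).
  move=> e /hu [n hn]; exists n => m /hn; apply: le_trans.
  by rewrite -raddfB normr_Re_le.
have [|b hb] := @real_complete (fun n => complex.Im (u n)).
  move=> e /hu [n hn]; exists n => m /hn; apply: le_trans.
  by rewrite -raddfB normr_Im_le.
exists (Complex a b) => e e0; have e2 : 0 < e / 2 by rewrite divr_gt0.
have [n hn] := ha _ e2; have [m hm] := hb _ e2.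
exists (maxn n m) => k; rewrite geq_max => /andP[/hn h1 /hm h2].
rewrite (le_trans (rnorm_le_ReIm _)) // [leRHS]splitr.
by move: h1 h2; case: (u k) => x y /= h1 h2; rewrite lerD.
Qed.

End Completeness.

HB.mixin Record isBanachStar (R : realType) V
    of StarLmodule R[i] V := {
  bnrm : V -> R;
  bmulA : forall x y z : V, x · (y · z) = (x · y) · z;
  bmulDl : forall x y z : V, (x + y) · z = x · z + y · z;
  bmulDr : forall x y z : V, x · (y + z) = x · y + x · z;
  bmulZl : forall (k : R[i]) (x y : V), (k *: x) · y = k *: (x · y);
  bmulZr : forall (k : R[i]) (x y : V), x · (k *: y) = k *: (x · y);
  bnrm_eq0 : forall x : V, bnrm x = 0 -> x = 0;
  bnrmD : forall x y : V, bnrm (x + y) <= bnrm x + bnrm y;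
  bnrmZ : forall (k : R[i]) (x : V), bnrm (k *: x) = rnorm k * bnrm x;
  bnrmM : forall x y : V, bnrm (x · y) <= bnrm x * bnrm y;
  bnrm_complete : forall u : nat -> V,
    (forall e, 0 < e -> exists n, forall m, (n <= m)%N -> bnrm (u m - u n) <= e) ->
    exists l, forall e, 0 < e -> exists n, forall m, (n <= m)%N -> bnrm (u m - l) <= e }.

#[short(type="banachStarType")]
HB.structure Definition BanachStar (R : realType) :=
  { V of StarLmodule R[i] V & isBanachStar R V }.

Definition uz {R : realType} (V : banachStarType R) := (V * R[i])%type.

Section UnitizationRing.
Context {R : realType} {V : banachStarType R}.
Implicit Types x y z : uz V.

HB.instance Definition _ := GRing.Lmodule.on (uz V).

Definition uz_mul x y : uz V := (x.1 · y.1 + x.2 *: y.1 + y.2 *: x.1, x.2 * y.2).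
Definition uz_one : uz V := (0, 1).
Definition uz_star x : uz V := (x.1^†, conjc x.2).

HB.instance Definition _ := hasMulStar.Build (uz V) uz_mul uz_star.

Lemma bmul0l (v : V) : 0 · v = 0.
Proof. by rewrite -[X in X · _](scale0r (0 : V)) bmulZl scale0r. Qed.
Lemma bmul0r (v : V) : v · 0 = 0.
Proof. by rewrite -[X in _ · X](scale0r (0 : V)) bmulZr scale0r. Qed.

Let uz_mulA : associative uz_mul.
Proof.
move=> [a k] [b l] [c m]; congr pair => /=; last exact: mulrA.
rewrite !bmulDl !bmulDr !scalerDr !bmulZl !bmulZr bmulA !scalerA.
rewrite -!addrA; congr (_ + _).
rewrite [RHS]addrCA; congr (_ + _); rewrite [m * k]mulrC [m * l]mulrC.
by rewrite addrCA; congr (_ + _); exact: addrCA.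
Qed.
Let uz_mul1 : left_id uz_one uz_mul.
Proof.
by move=> [a k]; rewrite /uz_mul /= bmul0l scaler0 addr0 add0r scale1r mul1r.
Qed.
Let uz_mulr1 : right_id uz_one uz_mul.
Proof.
by move=> [a k]; rewrite /uz_mul /= bmul0r scaler0 !add0r scale1r mulr1.
Qed.
Let uz_mulDl : left_distributive uz_mul +%R.
Proof.
move=> [a k] [b l] [c m]; congr pair => /=; last exact: mulrDl.
rewrite bmulDl scalerDl scalerDr [RHS]addrACA; congr (_ + _).
exact: addrACA.
Qed.
Let uz_mulDr : right_distributive uz_mul +%R.
Proof.
move=> [a k] [b l] [c m]; congr pair => /=; last exact: mulrDr.
rewrite bmulDr scalerDl scalerDr [RHS]addrACA; congr (_ + _).
exact: addrACA.
Qed.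
Let uz_one_neq0 : uz_one != 0.
Proof. by apply/eqP => -[/eqP]; rewrite oner_eq0. Qed.

HB.instance Definition _ := GRing.Zmodule_isNzRing.Build (uz V)
  uz_mulA uz_mul1 uz_mulr1 uz_mulDl uz_mulDr uz_one_neq0.

Let uz_scaleAl (k : R[i]) (x y : uz V) : k *: (x * y) = (k *: x) * y.
Proof.
case: x y => [a l] [b m]; congr pair => /=; last exact: mulrA.
by rewrite !scalerDr !scalerA bmulZl [m * k]mulrC.
Qed.
HB.instance Definition _ := GRing.Lmodule_isLalgebra.Build R[i] (uz V) uz_scaleAl.

Let uz_scaleAr (k : R[i]) (x y : uz V) : k *: (x * y) = x * (k *: y).
Proof.
case: x y => [a l] [b m]; congr pair => /=; last exact: mulrCA.
by rewrite !scalerDr !scalerA bmulZr [l * k]mulrC.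
Qed.
HB.instance Definition _ := GRing.Lalgebra_isAlgebra.Build R[i] (uz V) uz_scaleAr.

Definition uz_emb (v : V) : uz V := (v, 0).

Lemma uz_embM v w : uz_emb (v · w) = uz_emb v * uz_emb w.
Proof. by congr pair; rewrite /= ?mul0r // !scale0r !addr0. Qed.
Lemma uz_embD v w : uz_emb (v + w) = uz_emb v + uz_emb w.
Proof. by congr pair; exact/esym/addr0. Qed.
Lemma uz_embZ k v : uz_emb (k *: v) = k *: uz_emb v.
Proof. by congr pair; exact/esym/mulr0. Qed.
Lemma uz_embN v : uz_emb (- v) = - uz_emb v.
Proof. by congr pair; exact/esym/oppr0. Qed.
Lemma uz_embP x : x.2 = 0 -> x = uz_emb x.1.
Proof. by case: x => a k /= ->. Qed.

(* The l^1-norm: a Banach algebra norm, but not a C*-norm. *)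
Definition uz_l1 x : R := bnrm x.1 + rnorm x.2.

Lemma bnrm0 : bnrm (0 : V) = 0.
Proof. by rewrite -(scale0r (0 : V)) bnrmZ rnorm0 mul0r. Qed.
Lemma bnrmN (v : V) : bnrm (- v) = bnrm v.
Proof. by rewrite -scaleN1r bnrmZ rnormN1 mul1r. Qed.
Lemma bnrm_ge0 (v : V) : 0 <= bnrm v.
Proof. by have := bnrmD v (- v); rewrite subrr bnrm0 bnrmN; lra. Qed.

Lemma uz_complete (u : nat -> uz V) :
  (forall e, 0 < e -> exists n, forall m, (n <= m)%N -> uz_l1 (u m - u n) <= e) ->
  exists l, forall e, 0 < e -> exists n, forall m, (n <= m)%N -> uz_l1 (u m - l) <= e.
Proof.
move=> hu.
have [|a ha] := @bnrm_complete R V (fun n => (u n).1).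
  move=> e /hu [n hn]; exists n => m /hn; apply: le_trans.
  by rewrite lerDl rnorm_ge0.
have [|b hb] := @complex_complete R (fun n => (u n).2).
  move=> e /hu [n hn]; exists n => m /hn; apply: le_trans.
  by rewrite lerDr bnrm_ge0.
exists (a, b) => e e0; have e2 : 0 < e / 2 by rewrite divr_gt0.
have [n hn] := ha _ e2; have [m hm] := hb _ e2.
exists (maxn n m) => k; rewrite geq_max => /andP[/hn h1 /hm h2].
by rewrite [leRHS]splitr lerD.
Qed.

End UnitizationRing.

Definition uz1 {R : realType} (V : banachStarType R) := uz V.

Section L1Unitization.
Context {R : realType} {V : banachStarType R}.
HB.instance Definition _ := GRing.Algebra.on (uz1 V).
HB.instance Definition _ := StarLmodule.on (uz1 V).

Let l1_eq0 (x : uz1 V) : uz_l1 x = 0 -> x = 0.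
Proof.
case: x => a k /eqP; rewrite paddr_eq0 ?bnrm_ge0 ?rnorm_ge0 //= => /andP[].
by move=> /eqP/bnrm_eq0 -> /eqP/rnorm_eq0 ->.
Qed.
Let l1D (x y : uz1 V) : uz_l1 (x + y) <= uz_l1 x + uz_l1 y.
Proof. by rewrite /uz_l1 addrACA lerD ?bnrmD ?rnormD. Qed.
Let l1Z k (x : uz1 V) : uz_l1 (k *: x) = rnorm k * uz_l1 x.
Proof. by rewrite /uz_l1 /= bnrmZ rnormM mulrDr. Qed.
Let l1M (x y : uz1 V) : uz_l1 (x * y) <= uz_l1 x * uz_l1 y.
Proof.
case: x y => [a k] [b l]; rewrite /uz_l1 /=.
have h1 := bnrmD (a · b + k *: b) (l *: a); have h2 := bnrmD (a · b) (k *: b).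
have h3 := bnrmM a b; move: h1 h2; rewrite !bnrmZ rnormM => h1 h2.
by rewrite mulrDl !mulrDr; lra.
Qed.
Let l11 : uz_l1 (1 : uz1 V) <= 1.
Proof. by rewrite /uz_l1 /= bnrm0 rnorm1 add0r. Qed.

HB.instance Definition _ := isUnitalBanach.Build R (uz1 V)
  l1_eq0 l1D l1Z l1M l11 uz_complete.
End L1Unitization.

(** An alias of the carrier, so that the real-valued norm is attached without interfering with the
    structures already present on [A]. *)
Definition underlying_banach {R : realType} (A : cstarAlgType R) : Type := A.

Section CStarUnitization.
Context {R : realType} (A : cstarAlgType R).
Local Notation B := (underlying_banach A).

HB.instance Definition _ := StarLmodule.copy B A.

Let complete : forall u : nat -> A,
    (forall e, 0 < e -> exists n, forall m, (n <= m)%N -> rnorm (u m - u n) <= e) ->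
    exists l, forall e, 0 < e -> exists n, forall m, (n <= m)%N -> rnorm (u m - l) <= e.
Proof. exact: rnorm_complete. Qed.

HB.instance Definition _ := @isBanachStar.Build R B (@rnorm R A)
  (@amulA R A) (@amulDl R A) (@amulDr R A) (@amulZl R A) (@amulZr R A)
  (@rnorm_eq0 R A) (@rnormD R A) (@rnormZ R A) (@amul_rnormM R A) complete.

(* The unitization of A with the larger of the operator norm and |.| on scalars:
   a C*-norm whether or not A has a unit. *)
Definition cuz := uz B.
HB.instance Definition _ := GRing.Algebra.on cuz.
HB.instance Definition _ := StarLmodule.on cuz.

Implicit Types (x y : cuz) (a b : A).

Definition lact x : A -> A := fun b => x.1 · b + x.2 *: b.

Lemma lactM x y b : lact (x * y) b = lact x (lact y b).
Proof.
rewrite /lact /= amulDl amulDl amulDr !amulZl amulZr amulA scalerDr !scalerA -!addrA.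
by congr (_ + _); rewrite addrCA.
Qed.
Lemma lactD x y b : lact (x + y) b = lact x b + lact y b.
Proof. by rewrite /lact /= amulDl scalerDl addrACA. Qed.
Lemma lactZ k x b : lact (k *: x) b = k *: lact x b.
Proof. by rewrite /lact /= amulZl scalerDr scalerA. Qed.
Lemma lact_scale x k b : lact x (k *: b) = k *: lact x b.
Proof. by rewrite /lact amulZr scalerDr !scalerA mulrC. Qed.
Lemma lact1 b : lact 1 b = b.
Proof.
by rewrite /lact /= (@bmul0l R B) scale1r add0r.
Qed.
Lemma lact_emb a b : lact (uz_emb (a : B)) b = a · b.
Proof. by rewrite /lact /= scale0r addr0. Qed.
Lemma lact_star x b c : (lact x b)^† · c = b^† · lact x^† c.
Proof.
rewrite /lact astarD astarM astarZ amulDl amulDr amulA; congr (_ + _).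
by rewrite amulZl amulZr.
Qed.

Lemma lact_bound x b : rnorm (lact x b) <= (rnorm (x.1 : A) + rnorm x.2) * rnorm b.
Proof.
rewrite (le_trans (rnormD _ _)) // mulrDl lerD ?amul_rnormM //.
by rewrite rnormZ.
Qed.

Lemma rnorm_gt0 a : a != 0 -> 0 < rnorm a.
Proof.
move=> a0; rewrite lt_neqAle rnorm_ge0 andbT eq_sym; apply/eqP => /rnorm_eq0.
exact/eqP.
Qed.

Lemma lact_ubound x :
  has_ubound [set rnorm (lact x b) | b in [set b : A | rnorm b <= 1]].
Proof.
exists (rnorm (x.1 : A) + rnorm x.2) => _ [c /= c1 <-].
by rewrite (le_trans (lact_bound _ _)) // ler_piMr // addr_ge0 ?rnorm_ge0.
Qed.

Lemma lact_op_norm x b : rnorm (lact x b) <= unitization_norm x * rnorm b.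
Proof.
have [->|b0] := eqVneq b 0.
  by rewrite -[X in lact x X](scale0r (0 : A)) lact_scale scale0r rnorm0 mulr0.
have bp := rnorm_gt0 b0.
rewrite -ler_pdivrMr // mulrC -[X in X * _]rnormC_ge0 ?invr_ge0 ?rnorm_ge0 //.
rewrite -rnormZ -lact_scale; apply: ub_le_sup; last first.
  exists ((rnorm b)^-1%:C *: b) => //=.
  by rewrite rnormZ rnormC_ge0 ?invr_ge0 ?rnorm_ge0 // mulVf // gt_eqF.
exact: lact_ubound.
Qed.

Lemma unitization_norm_le x K : 0 <= K ->
  (forall b, rnorm (lact x b) <= K * rnorm b) -> unitization_norm x <= K.
Proof.
move=> K0 h; rewrite /unitization_norm /op_norm; set S := (X in sup X).
have [->|/set0P ne] := eqVneq S set0; first by rewrite sup0.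
apply: ge_sup => // _ [b /= b1 <-]; rewrite (le_trans (h b)) //.
by rewrite ler_piMr.
Qed.

Lemma unitization_norm_ge0 x : 0 <= unitization_norm x.
Proof.
apply: ub_le_sup; first exact: lact_ubound.
exists 0 => /=; first by rewrite rnorm0.
by rewrite (@bmul0r R B) scaler0 addr0 rnorm0.
Qed.

Definition cnrm x : R := Num.max (unitization_norm x) (rnorm x.2).

Lemma unitization_le_cnrm x : unitization_norm x <= cnrm x.
Proof. by rewrite le_max lexx. Qed.
Lemma scalar_le_cnrm x : rnorm x.2 <= cnrm x.
Proof. by rewrite le_max lexx orbT. Qed.
Lemma cnrm_ge0 x : 0 <= cnrm x.
Proof. exact: le_trans (unitization_norm_ge0 x) (unitization_le_cnrm x). Qed.
Lemma lact_cnrm x b : rnorm (lact x b) <= cnrm x * rnorm b.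
Proof.
rewrite (le_trans (lact_op_norm x b)) // ler_wpM2r ?rnorm_ge0 //.
exact: unitization_le_cnrm.
Qed.
Lemma cnrm_le x K : (forall b, rnorm (lact x b) <= K * rnorm b) -> rnorm x.2 <= K ->
  cnrm x <= K.
Proof.
move=> h1 h2; have K0 := le_trans (rnorm_ge0 _) h2.
by rewrite ge_max h2 andbT unitization_norm_le.
Qed.

Lemma astar_rnormE a : rnorm a^† = rnorm a.
Proof. by apply/eqP; rewrite eq_le astar_rnorm -{1}(astarK a) astar_rnorm. Qed.
Lemma rnorm_starM a : rnorm (a^† · a) = rnorm a ^+ 2.
Proof. by apply: complexI; rewrite rmorphXn /= -!rnormE astar_norm. Qed.

(** Testing on the adjoint of a turns the operator bound into ‖a‖^2 <= K ‖a‖, by the C*-identity. *)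
Lemma rnorm_le_lact a K : 0 <= K -> (forall b, rnorm (a · b) <= K * rnorm b) ->
  rnorm a <= K.
Proof.
move=> K0 h; have [->|a0] := eqVneq a 0; first by rewrite rnorm0.
have ap := rnorm_gt0 a0; rewrite -(ler_pM2r ap) -expr2.
have := h a^†; rewrite -{1}(astarK a) rnorm_starM astar_rnormE.
by [].
Qed.

(** One half of the equivalence with the l^1-norm, from which completeness is inherited. *)
Lemma l1_le_cnrm x : uz_l1 x <= 3 * cnrm x.
Proof.
have h : rnorm (x.1 : A) <= 2 * cnrm x.
  apply: rnorm_le_lact => [|b]; first by rewrite mulr_ge0 ?cnrm_ge0.
  have -> : x.1 · b = lact x b - x.2 *: b by rewrite /lact addrK.
  rewrite (le_trans (rnormD _ _)) // rnormN rnormZ mulrAC.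
  have := lact_cnrm x b.
  have : rnorm x.2 * rnorm b <= cnrm x * rnorm b.
    by rewrite ler_wpM2r ?rnorm_ge0 ?scalar_le_cnrm.
  by lra.
by have := scalar_le_cnrm x; rewrite /uz_l1 /= -/(rnorm (x.1 : A)); lra.
Qed.

Lemma cnrm_le_l1 x : cnrm x <= uz_l1 x.
Proof.
by apply: cnrm_le => [b|]; [exact: lact_bound | rewrite lerDr rnorm_ge0].
Qed.

Let cnrm_eq0 x : cnrm x = 0 -> x = 0.
Proof.
move=> h; have := l1_le_cnrm x; rewrite h mulr0 => h1.
have : uz_l1 x == 0 by rewrite eq_le h1 addr_ge0 ?bnrm_ge0 ?rnorm_ge0.
rewrite paddr_eq0 ?bnrm_ge0 ?rnorm_ge0 // => /andP[].
by case: x {h h1} => a k /= /eqP/rnorm_eq0 -> /eqP/rnorm_eq0 ->.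
Qed.
Let cnrmD x y : cnrm (x + y) <= cnrm x + cnrm y.
Proof.
apply: cnrm_le => [b|].
  by rewrite lactD (le_trans (rnormD _ _)) // mulrDl lerD ?lact_cnrm.
by rewrite (le_trans (rnormD _ _)) // lerD ?scalar_le_cnrm.
Qed.
Let cnrmZ_le k x : cnrm (k *: x) <= rnorm k * cnrm x.
Proof.
apply: cnrm_le => [b|].
  by rewrite lactZ rnormZ -mulrA ler_wpM2l ?rnorm_ge0 ?lact_cnrm.
by rewrite /= rnormM ler_wpM2l ?rnorm_ge0 ?scalar_le_cnrm.
Qed.
Let cnrmZ k x : cnrm (k *: x) = rnorm k * cnrm x.
Proof.
apply/eqP; rewrite eq_le cnrmZ_le /=.
have [->|k0] := eqVneq k 0; first by rewrite rnorm0 mul0r cnrm_ge0.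
have kp : 0 < rnorm k.
  rewrite lt_neqAle rnorm_ge0 andbT eq_sym; apply/eqP => /rnorm_eq0.
  exact/eqP.
rewrite -ler_pdivlMl // -{1}[x](scalerK k0) (le_trans (cnrmZ_le _ _)) //.
rewrite ler_wpM2r ?cnrm_ge0 // (_ : rnorm k^-1 = (rnorm k)^-1) //.
by apply: (mulfI (lt0r_neq0 kp)); rewrite -rnormM !divff ?rnorm1 // lt0r_neq0.
Qed.
Let cnrmM x y : cnrm (x * y) <= cnrm x * cnrm y.
Proof.
apply: cnrm_le => [b|].
  rewrite lactM (le_trans (lact_cnrm _ _)) // -mulrA ler_wpM2l ?cnrm_ge0 //.
  exact: lact_cnrm.
by rewrite /= rnormM ler_pM ?rnorm_ge0 ?scalar_le_cnrm.
Qed.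
Let cnrm1 : cnrm 1 <= 1.
Proof. by apply: cnrm_le => [b|]; rewrite ?lact1 ?mul1r //= rnorm1. Qed.
Let cnrm_complete (u : nat -> cuz) :
  (forall e, 0 < e -> exists n, forall m, (n <= m)%N -> cnrm (u m - u n) <= e) ->
  exists l, forall e, 0 < e -> exists n, forall m, (n <= m)%N -> cnrm (u m - l) <= e.
Proof.
move=> hu; have [|l hl] := @uz_complete R B u.
  move=> e e0; have [|n hn] := hu (e / 3); first by rewrite divr_gt0.
  exists n => m /hn h; rewrite (le_trans (l1_le_cnrm _)) //.
  by move: h; rewrite ler_pdivlMr // mulrC.
exists l => e /hl [n hn]; exists n => m /hn; apply: le_trans.
exact: cnrm_le_l1.
Qed.

HB.instance Definition _ := isUnitalBanach.Build R cuz
  cnrm_eq0 cnrmD cnrmZ cnrmM cnrm1 cnrm_complete.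

Let cmulE x y : x · y = x * y. Proof. by []. Qed.
Let cstarK x : x^†^† = x.
Proof. by case: x => a k; congr pair; [exact: astarK | exact: conjcK]. Qed.
Let cstarD x y : (x + y)^† = x^† + y^†.
Proof. by congr pair; [exact: astarD | exact: rmorphD]. Qed.
Let cstarZ k x : (k *: x)^† = conjc k *: x^†.
Proof. by congr pair; [exact: astarZ | exact: rmorphM]. Qed.
Let cstarM x y : (x * y)^† = y^† * x^†.
Proof.
congr pair => /=; last by rewrite rmorphM mulrC.
by rewrite !astarD astarM !astarZ -!addrA; congr (_ + _); exact: addrC.
Qed.
(** For b in A, ‖x b‖^2 = ‖b^† (x^† x) b‖ <= ‖x^† x‖ ‖b‖^2, where [lact_star] moves x to the other
    side; the scalar part satisfies the identity exactly. *)
Let cnrm_starM_ge x : cnrm x ^+ 2 <= cnrm (x^† * x).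
Proof.
rewrite -(@sqr_sqrtr _ (cnrm (x^† * x))) ?cnrm_ge0 //.
rewrite ler_pXn2r ?nnegrE ?cnrm_ge0 ?sqrtr_ge0 //.
apply: cnrm_le => [b|].
  rewrite -(@ler_pXn2r _ 2) ?nnegrE ?mulr_ge0 ?sqrtr_ge0 ?rnorm_ge0 //.
  rewrite exprMn sqr_sqrtr ?cnrm_ge0 // -rnorm_starM lact_star -lactM.
  rewrite (le_trans (amul_rnormM _ _)) // astar_rnormE expr2 mulrA [leRHS]mulrC.
  by rewrite ler_wpM2l ?rnorm_ge0 // lact_cnrm.
rewrite -(@ler_pXn2r _ 2) ?nnegrE ?sqrtr_ge0 ?rnorm_ge0 //.
rewrite sqr_sqrtr ?cnrm_ge0 // (le_trans _ (scalar_le_cnrm _)) //=.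
by rewrite rnormM rnorm_conj.
Qed.
Let cnrm_star_le x : cnrm x <= cnrm x^†.
Proof.
have [->|x0] := eqVneq (cnrm x) 0; first exact: cnrm_ge0.
have xp : 0 < cnrm x by rewrite lt_neqAle eq_sym x0 cnrm_ge0.
by rewrite -(ler_pM2r xp) -expr2 (le_trans (cnrm_starM_ge x)) // cnrmM.
Qed.
Let cnrm_starM x : cnrm (x^† * x) = cnrm x ^+ 2.
Proof.
apply/eqP; rewrite eq_le cnrm_starM_ge andbT (le_trans (cnrmM _ _)) // expr2.
by rewrite ler_wpM2r ?cnrm_ge0 // -{2}(cstarK x) cnrm_star_le.
Qed.

HB.instance Definition _ := isUnitalCStar.Build R cuz
  cmulE cstarK cstarD cstarZ cstarM cnrm_starM.

Lemma cnrm_emb a : nrm (uz_emb (a : B) : cuz) = rnorm a.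
Proof.
apply/eqP; rewrite eq_le; apply/andP; split.
  by apply: cnrm_le => [b|] /=; rewrite ?rnorm0 ?rnorm_ge0 // lact_emb amul_rnormM.
apply: rnorm_le_lact => [|b]; first exact: cnrm_ge0.
by rewrite -lact_emb lact_cnrm.
Qed.

End CStarUnitization.

(** * Real rank zero *)

Section Projections.
Context {R : realType} {U : ucstarType R}.
Implicit Types (p q e x y a b g c : U) (t d h : R).

Definition proj p := selfadjoint p /\ p * p = p.
Definition cor p x := p * x = x /\ x * p = x.

Lemma proj0 : proj 0. Proof. by split; [exact: sa0 | rewrite mul0r]. Qed.
Lemma proj1 : proj 1. Proof. by split; [exact: sa1 | rewrite mul1r]. Qed.
Lemma proj_compl p q : proj p -> proj q -> q * p = p -> proj (q - p).
Proof.
move=> [sp pp] [sq qq] qp; have pq : p * q = p by rewrite -{1}sp -sq -starM qp sp.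
split; first exact: saB.
by rewrite mulrBl !mulrBr qq qp pq pp subrr subr0.
Qed.
Lemma projC p : proj p -> proj (1 - p).
Proof. by move=> hp; apply: proj_compl => //; [exact: proj1 | rewrite mul1r]. Qed.
Lemma proj_pos p : proj p -> pos p.
Proof. by move=> [sp <-]; exact: pos_sqr. Qed.
Lemma proj_le1 p : proj p -> p ⊑ 1.
Proof. by move=> /projC/proj_pos. Qed.
Lemma proj_nrm p : proj p -> nrm p <= 1.
Proof.
move=> hp; apply: pos_le_nrm => //; first exact: proj_pos.
by rewrite scale1r; exact: proj_le1.
Qed.
Lemma proj_mulC0 p q : proj p -> proj q -> p * q = 0 -> q * p = 0.
Proof. by move=> [sp _] [sq _] h; rewrite -sp -sq -starM h star0. Qed.
Lemma projD p q : proj p -> proj q -> p * q = 0 -> proj (p + q).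
Proof.
move=> hp hq pq; have qp := proj_mulC0 hp hq pq.
case: hp hq => [sp pp] [sq qq]; split; first exact: saD.
by rewrite mulrDl !mulrDr pp qq pq qp addr0 add0r.
Qed.
Lemma subproj_sym p q : proj p -> proj q -> q * p = p -> p * q = p.
Proof. by move=> [sp _] [sq _] h; rewrite -{1}sp -sq -starM h sp. Qed.
Lemma star_absorb q x : proj q -> q * x = x -> x^† * q = x^†.
Proof. by move=> [sq _] h; rewrite -[in LHS]sq -starM h. Qed.
Lemma proj_mulCp p : proj p -> (1 - p) * p = 0.
Proof. by move=> [_ pp]; rewrite mulrBl mul1r pp subrr. Qed.
Lemma proj_mulpC p : proj p -> p * (1 - p) = 0.
Proof. by move=> [_ pp]; rewrite mulrBr mulr1 pp subrr. Qed.

Lemma proj_sum_nat (f : nat -> U) n : (forall k, proj (f k)) ->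
  (forall i j, i != j -> f i * f j = 0) -> proj (\sum_(k < n) f k).
Proof.
move=> hf fo; elim: n => [|n IH]; first by rewrite big_ord0; exact: proj0.
rewrite big_ord_recr; apply: projD => //; rewrite mulr_suml big1 // => i _.
by rewrite fo //= neq_ltn ltn_ord.
Qed.

Lemma cor_proj p q : proj p -> proj q -> q * p = p -> cor q p.
Proof. by move=> hp hq h; split => //; exact: subproj_sym. Qed.
Lemma corD p x y : cor p x -> cor p y -> cor p (x + y).
Proof. by move=> [h1 h2] [h3 h4]; split; rewrite ?mulrDr ?mulrDl ?h1 ?h2 ?h3 ?h4. Qed.
Lemma corZ p k x : cor p x -> cor p (k *: x).
Proof. by move=> [h1 h2]; split; rewrite -?scalerAr -?scalerAl ?h1 ?h2. Qed.
Lemma corN p x : cor p x -> cor p (- x).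
Proof. by move=> [h1 h2]; split; rewrite ?mulrN ?mulNr ?h1 ?h2. Qed.
Lemma corB p x y : cor p x -> cor p y -> cor p (x - y).
Proof. by move=> h1 h2; apply: corD => //; apply: corN. Qed.
Lemma corM p x y : cor p x -> cor p y -> cor p (x * y).
Proof. by move=> [h1 h2] [h3 h4]; split; rewrite ?mulrA ?h1 // -mulrA h4. Qed.
Lemma cor_star p x : proj p -> cor p x -> cor p x^†.
Proof. by move=> [sp _] [h1 h2]; split; rewrite -{1}sp -starM ?h1 ?h2. Qed.
Lemma cor_id p : proj p -> cor p p. Proof. by case. Qed.
Lemma cor_conj p x : proj p -> cor p (p * x * p).
Proof. by move=> [_ pp]; split; rewrite -?mulrA ?(mulrA p p) pp. Qed.
Lemma cor_le p q x : q * p = p -> p * q = p -> cor p x -> cor q x.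
Proof.
by move=> qp pq [h1 h2]; split; [rewrite -h1 mulrA qp|rewrite -h2 -mulrA pq].
Qed.
Lemma cor1 x : cor 1 x. Proof. by split; rewrite ?mul1r ?mulr1. Qed.

Lemma cor_ule p x t : proj p -> cor p x -> selfadjoint x -> nrm x <= t ->
  x ⊑ t%:C *: p.
Proof.
move=> [sp pp] [px xp] sx hn.
have := ule_conj p (sa_ule_nrm sx hn).
by rewrite sp px xp -scalerAr mulr1 -scalerAl pp.
Qed.

Lemma cor_nrm_le p x t : 0 <= t -> proj p -> selfadjoint x ->
  x ⊑ t%:C *: p -> - (t%:C *: p) ⊑ x -> nrm x <= t.
Proof.
move=> t0 hp sx h1 h2; have pt : t%:C *: p ⊑ t%:C *: 1.
  by apply: uleZ => //; exact: proj_le1.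
apply: sa_nrm_le => //; first exact: ule_trans h1 pt.
apply: ule_trans _ h2; rewrite opprK addrC; exact: pt.
Qed.

Lemma pos_sqrt_cor p x k : proj p -> cor p x -> pos k -> x = k * k -> cor p k.
Proof.
move=> hp [px xp] /pos_sa sk E.
suff kq : k * (1 - p) = 0.
  have kp : k * p = k by move: kq; rewrite mulrBr mulr1 => /subr0_eq.
  by split => //; rewrite -hp.1 -sk -starM kp.
apply: starM_eq0; rewrite starM sk -!mulrA (mulrA k k) -E mulrBr mulr1 xp.
by rewrite subrr mulr0.
Qed.

(* The inverse square root in the corner is that of x + d (1 - p), cut by p. *)
Lemma corner_invsqrt p x d : proj p -> cor p x -> 0 < d -> d%:C *: p ⊑ x ->
  exists c, [/\ pos c, cor p c, c * c * x = p, x * (c * c) = p & c * x * c = p].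
Proof.
move=> hp [px xp] d0 dx; have q0 := projC hp.
pose X := x + d%:C *: (1 - p).
have [|G [pG hG _]] := @pos_invertible _ _ X d d0.
  by rewrite /X scalerBr addrA addrAC addrK.
have pX : p * X = X * p.
  by rewrite /X mulrDr mulrDl px xp -scalerAr -scalerAl (proj_mulpC hp) (proj_mulCp hp).
have Xp : X * p = x by rewrite /X mulrDl xp -scalerAl (proj_mulCp hp) scaler0 addr0.
have [s [ps sE sC]] := pos_sqrt pG.
have pG' := inverses_comm hG pX; have pS := sC _ pG'.
exists (s * p); rewrite -pS.
have cc : p * s * (p * s) = p * G by rewrite {2}pS -mulrA (mulrA s s) -sE -pG' mulrA hp.2.
split.
- by apply: pos_commM => //; exact: proj_pos.
- by split; rewrite ?mulrA ?hp.2 // pS -mulrA hp.2.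
- by rewrite cc -mulrA -Xp -pX (mulrA G) -pG' -mulrA hG.2 mulr1 hp.2.
- by rewrite cc -Xp -mulrA (mulrA p p) hp.2 pG' mulrA hG.1 mul1r.
- have xs : x * s = s * x.
    by apply: sC; apply: (inverses_comm hG); rewrite /X mulrDr mulrDl -scalerAr -scalerAl mulrBr mulrBl px xp mulr1 mul1r.
  rewrite -!mulrA (mulrA x) xp xs (mulrA s s) -sE -Xp -pX mulrA.
  by rewrite pG' -mulrA (mulrA p) hp.2 pX mulrA hG.2 mul1r.
Qed.

Definition rank0 := forall x d, selfadjoint x -> 0 < d ->
  exists y g, [/\ selfadjoint y, inverses y g & nrm (x - y) <= d].

Definition cinv p x g := [/\ cor p g, x * g = p & g * x = p].

Hypothesis rr0 : rank0.

(* Schur complement. *)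
Lemma corner_rank0 p a d : proj p -> cor p a -> selfadjoint a -> 0 < d ->
  exists b g, [/\ selfadjoint b, cor p b, cinv p b g & nrm (a - b) <= d].
Proof.
(* With t <= 1/2 the complementary block of the approximant y has an inverse D of norm at most 2,
   and the total error is t + 2 t^2 <= 2 t <= d. *)
move=> hp ha sa d0; pose t := Num.min (d / 2) 2^-1.
have t0 : 0 < t by rewrite lt_min !divr_gt0 //= invr_gt0.
have td : t <= d / 2 by rewrite ge_min lexx.
have t2 : t <= 2^-1 by rewrite ge_min lexx orbT.
pose q : U := 1 - p; have hq : proj q := projC hp.
have pq : p * q = 0 := proj_mulpC hp.
have qp : q * p = 0 := proj_mulCp hp.
(* Adding q makes the block of y on the complementary corner close to q, hence invertible there. *)
have sax : selfadjoint (a + q) by apply: saD => //; exact: hq.1.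
have [y [c [sy [yc cy] hy]]] := rr0 sax t0.
have [pp qq] := (hp.2, hq.2).
have [pa ap] := ha.
have qa : q * a = 0 by rewrite -pa mulrA qp mul0r.
have aq : a * q = 0 by rewrite -ap -mulrA pq mulr0.
have pq1 : p + q = 1 by rewrite addrC subrK.
clearbody q.
pose H : U := q - q * y * q.
have nH : nrm H <= t.
  have -> : H = q * ((a + q) - y) * q.
    by rewrite /H mulrBr mulrBl mulrDr qa add0r qq qq.
  rewrite (le_trans (nrmM _ _)) // -[leRHS]mulr1 ler_pM ?nrm_ge0 ?proj_nrm //.
  rewrite (le_trans (nrmM _ _)) // -[leRHS]mul1r ler_pM ?nrm_ge0 ?proj_nrm //.
have [|W hW] := @neumann R U H; first by rewrite (le_lt_trans nH) // (le_lt_trans t2) // invf_lt1 // ltr1n.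
have qH : q * H = H by rewrite /H mulrBr !mulrA qq.
have Hq : H * q = H by rewrite /H mulrBl -!mulrA qq.
have qW : q * W = W * q.
  by apply: (inverses_comm hW); rewrite mulrBr mulrBl mulr1 mul1r qH Hq.
have W2 : nrm W <= 2.
  have E : W = 1 + H * W by have := hW.1; rewrite mulrBl mul1r => <-; rewrite subrK.
  have h1 : nrm W <= 1 + 2^-1 * nrm W.
    rewrite {1}E (le_trans (nrmD _ _)) // lerD ?nrm1 // (le_trans (nrmM _ _)) //.
    by rewrite ler_wpM2r ?nrm_ge0 // (le_trans nH).
  by move: h1; lra.
(* The inverse of q y q in the corner of q. *)
pose D := W * q.
have yD : q * y * q * D = q.
  have -> : q * y * q = q - H by rewrite /H opprB addrC subrK.
  rewrite /D -qW mulrA mulrBl qq Hq -[q in LHS]mulr1 -{1}qH -mulrBr -mulrA hW.1.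
  by rewrite mulr1.
have Dy : D * (q * y * q) = q.
  have -> : q * y * q = q - H by rewrite /H opprB addrC subrK.
  rewrite /D -mulrA mulrBr qq qH -[q in LHS]mul1r -{1}Hq -mulrBl mulrA hW.2.
  by rewrite mul1r.
have qD : q * D = D by rewrite /D mulrA qW -mulrA qq.
have Dq : D * q = D by rewrite /D -mulrA qq.
have nD : nrm D <= 2.
  by rewrite -[2]mulr1 /D nrm_mulr2 // proj_nrm.
clearbody D H.
have sp := hp.1; have sq := hq.1.
have sD : selfadjoint D.
  rewrite /selfadjoint -[LHS]mulr1 -pq1 mulrDr (_ : D^† * p = 0) ?add0r; last first.
    by rewrite -qD starM sq -mulrA qp mulr0.
  have Dsy : D^† * (q * y * q) = q.
    by have := congr1 (fun z : U => z^†) yD; rewrite !starM sq sy !mulrA.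
  by transitivity (D^† * (q * y * q) * D); [rewrite -mulrA yD | rewrite Dsy qD].
have sc := sa_inverses sy (conj yc cy).
have pD : p * D = 0 by rewrite -qD mulrA pq mul0r.
have qyD : q * y * D = q by rewrite -{1}qD !mulrA yD.
(* S is the Schur complement p y p - p y D y p; its inverse in the corner of p is p c p, where c is
   the inverse of y. *)
pose z : U := (1 - D * y) * p; pose S : U := y * z.
have qS : q * S = 0.
  by rewrite /S /z !mulrA mulrBr mulr1 !mulrA qyD subrr mul0r.
have SE : S = p * y * p - p * y * D * y * p.
  rewrite -[S]mul1r -pq1 mulrDl qS addr0 /S /z; nring.
have sS : selfadjoint S.
  rewrite SE; apply: saB; rewrite /selfadjoint !starM sp sy ?sD !mulrA //.
have gS : p * c * p * S = p.
  have -> : p * c * p * S = p * c * S.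
    by rewrite -[in RHS](mulr1 c) -pq1 mulrDr mulrDr mulrDl -!mulrA qS !mulr0 addr0.
  rewrite /S mulrA -(mulrA p) cy mulr1 /z mulrA mulrBr mulr1 mulrA pD mul0r subr0.
  exact: pp.
have sg : selfadjoint (p * c * p) by rewrite /selfadjoint !starM sp sc mulrA.
exists S, (p * c * p); split => //.
- by rewrite SE; apply: corB; [exact: cor_conj | split; rewrite ?mulrA ?pp // -!mulrA pp].
- split; [exact: cor_conj | | exact: gS].
  by rewrite -{1}sS -sg -starM gS.
pose w : U := (a + q) - y.
have nW : nrm w <= t by [].
have pwp : p * w * p = a - p * y * p.
  by rewrite /w mulrBr mulrBl mulrDr pa pq addr0 ap.
have pwq : p * w * q = - (p * y * q).
  by rewrite /w mulrBr mulrBl mulrDr pa pq addr0 aq sub0r.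
have qwp : q * w * p = - (q * y * p).
  by rewrite /w mulrBr mulrBl mulrDr qa qq add0r qp sub0r.
have -> : a - S = p * w * p + p * w * q * D * (q * w * p).
  rewrite pwp pwq qwp SE mulNr mulNr mulrN opprK -!mulrA (mulrA q D) qD.
  by rewrite (mulrA D q) Dq; nring.
have np := proj_nrm hp; have nq := proj_nrm hq.
have e1 (x y' z' : U) : nrm x <= 1 -> nrm z' <= 1 -> nrm (x * y' * z') <= nrm y'.
  move=> hx hz; rewrite -[leRHS]mulr1; apply: nrm_mulr2 => //.
  by rewrite -[leRHS]mul1r nrm_mulr2.
rewrite (le_trans (nrmD _ _)) //.
have h1 := le_trans (e1 p w p np np) nW.
have h2 := le_trans (e1 p w q np nq) nW.
have h3 := le_trans (e1 q w p nq np) nW.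
have h4 := nrm_mulr2 (nrm_mulr2 h2 nD) h3.
by rewrite (le_trans (lerD h1 h4)) //; nra.
Qed.

End Projections.

(** * Spectral cuts, step approximations and range projections *)

Section RealRankZero.
Context {R : realType} {U : ucstarType R}.
Implicit Types (p q e f x y a b g c : U) (t d h : R).
Hypothesis rr0 : @rank0 R U.

Lemma eq_pos x y : y = x -> pos x -> pos y.
Proof. by move=> ->. Qed.

(** After a perturbation a - t p becomes an invertible selfadjoint element b of the corner. Its sign
    s = |b| b^-1 is a symmetry, and e = (p + s) / 2 is the spectral projection of b for the positive
    half-line; the element returned is b + t p. *)
Lemma spectral_cut p a t d : proj p -> cor p a -> selfadjoint a -> 0 < d ->
  exists e b, [/\ proj e /\ cor p e, selfadjoint b /\ cor p b, nrm (a - b) <= d,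
    e * b = b * e & t%:C *: e ⊑ e * b /\ (p - e) * b ⊑ t%:C *: (p - e)].
Proof.
move=> hp ha sa d0; have [sp pp] := hp.
have hat : cor p (a - t%:C *: p) by apply: corB => //; apply: corZ; exact: cor_id.
have sat : selfadjoint (a - t%:C *: p) by apply: saB => //; exact: saZ.
have [b [g [sb hb hg nb]]] := corner_rank0 rr0 hp hat sat d0.
have [hgc bg gb] := hg; have [pg gp] := hgc.
have [k [pk kE kC]] := pos_sqrt (pos_sqr sb).
have sk := pos_sa pk.
have hk : cor p k by apply: pos_sqrt_cor pk kE => //; exact: corM.
have kb : k * b = b * k by apply/esym/kC; rewrite mulrA.
have kg : k * g = g * k.
  transitivity (g * b * k * g); first by rewrite gb hk.1.
  by rewrite -!mulrA (mulrA b) -kb -mulrA bg hk.2.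
have sg : selfadjoint g.
  transitivity (g^† * (b * g)); first by rewrite bg -{1}pg starM sp.
  by rewrite mulrA -{1}sb -starM bg sp pg.
pose s : U := k * g.
have ss : s * s = p.
  transitivity (k * k * (g * g)); first by rewrite /s -!mulrA (mulrA g) -kg !mulrA.
  by rewrite -kE -mulrA (mulrA b g) bg pg.
have hs : cor p s by exact: corM.
have sas : selfadjoint s by exact: saM.
have sb_ : s * b = k by rewrite /s -mulrA gb hk.2.
have bs_ : b * s = k by rewrite /s kg mulrA bg hk.1.
clearbody s.
pose e : U := (2^-1)%:C *: (p + s).
have hE (x : U) : (2^-1)%:C *: (x + x) = x.
  by rewrite scalerDr -scalerDl -rmorphD /= (_ : 2^-1 + 2^-1 = 1) ?scale1r //; lra.
have pe : proj e.
  split; first by apply: saZ; exact: saD.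
  rewrite /e -scalerAl -scalerAr mulrDl !mulrDr pp hs.1 hs.2 ss [s + p]addrC.
  by rewrite hE.
have he : cor p e by apply: corZ; apply: corD => //; exact: cor_id.
have eb : e * b = (2^-1)%:C *: (k + b) by rewrite -scalerAl mulrDl hb.1 sb_ addrC.
have be : b * e = (2^-1)%:C *: (k + b) by rewrite -scalerAr mulrDr hb.2 bs_ addrC.
have p_e : p - e = (2^-1)%:C *: (p - s).
  by rewrite /e -[X in X - _]hE; nring.
clearbody e.
exists e, (b + t%:C *: p); split => //.
- split; first by apply: saD => //; exact: saZ.
  by apply: corD => //; apply: corZ; exact: cor_id.
- by rewrite opprD addrA addrAC.
- by rewrite mulrDr mulrDl eb be -scalerAr -scalerAl he.1 he.2.
- rewrite !mulrDr -!scalerAr he.2 addrK (_ : (p - e) * p = p - e); last first.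
    by rewrite mulrBl pp he.2.
  rewrite opprD addrCA subrr addr0 eb p_e; split.
    by apply: posZ; rewrite ?invr_ge0 //; apply: pos_absD => //; rewrite kE.
  rewrite -scalerAl mulrBl hb.1 sb_ -scalerN opprB; apply: posZ; rewrite ?invr_ge0 //.
  apply: pos_absD; rewrite ?mulrN ?mulNr ?opprK ?kE //; first exact: saN.
  by rewrite kb.
Qed.

Lemma orth_nrm_le e f x y t : 0 <= t -> proj e -> proj f -> e * f = 0 ->
  selfadjoint x -> selfadjoint y -> cor e x -> cor f y ->
  nrm x <= t -> nrm y <= t -> nrm (x + y) <= t.
Proof.
move=> t0 he hf ef sx sy hx hy nx ny.
have sN (z : U) : selfadjoint z -> selfadjoint (- z) by exact: saN.
apply: (@cor_nrm_le _ _ (e + f)) => //; first exact: projD.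
- exact: saD.
- by rewrite scalerDr; apply: uleD; exact: cor_ule.
- rewrite opprK addrC scalerDr -[X in _ + X]opprK opprD.
  apply: uleD.
    by apply: cor_ule (sN _ sx) _; rewrite ?nrmN //; exact: corN.
  by apply: cor_ule (sN _ sy) _; rewrite ?nrmN //; exact: corN.
Qed.

(* Cut at the lower end of the spectrum and recurse in the upper corner. *)
Lemma finite_spectrum n p a t h d : proj p -> cor p a -> selfadjoint a ->
  0 < h -> 0 < d -> t%:C *: p ⊑ a -> a ⊑ (t + n%:R * h)%:C *: p ->
  exists e : nat -> U, (forall l, proj (e l) /\ cor p (e l)) /\
    nrm (a - (t%:C *: p + h%:C *: \sum_(l < n) e l)) <= h + d.
Proof.
elim: n p a t d => [|n IH] p a t d hp ha sa h0 d0 ta at_.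
  exists (fun=> 0); split.
    by move=> _; split; [exact: proj0 | split; rewrite ?mulr0 ?mul0r].
  have -> : a = t%:C *: p by apply: ule_anti => //; move: at_; rewrite mul0r addr0.
  by rewrite big_ord0 scaler0 addr0 subrr nrm0 addr_ge0 // ltW.
(* The error budget: r for replacing a by b, r for shifting the upper part, and h + d/2 for the two
   orthogonal parts together. The cut sits at t + h + r because b may exceed a by r. *)
pose r := d / 4; have r0 : 0 < r by rewrite divr_gt0.
have [e [b [[pe he] [sb hb] nab eb [b1 b2]]]] :=
  spectral_cut (t + h + r) hp ha sa r0.
have [pe_ ep] := he; have [sp pp] := hp; have [pb bp] := hb; have [se ee] := pe.
pose f : U := p - e; have pf : proj f by apply: proj_compl.
have ef : e * f = 0 by rewrite mulrBr ep ee subrr.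
have fp : f * p = f by rewrite mulrBl pp ep.
have pfp : p * f = f by rewrite mulrBr pp pe_.
(* The shift by r puts the upper part between t + h and t + h + n h, as the induction hypothesis
   demands. *)
pose x : U := e * b - r%:C *: e.
have sx : selfadjoint x by apply: saB; [exact: saM | exact: saZ].
have hx : cor e x.
  split; rewrite /x; first by rewrite mulrBr mulrA ee -scalerAr ee.
  by rewrite mulrBl -scalerAl ee eb -mulrA ee.
have sab : selfadjoint (a - b) by exact: saB.
have hab : cor p (a - b) by exact: corB.
have ab1 := cor_ule hp hab sab nab.
have ab2 : b - a ⊑ r%:C *: p.
  by have := cor_ule hp (corN hab) (saN sab); rewrite nrmN opprB; apply.
have bup : b ⊑ (t + n.+1%:R * h + r)%:C *: p.
  have := posD ab2 at_; apply: eq_pos; nring.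
have blo : (t - r)%:C *: p ⊑ b.
  have := posD ab1 ta; apply: eq_pos; nring.
have sf := pf.1; have ff := pf.2.
have fb : f * b = b - e * b by rewrite mulrBl pb.
have fbf : f * b * f = f * b.
  have fe : f * e = 0 by rewrite mulrBl pe_ ee subrr.
  by rewrite -mulrA {2}/f mulrBr bp -eb mulrBr mulrA fe mul0r subr0.
have ebe : e * b * e = e * b by rewrite eb -mulrA ee.
have epe : e * p * e = e by rewrite ep ee.
have fpf : f * p * f = f by rewrite fp ff.
have xup : x ⊑ (t + h + n%:R * h)%:C *: e.
  have := ule_conj e bup; rewrite se ebe -scalerAr -scalerAl epe; apply: eq_pos.
  rewrite /x (_ : n.+1%:R = n%:R + 1 :> R); last by rewrite natr1.
  move: (n%:R : R) => m. nring.
have xlo : (t + h)%:C *: e ⊑ x by move: b1; apply: eq_pos; rewrite /x; nring.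
have d2 : 0 < d / 2 by rewrite divr_gt0.
have [g [hg ng]] := IH e x (t + h) (d / 2) pe hx sx h0 d2 xlo xup.
pose y : U := f * b - t%:C *: f.
have sfb : selfadjoint (f * b) by rewrite fb; apply: saB => //; exact: saM.
have sy : selfadjoint y by apply: saB => //; exact: saZ.
have hy : cor f y.
  split; rewrite /y; first by rewrite mulrBr mulrA ff -scalerAr ff.
  by rewrite mulrBl -scalerAl ff fbf.
have ny : nrm y <= h + d / 2.
  apply: le_trans (_ : h + r <= _); last by rewrite /r; lra.
  apply: (@cor_nrm_le _ _ f) => //; first by rewrite addr_ge0 ?ltW.
    by move: b2; apply: eq_pos; rewrite /y /f; nring.
  have := ule_conj f blo; rewrite sf fbf -scalerAr -scalerAl fpf => h1.
  have h2 := posZ (ltW h0) (proj_pos pf).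
  by have := posD h1 h2; apply: eq_pos; rewrite /y; nring.
(* The projections of the recursive call lie in the corner of e, so the spectral projections come
   out nested, not orthogonal. *)
exists (fun l => if l is k.+1 then g k else e); split.
  case=> [|l]; first by split; [exact: pe | exact: he].
  by have [h1 h2] := hg l; split => //; apply: cor_le h2.
rewrite big_ord_recl /=; set S := \sum_(i < n) _.
have {}ng : nrm (x - ((t + h)%:C *: e + h%:C *: S)) <= h + d / 2 by exact: ng.
have sS : selfadjoint S.
  by rewrite /selfadjoint star_sum; apply: eq_bigr => i _; exact: (hg i).1.1.
have hS : cor e S.
  split; rewrite ?mulr_sumr ?mulr_suml; apply: eq_bigr => i _.
    exact: (hg i).2.1.
  exact: (hg i).2.2.
rewrite (_ : a - _ = (a - b) + (r%:C *: e +
  ((x - ((t + h)%:C *: e + h%:C *: S)) + y))); last by rewrite /x /y fb /f; nring.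
rewrite (le_trans (nrmD _ _)) //.
have : nrm (r%:C *: e + (x - ((t + h)%:C *: e + h%:C *: S) + y)) <= r + (h + d / 2).
  rewrite (le_trans (nrmD _ _)) // lerD //.
    rewrite nrmZr; last exact: ltW.
    by rewrite ler_piMr ?proj_nrm //; exact: ltW.
  apply: (@orth_nrm_le e f) => //; first by rewrite addr_ge0 ?ltW.
    by apply: saB => //; apply: saD; exact: saZ.
  by apply: corB => //; apply: corD; apply: corZ => //; exact: cor_id.
by move: nab; rewrite /r; lra.
Qed.

(* If a cut e of a^*a off 0 compresses a^*a to an invertible element of its
   corner, then a e has a closed range, whose projection is almost that of a. *)
Lemma range_cutoff a d : 0 < d ->
  exists p y, [/\ proj p, p = a * (y * a^†) & nrm ((1 - p) * a) <= d].
Proof.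
move=> d0; pose x : U := a^† * a; have px : pos x by exact: pos_starM.
have sx := pos_sa px.
(* The cut is made at 3 r with a perturbation r: on e the compression of a^† a is at least 2 r,
   hence invertible, and on 1 - e it is at most 4 r = d^2. *)
pose r := d ^+ 2 / 4; have r0 : 0 < r by rewrite divr_gt0 // exprn_gt0.
have [e [b [[pe _] [sb _] nab eb [b1 b2]]]] :=
  spectral_cut (3 * r) proj1 (cor1 x) sx r0.
have [se ee] := pe.
have ab1 := sa_ule_nrm (saB sx sb) nab.
have nab' : nrm (b - x) <= r by rewrite nrmC.
have ab2 := sa_ule_nrm (saB sb sx) nab'.
have h1 : (2 * r)%:C *: e ⊑ e * x * e.
  have := ule_conj e ab2; rewrite se -scalerAr -scalerAl mulr1 ee => h.
  have := posD h b1; apply: eq_pos.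
  rewrite [e * (b - x)]mulrBr mulrBl -(mulrA e b e) -eb (mulrA e e b) ee.
  by nring.
have r20 : 0 < 2 * r by rewrite mulr_gt0.
have [c [pc [ec ce] c1 c2 c3]] := corner_invsqrt pe (cor_conj x pe) r20 h1.
have sc := pos_sa pc.
suff H : proj (a * (c * c * a^†)) /\ nrm ((1 - a * (c * c * a^†)) * a) <= d.
  by exists (a * (c * c * a^†)), (c * c); case: H.
set p := a * _.
have pae : p * (a * e) = a * e.
  rewrite /p; transitivity (a * (c * c * (e * x * e))); last by rewrite c1.
  have -> : c * c * (e * x * e) = c * c * x * e by rewrite !mulrA -(mulrA c c e) ce.
  by rewrite /x !mulrA.
have pp : proj p.
  rewrite /p; split; first by rewrite /selfadjoint !starM starK sc !mulrA.
  transitivity (a * c * (c * (e * x * e) * c) * (c * a^†)).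
    have -> : c * (e * x * e) * c = c * a^† * a * c.
      by rewrite /x !mulrA ce -(mulrA _ e c) ec.
    by rewrite !mulrA.
  by rewrite c3 -!mulrA (mulrA e) ec.
split => //; have E : (1 - p) * a = (1 - p) * (a * (1 - e)).
  rewrite [a * _]mulrBr mulr1 [RHS]mulrBr; set z : U := a * e in pae *.
  by rewrite [(1 - p) * z]mulrBl mul1r pae subrr subr0.
clearbody p; rewrite E (le_trans (nrmM _ _)) //.
have n1 := proj_nrm (projC pp).
have n2 : nrm (a * (1 - e)) <= d.
  have [sf ff] := projC pe; set f : U := 1 - e in sf ff *.
  have d0' := ltW d0; have r0' := ltW r0.
  rewrite -(@ler_pXn2r _ 2) ?nnegrE ?nrm_ge0 // -nrm_starM.
  apply: pos_le_nrm; [exact: sqr_ge0 | exact: pos_starM |].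
  have fe : f * e = 0 by exact: proj_mulCp.
  have fbf : f * b * f = f * b.
    by rewrite -mulrA {2}/f mulrBr mulr1 -eb mulrBr mulrA fe mul0r subr0.
  have h2 := ule_conj f ab1.
  rewrite sf -scalerAr -scalerAl mulr1 ff [f * (x - b)]mulrBr mulrBl fbf in h2.
  have h3 : pos ((4 * r)%:C *: e) by apply: posZ; [rewrite mulr_ge0 | exact: proj_pos].
  have := posD (posD h2 b2) h3; apply: eq_pos.
  have -> : d ^+ 2 = 4 * r by rewrite /r mulrC divfK.
  by rewrite starM sf /x /f; nring.
by rewrite (le_trans (ler_wpM2l (nrm_ge0 _) n2)) // ler_piMl // ltW.
Qed.

End RealRankZero.

(** * Spans of projections in an ideal *)

(** Dependent choice, with the stage number available to the relation and an invariant [P] carried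
    along. *)
Lemma dependent_sequence (T : Type) (P : T -> Prop) (Q : nat -> T -> T -> Prop)
    (x0 : T) : P x0 -> (forall n x, P x -> exists y, P y /\ Q n x y) ->
  exists u : nat -> T, u 0%N = x0 /\ forall n, P (u n) /\ Q n (u n) (u n.+1).
Proof.
move=> P0 h; pose S := {x | P x}.
have h' (z : nat * S) : exists y : S, Q z.1 (sval z.2) (sval y).
  by case: z => n [x px]; have [y [py qy]] := h n x px; exists (exist _ y py).
have [f hf] := choice h'.
pose u := fix u n := if n is m.+1 then f (m, u m) else exist P x0 P0 : S.
exists (fun n => sval (u n)); split=> // n; split; first exact: (svalP (u n)).
exact: (hf (n, u n)).
Qed.

Section IdealProjections.
Context {R : realType} {U : ucstarType R}.
Implicit Types (p q r e f x y z a b g c v w : U) (t d h : R).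

(** Modelled on [A] inside its unitization: real rank zero, square roots and inverses are used in
    the whole of [U], while the projections that span must belong to [I]. *)
Record star_ideal (I : U -> Prop) : Prop := StarIdeal {
  ideal0 : I 0;
  idealD : forall x y, I x -> I y -> I (x + y);
  idealZ : forall k x, I x -> I (k *: x);
  idealMl : forall x y, I y -> I (x * y);
  idealMr : forall x y, I x -> I (x * y);
  ideal_star : forall x, I x -> I x^†;
  ideal_lim : forall (u : nat -> U) x, nlim u x -> (forall n, I (u n)) -> I x }.

(** Murray-von Neumann subequivalence, where the subprojection v v^† of q need not be proper. *)
Definition msub p q := exists v, v^† * v = p /\ q * v = v.

Lemma msub_pcor p v : proj p -> v^† * v = p -> v * p = v.
Proof.
move=> hp vv; apply/eqP; rewrite -subr_eq0; apply/eqP/starM_eq0.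
rewrite starB starM hp.1 (_ : _ * _ =
  p * (v^† * v) * p - p * (v^† * v) - (v^† * v) * p + v^† * v); last by nring.
by rewrite vv !hp.2; nring.
Qed.

(** From p = y x follows p <= ‖y‖^2 x^† x, so x p is bounded below on p and its polar part x p |x
    p|^-1 is a partial isometry, with range under q. *)
Lemma msub_factor p q x y : proj p -> p = y * x -> q * x = x -> msub p q.
Proof.
move=> hp pE qx; have [p0|p0] := eqVneq (nrm y) 0.
  exists 0; rewrite mulr0 mulr0 pE; split=> //.
  by rewrite (nrm_eq0 _ p0) mul0r.
have y0 : 0 < nrm y by rewrite lt_neqAle eq_sym p0 nrm_ge0.
have k0 : 0 < nrm y ^+ 2 by rewrite exprn_gt0.
have hx : ((nrm y ^+ 2)^-1)%:C *: p ⊑ p * (x^† * x) * p.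
  have h1 : p ⊑ (nrm y ^+ 2)%:C *: (x^† * x).
    have := ule_conj x (pos_ule_nrm (pos_starM y)); rewrite nrm_starM.
    apply: eq_pos; rewrite -scalerAr -scalerAl mulr1; congr (_ - _).
    by rewrite -{1}hp.2 -{1}hp.1 pE starM !mulrA.
  have := ule_conj p h1; rewrite hp.1 hp.2 hp.2 => h2.
  have : 0 <= (nrm y ^+ 2)^-1 by rewrite invr_ge0 ltW.
  move=> /uleZ /(_ h2); rewrite -scalerAr -scalerAl scalerA -rmorphM /=.
  by rewrite mulVf ?scale1r // gt_eqF.
have i0 : 0 < (nrm y ^+ 2)^-1 by rewrite invr_gt0.
have [c [pc _ _ _ cc]] := corner_invsqrt hp (cor_conj _ hp) i0 hx.
exists (x * p * c); split; last by rewrite !mulrA qx.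
by rewrite !starM (pos_sa pc) hp.1 -[RHS]cc !mulrA.
Qed.

Variable I : U -> Prop.
Hypothesis hI : star_ideal I.
Lemma idealB x y : I x -> I y -> I (x - y).
Proof. by move=> hx hy; rewrite -scaleN1r; apply: (idealD hI) => //; apply: (idealZ hI). Qed.
Lemma ideal_sum (J : Type) (s : seq J) (P : pred J) (F : J -> U) :
  (forall i, P i -> I (F i)) -> I (\sum_(i <- s | P i) F i).
Proof. by move=> h; elim/big_ind: _ => //; [exact: (ideal0 hI) | exact: (idealD hI)]. Qed.

Inductive span : U -> Prop :=
| span0 : span 0
| span_add k p x : proj p -> I p -> span x -> span (k *: p + x).

Lemma spanD x y : span x -> span y -> span (x + y).
Proof.
move=> hx hy; elim: hx => [|k p z hp ip _ IH]; first by rewrite add0r.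
by rewrite -addrA; exact: span_add.
Qed.
Lemma spanZ k x : span x -> span (k *: x).
Proof.
elim=> [|l p z hp ip _ IH]; first by rewrite scaler0; exact: span0.
by rewrite scalerDr scalerA; exact: span_add.
Qed.
Lemma spanN x : span x -> span (- x).
Proof. by rewrite -scaleN1r; exact: spanZ. Qed.
Lemma spanB x y : span x -> span y -> span (x - y).
Proof. by move=> hx hy; apply: spanD => //; exact: spanN. Qed.
Lemma span_proj p : proj p -> I p -> span p.
Proof.
by move=> hp ip; rewrite -[p]addr0 -[p]scale1r; apply: span_add => //; exact: span0.
Qed.
Lemma span_star x : span x -> span x^†.
Proof.
elim=> [|k p z hp ip _ IH]; first by rewrite star0; exact: span0.
by rewrite starD starZ hp.1; exact: span_add.
Qed.
Lemma span_sum (J : Type) (s : seq J) (P : pred J) (F : J -> U) :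
  (forall i, P i -> span (F i)) -> span (\sum_(i <- s | P i) F i).
Proof. by move=> h; elim/big_ind: _ => //; [exact: span0 | exact: spanD]. Qed.

(* For k = (r + sqrt (r - 4 y^*y)) / 2 one has k = k^2 + y^*y, so that
   (k + y) k^-1 (k + y)^* is a projection with off-diagonal part y + y^*.     *)
Lemma offdiag_proj r y : proj r -> I r -> r * y = 0 -> y * r = y -> nrm y <= 2^-1 ->
  exists k, [/\ I k & forall l : R[i], l * conjc l = 1 ->
    proj (k + l *: y + conjc l *: y^†) /\ I (k + l *: y + conjc l *: y^†)].
Proof.
move=> hr ir ry yr ny; have [sr rr] := hr.
have yr' : r * y^† = y^† by rewrite -[in LHS]sr -starM yr.
have ry' : y^† * r = 0 by rewrite -[in LHS]sr -starM ry star0.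
pose h : U := y^† * y.
have hh : cor r h by split; rewrite /h ?mulrA ?yr' // -mulrA yr.
have ph : pos h by exact: pos_starM.
have h4 : (4 : R)%:C *: h ⊑ r.
  have nh : nrm h <= 4^-1.
    rewrite nrm_starM (le_trans (_ : _ <= 2^-1 ^+ 2)) //; last by lra.
    by rewrite ler_pXn2r ?nnegrE ?nrm_ge0 ?invr_ge0.
  have := uleZ (_ : 0 <= 4) (cor_ule hr hh (pos_sa ph) nh).
  by rewrite scalerA -rmorphM /= divff ?scale1r ?pnatr_eq0 //; apply.
have [s [ps sE _]] := pos_sqrt h4.
have hs : cor r s.
  by apply: pos_sqrt_cor ps sE => //; apply: corB; [exact: cor_id | exact: corZ].
pose k : U := (2^-1)%:C *: (r + s).
have hk : cor r k by apply: corZ; apply: corD => //; exact: cor_id.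
have kk : k * k + h = k.
  rewrite /k; set u := (2^-1)%:C : R[i].
  have u1 : u + u = 1 by rewrite -rmorphD /= (_ : 2^-1 + 2^-1 = 1) //; lra.
  have u4 : u * u * (4 : R)%:C = 1.
    by rewrite -!rmorphM /= (_ : 2^-1 * 2^-1 * 4 = 1) //; lra.
  have h4E : (4 : R)%:C *: h = r - s * s by rewrite -sE; nring.
  transitivity ((u * u) *: (r * r + r * s + s * r + s * s + (4 : R)%:C *: h)).
    by rewrite [RHS]scalerDr scalerA u4 scale1r; nring.
  rewrite h4E rr hs.1 hs.2 [r + s + s + s * s + _](_ : _ = (r + s) + (r + s)); last by nring.
  by rewrite -scalerA scalerDr -scalerDl u1 scale1r.
have pk : (2^-1)%:C *: r ⊑ k.
  rewrite /k scalerDr addrAC subrr add0r; apply: posZ => //; by rewrite invr_ge0.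
have sk : selfadjoint k by apply: saZ; apply: saD => //; exact: pos_sa.
have h20 : 0 < 2^-1 :> R by rewrite invr_gt0.
have [c [pc hc gk kg ckc]] := corner_invsqrt hr hk h20 pk.
pose g : U := c * c; rewrite -/g in gk kg.
have hg : cor r g by exact: corM.
have ik : I k by rewrite -hk.1; apply: (idealMr hI).
have ky : k * y = 0 by rewrite -hk.2 -mulrA ry mulr0.
have ky' : y^† * k = 0 by rewrite -hk.1 mulrA ry' mul0r.
have sg : selfadjoint g by apply: saM => //; exact: pos_sa.
clearbody g k.
(* The diagonal part of the projection, which is independent of the phase l since |l| = 1. *)
exists (k + y * g * y^†); split.
  apply: (idealD hI) => //; rewrite -hg.1 !mulrA; apply: (idealMr hI) => //; apply: (idealMr hI) => //.
  exact: (idealMl hI).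
move=> l l1.
have E : k + y * g * y^† + l *: y + conjc l *: y^† =
    (k + l *: y) * g * (k + conjc l *: y^†).
  transitivity (k * g * k + conjc l *: (k * g * y^†) + l *: (y * (g * k)) +
    (l * conjc l) *: (y * g * y^†)); last by nring.
  by rewrite kg gk hk.1 yr' yr l1 scale1r; nring.
rewrite E; split; last first.
  rewrite -mulrA; apply: (idealMl hI).  rewrite -hg.1 -mulrA; exact: (idealMr hI).
split.
  rewrite /selfadjoint !starM !starD !starZ sg sk starK conjcK mulrA.
  by [].
have F : (k + conjc l *: y^†) * (k + l *: y) = k.
  rewrite mulrDl !mulrDr -!scalerAl -!scalerAr ky ky' !scaler0 scalerA.
  by rewrite [conjc l * l]mulrC l1 scale1r addr0 add0r.
rewrite -!mulrA (mulrA (k + conjc l *: y^†)) F (mulrA k g) kg (mulrA g r).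
by rewrite hg.2.
Qed.

(** The projections for the phases 1, -1, i, -i share their diagonal part, so their differences
    yield y + y^† and i (y - y^†), hence y. Scaling x brings its norm below 1/2. *)
Lemma span_offdiag r x : proj r -> I r -> r * x = 0 -> x * r = x -> span x.
Proof.
move=> hr ir rx xr; pose t := 2 * (nrm x + 1).
have t0 : 0 < t by rewrite mulr_gt0 // ltr_wpDl // nrm_ge0.
pose y : U := (t^-1)%:C *: x.
have ny : nrm y <= 2^-1.
  have t0' := ltW t0; rewrite nrmZr ?invr_ge0 // ler_pdivrMl // /t.
  by have := nrm_ge0 x; lra.
have [k [ik hk]] : exists k, [/\ I k & forall l : R[i], l * conjc l = 1 ->
    proj (k + l *: y + conjc l *: y^†) /\ I (k + l *: y + conjc l *: y^†)].
  by apply: (@offdiag_proj r) => //; rewrite /y -?scalerAr -?scalerAl ?rx ?xr ?scaler0.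
have sp l : l * conjc l = 1 -> span (k + l *: y + conjc l *: y^†).
  by move=> /hk [h1 h2]; exact: span_proj.
have half2 (w' : U) : (2^-1)%:C *: ((2 : R)%:C *: w') = w'.
  by rewrite scalerA -rmorphM /= mulVf ?pnatr_eq0 // scale1r.
have s1 : span (y + y^†).
  have h1 := sp 1; have h2 := sp (- 1).
  rewrite !rmorphN !rmorph1 /= mulr1 mulrNN mulr1 in h1 h2.
  have := spanZ (2^-1)%:C (spanB (h1 erefl) (h2 erefl)).
  rewrite (_ : _ - _ = (2 : R)%:C *: (y + y^†)); last first.
    by rewrite rmorph_nat scaler_nat mulr2n !scaleN1r !scale1r; nring.
  by rewrite half2.
have s2 : span ('i%C *: (y - y^†)).
  have ii : 'i%C * - 'i%C = 1 :> R[i] by rewrite mulrN mulii opprK.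
  have h1 := sp 'i%C; have h2 := sp (- 'i%C).
  have cN : conjc (- 'i%C) = 'i%C :> R[i].
    by apply/eqP; rewrite eq_complex /= oppr0 opprK !eqxx.
  rewrite conj_i in h1; rewrite cN in h2.
  have := spanZ (2^-1)%:C (spanB (h1 ii) (h2 (etrans (mulrC _ _) ii))).
  rewrite (_ : _ - _ = (2 : R)%:C *: ('i%C *: (y - y^†))); last first.
    by rewrite rmorph_nat scaler_nat mulr2n !scaleNr; nring.
  by rewrite half2.
have s3 := spanZ (- 'i%C) s2; rewrite scalerA mulNr mulii opprK scale1r in s3.
have := spanZ (t * 2^-1)%:C (spanD s1 s3).
rewrite (_ : y + y^† + _ = (2 : R)%:C *: y); last first.
  by rewrite rmorph_nat scaler_nat mulr2n; nring.
rewrite scalerA -rmorphM /= divfK ?pnatr_eq0 // /y scalerA -rmorphM /=.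
by rewrite divff ?scale1r // gt_eqF.
Qed.

Lemma span_offdiag_star r x : proj r -> I r -> x * r = 0 -> r * x = x -> span x.
Proof.
move=> hr ir xr rx; rewrite -[x]starK; apply: span_star.
by apply: (@span_offdiag r) => //; rewrite -[in LHS]hr.1 -starM ?rx ?xr ?star0.
Qed.

(** By linearity x is a projection p, and p a - a p = p a (1 - p) - (1 - p) a p is a difference of
    off-diagonal elements. *)
Lemma span_comm x a : span x -> span (x * a - a * x).
Proof.
elim=> [|k p z hp ip _ IH]; first by rewrite mul0r mulr0 subrr; exact: span0.
have -> : (k *: p + z) * a - a * (k *: p + z) =
    k *: (p * a * (1 - p) - (1 - p) * a * p) + (z * a - a * z) by nring.
have [_ pp] := hp.
apply: spanD => //; apply: spanZ; apply: spanB.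
  apply: (@span_offdiag_star p) => //; last by rewrite -!mulrA (mulrA p p) pp.
  by rewrite -mulrA (proj_mulCp hp) mulr0.
apply: (@span_offdiag p) => //; last by rewrite -(mulrA _ p p) pp.
by rewrite !mulrA (proj_mulpC hp) !mul0r.
Qed.

(* Everything in the ideal is moved to the corner of r by commutators. *)
Lemma relocate r a n (z : nat -> U) : proj r -> I r -> I a ->
  (forall i, r * z i = z i) -> \sum_(i < n) ((z i)^† * z i) * a = a ->
  exists b, [/\ cor r b, I b & span (a - b)].
Proof.
move=> hr ir ia rz za; have [sr rr] := hr.
have zr i : (z i)^† * r = (z i)^† by rewrite -[in LHS]sr -starM rz.
pose s : U := 1 - r; have rs : r * s = 0 := proj_mulpC hr.
have sr0 : s * r = 0 := proj_mulCp hr.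
(* With s = 1 - r, the off-diagonal blocks of a lie in the span. The block s a s is the sum of s
   z_i^† z_i a s, and each term is exchanged for z_i a s z_i^† in the corner of r by a commutator
   with the off-diagonal element s z_i^†. *)
exists (r * a * r + \sum_(i < n) z i * a * s * (z i)^†); split.
- apply: corD; first exact: cor_conj.
  split; rewrite ?mulr_sumr ?mulr_suml; apply: eq_bigr => i _.
    by rewrite !mulrA rz.
  by rewrite -!mulrA zr.
- apply: (idealD hI) => //; first by apply: (idealMr hI) => //; exact: (idealMl hI).
  apply: ideal_sum => i _; apply: (idealMr hI) => //; apply: (idealMr hI) => //.
  exact: (idealMl hI).
have -> : a - (r * a * r + \sum_(i < n) z i * a * s * (z i)^†) =
    r * a * s + s * a * r + (s * a * s - \sum_(i < n) z i * a * s * (z i)^†).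
  by rewrite /s; nring.
apply: spanD; first apply: spanD.
- apply: (@span_offdiag_star r) => //; last by rewrite !mulrA rr.
  by rewrite -mulrA sr0 mulr0.
- apply: (@span_offdiag r) => //; last by rewrite -(mulrA _ r r) rr.
  by rewrite !mulrA rs !mul0r.
have -> : s * a * s = \sum_(i < n) s * ((z i)^† * z i * (a * s)).
  rewrite -[a in LHS]za mulr_sumr mulr_suml.
  by apply: eq_bigr => i _; rewrite !mulrA.
rewrite -sumrB; apply: span_sum => i _.
have -> : s * ((z i)^† * z i * (a * s)) - z i * a * s * (z i)^† =
   ((s * (z i)^†) * (z i * a * s) - (z i * a * s) * (s * (z i)^†)).
  have ss : s * s = s by exact: (projC hr).2.
  by rewrite [X in _ = _ - X]mulrA -[z i * a * s * s]mulrA ss !mulrA.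
apply: span_comm; apply: (@span_offdiag r) => //.
  by rewrite mulrA rs mul0r.
by rewrite -mulrA zr.
Qed.

End IdealProjections.

(** * Full projections and decompositions of projections *)

Section Simple.
Context {R : realType} {U : ucstarType R}.
Implicit Types (p q r e f x y a b g c v w : U) (t d h : R) (z : nat -> U).
Hypothesis rr0 : @rank0 R U.
Variable I : U -> Prop.
Hypothesis hI : star_ideal I.

Definition generates r := forall a d, I a -> 0 < d ->
  exists n (x y : nat -> U), nrm (a - \sum_(i < n) x i * r * y i) <= d.

(** Let m = sum x_i r y_i approximate q within 1/4. Positivity of (x_i - y_i^†) r (x_i - y_i^†)^†
    gives m + m^† <= K with K = sum (x_i r x_i^† + y_i^† r y_i), so q K q >= (3/2) q >= q, and an
    inverse square root in the corner renormalizes q K q to q. *)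
Lemma fullness r q : proj r -> I r -> generates r -> proj q -> I q ->
  exists n z, (forall i, r * z i = z i /\ z i * q = z i) /\
    q = \sum_(i < n) (z i)^† * z i.
Proof.
move=> hr ir gr hq iq; have [sr rr] := hr; have [sq qq] := hq.
have [|n [x [y hxy]]] := gr q 4^-1 iq; first by rewrite invr_gt0.
set m : U := \sum_(i < n) _ in hxy.
pose u i : U := if (i < n)%N then r * (x i)^† else r * y (i - n)%N.
have ru i : r * u i = u i by rewrite /u; case: ifP => _; rewrite mulrA rr.
pose K : U := \sum_(i < n + n) (u i)^† * u i.
have KE : K = \sum_(i < n) (x i * r * (x i)^† + (y i)^† * r * y i).
  rewrite /K big_split_ord big_split /=; congr (_ + _); apply: eq_bigr => i _.
    by rewrite /u ltn_ord starM starK sr -!mulrA (mulrA r r) rr.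
  rewrite /u ltnNge leq_addr /= addKn starM sr -!mulrA (mulrA r r) rr.
  by [].
have mK : m + m^† ⊑ K.
  rewrite KE /m star_sum -big_split -sumrB; apply: pos_sum => i _ /=.
  have := pos_conjr (x i - (y i)^†) (proj_pos hr); apply: eq_pos.
  by rewrite !starM sr starB starK; nring.
have hK : q ⊑ q * K * q.
  have s1 : selfadjoint (2%:C *: q - (m + m^†)).
    by apply: saB; [exact: saZ | rewrite /selfadjoint starD starK addrC].
  have n1 : nrm (2%:C *: q - (m + m^†)) <= 2^-1.
    have -> : 2%:C *: q - (m + m^†) = (q - m) + (q - m)^†.
      by rewrite starB sq rmorph_nat scaler_nat mulr2n; nring.
    by rewrite (le_trans (nrmD _ _)) // nrm_star; move: hxy; lra.
  have h1 := ule_conj q (sa_ule_nrm s1 n1); have h2 := ule_conj q mK.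
  have h3 : pos ((2^-1)%:C *: q) by apply: posZ; [rewrite invr_ge0 | exact: proj_pos].
  have := posD (posD h1 h2) h3; rewrite sq; apply: eq_pos.
  have -> : q * (2^-1)%:C%:A * q = (2^-1)%:C *: q by rewrite -scalerAr mulr1 -scalerAl qq.
  have -> : q * (2%:C *: q - (m + m^†)) * q = 2%:C *: q - q * (m + m^†) * q.
    by rewrite mulrBr mulrBl -scalerAr -scalerAl !qq.
  have E : (2^-1)%:C + (2^-1)%:C - 2%:C = -1 :> R[i].
    by rewrite -rmorphD -rmorphB /= (_ : 2^-1 + 2^-1 - 2 = -1) ?rmorphN1 //; lra.
  transitivity (q * K * q + ((2^-1)%:C + (2^-1)%:C - 2%:C) *: q); last by nring.
  by rewrite E scaleN1r.
have hK1 : (1 : R)%:C *: q ⊑ q * K * q by rewrite scale1r.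
have [c [pc [qc cq] _ _ ckc]] := corner_invsqrt hq (cor_conj K hq) ltr01 hK1.
exists (n + n)%N, (fun i => u i * c); split.
  by move=> i; rewrite mulrA ru -mulrA cq.
rewrite -ckc (_ : c * (q * K * q) * c = c * K * c); last first.
  by rewrite !mulrA cq -[X in _ = X]/(c * K * c) -!mulrA qc.
rewrite /K mulr_sumr mulr_suml; apply: eq_bigr => i _.
by rewrite starM (pos_sa pc) !mulrA.
Qed.

Lemma msub0 f : msub (0 : U) f.
Proof. by exists 0; rewrite !mulr0. Qed.

(** A projection P almost containing the range of z_0^† is split off; it is subequivalent to f
    because it factors through z_0. On k = q - P the term z_0^† z_0 has become small, so the other
    terms still dominate k / 2, and renormalized they decompose k for the induction. *)
Lemma riesz n q f z : proj q -> q = \sum_(i < n) (z i)^† * z i ->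
  (forall i, f * z i = z i /\ z i * q = z i) ->
  exists s : nat -> U, [/\ forall i, [/\ proj (s i), msub (s i) f & q * s i = s i],
    forall i j, i != j -> s i * s j = 0 & q = \sum_(i < n) s i].
Proof.
elim: n q z => [|n IH] q z hq qE hz.
  exists (fun=> 0); split; last by rewrite qE !big_ord0.
    by move=> i; split; [exact: proj0 | exact: msub0 | rewrite mulr0].
  by move=> i j _; rewrite mulr0.
have [sq qq] := hq.
have qz : q * (z 0%N)^† = (z 0%N)^† by rewrite -[in LHS]sq -starM (hz _).2.
have [|P [y [hP PE nP]]] := range_cutoff rr0 (z 0%N)^† (_ : 0 < 2^-1).
  by rewrite invr_gt0.
rewrite starK in PE; have [sP PP] := hP.
have qP : q * P = P by rewrite PE mulrA qz.
have Pq := subproj_sym hP hq qP.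
have Pf : msub P f.
  by apply: (@msub_factor _ _ _ _ (z 0%N) ((z 0%N)^† * y)) => //; rewrite ?(hz _).1 // PE mulrA.
pose k : U := q - P; have hk : proj k by exact: proj_compl.
have [sk kk] := hk.
have qk : q * k = k by rewrite /k mulrBr qq qP.
have kq : k * q = k by rewrite /k mulrBl qq Pq.
have kP : k * P = 0 by rewrite /k mulrBl qP PP subrr.
have Pk : P * k = 0 by rewrite /k mulrBr Pq PP subrr.
have kE : k = q - P by [].
clearbody k.
pose X : U := \sum_(i < n) k * ((z i.+1)^† * z i.+1) * k.
have hkX : (2^-1)%:C *: k ⊑ X.
  have n1 : nrm (k * (z 0%N)^†) <= 2^-1.
    rewrite (_ : k * _ = (1 - P) * (z 0%N)^†) //.
    by rewrite kE !mulrBl qz mul1r.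
  have h1 : k * ((z 0%N)^† * z 0%N) * k ⊑ (2^-1)%:C *: k.
    apply: cor_ule => //; first exact: cor_conj.
      by rewrite -{1}sk; apply: sa_conj; exact: pos_sa (pos_starM _).
    rewrite (_ : _ * _ * k = (k * (z 0%N)^†) * (k * (z 0%N)^†)^†); last first.
      by rewrite starM starK sk !mulrA.
    rewrite nrm_mulstar (le_trans (_ : _ <= 2^-1 ^+ 2)) //; last by lra.
    by rewrite ler_pXn2r ?nnegrE ?nrm_ge0 ?invr_ge0.
  move: h1; apply: eq_pos.
  have E : k = k * ((z 0%N)^† * z 0%N) * k + X.
    transitivity (k * q * k); first by rewrite kq kk.
    rewrite {1}qE big_ord_recl /= mulrDr mulrDl; congr (_ + _).
    by rewrite mulr_sumr mulr_suml; apply: eq_bigr => i _; rewrite !mulrA.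
  have XE : X = k - k * ((z 0%N)^† * z 0%N) * k by rewrite {1}E addrC addKr.
  have u1 : (2^-1)%:C + (2^-1)%:C = 1 :> R[i].
    by rewrite -rmorphD /= (_ : 2^-1 + 2^-1 = 1) //; lra.
  rewrite XE; move: (k * _ * k) => Y.
  by rewrite -[X in X - Y]scale1r -u1; nring.
have hX : cor k X.
  split; rewrite /X ?mulr_sumr ?mulr_suml; apply: eq_bigr => i _.
    by rewrite !mulrA kk.
  by rewrite -!mulrA kk.
have h20 : 0 < 2^-1 :> R by rewrite invr_gt0.
have [c [pc [kc ck] _ _ cXc]] := corner_invsqrt hk hX h20 hkX.
have [|i|s [s1 s2 s3]] := IH k (fun i => z i.+1 * c) hk.
- rewrite -[LHS]cXc /X mulr_sumr mulr_suml; apply: eq_bigr => i _.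
  by rewrite starM (pos_sa pc) !mulrA ck -!mulrA kc.
- by rewrite mulrA (hz _).1 -mulrA ck.
have Ps i : P * s i = 0 by have [_ _ <-] := s1 i; rewrite mulrA Pk mul0r.
exists (fun i => if i is j.+1 then s j else P); split.
- case=> [|i]; first by split.
  by have [h1 h2 h3] := s1 i; split => //; rewrite -h3 mulrA qk.
- case=> [|i] [|j] //= ij; last exact: s2.
  by have [h1 _ _] := s1 i; exact: (proj_mulC0 hP h1).
- by rewrite big_ord_recl /= -s3 kE addrC subrK.
Qed.

(** [range_cutoff] is applied again and again to the part (1 - p) a not yet covered. If p = a y, the
    new projection (1 - p) a c equals a (c - y a c), so the form a times an element of [I] is
    preserved. *)
Lemma range_sequence a (d : nat -> R) : I a -> (forall n, 0 < d n) ->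
  exists e : nat -> U, [/\ forall k, [/\ proj (e k), I (e k) & exists2 y, I y & e k = a * y],
    forall i j, i != j -> e i * e j = 0
    & forall n, nrm ((1 - \sum_(k < n.+1) e k) * a) <= d n].
Proof.
move=> ia d0; pose good p := [/\ proj p, I p & exists2 y, I y & p = a * y].
have step n p : good p -> exists p', good p' /\
    [/\ good (p' - p), p * (p' - p) = 0 & nrm ((1 - p') * a) <= d n].
  move=> [hp ip [y iy py]]; have [sp pp] := hp.
  have [f [w [hf fE nf]]] := range_cutoff rr0 ((1 - p) * a) (d0 n).
  have pf : p * f = 0 by rewrite fE !mulrA (proj_mulpC hp) !mul0r.
  have fp := proj_mulC0 hp hf pf.
  have gf : good f.
    have ic : I (w * ((1 - p) * a)^†).
      by apply: (idealMl hI); apply: (ideal_star hI); exact: (idealMl hI).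
    split => //; first by rewrite fE; exact: (idealMl hI).
    exists (w * ((1 - p) * a)^† - y * (a * (w * ((1 - p) * a)^†))).
      by apply: (idealB hI) => //; exact: (idealMr hI).
    by rewrite {1}fE py; nring.
  exists (p + f); rewrite (_ : p + f - p = f); last by rewrite addrC addKr.
  split; last first.
    split=> //; move: nf; rewrite mulrA (_ : (1 - f) * (1 - p) = 1 - (p + f)) //.
    by rewrite mulrBr mulr1 mulrBl mul1r fp; nring.
  have [_ if_ [y' iy' fy']] := gf.
  split; [exact: projD | exact: (idealD hI) |].
  exists (y + y'); first exact: (idealD hI).
  by rewrite mulrDr -py -fy'.
have g0 : good 0.
  split; [exact: proj0 | exact: (ideal0 hI) |].
  by exists 0; [exact: (ideal0 hI) | rewrite mulr0].
have [u [u0 hu]] := dependent_sequence g0 step.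
pose e k : U := u k.+1 - u k.
have ue n : u n = \sum_(k < n) e k.
  elim: n => [|n IH]; first by rewrite u0 big_ord0.
  by rewrite big_ord_recr /= -IH /e addrC subrK.
have ge k : good (e k) by have [_ []] := hu k.
have uek k : u k * e k = 0 by have [_ []] := hu k.
have eu k j : (j < k)%N -> e j * u k = e j.
  elim: k => // k IH; rewrite ltnS leq_eqVlt => /orP[/eqP ->|jk].
    have [h1 _ _] := ge k; have [[h2 _ _] _] := hu k.
    rewrite (_ : u k.+1 = u k + e k); last by rewrite /e addrC subrK.
    by rewrite mulrDr (proj_mulC0 h2 h1 (uek k)) add0r h1.2.
  rewrite (_ : u k.+1 = u k + e k); last by rewrite /e addrC subrK.
  by rewrite mulrDr -[e j in X in _ + X](IH jk) -mulrA uek mulr0 addr0 IH.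
have ee j k : (j < k)%N -> e j * e k = 0.
  by move=> jk; rewrite -(eu _ _ jk) -mulrA uek mulr0.
exists e; split => //.
- move=> i j; rewrite neq_ltn => /orP[/ee //|ji].
  have [h1 _ _] := ge i; have [h2 _ _] := ge j.
  exact: (proj_mulC0 h2 h1 (ee _ _ ji)).
- by move=> n; rewrite -ue; have [_ []] := hu n.
Qed.

(* z z^* is strictly positive on the tail, and z carries the tail under p. *)
Lemma relocate_tail p a (e w : nat -> U) : proj p -> I p -> I a ->
  (forall k, I (w k)) ->
  (forall k, (w k)^† * w k = e k /\ w k * e k = w k) ->
  (forall k, p * w k = w k /\ p * e k = 0) ->
  (forall i j, i != j -> (w i)^† * w j = 0) ->
  nlim (fun n => \sum_(k < n) e k * a) ((1 - p) * a) ->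
  (forall k, nrm (e k * a) <= (4^-1) ^+ k) ->
  exists b, [/\ cor p b, I b & span I (a - b)].
Proof.
move=> hp ip ia iw we pw wo la na; have [sp pp] := hp.
have h40 : 0 <= 2^-1 :> R by rewrite invr_ge0.
have h41 : 2^-1 < 1 :> R by rewrite invf_lt1 // ltr1n.
have nw k : nrm (w k) <= 1.
  rewrite -(@expr_le1 _ 2) ?nrm_ge0 // -nrm_starM (we k).1.
  have sw : selfadjoint (e k) by rewrite -(we k).1; exact: pos_sa (pos_starM _).
  apply: proj_nrm; split => //.
  by rewrite -{1}(we k).1 -mulrA (we k).2 (we k).1.
have s1 n := sum_geo_le n h40 h41.
(* The weights 2^-k in Z and 2^k in Y make both series converge, since ‖e_k a‖ <= 4^-k. They cancel
   in Z Y = (1 - p) a, whereas Y Z lies in the corner of p. *)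
have [|Z hZ] := nsum_cvg (x := fun k => ((2^-1) ^+ k)%:C *: (w k)^†) _ s1.
  by move=> k; rewrite nrmZr ?exprn_ge0 // nrm_star ler_piMr // exprn_ge0.
have [|Y hY] := nsum_cvg (x := fun k => (2 ^+ k)%:C *: (w k * a)) _ s1.
  move=> k; rewrite nrmZr ?exprn_ge0 //.
  have : nrm (w k * a) <= (4^-1) ^+ k.
    rewrite -(we k).2 -mulrA (le_trans (nrmM _ _)) // -[leRHS]mul1r.
    by rewrite ler_pM ?nrm_ge0.
  move=> /(ler_wpM2l (exprn_ge0 k (ler0n R 2))) h; apply: le_trans h _.
  by rewrite -exprMn (_ : 2 * 4^-1 = 2^-1) //; lra.
have ZY : Z * Y = (1 - p) * a.
  apply: (nlim_uniq (nlimM hZ hY)); apply: nlim_ext la => n.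
  elim: n => [|n IH]; first by rewrite !big_ord0 mul0r.
  rewrite !big_ord_recr /= mulrDl !mulrDr -IH -addrA; congr (_ + _).
  rewrite mulr_suml big1 => [|i _]; last first.
    by rewrite -scalerAl -scalerAr mulrA wo ?mul0r ?scaler0 // neq_ltn ltn_ord.
  rewrite mulr_sumr big1 => [|i _]; last first.
    by rewrite -scalerAl -scalerAr mulrA wo ?mul0r ?scaler0 // neq_ltn ltn_ord orbT.
  rewrite !add0r -scalerAl -scalerAr scalerA mulrA (we n).1 -rmorphM /= -exprMn.
  by rewrite mulVf ?pnatr_eq0 // expr1n scale1r.
have iZ : I Z.
  apply: (ideal_lim hI hZ) => n; apply: (ideal_sum hI) => k _.
  by apply: (idealZ hI); exact: (ideal_star hI).
have pZ : p * Z = 0.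
  apply: (nlim_uniq (nlimMl p hZ)); apply: nlim_ext (nlim_cst 0) => n.
  rewrite mulr_sumr big1 // => k _; rewrite -scalerAr -{1}sp -starM.
  have se : selfadjoint (e k) by rewrite -(we k).1; exact: pos_sa (pos_starM _).
  have ep : e k * p = 0 by rewrite -[LHS]starK starM sp se (pw k).2 star0.
  by rewrite -(we k).2 -mulrA ep mulr0 star0 scaler0.
have Zp : Z * p = Z.
  apply: (nlim_uniq (nlimMr p hZ)); apply: nlim_ext hZ => n.
  rewrite mulr_suml; apply: eq_bigr => k _.
  have wp : (w k)^† * p = (w k)^† by rewrite -[in LHS]sp -starM (pw k).1.
  by rewrite -scalerAl wp.
have pY : p * Y = Y.
  apply: (nlim_uniq (nlimMl p hY)); apply: nlim_ext hY => n.
  rewrite mulr_sumr; apply: eq_bigr => k _.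
  by rewrite -scalerAr mulrA (pw k).1.
exists (p * a * p + Y * Z); split.
- apply: corD; first exact: cor_conj.
  by split; [rewrite mulrA pY | rewrite -mulrA Zp].
- apply: (idealD hI); last exact: (idealMl hI).
  by apply: (idealMr hI); exact: (idealMl hI).
have -> : a - (p * a * p + Y * Z) = p * a * (1 - p) + (Z * Y - Y * Z).
  by rewrite ZY; nring.
apply: spanD.
  apply: (@span_offdiag_star _ _ _ hI p) => //; last by rewrite !mulrA pp.
  by rewrite -mulrA (proj_mulCp hp) mulr0.
by apply: (span_comm hI); apply: (@span_offdiag _ _ _ hI p).
Qed.

End Simple.

(** * Sums of commutators in a corner *)

Section CornerTraces.
Context {R : realType} {U : ucstarType R}.
Implicit Types (p q r e f x y a b g c v w : U) (d h : R).
Hypothesis rr0 : @rank0 R U.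
Variable I : U -> Prop.
Hypothesis hI : star_ideal I.
Variable Q : U.
Hypothesis hQ : proj Q.

(** The real part of a finite trace on the corner, hence only real-linear; it is not normalized, so
    that one corner may carry the restrictions of all the weights. *)
Record corner_trace (t : U -> R) : Prop := CornerTrace {
  traceD : forall x y, cor Q x -> cor Q y -> t (x + y) = t x + t y;
  traceZ : forall h x, cor Q x -> t (h%:C *: x) = h * t x;
  trace_starM : forall x, cor Q x -> 0 <= t (x^† * x);
  traceC : forall x y, cor Q x -> cor Q y -> t (x * y) = t (y * x);
  trace_gt0 : 0 < t Q }.

Section OneTrace.
Variable t : U -> R.
Hypothesis ht : corner_trace t.

Lemma cor0 p : cor p 0. Proof. by split; rewrite ?mulr0 ?mul0r. Qed.
Lemma trace0 : t 0 = 0.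
Proof. by rewrite -[X in t X](scale0r (0 : U)) (traceZ ht 0 (cor0 Q)) mul0r. Qed.
Lemma traceN x : cor Q x -> t (- x) = - t x.
Proof.
move=> hx; have := traceZ ht (-1) hx.
by rewrite rmorphN1 scaleN1r mulN1r.
Qed.
Lemma traceB x y : cor Q x -> cor Q y -> t (x - y) = t x - t y.
Proof. by move=> hx hy; rewrite (traceD ht) ?traceN //; exact: corN. Qed.
Lemma cor_sum p n (F : nat -> U) : (forall i, (i < n)%N -> cor p (F i)) ->
  cor p (\sum_(i < n) F i).
Proof. by move=> h; split; rewrite ?mulr_sumr ?mulr_suml; apply: eq_bigr => i _; case: (h i (ltn_ord i)). Qed.
Lemma trace_sum n (F : nat -> U) : (forall i, (i < n)%N -> cor Q (F i)) ->
  t (\sum_(i < n) F i) = \sum_(i < n) t (F i).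
Proof.
elim: n => [|n IH] h; first by rewrite !big_ord0 trace0.
have h' i : (i < n)%N -> cor Q (F i) by move=> hi; apply: h; exact: ltnW.
by rewrite !big_ord_recr /= (traceD ht) ?IH //; [exact: cor_sum | exact: h].
Qed.
Lemma trace_pos x : cor Q x -> pos x -> 0 <= t x.
Proof.
move=> hx px; have [k [pk kE _]] := pos_sqrt px.
rewrite kE -{1}(pos_sa pk); apply: (trace_starM ht).
exact: pos_sqrt_cor pk kE.
Qed.
Lemma trace_mono x y : cor Q x -> cor Q y -> x ⊑ y -> t x <= t y.
Proof.
move=> hx hy xy; rewrite -subr_ge0 -traceB //; apply: trace_pos => //.
exact: corB.
Qed.
Lemma trace_proj_ge0 p : proj p -> cor Q p -> 0 <= t p.
Proof. by move=> hp hc; apply: trace_pos => //; exact: proj_pos. Qed.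
Lemma trace_nrm p x d : proj p -> cor Q p -> cor p x -> selfadjoint x ->
  nrm x <= d -> `|t x| <= d * t p.
Proof.
move=> hp hc hx sx nx; have hx' : cor Q x by case: hc => h1 h2; apply: cor_le hx.
have h1 := trace_mono hx' (corZ d%:C hc) (cor_ule hp hx sx nx).
have := cor_ule hp (corN hx) (saN sx); rewrite nrmN => /(_ _ nx).
move=> /(trace_mono (corN hx') (corZ d%:C hc)).
rewrite (traceZ ht) // in h1 *; rewrite traceN // ler_norml h1 andbT.
by rewrite lerNl.
Qed.
Lemma trace_msub p q : proj p -> proj q -> cor Q p -> cor Q q -> msub p q ->
  t p <= t q.
Proof.
move=> hp hq cp cq [v [vv qv]]; have vp := msub_pcor hp vv.
have cv : cor Q v by split; [rewrite -qv mulrA cq.1 | rewrite -vp -mulrA cp.2].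
have cvs := cor_star hQ cv.
rewrite -vv (traceC ht) //; apply: trace_mono => //; first exact: corM.
have -> : v * v^† = q * (v * v^†) * q.
  by rewrite -!mulrA (star_absorb hq qv) mulrA qv.
have nv : nrm (v * v^†) <= 1.
  by rewrite nrm_mulstar -nrm_starM vv proj_nrm.
have := ule_conj q (sa_ule_nrm (pos_sa (pos_mulstar v)) nv).
by rewrite hq.1 scale1r mulr1 hq.2.
Qed.
Lemma trace_conj p u : proj p -> cor Q p -> cor Q u -> u^† * u = p ->
  t (u * u^†) = t p.
Proof. by move=> hp cp cu uu; rewrite (traceC ht) ?uu //; exact: cor_star. Qed.

Hypothesis iQ : I Q.
(** Write Q as a sum of z_i^† z_i with p z_i = z_i. Then t(z_i^† z_i) = t(z_i z_i^†) <= ‖z_i‖^2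
    t(p), so t(p) = 0 would force t(Q) = 0. *)
Lemma trace_proj_gt0 p : generates I p -> proj p -> I p -> cor Q p -> 0 < t p.
Proof.
move=> gp hp ip cp; rewrite lt_neqAle eq_sym trace_proj_ge0 // andbT.
apply/eqP => tp0; have [n [z [hz QE]]] := fullness hp ip gp hQ iQ.
have cz i : cor Q (z i).
  by have [h1 h2] := hz i; split => //; rewrite -h1 mulrA cp.1.
have := trace_gt0 ht; rewrite {1}QE (@trace_sum n (fun i => (z i)^† * z i)); last first.
  by move=> i _; apply: corM => //; exact: cor_star.
rewrite big1 ?ltxx // => i _; apply/eqP; rewrite eq_le (trace_starM ht) // andbT.
have czs := cor_star hQ (cz i).
rewrite (traceC ht) // -[leRHS](mulr0 (nrm (z i) ^+ 2)) -tp0.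
rewrite -(traceZ ht) //; apply: trace_mono; [exact: corM | exact: corZ |].
apply: cor_ule => //; last by rewrite nrm_mulstar.
  have [h1 _] := hz i; split; first by rewrite mulrA h1.
  by rewrite -mulrA (star_absorb hp h1).
exact: pos_sa (pos_mulstar _).
Qed.
End OneTrace.

Variable m : nat.
Variable t : 'I_m -> U -> R.
Hypothesis ht : forall j, corner_trace (t j).
Hypothesis iQ : I Q.
Hypothesis hcmp : forall p q, proj p -> proj q -> cor Q p -> cor Q q ->
  (forall j, t j p < t j q) -> msub p q.
Hypothesis hgen : forall r, proj r -> I r -> r != 0 -> generates I r.

Lemma cor_ideal x : cor Q x -> I x.
Proof. by move=> [<- _]; exact: (idealMr hI). Qed.
Lemma trace_proj_pos p j : proj p -> cor Q p -> p != 0 -> 0 < t j p.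
Proof.
move=> hp cp p0; have ip := cor_ideal cp.
by apply: (trace_proj_gt0 (ht j) iQ) => //; exact: hgen.
Qed.

Definition minimal g := [/\ proj g, g != 0 &
  forall f, proj f -> g * f = f -> f = 0 \/ f = g].

(** The spectral projections in the corner are 0 or g, so [finite_spectrum] approximates x by
    multiples of g; their coefficients form a Cauchy sequence as ‖g‖ = 1. *)
Lemma minimal_corner g x : minimal g -> cor g x -> selfadjoint x ->
  exists h, x = h%:C *: g.
Proof.
move=> [hg g0 gmin] hx sx; have g1 : nrm g = 1.
  have n0 : nrm g != 0 by apply: contra_neq g0 => /nrm_eq0.
  have := nrm_sqr hg.1; rewrite hg.2 expr2 => h; apply: (mulfI n0).
  by rewrite -h mulr1.
have n0 := nrm_ge0 x; have n1 := ltr_pwDr ltr01 n0.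
have app d : 0 < d -> exists h, nrm (x - h%:C *: g) <= d.
  move=> d0; pose k := Num.truncn ((nrm x + 1 + (nrm x + 1)) / (d / 2)).
  have dd : 0 < d / 2 by rewrite divr_gt0.
  have lo : (- (nrm x + 1))%:C *: g ⊑ x.
    have := cor_ule hg (corN hx) (saN sx) (_ : nrm (- x) <= nrm x + 1).
    by rewrite nrmN lerDl ler01 => /(_ isT); apply: eq_pos; nring.
  have up : x ⊑ (- (nrm x + 1) + k.+1%:R * (d / 2))%:C *: g.
    have h1 := cor_ule hg hx sx (lexx _).
    have h2 : nrm x <= - (nrm x + 1) + k.+1%:R * (d / 2).
      have := truncnS_gt ((nrm x + 1 + (nrm x + 1)) / (d / 2)).
      by rewrite ltr_pdivrMr // -/k; lra.
    exact: ule_trans h1 (uleZr h2 (proj_pos hg)).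
  have [e [he ne]] := finite_spectrum rr0 hg hx sx dd dd lo up.
  have [c cE] : exists c : R, \sum_(l < k.+1) e l = c%:C *: g.
    elim: {up ne}(k.+1) => [|l [c cE]]; first by exists 0; rewrite big_ord0 scale0r.
    have [h1 h2] := he l; case: (gmin _ h1 h2.1) => el.
      by exists c; rewrite big_ord_recr /= el addr0.
    by exists (c + 1); rewrite big_ord_recr /= el cE rmorphD rmorph1 scalerDl scale1r.
  exists (- (nrm x + 1) + d / 2 * c); move: ne; rewrite cE -splitr.
  by rewrite scalerA -rmorphM -scalerDl -rmorphD.
have app' n : exists h, nrm (x - h%:C *: g) <= n.+1%:R^-1.
  by apply: app; rewrite invr_gt0 ltr0n.
have [u hu] := choice app'.
have [|l hl] := @real_complete R u.
  move=> d d0; have [n hn] := invS_small (divr_gt0 d0 (ltr0Sn R 1)).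
  exists n => k nk; rewrite -[leLHS]mulr1 -g1.
  rewrite -rnormC -nrmZ rmorphB scalerBl (le_trans (nrm_tri x _ _)) //.
  rewrite nrmC [leRHS]splitr lerD // (le_trans (hu _)) //.
    exact: hn nk.
  exact: hn (leqnn n).
exists l; apply/eqP; rewrite -subr_eq0; apply/eqP/nrm_eq0/eqP.
rewrite eq_le nrm_ge0 andbT; apply/ler_addgt0Pr => d d0; rewrite add0r.
have d2 := divr_gt0 d0 (ltr0Sn R 1).
have [n hn] := invS_small d2; have [k hk] := hl _ d2.
rewrite (le_trans (nrm_tri ((u (maxn n k))%:C *: g) _ _)) // [leRHS]splitr lerD //.
  by rewrite (le_trans (hu _)) // hn // leq_maxl.
by rewrite -scalerBl -rmorphB nrmZ rnormC g1 mulr1 hk // leq_maxr.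
Qed.

Lemma span_minimal g a : minimal g -> cor Q g -> cor Q a -> span I a.
Proof.
move=> gm cg ca; have [hg g0 _] := gm; have ig := cor_ideal cg.
have [n [z [hz QE]]] := fullness hg ig (hgen hg ig g0) hQ iQ.
have [||b [cb ib sb]] := relocate hI (n := n) (z := z) hg ig (cor_ideal ca).
- by move=> i; case: (hz i).
- by rewrite -mulr_suml -QE ca.1.
have sg := hg.1; have half (x : U) : (2^-1)%:C *: (x + x) = x.
  by rewrite scalerDr -scalerDl -rmorphD /= (_ : 2^-1 + 2^-1 = 1) ?scale1r //; lra.
have cbs := cor_star hg cb.
have [|h1 E1] := minimal_corner gm (corZ (2^-1)%:C (corD cb cbs)).
  by apply: saZ; rewrite /selfadjoint starD starK addrC.
have [|h2 E2] := minimal_corner gm (corZ (2^-1)%:C (corZ (- 'i%C) (corB cb cbs))).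
  apply: saZ; rewrite /selfadjoint starZ starB starK.
  rewrite (_ : conjc (- 'i%C) = 'i%C) ?scaleNr -?scalerN ?opprB //.
  by apply/eqP; rewrite eq_complex /= oppr0 opprK !eqxx.
have bE : b = h1%:C *: g + ('i%C * h2%:C) *: g.
  have c1 : 'i%C * (2^-1)%:C * - 'i%C = (2^-1)%:C :> R[i].
    by rewrite mulrAC mulrN mulii opprK mul1r.
  rewrite -scalerA -E2 -E1.
  have -> : 'i%C *: ((2^-1)%:C *: (- 'i%C *: (b - b^†))) = (2^-1)%:C *: (b - b^†).
    by rewrite !scalerA ?mulrA c1.
  rewrite -scalerDr.
  by rewrite (_ : b + b^† + (b - b^†) = b + b) ?half //; nring.
rewrite -(subrK b a); apply: spanD => //; rewrite bE; apply: spanD; apply: spanZ;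
  exact: span_proj.
Qed.

Hypothesis no_minimal : forall g, minimal g -> ~ cor Q g.

Lemma proper_subproj g : proj g -> cor Q g -> g != 0 ->
  exists f, [/\ proj f, g * f = f, f != 0 & f != g].
Proof.
move=> hg cg g0; apply: contrapT => hn; apply: (no_minimal _ cg); split => // f hf gf.
have [->|f0] := eqVneq f 0; first by left.
have [->|fg] := eqVneq f g; first by right.
by case: hn; exists f.
Qed.

(** Where nothing is minimal there is a strictly decreasing sequence of subprojections. If each
    successive difference had some trace above d, the sum of all the traces would drop by d at every
    step. *)
Lemma small_proj q d : proj q -> cor Q q -> q != 0 -> 0 < d ->
  exists f, [/\ proj f, q * f = f, f != 0 & forall j, t j f <= d].
Proof.
move=> hq cq q0 d0; pose P g := [/\ proj g, q * g = g & g != 0].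
have step (n : nat) g : P g -> exists g', P g' /\ (g * g' = g' /\ g' != g).
  move=> [hg qg g0]; have cg : cor Q g.
    by apply: cor_proj => //; rewrite -qg mulrA cq.1.
  have [f [hf gf f0 fg]] := proper_subproj hg cg g0.
  by exists f; split => //; split => //; rewrite -gf mulrA qg.
have Pq : P q by split => //; exact: hq.2.
have [u [u0 hu]] := dependent_sequence Pq step.
have cu k : cor Q (u k).
  have [[h1 h2 _] _] := hu k; by apply: cor_proj => //; rewrite -h2 mulrA cq.1.
pose f k : U := u k - u k.+1.
have hf k : proj (f k).
  by have [[h1 _ _] [h2 _]] := hu k; have [[h3 _ _] _] := hu k.+1; exact: proj_compl.
have qf k : q * f k = f k.
  have [[_ h1 _] _] := hu k; have [[_ h2 _] _] := hu k.+1.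
  by rewrite mulrBr h1 h2.
have f0 k : f k != 0.
  by rewrite subr_eq0 eq_sym; have [_ [_ h]] := hu k.
apply: contrapT => hn.
have big k : exists j, d < t j (f k).
  apply: contrapT => hk; apply: hn; exists (f k); split => // j.
  by rewrite leNgt; apply/negP => h; apply: hk; exists j.
pose S k := \sum_(j < m) t j (u k).
have Sd k : S k.+1 + d <= S k.
  have [j hj] := big k.
  have E : \sum_(j < m) t j (f k) = S k - S k.+1.
    by rewrite -sumrB; apply: eq_bigr => i _; rewrite (traceB (ht i)).
  have : d <= \sum_(j < m) t j (f k).
    rewrite (bigD1 j) //= ler_wpDr ?(ltW hj) // sumr_ge0 // => i _.
    by apply: (trace_proj_ge0 (ht i)) => //; exact: corB.
  by rewrite E; lra.
have Sk k : k%:R * d <= S 0%N.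
  have : S k + k%:R * d <= S 0%N.
    elim: k => [|k IH]; first by rewrite mul0r addr0.
    by move: (Sd k) IH; rewrite -natr1; lra.
  apply: le_trans; rewrite lerDr sumr_ge0 // => j _.
  by have [[h1 _ _] _] := hu k; apply: (trace_proj_ge0 (ht j)).
have := Sk (Num.truncn (S 0%N / d)).+1.
by have := truncnS_gt (S 0%N / d); rewrite ltr_pdivrMr // => h1; rewrite leNgt h1.
Qed.

(* Greedy choice of signs keeping the sum of the squared discrepancies small. *)
Lemma balance n (v : nat -> 'I_m -> R) : exists s : nat -> bool,
  \sum_(j < m) (\sum_(i < n) (-1) ^+ s i * v i j) ^+ 2 <=
  \sum_(i < n) \sum_(j < m) v i j ^+ 2.
Proof.
elim: n => [|n [s IH]].
  by exists (fun=> false); rewrite !big_ord0 big1 // => j _; rewrite big_ord0 expr0n.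
pose D j : R := \sum_(i < n) (-1) ^+ s i * v i j.
pose c : R := \sum_(j < m) D j * v n j.
exists (fun i => if (i < n)%N then s i else (0 < c)%R).
rewrite [leRHS]big_ord_recr /=; apply: le_trans (lerD IH (lexx _)).
have E j : \sum_(i < n.+1) (-1) ^+ (if (i < n)%N then s i else (0 < c)%R) * v i j =
    D j + (-1) ^+ (0 < c)%R * v n j.
  rewrite big_ord_recr /= ltnn; congr (_ + _).
  by apply: eq_bigr => i _; rewrite ltn_ord.
under eq_bigr do rewrite E.
have : \sum_(j < m) (D j + (-1) ^+ (0 < c)%R * v n j) ^+ 2 =
    \sum_(j < m) D j ^+ 2 + \sum_(j < m) v n j ^+ 2 + 2 * ((-1) ^+ (0 < c)%R * c).
  rewrite /c !mulr_sumr -!big_split /=; apply: eq_bigr => j _.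
  rewrite sqrrD exprMn -exprM mulnC exprM sqrrN expr1n expr1n mul1r -mulr_natl.
  by ring.
move=> ->; rewrite gerDl.
by case: ltrP => c0; rewrite ?expr1 ?expr0 ?mulN1r ?mul1r; lra.
Qed.

(** q is cut into orthogonal pieces subequivalent to a projection f of small trace, and the signs of
    [balance] distribute the pieces over two halves. The squared error is at most the sum of the
    squares of the normalized traces of the pieces, which is small because each is small and they
    add up to 1. *)
Lemma halve q d : proj q -> cor Q q -> q != 0 -> 0 < d ->
  exists g, [/\ proj g, q * g = g & forall j, `|2 * t j g - t j q| <= d * t j q].
Proof.
move=> hq cq q0 d0.
have tq j : 0 < t j q by exact: trace_proj_pos.
pose K := \sum_(j < m) (t j q)^-1 + 1.
have K1 : 1 <= K.
  by rewrite /K lerDr sumr_ge0 // => j _; rewrite invr_ge0 ltW.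
have Kj j : (t j q)^-1 <= K.
  rewrite /K (bigD1 j) //= -addrA lerDl addr_ge0 // sumr_ge0 // => i _.
  by rewrite invr_ge0 ltW.
(* Makes every normalized piece [v i j] at most d^2 / (m + 1), so that the squares, summed over i
   and over the m traces, stay below d^2. K bounds all the 1 / t_j(q). *)
pose b := d ^+ 2 / (m%:R + 1) / K.
have m0 : 0 < m%:R + 1 :> R by rewrite ltr_wpDl.
have K0 : 0 < K := lt_le_trans ltr01 K1.
have b0 : 0 < b by rewrite divr_gt0 // divr_gt0 // exprn_gt0.
have [f [hf qf f0 fd]] := small_proj hq cq q0 b0.
have cf : cor Q f by apply: cor_proj => //; rewrite -qf mulrA cq.1.
have iff := cor_ideal cf.
have [n [z [hz qE]]] := fullness hf iff (hgen hf iff f0) hq (cor_ideal cq).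
have [s [hs so qs]] := riesz rr0 hq qE hz.
have cs i : cor Q (s i).
  by have [h1 _ h2] := hs i; apply: cor_proj => //; rewrite -h2 mulrA cq.1.
pose v i j := t j (s i) / t j q.
have v0 i j : 0 <= v i j.
  have [h1 _ _] := hs i.
  by rewrite divr_ge0 ?(ltW (tq j)) //; apply: (trace_proj_ge0 (ht j)).
have vb i j : v i j <= d ^+ 2 / (m%:R + 1).
  have [h1 h2 _] := hs i; have h3 := trace_msub (ht j) h1 hf (cs i) cf h2.
  rewrite (le_trans (_ : _ <= b * K)) //; last by rewrite /b divfK // gt_eqF // (lt_le_trans ltr01).
  by rewrite ler_pM // ?invr_ge0 ?(ltW (tq j)) ?(le_trans h3) //; apply: (trace_proj_ge0 (ht j)).
have v1 j : \sum_(i < n) v i j = 1.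
  rewrite -mulr_suml -(trace_sum (ht j)) // -qs divff //; exact: lt0r_neq0.
have [e he] := balance n v.
pose g : U := \sum_(i < n) (if e i then 0 else s i).
have gp : proj g.
  apply: (@proj_sum_nat _ _ (fun i => if e i then 0 else s i)) => [k|i j ij].
    by case: ifP => _; [exact: proj0 | case: (hs k)].
  by case: (e i); case: (e j); rewrite ?mul0r ?mulr0 // so.
have qg : q * g = g.
  by rewrite mulr_sumr; apply: eq_bigr => i _; case: ifP => _; rewrite ?mulr0 //; case: (hs i).
exists g; split=> // j.
have tg : 2 * t j g - t j q = t j q * \sum_(i < n) (-1) ^+ e i * v i j.
  have cc i : (i < n)%N -> cor Q (if e i then 0 else s i).
    by move=> _; case: ifP => _; [exact: cor0 | exact: cs].
  have tqs : t j q = \sum_(i < n) t j (s i) by rewrite {1}qs (trace_sum (ht j)).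
  rewrite /g (trace_sum (ht j) cc) [X in _ - X]tqs mulr_sumr -sumrB mulr_sumr.
  apply: eq_bigr => i _; rewrite /v mulrCA [t j q * _]mulrC divfK; last exact: lt0r_neq0.
  by case: (e i); rewrite ?(trace0 (ht j)) ?expr1 ?expr0; lra.
rewrite tg normrM gtr0_norm // mulrC ler_wpM2r ?(ltW (tq j)) //.
rewrite -(@ler_pXn2r _ 2) ?nnegrE ?(ltW d0) // real_normK ?num_real //.
apply: le_trans (_ : \sum_(j < m) (\sum_(i < n) (-1) ^+ e i * v i j) ^+ 2 <= _).
  by rewrite (bigD1 j) //= lerDl sumr_ge0 // => i _; exact: sqr_ge0.
apply: le_trans he _; rewrite exchange_big /=.
apply: le_trans (_ : \sum_(j < m) d ^+ 2 / (m%:R + 1) <= _).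
  apply: ler_sum => k _.
  have -> : d ^+ 2 / (m%:R + 1) = \sum_(i < n) d ^+ 2 / (m%:R + 1) * v i k.
    by rewrite -mulr_sumr v1 mulr1.
  by apply: ler_sum => i _; rewrite expr2 ler_wpM2r.
have mc : (m%:R : R) <= m%:R + 1 by rewrite lerDl.
rewrite sumr_const card_ord; move: (m%:R + 1 : R) m0 mc => c c0 mc.
have -> : (d ^+ 2 / c) *+ m = d ^+ 2 * (m%:R / c) by rewrite -mulr_natr; ring.
by rewrite ler_piMr ?sqr_ge0 // ler_pdivrMr // mul1r.
Qed.

End CornerTraces.

(** * Orthogonal copies of a projection and block diagonal elements *)

Section MatrixUnits.
Context {R : realType} {U : ucstarType R}.
Implicit Types (p q r e f x y a b g c v w : U) (d h : R).
Variables (rho : U) (u : nat -> U) (N : nat).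
Hypothesis hrho : proj rho.
Hypothesis uu : forall i j, (i < N)%N -> (j < N)%N ->
  (u i)^† * u j = if i == j then rho else 0.

Lemma copy_rho i : (i < N)%N -> u i * rho = u i.
Proof. by move=> iN; apply: (msub_pcor hrho); rewrite uu // eqxx. Qed.
Lemma copy_rho_star i : (i < N)%N -> rho * (u i)^† = (u i)^†.
Proof. by move=> iN; rewrite -[in LHS]hrho.1 -starM copy_rho. Qed.

Definition block (F : nat -> U) i n := \sum_(l < n) u (i + l)%N * F (i + l)%N * (u (i + l)%N)^†.

Lemma block_u F i n l : (i + n <= N)%N -> (l < N)%N ->
  (forall k, cor rho (F k)) ->
  block F i n * u l = if (i <= l < i + n)%N then u l * F l else 0.
Proof.
move=> inN lN cF; rewrite /block mulr_suml.
have E (k : 'I_n) : u (i + k)%N * F (i + k)%N * (u (i + k)%N)^† * u l =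
    if (i + k == l)%N then u l * F l else 0.
  rewrite -mulrA uu //; last by rewrite (leq_trans _ inN) // ltn_add2l.
  by case: eqP => [->|_]; rewrite ?mulr0 // -mulrA (cF _).2.
under eq_bigr do rewrite E.
case: ifP => [/andP[il lin]|hl].
  have lk : (l - i < n)%N by rewrite ltn_subLR.
  rewrite (bigD1 (Ordinal lk)) //= subnKC // eqxx big1 ?addr0 // => k kl.
  case: eqP => // kE; case/eqP: kl; apply: val_inj; rewrite /= -kE addKn //.
rewrite big1 // => k _; case: eqP => // kE; move: hl.
by rewrite -kE leq_addr ltn_add2l ltn_ord.
Qed.

Lemma u_block F i n l : (i + n <= N)%N -> (l < N)%N ->
  (forall k, cor rho (F k)) ->
  (u l)^† * block F i n = if (i <= l < i + n)%N then F l * (u l)^† else 0.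
Proof.
move=> inN lN cF; rewrite -[LHS]starK starM starK.
have -> : (block F i n)^† = block (fun k => (F k)^†) i n.
  by rewrite star_sum; apply: eq_bigr => k _; rewrite !starM starK mulrA.
rewrite block_u // => [|k]; last exact: cor_star.
by case: ifP => _; rewrite ?star0 // starM starK.
Qed.

Lemma block_mul F G i n j k : (i + n <= N)%N -> (j + k <= N)%N ->
  (forall k, cor rho (F k)) ->
  block F i n * block G j k = \sum_(l < k)
    (if (i <= j + l < i + n)%N then u (j + l)%N * (F (j + l)%N * G (j + l)%N) * (u (j + l)%N)^† else 0).
Proof.
move=> inN jkN cF; rewrite {2}/block mulr_sumr; apply: eq_bigr => l _.
rewrite !mulrA block_u //; last by rewrite (leq_trans _ jkN) // ltn_add2l.
by case: ifP => _; rewrite ?mul0r // !mulrA.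
Qed.

Lemma block_mul_in F G i n j k : (i + n <= N)%N -> (i <= j)%N ->
  (j + k <= i + n)%N -> (forall k, cor rho (F k)) ->
  block F i n * block G j k = block (fun l => F l * G l) j k.
Proof.
move=> inN ij jk cF; rewrite block_mul ?(leq_trans jk) //.
apply: eq_bigr => l _; rewrite (leq_trans ij (leq_addr _ _)) /=.
by rewrite (leq_trans _ jk) // ltn_add2l.
Qed.

Lemma block_mul0 F G i n j k : (i + n <= N)%N -> (j + k <= N)%N ->
  (i + n <= j)%N || (j + k <= i)%N -> (forall k, cor rho (F k)) ->
  block F i n * block G j k = 0.
Proof.
move=> inN jkN dj cF; rewrite block_mul // big1 // => l _; case: ifP => // /andP[h1 h2].
case/orP: dj => h.
  by move: (leq_ltn_trans h (leq_ltn_trans (leq_addr l j) h2)); rewrite ltnn.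
by move: (leq_trans h h1); rewrite leq_add2l leqNgt ltn_ord.
Qed.

Lemma block_star F i n : (block F i n)^† = block (fun k => (F k)^†) i n.
Proof. by rewrite star_sum; apply: eq_bigr => k _; rewrite !starM starK mulrA. Qed.

Lemma eq_block F G i n : F =1 G -> block F i n = block G i n.
Proof. by move=> h; apply: eq_bigr => l _; rewrite h. Qed.

Lemma block_proj F i n : (i + n <= N)%N -> (forall k, cor rho (F k)) ->
  (forall k, proj (F k)) -> proj (block F i n).
Proof.
move=> inN cF pF; split.
  by rewrite /selfadjoint block_star; apply: eq_block => k; rewrite (pF k).1.
by rewrite block_mul_in //; apply: eq_block => k; rewrite (pF k).2.
Qed.

Lemma block_cat F i n k : block F i (n + k) = block F i n + block F (i + n) k.
Proof.
rewrite /block big_split_ord /=; congr (_ + _).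
by apply: eq_bigr => l _; rewrite addnA.
Qed.

Lemma block_cor Q F i n : (forall k, (k < N)%N -> cor Q (u k)) -> proj Q ->
  (i + n <= N)%N -> cor Q (block F i n).
Proof.
move=> cu hQ inN; split; rewrite /block ?mulr_sumr ?mulr_suml; apply: eq_bigr => l _.
  by rewrite !mulrA (cu _ _).1 // (leq_trans _ inN) // ltn_add2l.
by rewrite -!mulrA (cor_star hQ (cu _ _)).2 // (leq_trans _ inN) // ltn_add2l.
Qed.

End MatrixUnits.

(** * Series of commutators *)

Section CommutatorSeries.
Context {R : realType} {U : ucstarType R}.
Implicit Types (B x y : U).
Variable I : U -> Prop.
Hypothesis hI : star_ideal I.

Definition summable_in_span (d : nat -> U) :=
  exists2 l, nlim (fun n => \sum_(k < n) d k) l & span I l.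

Lemma summable_spanD (d e : nat -> U) : summable_in_span d -> summable_in_span e ->
  summable_in_span (fun k => d k + e k).
Proof.
move=> [l1 hl1 s1] [l2 hl2 s2]; exists (l1 + l2); last exact: spanD.
by apply: nlim_ext (nlimD hl1 hl2) => k; rewrite -big_split.
Qed.

(* By orthogonality the series of commutators is the commutator of the series. *)
Lemma summable_commutators B (A C x y : nat -> U) (c : R) : proj B -> I B ->
  (forall i j, i != j -> A i * A j = 0 /\ C i * C j = 0) ->
  (forall k, [/\ B * x k = 0, x k * B = x k, nrm (x k) <= c * 2^-1 ^+ k
    & nrm (y k) <= c * 2^-1 ^+ k]) ->
  (forall k, [/\ A k * x k = x k, x k * C k = x k, C k * y k = y k & y k * A k = y k]) ->
  summable_in_span (fun k => x k * y k - y k * x k).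
Proof.
move=> hB iB oAC hxy hac.
have h40 : 0 <= 2^-1 :> R by rewrite invr_ge0.
have h41 : 2^-1 < 1 :> R by rewrite invf_lt1 // ltr1n.
have c0 : 0 <= c.
  have [_ _ h _] := hxy 0%N; move: h; rewrite expr0 mulr1; apply: le_trans.
  exact: nrm_ge0.
have s1 n : \sum_(i < n) c * 2^-1 ^+ i <= c * (1 - 2^-1)^-1.
  by rewrite -mulr_sumr ler_wpM2l // sum_geo_le.
have [|X hX] := nsum_cvg (x := x) (c := fun k => c * 2^-1 ^+ k) _ s1; first by move=> k; case: (hxy k).
have [|Y hY] := nsum_cvg (x := y) (c := fun k => c * 2^-1 ^+ k) _ s1; first by move=> k; case: (hxy k).
have prod (w z : nat -> U) : (forall i j, i != j -> w i * z j = 0) -> forall n,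
    (\sum_(k < n) w k) * (\sum_(k < n) z k) = \sum_(k < n) w k * z k.
  move=> h; elim=> [|n IH]; first by rewrite !big_ord0 mul0r.
  rewrite !big_ord_recr /= mulrDl !mulrDr -IH -addrA; congr (_ + _).
  rewrite mulr_suml big1 => [|i _]; last by rewrite h // neq_ltn ltn_ord.
  rewrite mulr_sumr big1 => [|i _]; last by rewrite h // neq_ltn ltn_ord orbT.
  by rewrite !add0r.
have xy i j : i != j -> x i * y j = 0.
  move=> ij; have [_ <- _ _] := hac i; have [_ _ <- _] := hac j.
  by rewrite -mulrA (mulrA (C i)) (oAC _ _ ij).2 mul0r mulr0.
have yx i j : i != j -> y i * x j = 0.
  move=> ij; have [_ _ _ <-] := hac i; have [<- _ _ _] := hac j.
  by rewrite -mulrA (mulrA (A i)) (oAC _ _ ij).1 mul0r mulr0.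
exists (X * Y - Y * X).
  apply: nlim_ext (nlimB (nlimM hX hY) (nlimM hY hX)) => n.
  by rewrite !prod // sumrB.
(* X is off-diagonal for B, as all the x_k are, hence in the span; so are its commutators. *)
apply: (span_comm hI); apply: (@span_offdiag _ _ _ hI B) => //.
  apply: (nlim_uniq (nlimMl B hX)); apply: nlim_ext (nlim_cst 0) => n.
  by rewrite mulr_sumr big1 // => k _; case: (hxy k).
apply: (nlim_uniq (nlimMr B hX)); apply: nlim_ext hX => n.
by rewrite mulr_suml; apply: eq_bigr => k _; case: (hxy k).
Qed.

End CommutatorSeries.

(** * A chain of orthogonal projections of decreasing trace *)

Section Chain.
Context {R : realType} {U : ucstarType R}.
Implicit Types (p q r e f x y a b g c v w : U) (d h : R).
Hypothesis rr0 : @rank0 R U.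
Variable I : U -> Prop.
Hypothesis hI : star_ideal I.
Variable Q : U.
Hypothesis hQ : proj Q.
Variable m : nat.
Variable t : 'I_m -> U -> R.
Hypothesis ht : forall j, corner_trace Q (t j).
Hypothesis iQ : I Q.
Hypothesis hcmp : forall p q, proj p -> proj q -> cor Q p -> cor Q q ->
  (forall j, t j p < t j q) -> msub p q.
Hypothesis hgen : forall r, proj r -> I r -> r != 0 -> generates I r.
Hypothesis no_minimal : forall g, minimal g -> ~ cor Q g.

Lemma nrm_isom p v : proj p -> v^† * v = p -> nrm v <= 1.
Proof.
move=> hp vv; rewrite -(@ler_pXn2r _ 2) ?nnegrE ?nrm_ge0 //.
by rewrite expr1n -nrm_starM vv proj_nrm.
Qed.

Lemma uniform_pos n (f : 'I_n -> R) : (forall j, 0 < f j) ->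
  exists2 d, 0 < d & forall j, d <= f j.
Proof.
move=> f0; have S0 : 0 <= \sum_j (f j)^-1.
  by apply: sumr_ge0 => j _; rewrite invr_ge0 ltW.
have K0 := ltr_wpDl S0 (@ltr01 R); exists (\sum_j (f j)^-1 + 1)^-1; first by rewrite invr_gt0.
move=> j; rewrite -[leRHS]invrK lef_pV2 ?posrE ?invr_gt0 // (bigD1 j) //= -addrA lerDl.
by rewrite addr_ge0 // sumr_ge0 // => i _; rewrite invr_ge0 ltW.
Qed.

Lemma msub_cor p q v : proj p -> cor Q p -> cor Q q -> v^† * v = p -> q * v = v ->
  cor Q v.
Proof.
move=> hp cp cq vv qv; have vp := msub_pcor hp vv.
by split; [rewrite -qv mulrA cq.1 | rewrite -vp -mulrA cp.2].
Qed.

(** As long as the copies found so far leave room in every trace, comparison places one more under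
    their complement in Q. *)
Lemma copies rho n : proj rho -> cor Q rho ->
  (forall j, n%:R * t j rho < t j Q) ->
  exists u : nat -> U, [/\ u 0%N = rho, forall i, (i < n)%N -> cor Q (u i) &
   forall i j, (i < n)%N -> (j < n)%N -> (u i)^† * u j = if i == j then rho else 0].
Proof.
move=> hr cr; elim: n => [|n IH] hn; first by exists (fun=> rho); split.
have cQ : cor Q Q by exact: cor_id.
have [|u [u0 cu uu]] := IH.
  move=> j; apply: le_lt_trans (hn j); rewrite ler_wpM2r ?ler_nat //.
  exact: (trace_proj_ge0 hQ (ht j)).
case: (posnP n) => [n0|n0].
  exists (fun=> rho); split=> // i j; rewrite n0 !ltnS !leqn0 => /eqP -> /eqP -> /=.
  by rewrite hr.1 hr.2.
pose P : U := block u (fun=> rho) 0 n.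
have cF (k : nat) : cor rho rho by exact: cor_id.
have hP : proj P by exact: (block_proj uu).
have cP : cor Q P by apply: (@block_cor _ _ u n).
have tP j : t j P = n%:R * t j rho.
  rewrite /P /block (@trace_sum _ _ _ _ (ht j) n (fun i => u (0 + i)%N * rho * (u (0 + i)%N)^†)); last first.
    by move=> i i_n; apply: corM; [apply: corM => // | apply: cor_star => //]; exact: cu.
  rewrite (eq_bigr (fun=> t j rho)) ?sumr_const ?card_ord ?mulr_natl // => i _.
  have uiE : (u i)^† * u i = rho by rewrite uu // eqxx.
  have -> : u (0 + i)%N * rho = u i by rewrite add0n -uiE mulrA -mulrA uiE (copy_rho hr uu).
  by rewrite (trace_conj hQ (ht j) hr) //; exact: cu.
have [||v [vv qv]] := hcmp hr (proj_compl hP hQ cP.1) cr.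
- exact: corB.
- move=> j; rewrite (traceB (ht j)) // tP; have := hn j.
  by rewrite -addn1 natrD mulrDl mul1r; lra.
have cv := msub_cor hr cr (corB cQ cP) vv qv.
have uP i : (i < n)%N -> (u i)^† * P = (u i)^†.
  by move=> i_n; rewrite /P (u_block hr uu) //= add0n i_n (copy_rho_star hr uu).
have uv i : (i < n)%N -> (u i)^† * v = 0.
  move=> i_n; rewrite -uP // -qv -mulrA (mulrA P) mulrBr cP.2 hP.2.
  by rewrite subrr mul0r mulr0.
exists (fun i => if i == n then v else u i); split; first by rewrite eq_sym gtn_eqF.
  by move=> i; rewrite ltnS leq_eqVlt; case: eqP => //= _; exact: cu.
move=> i j; rewrite !ltnS (leq_eqVlt i) (leq_eqVlt j).
case: (eqVneq i n) => [->|i_n] /=; case: (eqVneq j n) => [->|j_n] //=.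
- by move=> _ jn; rewrite -[LHS]starK starM starK uv // star0.
- by move=> i_ltn _; rewrite (negbTE i_n) uv.
- exact: uu.
Qed.

(** r_{k+1} is equivalent to a piece g of r_k carrying between 0.45 and 0.55 of each trace. The rest
    r_k - g carries at most 0.55 and is halved again into pieces of at most 0.3025, which fit under
    r_{k+1}; thus three partial isometries carry r_k under r_{k+1}. *)
Lemma halving_chain rho : 'I_m -> proj rho -> cor Q rho -> rho != 0 ->
  exists (r : nat -> U) (v : nat -> nat -> U),
  [/\ forall k, [/\ proj (r k), cor rho (r k) & r k != 0],
      forall i j, i != j -> r i * r j = 0,
      forall k, \sum_(i < 3) (v k i)^† * v k i = r k
    & forall k i, r k.+1 * v k i = v k i /\ v k i * r k = v k i].
Proof.
move=> j0 hrho crho rho0; have sr := hrho.1.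
have tp p j : proj p -> cor Q p -> p != 0 -> 0 < t j p.
  exact: (trace_proj_pos hI hQ ht iQ hgen).
(* A quarter of [rho] suffices for the invariant below at the start, where it reads 3 t(r_0) <
   t(rho). *)
have [|d d0 hd] := @uniform_pos m (fun j => t j rho / 4).
  by move=> j; rewrite divr_gt0 // tp.
have [r0 [hr0 rr r00 tr0]] := small_proj hQ ht no_minimal hrho crho rho0 d0.
(* [s.1] is the current r_k and [s.2] the sum of r_0, ..., r_k. The inequality reserves room for all
   later terms; it persists because t(r_{k+1}) <= 0.55 t(r_k) and 3 * 0.55 < 2. *)
pose P (s : U * U) := [/\ proj s.1, proj s.2, rho * s.2 = s.2, s.2 * s.1 = s.1 &
  s.1 != 0 /\ forall j, t j s.2 + 2 * t j s.1 < t j rho].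
pose T (s s' : U * U) (w : nat -> U) := [/\ s.2 * s'.1 = 0, s'.2 * s.2 = s.2,
  \sum_(i < 3) (w i)^† * w i = s.1 & forall i, s'.1 * w i = w i /\ w i * s.1 = w i].
have step (n : nat) (s : U * U) : P s -> exists s', P s' /\ exists w : nat -> U, T s s' w.
  case: s => r s [/= hr hs rs sr' [rn0 ts]].
  have cs : cor Q s by apply: cor_proj => //; rewrite -rs mulrA crho.1.
  have cr : cor Q r by apply: cor_proj => //; rewrite -sr' mulrA cs.1.
  have d10 : 0 < 10^-1 :> R by rewrite invr_gt0.
  have trj j : 0 < t j r by exact: tp.
  have [g [hg rg tg]] := halve rr0 hI hQ ht iQ hgen no_minimal hr cr rn0 d10.
  have cg : cor Q g by apply: cor_proj => //; rewrite -rg mulrA cr.1.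
  have tg' j : 45 / 100 * t j r <= t j g <= 55 / 100 * t j r.
    by move: (tg j); rewrite ler_norml => /andP[h1 h2]; apply/andP; split; lra.
  have g0 : g != 0.
    apply: contraTneq (tg' j0) => ->; rewrite (trace0 (ht j0)) negb_and -!ltNge.
    by apply/orP; left; move: (trj j0) => ?; lra.
  have hrs : proj (rho - s) by exact: proj_compl.
  have [||v0 [vv qv]] := hcmp hg hrs cg; first exact: corB.
    by move=> j; rewrite (traceB (ht j)) //; move: (ts j) (tg' j) (trj j) => /= *; lra.
  have cv0 := msub_cor hg cg (corB crho cs) vv qv.
  have v0g := msub_pcor hg vv.
  pose r' : U := v0 * v0^†.
  have hr' : proj r'.
    split; first by rewrite /selfadjoint starM starK.
    by rewrite /r' mulrA -(mulrA v0) vv v0g.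
  have cr' : cor Q r' by apply: corM => //; exact: cor_star.
  have tr' j : t j r' = t j g by exact: (trace_conj hQ (ht j) hg).
  have sv : s * v0 = 0.
    by rewrite -qv mulrA mulrBr hs.2 (subproj_sym hs hrho rs) subrr mul0r.
  have sr0 : s * r' = 0 by rewrite mulrA sv mul0r.
  have rr' : rho * r' = r'.
    have -> : r' = (rho - s) * r' by rewrite mulrA qv.
    by rewrite !mulrA mulrBr hrho.2 rs.
  have r'0 : r' != 0.
    by apply: contraTneq (tp g j0 hg cg g0) => h; rewrite -tr' h (trace0 (ht j0)) ltxx.
  have r'v : r' * v0 = v0 by rewrite -mulrA vv v0g.
  have hrg : proj (r - g) by exact: proj_compl.
  have crg : cor Q (r - g) by exact: corB.
  have trg j : t j (r - g) = t j r - t j g by exact: (traceB (ht j)).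
  have rg0 : r - g != 0.
    apply/eqP => h; have := trg j0; rewrite h (trace0 (ht j0)).
    by move: (tg' j0) (trj j0) => *; lra.
  have [h1 [hh1 rh1 th1]] := halve rr0 hI hQ ht iQ hgen no_minimal hrg crg rg0 d10.
  have ch1 : cor Q h1 by apply: cor_proj => //; rewrite -rh1 mulrA crg.1.
  have hh2 : proj (r - g - h1) by exact: proj_compl.
  have ch2 : cor Q (r - g - h1) by exact: corB.
  have th1' j : t j h1 < t j r' /\ t j (r - g - h1) < t j r'.
    rewrite (traceB (ht j)) // trg tr'; move: (th1 j) (tg' j) (trj j).
    by rewrite trg ler_norml => /andP[? ?] /andP[? ?] ?; split; lra.
  have [v1 [v1v q1v]] := hcmp hh1 hr' ch1 cr' (fun j => (th1' j).1).
  have [v2 [v2v q2v]] := hcmp hh2 hr' ch2 cr' (fun j => (th1' j).2).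
  have rgr : (r - g) * r = r - g.
    by rewrite mulrBl hr.2 (subproj_sym hg hr rg).
  have h1r : h1 * r = h1.
    rewrite -(subproj_sym hh1 hrg rh1) -[LHS]mulrA rgr.
    by [].
  pose w i := nth 0 [:: v0; v1; v2] i.
  exists (r', s + r'); split; last first.
    exists w; split => //=.
    - by rewrite mulrDl hs.2 (proj_mulC0 hs hr' sr0) addr0.
    - by rewrite !big_ord_recr big_ord0 /= add0r vv v1v v2v; nring.
    - case=> [|[|[|i]]]; rewrite /w /= ?nth_nil ?mulr0 ?mul0r //; split => //.
      + by rewrite -v0g -mulrA (subproj_sym hg hr rg).
      + by rewrite -(msub_pcor hh1 v1v) -mulrA h1r.
      + by rewrite -(msub_pcor hh2 v2v) -mulrA mulrBl rgr h1r.
  split => //=.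
  - exact: projD.
  - by rewrite mulrDr rs rr'.
  - by rewrite mulrDl sr0 hr'.2 add0r.
  - split=> // j; rewrite (traceD (ht j)) // tr'.
    by move: (ts j) (tg' j) (trj j) => /= *; lra.
have cr0 : cor Q r0 by apply: cor_proj => //; rewrite -rr mulrA crho.1.
have P0 : P (r0, r0).
  split => //=; first exact: hr0.2.
  split=> // j; move: (tr0 j) (hd j) (tp _ j hrho crho rho0) => *; lra.
have [S [S0 hS]] := dependent_sequence P0 step.
have [v hv] := choice (fun k => (hS k).2).
have rS k i : (i <= k)%N -> (S k).2 * (S i).1 = (S i).1.
  elim: k => [|k IH].
    by rewrite leqn0 => /eqP ->; case: (hS 0%N) => [[]].
  rewrite leq_eqVlt => /predU1P[->|]; first by case: (hS k.+1) => [[]].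
  by rewrite ltnS => /IH h; rewrite -h mulrA; have [_ -> _ _] := hv k.
have pr k : proj (S k).1 by case: (hS k) => [[]].
have ps k : proj (S k).2 by case: (hS k) => [[]].
have orth i j : (i < j)%N -> (S i).1 * (S j).1 = 0.
  case: j => // j; rewrite ltnS => /rS h.
  by rewrite -(subproj_sym (pr i) (ps j) h) -mulrA; have [-> _ _ _] := hv j; rewrite mulr0.
exists (fun k => (S k).1), v; split.
- move=> k; have [[h1 h2 h3 h4 [h5 _]] _] := hS k; split=> //.
  by apply: cor_proj => //; rewrite -h4 mulrA h3.
- move=> i j; rewrite neq_ltn => /orP[|] h; first exact: orth.
  by apply: proj_mulC0 => //; exact: orth.
- by move=> k; have [_ _ -> _] := hv k.
- by move=> k i; have [_ _ _ h] := hv k; exact: h.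
Qed.

End Chain.

(** * Finite sums of commutators with prescribed supports *)

Section CommutatorSums.
Context {R : realType} {U : ucstarType R}.
Implicit Types (p q r e f x y a b g c v w B S : U) (d h k : R).

(** B makes x off-diagonal and is to be the same at all stages; S and C are the supports, which vary
    with the stage and make products of factors from different stages vanish. *)
Definition offdiag_pair B S C k x y :=
  [/\ B * x = 0, x * B = x, nrm x <= k & nrm y <= k] /\
  [/\ S * x = x, x * C = x, C * y = y & y * S = y].

(* [L] lists the corner projection of each commutator, flagged if the right *)
(* support of its first factor lies under [r] rather than under [S]. *)
Fixpoint commutator_sum (L : seq (U * bool)) S r k a := match L with
  | [::] => a = 0
  | l :: L' => exists x y, offdiag_pair l.1 S (if l.2 then r else S) k x y /\
      commutator_sum L' S r k (a - (x * y - y * x))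
  end.

Lemma commutator_sum_cat L1 L2 S r k a b : commutator_sum L1 S r k a ->
  commutator_sum L2 S r k b -> commutator_sum (L1 ++ L2) S r k (a + b).
Proof.
elim: L1 a => [|l L IH] a /=; first by move=> -> ; rewrite add0r.
move=> [x [y [hxy ha]]] hb; exists x, y; split=> //.
by rewrite addrAC; exact: IH.
Qed.

Lemma commutator_sum1 B fl S r k x y :
  offdiag_pair B S (if fl then r else S) k x y ->
  commutator_sum [:: (B, fl)] S r k (x * y - y * x).
Proof. by move=> h; exists x, y; split=> //=; rewrite subrr. Qed.

Lemma commutator_sum_nat n (B x y : nat -> U) fl S r k :
  (forall i, (i < n)%N -> offdiag_pair (B i) S (if fl then r else S) k (x i) (y i)) ->
  commutator_sum (mkseq (fun i => (B i, fl)) n) S r k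
    (\sum_(i < n) (x i * y i - y i * x i)).
Proof.
elim: n => [|n IH] h; first by rewrite big_ord0.
rewrite mkseqS -cats1 big_ord_recr /=; apply: commutator_sum_cat.
  by apply: IH => i i_n; apply: h; exact: ltnW.
by apply: commutator_sum1; exact: h.
Qed.

(** As [L] does not depend on the stage, the first commutators of all stages form one series, to
    which [summable_commutators] applies; the rest follows by induction on [L]. *)
Lemma commutator_sum_summable (I : U -> Prop) (L : seq (U * bool)) (S r a : nat -> U) k :
  star_ideal I -> (forall l, l \in L -> proj l.1 /\ I l.1) ->
  (forall i j, i != j -> S i * S j = 0) -> (forall i j, i != j -> r i * r j = 0) ->
  (forall n, commutator_sum L (S n) (r n) (k * 2^-1 ^+ n) (a n)) ->
  summable_in_span I a.
Proof.
move=> hI; elim: L a => [|l L IH] a hL hS hr ha /=.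
  exists 0; last exact: span0.
  by apply: nlim_ext (nlim_cst 0) => n; rewrite big1 // => i _; exact: ha.
have hxy' n : exists xy : U * U,
    offdiag_pair l.1 (S n) (if l.2 then r n else S n) (k * 2^-1 ^+ n) xy.1 xy.2 /\
    commutator_sum L (S n) (r n) (k * 2^-1 ^+ n) (a n - (xy.1 * xy.2 - xy.2 * xy.1)).
  by have [x [y h]] := ha n; exists (x, y).
have [xy hxy] := choice hxy'.
have [hB iB] := hL l (mem_head _ _).
have h1 : summable_in_span I
    (fun n => (xy n).1 * (xy n).2 - (xy n).2 * (xy n).1).
  apply: (@summable_commutators _ _ I hI l.1 S (fun n => if l.2 then r n else S n) _ _ k) => //.
  - by move=> i j ij; split; [exact: hS | case: (l.2); [exact: hr | exact: hS]].
  - by move=> n; case: (hxy n) => [[]].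
  - by move=> n; case: (hxy n) => [[]].
have h2 := IH _ (fun l' hl' => hL l' (mem_behead (s := l :: L) hl')) hS hr (fun n => (hxy n).2).
have := summable_spanD h2 h1; congr summable_in_span; apply/funext => n.
by rewrite subrK.
Qed.

Lemma nrm_scale_le (s k : R) x : `|s| <= k -> nrm x <= 1 -> nrm (s%:C *: x) <= k.
Proof.
move=> sk nx; rewrite nrmZ rnormC (le_trans _ sk) //.
by rewrite -[leRHS]mulr1 ler_wpM2l.
Qed.

Lemma nrm_conj_le x y z k : nrm x <= 1 -> nrm y <= 1 -> nrm z <= k -> nrm (x * z * y) <= k.
Proof.
move=> nx ny nz; have k0 := le_trans (nrm_ge0 z) nz.
apply: le_trans (nrmM _ _) _; rewrite -[leRHS]mulr1 ler_pM ?nrm_ge0 //.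
by apply: le_trans (nrmM _ _) _; rewrite -[leRHS]mul1r ler_pM ?nrm_ge0.
Qed.

Lemma offdiag_isom B S E G V (s1 s2 k : R) : proj B -> proj S -> proj E -> proj G ->
  V^† * V = E -> G * V = V -> S * E = E -> S * G = G -> B * E = 0 -> B * G = G ->
  `|s1| <= k -> `|s2| <= k -> offdiag_pair B S S k (s1%:C *: V^†) (s2%:C *: V).
Proof.
move=> hB hS hE hG VV GV SE SG BE BG s1k s2k.
have VE := msub_pcor hE VV; have EV : E * V^† = V^† by rewrite -[in LHS]hE.1 -starM VE.
have nV := nrm_isom hE VV.
have BV : B * V = V by rewrite -GV mulrA BG.
have SV : S * V = V by rewrite -GV mulrA SG.
split; split; rewrite -?scalerAl -?scalerAr.
- by rewrite -EV mulrA BE mul0r scaler0.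
- by rewrite (star_absorb hB BV).
- by apply: nrm_scale_le => //; rewrite nrm_star.
- exact: nrm_scale_le.
- by rewrite -EV mulrA SE.
- by rewrite (star_absorb hS SV).
- by rewrite SV.
- by rewrite -VE -mulrA (subproj_sym hE hS SE).
Qed.

End CommutatorSums.

(** * One halving step for an element of trace zero *)

Section Step.
Context {R : realType} {U : ucstarType R}.
Implicit Types (p q r e f x y a b g c w B S : U) (d h k : R).
Hypothesis rr0 : @rank0 R U.
Variable Q : U.
Hypothesis hQ : proj Q.
Variable m : nat.
Variable t : 'I_m -> U -> R.
Hypothesis ht : forall j, corner_trace Q (t j).
Hypothesis hcmp : forall p q, proj p -> proj q -> cor Q p -> cor Q q ->
  (forall j, t j p < t j q) -> msub p q.
Variables (M : nat) (rho : U) (u : nat -> U).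
Hypothesis hM : 480 <= M%:R :> R.
(** The layout of the N copies: position 0 is [rho] itself; then 2 M positions for spectral
    projections, M for multiples of r, 3 for the slack in the first comparison, 6 for the target of
    the second comparison, and one, at p4, for the approximation error. *)
Let p1 := (1 + (M + M))%N.
Let p2 := (p1 + M)%N.
Let p3 := (p2 + 3)%N.
Let p4 := (p3 + 6)%N.
Let N := (p4 + 1)%N.
Hypothesis hrho : proj rho.
Hypothesis crho : cor Q rho.
Hypothesis u0 : u 0%N = rho.
Hypothesis cu : forall i, (i < N)%N -> cor Q (u i).
Hypothesis uu : forall i j, (i < N)%N -> (j < N)%N ->
  (u i)^† * u j = if i == j then rho else 0.

Let crr (k : nat) : cor rho rho. Proof. exact: cor_id. Qed.
Let corQ x : cor rho x -> cor Q x.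
Proof. by case: crho; exact: cor_le. Qed.

Lemma trace_block j F i n : (i + n <= N)%N -> (forall l, cor rho (F l)) ->
  t j (block u F i n) = \sum_(l < n) t j (F (i + l)%N).
Proof.
move=> inN cF; have lN (l : nat) : (l < n)%N -> (i + l < N)%N.
  by move=> ln; rewrite (leq_trans _ inN) // ltn_add2l.
rewrite /block (@trace_sum _ _ _ _ (ht j) n (fun l => u (i + l)%N * F (i + l)%N * (u (i + l)%N)^†)); last first.
  move=> l /lN h; apply: corM; last by apply: cor_star => //; exact: cu.
  by apply: corM; [exact: cu | exact: corQ].
apply: eq_bigr => l _; have h := lN _ (ltn_ord l).
rewrite (traceC (ht j)) //; last first.
- by apply: cor_star => //; exact: cu.
- by apply: corM; [exact: cu | exact: corQ].
by rewrite mulrA uu // eqxx (cF _).1.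
Qed.

Lemma nrm_u l : (l < N)%N -> nrm (u l) <= 1.
Proof. by move=> lN; apply: (nrm_isom hrho); rewrite uu // eqxx. Qed.

Lemma rho_u l : (0 < l < N)%N -> rho * u l = 0.
Proof. by move=> /andP[l0 lN]; rewrite -hrho.1 -u0 uu // eq_sym gtn_eqF. Qed.

Lemma block_u_r r l i n : (i + n <= N)%N -> (i <= l < i + n)%N -> cor rho r ->
  block u (fun=> r) i n * u l = u l * r.
Proof.
move=> inN il cr; rewrite (block_u uu) ?il //.
by case/andP: il => _ h; exact: leq_trans h inN.
Qed.
Lemma u_block_r r l i n : (i + n <= N)%N -> (i <= l < i + n)%N -> cor rho r ->
  (u l)^† * block u (fun=> r) i n = r * (u l)^†.
Proof.
move=> inN il cr; rewrite (u_block hrho uu) ?il //.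
by case/andP: il => _ h; exact: leq_trans h inN.
Qed.

Lemma block_absorb r i n : (0 < n)%N -> i = 0%N -> (i + n <= N)%N -> cor rho r -> proj r ->
  block u (fun=> r) i n * r = r.
Proof.
move=> n0 -> nN cr hr; rewrite -[X in _ * X]cr.1 mulrA -{1}u0.
by rewrite block_u_r // u0 cr.1 hr.2.
Qed.

Variables (r r' : U) (v : nat -> U).
Hypothesis hr : proj r.
Hypothesis cr : cor rho r.
Hypothesis tr : forall j, 0 < t j r.
Hypothesis hr' : proj r'.
Hypothesis cr' : cor rho r'.
Hypothesis vv : \sum_(i < 3) (v i)^† * v i = r.
Hypothesis hv : forall i, r' * v i = v i /\ v i * r = v i.

Let S := block u (fun=> r) 0 N.
Let cF (k : nat) : cor rho r. Proof. exact: cr. Qed.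
Let pF (k : nat) : proj r. Proof. exact: hr. Qed.
Let hS : proj S. Proof. by apply: (block_proj uu). Qed.
Let Su l : (l < N)%N -> S * u l = u l * r.
Proof. by move=> lN; apply: block_u_r. Qed.
Let uS l : (l < N)%N -> (u l)^† * S = r * (u l)^†.
Proof. by move=> lN; apply: u_block_r. Qed.
Let Sr : S * r = r.
Proof. by apply: block_absorb. Qed.
Let rS : r * S = r.
Proof. by rewrite (subproj_sym hr hS Sr). Qed.

(** One commutator transports b from position 0 to position l. It is off-diagonal for the range of
    the l-th copy, and s1, s2 share out the norm between the factors. *)
Lemma copy_pair b (s1 s2 k : R) l : (0 < l < N)%N -> cor r b ->
  nrm (s1%:C *: b) <= k -> `|s2| <= k ->
  offdiag_pair (u l * (u l)^†) S S k (s1%:C *: (b * (u l)^†)) (s2%:C *: (u l * r)) /\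
  (s1%:C *: (b * (u l)^†)) * (s2%:C *: (u l * r)) -
  (s2%:C *: (u l * r)) * (s1%:C *: (b * (u l)^†)) =
  (s1 * s2)%:C *: (b - u l * b * (u l)^†).
Proof.
move=> /andP[l0 lN] [rb br] nb s2k; have h0 := rho_u (introT andP (conj l0 lN)).
have ub : (u l)^† * b = 0.
  by rewrite -rb -cr.1 !mulrA -[(u l)^† * rho]starK starM starK hrho.1 h0 star0 !mul0r.
have uul : (u l)^† * u l = rho by rewrite uu // eqxx.
have nr : nrm (u l * r) <= 1.
  by apply: le_trans (nrmM _ _) _; rewrite mulr_ile1 ?nrm_ge0 ?nrm_u ?proj_nrm.
have bub : b * ((u l)^† * u l) = b by rewrite uul -br -mulrA cr.2.
split; last first.
  rewrite rmorphM -!scalerAl -!scalerAr !scalerA [s2%:C * _]mulrC -scalerBr; congr (_ *: (_ - _)); last first.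
    by rewrite -!mulrA (mulrA r) rb.
  by rewrite -mulrA (mulrA _ (u l)) mulrA bub br.
split; split; rewrite -?scalerAl -?scalerAr.
- by rewrite mulrA -(mulrA (u l)) ub mulr0 mul0r scaler0.
- have -> // : b * (u l)^† * (u l * (u l)^†) = b * (u l)^†.
  by rewrite mulrA -(mulrA b) bub.
- rewrite scalerAl; apply: le_trans (nrmM _ _) _; rewrite nrm_star -[leRHS]mulr1.
  by rewrite ler_pM ?nrm_ge0 ?nrm_u.
- exact: nrm_scale_le.
- by rewrite -rb !mulrA Sr.
- by rewrite -mulrA uS // mulrA br.
- by rewrite mulrA Su // -mulrA hr.2.
- by rewrite -mulrA rS.
Qed.

(** One commutator exchanges z^† z X for z X z^†, which lies in the corner of r'. The scale s splits
    the norm of X, of order d^2, evenly between the two factors. *)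
Lemma matrix_pair (X : U) (s k : R) i l : (i < 3)%N -> 0 < s -> (0 < l < N)%N -> S * X = X -> X * S = X ->
  s <= k -> s^-1 * nrm X <= k ->
  let z := v i * (u l)^† in
  offdiag_pair rho S r' k (s%:C *: z^†) (s^-1%:C *: (z * X)) /\
  (s%:C *: z^†) * (s^-1%:C *: (z * X)) - (s^-1%:C *: (z * X)) * (s%:C *: z^†) =
  z^† * z * X - z * X * z^†.
Proof.
move=> i3 s0 /andP[l0 lN] SX XS sk Xk z; have h0 := rho_u (introT andP (conj l0 lN)).
have [r'v vr] := hv i.
have nv : nrm (v i) <= 1.
  rewrite -(@ler_pXn2r _ 2) ?nnegrE ?nrm_ge0 // expr1n -nrm_starM.
  apply: le_trans (proj_nrm hr); apply: nrm_mono; first exact: pos_starM.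
  rewrite -vv (bigD1 (Ordinal i3)) //= addrC; apply: eq_pos (addrK _ _) _.
  by apply: pos_sum => j _; exact: pos_starM.
have nz : nrm z <= 1.
  by apply: le_trans (nrmM _ _) _; rewrite nrm_star mulr_ile1 ?nrm_ge0 ?nrm_u.
have ss : s%:C * s^-1%:C = 1 :> R[i] by rewrite -rmorphM divff ?gt_eqF.
have vrho : rho * v i = v i by rewrite -r'v mulrA cr'.1.
have zE : z^† = u l * (v i)^† by rewrite starM starK.
split; last first.
  by rewrite -!scalerAl -!scalerAr !scalerA [s^-1%:C * _]mulrC ss !scale1r mulrA.
split; split; rewrite -?scalerAl -?scalerAr.
- by rewrite zE mulrA h0 mul0r scaler0.
- by rewrite zE -mulrA (star_absorb hrho vrho).
- by apply: nrm_scale_le; rewrite ?nrm_star // gtr0_norm.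
- rewrite nrmZ rnormC gtr0_norm ?invr_gt0 // (le_trans _ Xk) //.
  rewrite ler_wpM2l ?invr_ge0 ?(ltW s0) //.
  apply: le_trans (nrmM _ _) _; rewrite -[leRHS]mul1r.
  by rewrite ler_wpM2r ?nrm_ge0.
- rewrite zE mulrA Su // -mulrA; congr (_ *: (_ * _)).
  by rewrite -[LHS](congr1 (fun w => w * _) hr.1) -starM vr.
- by rewrite zE -mulrA (star_absorb hr' r'v).
- by rewrite !mulrA r'v.
- by rewrite -mulrA XS.
Qed.

Lemma copy_sum F (s d k : R) i n : (0 < i)%N -> (i + n <= N)%N -> (forall l, cor r (F l)) ->
  (forall l, nrm (s%:C *: F l) <= k) -> `|d| <= k ->
  commutator_sum (mkseq (fun l => (u (i + l)%N * (u (i + l)%N)^†, false)) n) S r' k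
    (\sum_(l < n) (s * d)%:C *: (F (i + l)%N - u (i + l)%N * F (i + l)%N * (u (i + l)%N)^†)).
Proof.
move=> i0 inN cFr nF dk.
have lN (l : nat) : (l < n)%N -> (0 < i + l < N)%N.
  by move=> ln; rewrite ltn_addr // (leq_trans _ inN) // ltn_add2l.
have cp (l : nat) (ln : (l < n)%N) :=
  @copy_pair (F (i + l)%N) s d k (i + l)%N (lN l ln) (cFr (i + l)%N) (nF (i + l)%N) dk.
rewrite (eq_bigr (fun l : 'I_n => (s%:C *: (F (i + l)%N * (u (i + l)%N)^†)) * (d%:C *: (u (i + l)%N * r)) -
  (d%:C *: (u (i + l)%N * r)) * (s%:C *: (F (i + l)%N * (u (i + l)%N)^†)))); last first.
  by move=> l _; rewrite (cp l (ltn_ord l)).2.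
apply: (@commutator_sum_nat _ _ n (fun l => u (i + l)%N * (u (i + l)%N)^†)
  (fun l => s%:C *: (F (i + l)%N * (u (i + l)%N)^†)) (fun l => d%:C *: (u (i + l)%N * r))) => l ln.
exact: (cp l ln).1.
Qed.

Lemma isom_commutator (s d : R) (V E : U) : V^† * V = E ->
  (s%:C *: V^†) * (d%:C *: V) - (d%:C *: V) * (s%:C *: V^†) = (s * d)%:C *: (E - V * V^†).
Proof.
move=> <-; rewrite rmorphM -!scalerAl -!scalerAr !scalerA [d%:C * _]mulrC.
by rewrite scalerBr.
Qed.

(** One entry per commutator of [trace_step], in the order used there. The list depends on [rho] and
    its copies only, not on r, so it serves every stage. *)
Definition step_corners : seq (U * bool) :=
  [:: (u p4 * (u p4)^†, false)] ++
  (mkseq (fun l => (u (1 + l)%N * (u (1 + l)%N)^†, false)) (M + M) ++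
  (mkseq (fun l => (u (p1 + l)%N * (u (p1 + l)%N)^†, false)) M ++
  ([:: (block u (fun=> rho) p1 (M + 3), false)] ++
  ([:: (block u (fun=> rho) p3 6, false)] ++
  (mkseq (fun=> (rho, true)) 10 ++ (mkseq (fun=> (rho, true)) 10 ++
  mkseq (fun=> (rho, true)) 10)))))).

(** Up to an error b of norm 2 h, a is h (sum e_l - M r). As a has trace zero, the traces of sum e_l
    and of M r differ by at most 2 t(r); so the copies E of the e_l go under M + 3 copies of r, and
    the complement P of their image, of trace at most 5 t(r), goes under 6 further copies. What
    remains is the copy of b plus h times a difference of two projections, an element X of norm at
    most 4 h on ten copies of r, which the v_i move into the corner of r'. *)
Lemma trace_step a d : cor r a -> selfadjoint a -> (forall j, t j a = 0) -> 0 < d ->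
  nrm a <= d ^+ 2 ->
  exists a', [/\ cor r' a', selfadjoint a', forall j, t j a' = 0 & nrm a' <= (d / 2) ^+ 2] /\
    commutator_sum step_corners S r' (2 * d) (a - a').
Proof.
move=> ca sa_a ta d0 na.
have M0 : 0 < M%:R :> R by rewrite (lt_le_trans _ hM) // ltr0n.
have M1 : 1 <= M%:R :> R by apply: le_trans hM; rewrite ler1n.
have e0 : 0 < d ^+ 2 by rewrite exprn_gt0.
(* The mesh for which 2 M steps cover the interval from - d^2 to d^2. The new remainder is a sum of
   30 terms of norm at most 4 h, and 120 h <= (d / 2)^2 is where 480 comes from. *)
pose h := d ^+ 2 / M%:R.
have h0 : 0 < h by rewrite divr_gt0.
have hME : h * M%:R = d ^+ 2 by rewrite /h divfK // gt_eqF.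
have hh : h <= d ^+ 2 / 480.
  have M480 : 0 < 480 :> R by rewrite ltr0n.
  by rewrite /h ler_pM2l // lef_pV2.
have hd : h = d / M%:R * d by rewrite /h expr2; ring.
have dM : d / M%:R <= d by rewrite ler_pdivrMr // ler_peMr // ltW.
have dM0 : 0 < d / M%:R by rewrite divr_gt0.
have dM2 : 0 <= d by exact: ltW.
have lo : (- d ^+ 2)%:C *: r ⊑ a.
  have := cor_ule hr (corN ca) (saN sa_a) (_ : nrm (- a) <= d ^+ 2).
  by rewrite nrmN na => /(_ isT); apply: eq_pos; nring.
have up : a ⊑ (- d ^+ 2 + (M + M)%:R * h)%:C *: r.
  rewrite natrD mulrDl ![_ * h]mulrC hME addrA addNr add0r.
  exact: cor_ule hr ca sa_a na.
have [e1 [he1 ne1]] := finite_spectrum rr0 hr ca sa_a h0 h0 lo up.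
pose e (l : nat) := e1 l.-1.
have he l : proj (e l) /\ cor r (e l) by exact: he1.
have ce l : cor rho (e l) by case: cr => h1 h2; apply: (cor_le h1 h2); case: (he l).
have cQr := corQ cr.
have rQ : cor Q r := cQr.
pose Se : U := \sum_(l < M + M) e (1 + l)%N.
have SeE : Se = \sum_(l < M + M) e1 l by apply: eq_bigr.
pose b : U := a - ((- d ^+ 2)%:C *: r + h%:C *: Se).
have nb : nrm b <= h + h by rewrite /b SeE.
have cSe : cor r Se by rewrite /Se; apply: (@cor_sum _ _ _ _ (fun l => e (1 + l)%N)) => l _; case: (he (1 + l)%N).
have cb : cor r b.
  by apply: corB => //; apply: corD; apply: corZ => //; exact: cor_id.
have sSe : selfadjoint Se.
  by rewrite /selfadjoint star_sum; apply: eq_bigr => l _; case: (he (1 + l)%N) => [[]].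
have sb : selfadjoint b by apply: saB => //; apply: saD; apply: saZ => //; case: hr.
have corr x : cor r x -> cor Q x by move=> [h1 h2]; apply: (cor_le rQ.1 rQ.2).
have tb j : t j b = h * (M%:R * t j r - t j Se).
  rewrite /b (traceB (ht j)) ?ta; [|exact: corr|apply: corD; apply: corZ; [exact: rQ | exact: corr]].
  rewrite (traceD (ht j)) ?(traceZ (ht j)); [|exact: corr|exact: rQ|apply: corZ; exact: rQ|apply: corZ; exact: corr].
  by rewrite -hME; ring.
have tSe j : `|M%:R * t j r - t j Se| <= 2 * t j r.
  have := trace_nrm hQ (ht j) hr rQ cb sb nb; rewrite tb normrM gtr0_norm // => H.
  by rewrite -(ler_pM2l h0) (le_trans H) // mulrDl; lra.
pose E := block u e 1 (M + M).
pose NM := block u (fun=> r) p1 M.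
pose DD := block u (fun=> r) p2 3.
pose NN := block u (fun=> r) p1 (M + 3).
pose FF := block u (fun=> r) p3 6.
have NNE : NN = NM + DD by exact: block_cat.
have n1 : (1 + (M + M) <= N)%N by rewrite /N /p4 /p3 /p2 /p1 -!addnA leq_add2l !leq_add2l leq_addr.
have n2 : (p1 + (M + 3) <= N)%N by rewrite /N /p4 /p3 /p2 -!addnA !leq_add2l.
have n2' : (p1 + M <= N)%N by rewrite (leq_trans _ n2) // leq_add2l leq_addr.
have n3 : (p2 + 3 <= N)%N by rewrite /p2 -addnA.
have n4 : (p3 + 6 <= N)%N by rewrite /N leq_addr.
have n5 : (p2 + 10 <= N)%N by rewrite /N /p4 /p3 -!addnA leq_add2l.
have p40 : (0 < p4 < N)%N by rewrite /N addn1 ltnS leqnn /p4 addnS.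
have hE : proj E by apply: (block_proj uu) => // l; case: (he l).
have hNN : proj NN by apply: (block_proj uu).
have hDD : proj DD by apply: (block_proj uu).
have hFF : proj FF by apply: (block_proj uu).
have cE : cor Q E by apply: (block_cor _ cu).
have cNN : cor Q NN by apply: (block_cor _ cu).
have cFF : cor Q FF by apply: (block_cor _ cu).
have cDD : cor Q DD by apply: (block_cor _ cu).
have tE j : t j E = t j Se.
  rewrite trace_block // /Se (@trace_sum _ _ _ _ (ht j) _ (fun l => e (1 + l)%N)) // => l _.
  by apply: corQ.
have tNN j : t j NN = M%:R * t j r + 3 * t j r.
  by rewrite trace_block // sumr_const card_ord mulrnDr -!(mulr_natl (t j r)).
have tDD j : t j DD = 3 * t j r.
  by rewrite trace_block // sumr_const card_ord -(mulr_natl (t j r)).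
have tFF j : t j FF = 6 * t j r.
  by rewrite trace_block // sumr_const card_ord -(mulr_natl (t j r)).
(* t(E) <= (M + 2) t(r) < (M + 3) t(r) = t(NN). *)
have [|V [VV NV]] := hcmp hE hNN cE cNN.
  by move=> j; rewrite tE tNN; move: (tSe j) (tr j); rewrite ler_norml => /andP[? ?] ?; lra.
have cV := msub_cor hE cE cNN VV NV.
have VE := msub_pcor hE VV.
have cVs := cor_star hQ cV.
pose P := NN - V * V^†.
have hVV : proj (V * V^†).
  split; first by rewrite /selfadjoint starM starK.
  by rewrite mulrA -(mulrA V) VV VE.
have hP : proj P by apply: proj_compl => //; rewrite mulrA NV.
have cP : cor Q P by apply: corB => //; exact: corM.
have tP j : t j P = t j NN - t j E.
  rewrite (traceB (ht j)) //; last exact: corM.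
  by rewrite (trace_conj hQ (ht j) hE).
(* t(P) = t(NN) - t(E) <= 5 t(r) < 6 t(r) = t(FF). *)
have [|W [WW FW]] := hcmp hP hFF cP cFF.
  by move=> j; rewrite tP tE tNN tFF; move: (tSe j) (tr j); rewrite ler_norml => /andP[? ?] ?; lra.
have cW := msub_cor hP cP cFF WW FW.
have WP := msub_pcor hP WW.
have hWW : proj (W * W^†).
  split; first by rewrite /selfadjoint starM starK.
  by rewrite mulrA -(mulrA W) WW WP.
pose ub := u p4 * b * (u p4)^†.
(* What is left of a once E is matched with V V^† inside NN and P with W W^†; DD is the part of NN
   in excess of the M copies of r. *)
pose X : U := ub + h%:C *: (DD - W * W^†).
have cub : cor Q ub.
  have c4 := cu (andP p40).2.
  by apply: corM; [apply: corM => //; exact: corr | exact: cor_star].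
have cWW : cor Q (W * W^†) by apply: corM => //; exact: cor_star.
have cX : cor Q X by apply: corD => //; apply: corZ; exact: corB.
have sX : selfadjoint X.
  apply: saD; first by rewrite /selfadjoint !starM starK sb mulrA.
  by apply: saZ => //; apply: saB; [case: hDD | case: hWW].
have nX : nrm X <= 4 * h.
  apply: le_trans (nrmD _ _) _; rewrite (_ : 4 * h = (h + h) + (h * 2)); last by lra.
  rewrite lerD //; first by apply: nrm_conj_le; rewrite ?nrm_star ?nrm_u //; case/andP: p40.
  rewrite nrmZr ?(ltW h0) // ler_wpM2l ?(ltW h0) //.
  apply: le_trans (nrmB _ _) _; have := proj_nrm hDD; have := proj_nrm hWW.
  by move=> *; lra.
have tub j : t j ub = t j b.
  have c4 := cu (andP p40).2.
  rewrite /ub (traceC (ht j)); [|by apply: corM => //; exact: corr|exact: cor_star].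
  rewrite mulrA uu ?eqxx; [|by case/andP: p40|by case/andP: p40].
  by case: cr cb => h1 h2 [h3 _]; rewrite -h3 mulrA h1.
have tX j : t j X = 0.
  rewrite (traceD (ht j)) // ?(traceZ (ht j)); [|exact: corB|by apply: corZ; exact: corB].
  rewrite (traceB (ht j)) // tub tb tDD (trace_conj hQ (ht j) hP) // tP tE tNN; lra.
(* The window of 3 + 6 + 1 positions that supports X. *)
pose G := block u (fun=> r) p2 10.
have hG : proj G by apply: (block_proj uu).
have crl (l : nat) : cor r r by exact: cor_id.
have sub3 i n F : (p2 <= i)%N -> (i + n <= p2 + 10)%N -> (forall l, cor r (F l)) ->
    G * block u F i n = block u F i n.
  move=> h1 h2 cFr; rewrite (block_mul_in uu) //; apply: eq_block => l.
  by case: (cFr l).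
have Gu : G * u p4 = u p4 * r.
  by apply: block_u_r => //; rewrite /p4 /p3 -addnA leq_addr ltn_add2l.
have GDD : G * DD = DD by apply: sub3 => //; rewrite leq_add2l.
have GFF : G * FF = FF by apply: sub3 => //; rewrite /p3 ?leq_addr // -addnA leq_add2l.
have GW : G * W = W by rewrite -{1}FW mulrA GFF FW.
have GX : G * X = X.
  rewrite /X mulrDr -scalerAr mulrBr GDD (mulrA G W) GW /ub !mulrA Gu.
  by rewrite -(mulrA (u p4) r b) cb.1.
have XG : X * G = X by rewrite -{1}sX -[X in _ * X]hG.1 -starM GX.
have SB F i n : (i + n <= N)%N -> (forall l, cor r (F l)) -> S * block u F i n = block u F i n.
  move=> h1 cFr; rewrite (block_mul_in uu) //; apply: eq_block => l.
  by case: (cFr l).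
have SG : S * G = G by exact: SB.
have SX : S * X = X by rewrite -GX mulrA SG.
have XS : X * S = X by rewrite -{1}sX -[X in _ * X]hS.1 -starM SX.
have [z zE] : exists z : nat -> nat -> U, forall i l, z i l = v i * (u (p2 + l)%N)^†.
  by exists (fun i l => v i * (u (p2 + l)%N)^†).
pose Z i : U := \sum_(l < 10) z i l * X * (z i l)^†.
pose a' : U := \sum_(i < 3) Z i.
have lk (l : nat) : (l < 10)%N -> (0 < p2 + l < N)%N.
  by move=> l10; rewrite (leq_trans _ n5) ?ltn_add2l // andbT /p2 /p1 -!addnA.
have cv i : cor Q (v i).
  have c1 := corQ cr'; have [h1 h2] := hv i.
  by split; [rewrite -h1 mulrA c1.1 | rewrite -h2 -mulrA rQ.2].
have nv i : (i < 3)%N -> nrm (v i) <= 1.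
  move=> i3; rewrite -(@ler_pXn2r _ 2) ?nnegrE ?nrm_ge0 // expr1n -nrm_starM.
  apply: le_trans (proj_nrm hr); apply: nrm_mono; first exact: pos_starM.
  rewrite -vv (bigD1 (Ordinal i3)) //= addrC; apply: eq_pos (addrK _ _) _.
  by apply: pos_sum => j _; exact: pos_starM.
have nz i l : (i < 3)%N -> (l < 10)%N -> nrm (z i l) <= 1.
  move=> i3 l10; rewrite zE; apply: le_trans (nrmM _ _) _; rewrite nrm_star mulr_ile1 ?nrm_ge0 ?nv //.
  by apply: nrm_u; case/andP: (lk l l10).
have cz i l : (l < 10)%N -> cor Q (z i l).
  move=> l10; rewrite zE; apply: corM => //; apply: cor_star => //; apply: cu.
  by case/andP: (lk l l10).
have zz : \sum_(i < 3) \sum_(l < 10) (z i l)^† * z i l = G.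
  rewrite exchange_big /=; apply: eq_bigr => l _; rewrite -vv mulr_sumr mulr_suml.
  by apply: eq_bigr => i _; rewrite zE starM starK !mulrA.
have czX i l : (l < 10)%N -> cor Q (z i l * X * (z i l)^†).
  by move=> l10; apply: corM; [apply: corM => //; exact: cz | apply: cor_star => //; exact: cz].
have czX' i l : (l < 10)%N -> cor Q ((z i l)^† * z i l * X).
  by move=> l10; apply: corM => //; apply: corM; [apply: cor_star => //; exact: cz | exact: cz].
have ta' j : t j a' = 0.
  rewrite /a' (@trace_sum _ _ _ _ (ht j) 3 Z); last first.
    by move=> i _; apply: (@cor_sum _ _ _ _ (fun l => z i l * X * (z i l)^†)) => l; exact: czX.
  have -> : \sum_(i < 3) t j (Z i) = \sum_(i < 3) t j (\sum_(l < 10) (z i l)^† * z i l * X).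
    apply: eq_bigr => i _; rewrite /Z (@trace_sum _ _ _ _ (ht j) 10 (fun l => z i l * X * (z i l)^†)); last by move=> l; exact: czX.
    rewrite (@trace_sum _ _ _ _ (ht j) 10 (fun l => (z i l)^† * z i l * X)); last by move=> l; exact: czX'.
    apply: eq_bigr => l _; rewrite (traceC (ht j)) ?mulrA //; first by apply: corM => //; exact: cz.
    by apply: cor_star => //; exact: cz.
  rewrite -(@trace_sum _ _ _ _ (ht j) 3 (fun i => \sum_(l < 10) (z i l)^† * z i l * X)); last first.
    by move=> i _; apply: (@cor_sum _ _ _ _ (fun l => (z i l)^† * z i l * X)) => l; exact: czX'.
  rewrite -(tX j); congr (t j _); rewrite -[RHS]GX -zz mulr_suml.
  by apply: eq_bigr => i _; rewrite mulr_suml.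
have r'z i l : r' * z i l = z i l by rewrite zE mulrA; case: (hv i) => ->.
have ca' : cor r' a'.
  apply: (@cor_sum _ _ _ _ Z) => i _; apply: (@cor_sum _ _ _ _ (fun l => z i l * X * (z i l)^†)) => l _.
  by split; [rewrite mulrA (mulrA r') r'z | rewrite -mulrA (star_absorb hr' (r'z i l))].
have sa' : selfadjoint a'.
  rewrite /selfadjoint star_sum; apply: eq_bigr => i _; rewrite star_sum; apply: eq_bigr => l _.
  by rewrite !starM starK sX mulrA.
have na' : nrm a' <= (d / 2) ^+ 2.
  have nZ (i : 'I_3) : nrm (Z i) <= 10 * (4 * h).
    apply: le_trans (nrm_sum _ _ _) _; rewrite mulr_natl -[X in _ *+ X]card_ord -sumr_const.
    apply: ler_sum => l _; apply: nrm_conj_le => //; rewrite ?nrm_star; exact: nz.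
  apply: le_trans (nrm_sum _ _ _) _.
  apply: le_trans (_ : \sum_(i < 3) 10 * (4 * h) <= _); first exact: ler_sum.
  rewrite sumr_const card_ord -mulr_natl; move: hh; rewrite exprMn.
  by rewrite (_ : 2^-1 ^+ 2 = 4^-1 :> R); [move=> ?; lra | field].
exists a'; split=> //.
have nh : h + h <= d * (2 * d).
  move: hh e0; rewrite expr2 => *; nra.
(* The bookkeeping: b goes to its copy, the e_l and M times r to their positions, E to V V^†, P to W
   W^†, and finally X to a' in three groups of ten. *)
have -> : a - a' = (b - ub) + ((\sum_(l < M + M) h%:C *: (e (1 + l)%N - u (1 + l)%N * e (1 + l)%N * (u (1 + l)%N)^†)) +
   ((\sum_(l < M) (- h)%:C *: (r - u (p1 + l)%N * r * (u (p1 + l)%N)^†)) +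
   (h%:C *: (E - V * V^†) + ((- h)%:C *: (P - W * W^†) +
   ((\sum_(l < 10) ((z 0 l)^† * z 0 l * X - z 0 l * X * (z 0 l)^†)) +
   ((\sum_(l < 10) ((z 1 l)^† * z 1 l * X - z 1 l * X * (z 1 l)^†)) +
   (\sum_(l < 10) ((z 2 l)^† * z 2 l * X - z 2 l * X * (z 2 l)^†)))))))).
  rewrite -!scaler_sumr !sumrB -/Se -/E.
  have -> : \sum_(l < M) u (p1 + l)%N * r * (u (p1 + l)%N)^† = NM by [].
  have -> : \sum_(l < M + M) u (1 + l)%N * e (1 + l)%N * (u (1 + l)%N)^† = E by [].
  have -> : \sum_(l < M) r = M%:R%:C *: r.
    by rewrite sumr_const card_ord rmorph_nat scaler_nat.
  have zzX : \sum_(l < 10) (z 0 l)^† * z 0 l * X + (\sum_(l < 10) (z 1 l)^† * z 1 l * X +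
      \sum_(l < 10) (z 2 l)^† * z 2 l * X) = X.
    by rewrite -[RHS]GX -zz -!mulr_suml -!mulrDl [in RHS]big_ord_recl [in RHS]big_ord_recl [in RHS]big_ord_recl [in RHS]big_ord0 addr0.
  have a'E : a' = Z 0%N + (Z 1%N + Z 2%N) by rewrite /a' !big_ord_recr big_ord0 /= add0r addrA.
  have -> : a = b + ((- d ^+ 2)%:C *: r + h%:C *: Se) by rewrite /b subrK.
  rewrite a'E -/(Z 0%N) -/(Z 1%N) -/(Z 2%N) /P NNE.
  move: zzX.
  have -> : (- d ^+ 2)%:C *: r = (- h)%:C *: (M%:R%:C *: r).
    by rewrite scalerA -rmorphM mulNr hME.
  move: (\sum_(l < 10) (z 0 l)^† * z 0 l * X) (\sum_(l < 10) (z 1 l)^† * z 1 l * X) (\sum_(l < 10) (z 2 l)^† * z 2 l * X).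
  move: (Z 0%N) (Z 1%N) (Z 2%N) (V * V^†) => Z0 Z1 Z2 VV' s0 s1 s2 sE.
  have -> : s0 = X - (s1 + s2) by rewrite -sE addrK.
  rewrite /X; move: (W * W^†) => WW'.
  by move: (M%:R%:C *: r) => Mr; nring.
have dd1 : d^-1 * d = 1 by rewrite mulVf // gt_eqF.
apply: commutator_sum_cat.
  (* ‖b‖ <= 2 h is of order d^2, so one factor of d is shifted from the side of b to the other. *)
  have [||h1 h2] := @copy_pair b d^-1 d (2 * d) p4 p40 cb.
  - by rewrite nrmZr ?invr_ge0 // ler_pdivrMl // (le_trans nb).
  - by rewrite gtr0_norm //; lra.
  by move: h2; rewrite dd1 scale1r -/ub => <-; apply: commutator_sum1.
have d2 : `|d| <= 2 * d by rewrite gtr0_norm //; lra.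
have dMd : `|d / M%:R| <= 2 * d by rewrite gtr0_norm //; lra.
have dMd' : `|- (d / M%:R)| <= 2 * d by rewrite normrN.
have SE : S * E = E by apply: SB => // l; case: (he l).
have SNN : S * NN = NN by apply: SB.
have SFF : S * FF = FF by apply: SB.
have SP : S * P = P by rewrite /P mulrBr SNN mulrA -{1}NV mulrA SNN NV.
apply: commutator_sum_cat.
  rewrite hd; apply: copy_sum => // l; first by case: (he l).
  by apply: nrm_scale_le => //; apply: proj_nrm; case: (he l).
apply: commutator_sum_cat.
  rewrite hd -mulNr; apply: (@copy_sum (fun=> r)) => //.
  by move=> l; apply: nrm_scale_le => //; exact: proj_nrm.
have hB i n : (i + n <= N)%N -> proj (block u (fun=> rho) i n).
  by move=> h1; apply: (block_proj uu).
have BF i n F : (i + n <= N)%N -> (forall l, cor r (F l)) ->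
    block u (fun=> rho) i n * block u F i n = block u F i n.
  move=> h1 cFr; rewrite (block_mul_in uu) //; apply: eq_block => l.
  by case: (cFr l) => h2 _; rewrite -h2 mulrA cr.1.
apply: commutator_sum_cat.
  rewrite hd -(isom_commutator _ _ VV); apply: commutator_sum1.
  apply: (offdiag_isom _ hS hE hNN VV NV) => //; [exact: hB | | exact: BF].
  by apply: (block_mul0 uu) => //; rewrite /p1 leqnn orbT.
apply: commutator_sum_cat.
  rewrite hd -mulNr -(isom_commutator _ _ WW); apply: commutator_sum1.
  apply: (offdiag_isom _ hS hP hFF WW FW) => //; [exact: hB | | exact: BF].
  have BNN : block u (fun=> rho) p3 6 * NN = 0.
    by apply: (block_mul0 uu) => //; rewrite /p3 /p2 addnA leqnn orbT.
  by rewrite /P mulrBr BNN mulrA -{1}NV mulrA BNN !mul0r subr0.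
have dd : d <= 2 * d by lra.
have dX : d^-1 * nrm X <= 2 * d.
  rewrite ler_pdivrMl // (le_trans nX) //; move: hh e0; rewrite expr2 => ? ?; lra.
have zsum i : (i < 3)%N -> commutator_sum (mkseq (fun=> (rho, true)) 10) S r' (2 * d)
    (\sum_(l < 10) ((z i l)^† * z i l * X - z i l * X * (z i l)^†)).
  move=> i3; have mp (l : nat) (l10 : (l < 10)%N) :=
    @matrix_pair X d (2 * d) i (p2 + l)%N i3 d0 (lk l l10) SX XS dd dX.
  rewrite (eq_bigr (fun l : 'I_10 => (d%:C *: (z i l)^†) * (d^-1%:C *: (z i l * X)) -
     (d^-1%:C *: (z i l * X)) * (d%:C *: (z i l)^†))); last first.
    by move=> l _; rewrite zE (mp l (ltn_ord l)).2.
  apply: (@commutator_sum_nat _ _ 10 (fun=> rho) (fun l => d%:C *: (z i l)^†)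
    (fun l => d^-1%:C *: (z i l * X))) => l l10.
  by rewrite zE; exact: (mp l l10).1.
apply: commutator_sum_cat; first exact: zsum.
by apply: commutator_sum_cat; apply: zsum.
Qed.

Lemma step_cornersP l : l \in step_corners -> proj l.1 /\ cor Q l.1.
Proof.
have hu (k : nat) : (k < N)%N -> proj (u k * (u k)^†) /\ cor Q (u k * (u k)^†).
  move=> kN; split; last by apply: corM; [exact: cu | apply: cor_star => //; exact: cu].
  split; first by rewrite /selfadjoint starM starK.
  by rewrite mulrA -(mulrA (u k)) uu // eqxx (copy_rho hrho uu).
have hb i n : (i + n <= N)%N ->
    proj (block u (fun=> rho) i n) /\ cor Q (block u (fun=> rho) i n).
  by move=> h1; split; [apply: (block_proj uu) | apply: (block_cor _ cu)].
have n1 : (1 + (M + M) <= N)%N by rewrite /N /p4 /p3 /p2 /p1 -!addnA leq_add2l !leq_add2l leq_addr.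
have n2 : (p1 + (M + 3) <= N)%N by rewrite /N /p4 /p3 /p2 -!addnA !leq_add2l.
have n2' : (p1 + M <= N)%N by rewrite (leq_trans _ n2) // leq_add2l leq_addr.
have n4 : (p3 + 6 <= N)%N by rewrite /N leq_addr.
have h10 : l \in mkseq (fun=> (rho, true)) 10 -> proj l.1 /\ cor Q l.1.
  by move=> /mapP[k _ ->].
rewrite /step_corners mem_cat => /orP[|].
  by rewrite mem_seq1 => /eqP ->; apply: hu; rewrite /N addn1.
rewrite mem_cat => /orP[/mapP[k]|].
  by rewrite mem_iota => /andP[_ hk] ->; apply: hu; rewrite (leq_trans _ n1) // ltn_add2l.
rewrite mem_cat => /orP[/mapP[k]|].
  by rewrite mem_iota => /andP[_ hk] ->; apply: hu; rewrite (leq_trans _ n2') // ltn_add2l.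
rewrite mem_cat => /orP[|].
  by rewrite mem_seq1 => /eqP ->; exact: hb.
rewrite mem_cat => /orP[|].
  by rewrite mem_seq1 => /eqP ->; exact: hb.
by rewrite !mem_cat => /orP[|/orP[|]].
Qed.

End Step.

(** * Elements of trace zero, and the correction of traces *)

Section TraceZero.
Context {R : realType} {U : ucstarType R}.
Implicit Types (p q r e f x y a b g c v w : U) (d h : R).
Hypothesis rr0 : @rank0 R U.
Variable I : U -> Prop.
Hypothesis hI : star_ideal I.
Variable Q : U.
Hypothesis hQ : proj Q.
Variable m : nat.
Variable t : 'I_m -> U -> R.
Hypothesis ht : forall j, corner_trace Q (t j).
Hypothesis iQ : I Q.
Hypothesis hcmp : forall p q, proj p -> proj q -> cor Q p -> cor Q q ->
  (forall j, t j p < t j q) -> msub p q.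
Hypothesis hgen : forall r, proj r -> I r -> r != 0 -> generates I r.
Hypothesis no_minimal : forall g, minimal g -> ~ cor Q g.

Lemma nlim0_pow (b : nat -> U) : (forall k, nrm (b k) <= (2^-1 ^+ k) ^+ 2) -> nlim b 0.
Proof.
move=> nb d d0; have [n hn] := invS_small d0; exists n => k nk.
rewrite subr0 (le_trans (nb k)) // (le_trans _ (hn k nk)) //.
have h2 : 0 <= 2^-1 ^+ k :> R by rewrite exprn_ge0 // invr_ge0.
have h1 : 2^-1 ^+ k <= 1 :> R by rewrite exprn_ile1 // ?invr_ge0 // invf_le1 // ler1n.
rewrite expr2 (le_trans (_ : _ <= 2^-1 ^+ k * 1)) ?ler_wpM2l // mulr1 exprVn.
by rewrite lef_pV2 ?posrE ?exprn_gt0 ?ltr0n // -natrX ler_nat ltn_expl.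
Qed.

(** Iterating [trace_step] along the chain yields remainders b_k with ‖b_k‖ <= 4^-k. So b_0 is the
    telescoping series of the b_k - b_{k+1}, which is summable in the span because every stage uses
    the same list of corners. *)
Lemma trace_zero_span (j0 : 'I_m) : exists r0, [/\ proj r0, cor Q r0, r0 != 0 &
  forall a, cor r0 a -> selfadjoint a -> (forall j, t j a = 0) -> span I a].
Proof.
pose M := 480%N.
have hM : 480 <= M%:R :> R by [].
(* From here on only the lower bound on [M] is kept, not its value. *)
move: M hM => M hM.
set N := (1 + (M + M) + M + 3 + 6 + 1)%N.
have N0 : 0 < N%:R + 1 :> R by rewrite ltr_wpDl.
have Q0 : Q != 0.
  by apply: contraTneq (trace_gt0 (ht j0)) => ->; rewrite (trace0 (ht j0)) ltxx.
(* The choice N + 1 in the denominator leaves room in Q for N orthogonal copies of [rho], with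
   strict inequality. *)
have [|d d0 hd] := @uniform_pos R m (fun j => t j Q / (N%:R + 1)).
  by move=> j; rewrite divr_gt0 // (trace_gt0 (ht j)).
have [rho [hrho Qrho rho0 trho]] := small_proj hQ ht no_minimal hQ (cor_id hQ) Q0 d0.
have crho : cor Q rho by exact: cor_proj.
have [|u [u0 cu uu]] := copies hQ ht hcmp (n := N) hrho crho.
  move=> j; have h1 := le_trans (trho j) (hd j).
  have h2 := trace_proj_pos hI hQ ht iQ hgen j hrho crho rho0.
  by move: h1; rewrite ler_pdivlMr // mulrDr mulr1 mulrC; lra.
have [r [v [hr or vr hv]]] := halving_chain rr0 hI hQ ht iQ hcmp hgen no_minimal j0 hrho crho rho0.
have crQ x : cor rho x -> cor Q x by case: crho; exact: cor_le.
have pr k : proj (r k) by case: (hr k).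
have cr k : cor rho (r k) by case: (hr k).
exists (r 0%N); split=> //; [exact: crQ | by case: (hr 0%N) |].
have tr k j : 0 < t j (r k).
  by apply: (trace_proj_pos hI hQ ht iQ hgen) => //; [exact: crQ | case: (hr k)].
move=> a ca sa_a ta.
pose C := nrm a + 1.
have C0 : 0 < C by rewrite ltr_wpDl ?nrm_ge0.
pose P (s : nat * U) := [/\ cor (r s.1) s.2, selfadjoint s.2, forall j, t j s.2 = 0 &
  nrm s.2 <= (2^-1 ^+ s.1) ^+ 2].
pose L := step_corners M rho u.
pose S k := block u (fun=> r k) 0 N.
pose T (s s' : nat * U) := s'.1 = s.1.+1 /\
  commutator_sum L (S s.1) (r s.1.+1) (2 * 2^-1 ^+ s.1) (s.2 - s'.2).
have P0 : P (0%N, C^-1%:C *: a).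
  split; rewrite /=.
  - exact: corZ.
  - exact: saZ.
  - by move=> j; rewrite (traceZ (ht j)) ?ta ?mulr0 //; apply: crQ; case: (cr 0%N) => h1 h2; exact: cor_le h1 h2 ca.
  - by rewrite nrmZr ?invr_ge0 ?(ltW C0) // expr0 expr1n ler_pdivrMl // mulr1 lerDl.
have step (n : nat) s : P s -> exists s', P s' /\ T s s'.
  case: s => k b [/= cb sb tb nb].
  have dk : 0 < 2^-1 ^+ k :> R by rewrite exprn_gt0 // invr_gt0.
  have [b' [[h1 h2 h3 h4] h5]] := trace_step rr0 hQ ht hcmp hM hrho crho u0 cu uu
    (pr k) (cr k) (tr k) (pr k.+1) (cr k.+1) (vr k) (hv k) cb sb tb dk nb.
  exists (k.+1, b'); split; last by split.
  by split=> //=; rewrite [_ ^+ k.+1]exprSr.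
have [w [w0 hw]] := dependent_sequence P0 step.
have w1 k : (w k).1 = k.
  by elim: k => [|k IH]; [rewrite w0 | have [_ [-> _]] := hw k; rewrite IH].
pose b k := (w k).2.
have [l hl sl] : summable_in_span I (fun k => b k - b k.+1).
  apply: (@commutator_sum_summable _ _ I L S (fun k => r k.+1) _ 2 hI).
  - move=> l /(step_cornersP hQ hrho crho cu uu)[h1 h2]; split=> //.
    exact: (cor_ideal hI iQ h2).
  - move=> i j ij; rewrite /S (block_mul_in uu) // /block big1 // => k _ /=.
    by rewrite or // mulr0 mul0r.
  - by move=> i j ij; apply: or.
  - by move=> n; have [_ [_]] := hw n; rewrite w1.
have b0 : nlim b 0.
  by apply: nlim0_pow => k; have [[_ _ _]] := hw k; rewrite w1.
have : span I (b 0%N).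
  rewrite (_ : b 0%N = l) //; apply: (nlim_uniq _ hl).
  rewrite -[X in nlim _ X]subr0; apply: nlim_ext (nlimB (nlim_cst (b 0%N)) b0) => n.
  elim: n => [|n IH]; first by rewrite big_ord0 subrr.
  by rewrite big_ord_recr /= -IH addrA subrK.
move=> h; have := spanZ C%:C h; rewrite /b w0 /= scalerA -rmorphM divff ?gt_eqF //.
by rewrite scale1r.
Qed.

(** Take finitely many projections of the corner for which the matrix of their traces has maximal
    rank. Its row space contains the trace vector of every projection of the corner, hence of every
    real combination of them, hence of b, since [finite_spectrum] approximates b by such
    combinations and a row space is closed. *)
Lemma trace_correction r0 b : proj r0 -> cor Q r0 -> cor r0 b -> selfadjoint b ->
  exists v, [/\ span I v, cor r0 v, selfadjoint v & forall j, t j v = t j b].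
Proof.
move=> hr cr cb sb.
pose F k := 'I_k -> U.
pose A k (f : F k) : 'M[R]_(k, m) := \matrix_(i, j) t j (f i).
pose good k (f : F k) := forall i, proj (f i) /\ cor r0 (f i).
pose P n := `[< exists k (f : F k), good k f /\ \rank (A k f) = n >].
have P0 : exists n, P n.
  exists 0%N; apply/asboolP; exists 0%N, (fun _ => 0); split; first by case.
  by apply/eqP; rewrite -leqn0 rank_leq_row.
have Pm n : P n -> (n <= m)%N by move=> /asboolP[k [f [_ <-]]]; exact: rank_leq_col.
case: (ex_maxnP P0 Pm) => n /asboolP[k [f [gf rf]]] nmax.
have corQ x : cor r0 x -> cor Q x by case: cr => h1 h2; exact: cor_le.
pose tv x : 'rV[R]_m := \row_j t j x.
(* Otherwise appending p to the family would increase the rank. *)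
have sub p : proj p -> cor r0 p -> (tv p <= A k f)%MS.
  move=> hp cp; pose f' (i : 'I_(k + 1)) := match fintype.split i with inl i => f i | inr _ => p end.
  have E : A _ f' = col_mx (A k f) (tv p).
    apply/matrixP => i j; rewrite !mxE /f'; case: (fintype.split i) => i'; by rewrite !mxE.
  have /nmax : P (\rank (A _ f')).
    apply/asboolP; exists (k + 1)%N, f'; split=> // i.
    by rewrite /f'; case: (fintype.split i) => // i'; exact: gf.
  rewrite E -rf -addsmxE => h; apply: submx_trans (addsmxSr (A k f) _) _.
  by rewrite -(geq_leqif (mxrank_leqif_sup (addsmxSl (A k f) (tv p)))).
have key : (tv b <= A k f)%MS.
  rewrite submxE; apply/eqP/matrixP => i j; rewrite [RHS]mxE.
  pose c := cokermx (A k f).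
  pose K := \sum_l `|c l j| * t l r0.
  have K0 : 0 <= K.
    apply: sumr_ge0 => l _; rewrite mulr_ge0 //.
    exact: (trace_proj_ge0 hQ (ht l)).
  apply/eqP; rewrite -normr_le0; apply/ler_addgt0Pr => d d0; rewrite add0r.
  (* An approximation of b within 2 h changes the product with the column j of the cokernel by at
     most 2 h K <= d; the product vanishes on the approximant. *)
  pose h := d / (K + 1) / 2.
  have K1 : 0 < K + 1 by rewrite ltr_wpDl.
  have h0 : 0 < h by rewrite !divr_gt0.
  have nb := nrm_ge0 b.
  pose k0 := Num.truncn ((nrm b + nrm b) / h).
  have lo : (- nrm b)%:C *: r0 ⊑ b.
    have := cor_ule hr (corN cb) (saN sb) (lexx _); rewrite nrmN.
    by apply: eq_pos; nring.
  have up : b ⊑ (- nrm b + k0.+1%:R * h)%:C *: r0.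
    apply: ule_trans (cor_ule hr cb sb (lexx _)) (uleZr _ (proj_pos hr)).
    have := truncnS_gt ((nrm b + nrm b) / h).
    by rewrite ltr_pdivrMr // -/k0; lra.
  have [e [he ne]] := finite_spectrum rr0 hr cb sb h0 h0 lo up.
  set y := (X in nrm (b - X)) in ne.
  have cS : cor r0 (\sum_(l < k0.+1) e l) by apply: cor_sum => l _; case: (he l).
  have cy : cor r0 y by apply: corD; apply: corZ => //; exact: cor_id.
  have sy : selfadjoint y.
    apply: saD; apply: saZ; first exact: hr.1.
    by rewrite /selfadjoint star_sum; apply: eq_bigr => l _; case: (he l) => [[]].
  have ty : (tv y <= A k f)%MS.
    have -> : tv y = (- nrm b) *: tv r0 + h *: \sum_(l < k0.+1) tv (e l).
      apply/matrixP => i0 l; rewrite !mxE summxE (traceD (ht l)); [|exact: corZ|by apply: corZ; exact: corQ].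
      rewrite !(traceZ (ht l)) //; last exact: corQ.
      rewrite (@trace_sum _ _ _ _ (ht l)); last by move=> i1 _; apply: corQ; case: (he i1).
      by congr (_ + _ * _); apply: eq_bigr => i1 _; rewrite mxE.
    apply: addmx_sub; apply: scalemx_sub; first by apply: sub => //; exact: cor_id.
    by apply: summx_sub => l _; apply: sub; case: (he l).
  have y0 : (tv y *m c) i j = 0 by move: ty; rewrite submxE => /eqP ->; rewrite mxE.
  have -> : (tv b *m c) i j = \sum_l t l (b - y) * c l j.
    transitivity ((tv b *m c) i j - (tv y *m c) i j); first by rewrite y0 subr0.
    rewrite !mxE -sumrB; apply: eq_bigr => l _.
    by rewrite !mxE (traceB (ht l)) ?mulrBl //; exact: corQ.
  apply: le_trans (ler_norm_sum _ _ _) _.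
  apply: le_trans (_ : (h + h) * K <= _).
    rewrite mulr_sumr; apply: ler_sum => l _; rewrite normrM mulrCA [leRHS]mulrC -mulrA.
    rewrite mulrA ler_wpM2r //.
    exact: (trace_nrm hQ (ht l) hr cr (corB cb cy) (saB sb sy) ne).
  rewrite /h -splitr mulrAC ler_pdivrMr // ler_wpM2l ?(ltW d0) // lerDl.
  exact: ler01.
case/submxP: key => c hc.
exists (\sum_(i < k) (c 0 i)%:C *: f i); split.
- by apply: span_sum => // i _; apply: spanZ => //; case: (gf i) => h1 h2; apply: span_proj => //; exact: (cor_ideal hI iQ (corQ _ h2)).
- split; rewrite ?mulr_sumr ?mulr_suml; apply: eq_bigr => i _; have [_ [h1 h2]] := gf i.
    by rewrite -scalerAr h1.
  by rewrite -scalerAl h2.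
- rewrite /selfadjoint star_sum; apply: eq_bigr => i _.
  by apply: saZ; case: (gf i) => [[]].
- move=> j; have := congr1 (fun M : 'rV[R]_m => M 0 j) hc; rewrite !mxE => ->.
  have tS (J : seq 'I_k) : t j (\sum_(i <- J) (c 0 i)%:C *: f i) = \sum_(i <- J) c 0 i * t j (f i)
     /\ cor Q (\sum_(i <- J) (c 0 i)%:C *: f i).
    elim: J => [|i J [IH IC]]; first by rewrite !big_nil (trace0 (ht j)); split => //; exact: cor0.
    have cf : cor Q (f i) by apply: corQ; case: (gf i).
    rewrite !big_cons; split; last by apply: corD => //; exact: corZ.
    by rewrite (traceD (ht j)) ?IH ?(traceZ (ht j)) //; exact: corZ.
  by rewrite (tS _).1; apply: eq_bigr => i _; rewrite mxE.
Qed.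

End TraceZero.

(** * Corners lie in the span of the projections *)

Section CornerSpan.
Context {R : realType} {U : ucstarType R}.
Implicit Types (p q r e f x y a b g c v w : U) (d h : R).
Hypothesis rr0 : @rank0 R U.
Variable I : U -> Prop.
Hypothesis hI : star_ideal I.
Variable Q : U.
Hypothesis hQ : proj Q.
Variable m : nat.
Variable t : 'I_m -> U -> R.
Hypothesis ht : forall j, corner_trace Q (t j).
Hypothesis iQ : I Q.
Hypothesis hcmp : forall p q, proj p -> proj q -> cor Q p -> cor Q q ->
  (forall j, t j p < t j q) -> msub p q.
Hypothesis hgen : forall r, proj r -> I r -> r != 0 -> generates I r.

Lemma cor_real_imag r b : proj r -> cor r b -> exists b1 b2,
  [/\ cor r b1, selfadjoint b1, cor r b2, selfadjoint b2 & b = b1 + 'i%C *: b2].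
Proof.
move=> hr cb; have cbs := cor_star hr cb.
exists ((2^-1)%:C *: (b + b^†)), ((2^-1)%:C *: (- 'i%C *: (b - b^†))); split.
- exact/corZ/corD.
- by apply: saZ; rewrite /selfadjoint starD starK addrC.
- exact/corZ/corZ/corB.
- apply: saZ; rewrite /selfadjoint starZ starB starK.
  rewrite (_ : conjc (- 'i%C) = 'i%C) ?scaleNr -?scalerN ?opprB //.
  by apply/eqP; rewrite eq_complex /= oppr0 opprK !eqxx.
have c1 : 'i%C * (2^-1)%:C * - 'i%C = (2^-1)%:C :> R[i].
  by rewrite mulrAC mulrN mulii opprK mul1r.
have -> : 'i%C *: ((2^-1)%:C *: (- 'i%C *: (b - b^†))) = (2^-1)%:C *: (b - b^†).
  by rewrite !scalerA ?mulrA c1.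
rewrite -scalerDr (_ : b + b^† + (b - b^†) = b + b); last by nring.
by rewrite scalerDr -scalerDl -rmorphD /= (_ : 2^-1 + 2^-1 = 1) ?scale1r //; lra.
Qed.

(** A minimal projection under Q settles the matter directly. Otherwise a is relocated, modulo the
    span, into a corner in which trace-zero selfadjoint elements lie in the span, and the real and
    imaginary parts are corrected to have vanishing traces. *)
Lemma corner_span (j0 : 'I_m) a : cor Q a -> span I a.
Proof.
move=> ca; have [[g [gm cg]]|hn] := pselect (exists g, minimal g /\ cor Q g).
  exact: (span_minimal rr0 hI hQ iQ hgen gm).
have no_minimal g : minimal g -> ~ cor Q g by move=> h1 h2; apply: hn; exists g.
have [r0 [hr cr r0n hr0]] := trace_zero_span rr0 hI hQ ht iQ hcmp hgen no_minimal j0.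
have ir := cor_ideal hI iQ cr.
have [n [z [hz QE]]] := fullness hr ir (hgen hr ir r0n) hQ iQ.
have [||b [cb ib sb]] := relocate hI (n := n) (z := z) hr ir (cor_ideal hI iQ ca).
- by move=> i; case: (hz i).
- by rewrite -mulr_suml -QE ca.1.
have corQ x : cor r0 x -> cor Q x by case: cr => h1 h2; exact: cor_le.
have sa_span x : cor r0 x -> selfadjoint x -> span I x.
  move=> cx sx; have [v [h1 h2 h3 h4]] := trace_correction rr0 hI hQ ht iQ hr cr cx sx.
  rewrite -(subrK v x); apply: spanD => //; apply: hr0; [exact: corB|exact: saB|].
  by move=> j; rewrite (traceB (ht j)) ?h4 ?subrr //; exact: corQ.
have [b1 [b2 [h1 h2 h3 h4 bE]]] := cor_real_imag hr cb.
rewrite -(subrK b a); apply: spanD => //; rewrite bE; apply: spanD; first exact: sa_span.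
by apply: spanZ; exact: sa_span.
Qed.

End CornerSpan.

(** * Tracial weights *)

Section Embedding.
Context {R : realType} (A : cstarAlgType R).
Implicit Types (a b p q : A).

Definition emb a : cuz A := uz_emb (a : underlying_banach A).

Lemma embM a b : emb (a · b) = emb a * emb b. Proof. exact: uz_embM. Qed.
Lemma embD a b : emb (a + b) = emb a + emb b. Proof. exact: uz_embD. Qed.
Lemma embZ k a : emb (k *: a) = k *: emb a. Proof. exact: uz_embZ. Qed.
Lemma embN a : emb (- a) = - emb a. Proof. exact: uz_embN. Qed.
Lemma embB a b : emb (a - b) = emb a - emb b. Proof. by rewrite embD embN. Qed.
Lemma emb0 : emb 0 = 0. Proof. by []. Qed.
Lemma emb_star a : emb a^† = (emb a)^†.
Proof. by congr pair; rewrite conjc0. Qed.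
Lemma emb_inj : injective emb. Proof. by move=> a b []. Qed.
Lemma emb_sum (J : Type) (r : seq J) (P : pred J) (F : J -> A) :
  emb (\sum_(i <- r | P i) F i) = \sum_(i <- r | P i) emb (F i).
Proof. by apply: (big_morph emb); [exact: embD | exact: emb0]. Qed.
Lemma nrm_emb a : nrm (emb a) = rnorm a. Proof. exact: cnrm_emb. Qed.

Definition in_base (x : cuz A) : Prop := x.2 = 0.
Definition alg_part (x : cuz A) : A := x.1.

Lemma in_baseP x : in_base x -> x = emb (alg_part x).
Proof. exact: uz_embP. Qed.
Lemma in_base_emb a : in_base (emb a). Proof. by []. Qed.
Lemma alg_partK a : alg_part (emb a) = a. Proof. by []. Qed.

Lemma alg_star_ideal : star_ideal in_base.
Proof.
split.
- by [].
- by move=> x y hx hy; rewrite /in_base /= hx hy addr0.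
- by move=> k x hx; rewrite /in_base /= hx; exact: mulr0.
- by move=> x y hx; rewrite /in_base /= hx mulr0.
- by move=> x y hx; rewrite /in_base /= hx mul0r.
- by move=> x hx; rewrite /in_base /= hx conjc0.
- move=> u x hu hx; apply/(@rnorm_eq0 R (R[i] : normedZmodType _))/eqP.
  rewrite eq_le rnorm_ge0 andbT; apply/ler_addgt0Pr => d d0; rewrite add0r.
  have [n hn] := hu d d0; apply: le_trans (hn n (leqnn n)).
  have -> : rnorm x.2 = rnorm (u n - x).2 by rewrite /= hx sub0r rnormN.
  exact: scalar_le_cnrm.
Qed.

Lemma projection_emb p : projection p <-> proj (emb p).
Proof.
split=> [[h1 h2]|[h1 h2]].
  by split; [rewrite /selfadjoint -emb_star h1 | rewrite -embM h2].
by split; apply: emb_inj; rewrite ?emb_star ?embM.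
Qed.

Lemma positive_emb a : positive a <-> pos (emb a).
Proof.
split=> [[y ->]|/pos_sqrt[h [ph hE _]]].
  by rewrite embM emb_star; exact: pos_starM.
have h0 : in_base h.
  have := congr1 snd hE; rewrite /= => /esym/eqP.
  by rewrite mulf_eq0 orbb => /eqP.
exists (alg_part h); apply: emb_inj.
by rewrite embM emb_star -(in_baseP h0) (pos_sa ph).
Qed.

Lemma combination_emb a : combination_of_projections a <-> span in_base (emb a).
Proof.
split=> [[n [c [p [hp ->]]]]|].
  rewrite emb_sum; apply: span_sum => i _; rewrite embZ; apply: spanZ.
  by apply: span_proj => //; apply/projection_emb.
move=> h; have : exists2 b, emb a = emb b & combination_of_projections b.
  elim: h => [|k p x hp ip _ [b -> [n [c [q [hq bE]]]]]].
    exists 0 => //; exists 0%N, (fun=> 0), (fun=> 0); split; first by case.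
    by rewrite big_ord0.
  exists (k *: alg_part p + b); first by rewrite embD embZ -in_baseP.
  exists n.+1, (fun i => if unlift ord0 i is Some j then c j else k),
    (fun i => if unlift ord0 i is Some j then q j else alg_part p); split.
    move=> i; case: unliftP => [j _|_]; first exact: hq.
    by apply/projection_emb; rewrite -in_baseP.
  rewrite big_ord_recl unlift_none bE; congr (_ + _).
  by apply: eq_bigr => j _; rewrite liftK.
by case=> b /emb_inj ->.
Qed.

Lemma mvn_prec_msub p q : mvn_prec p q -> msub (emb p) (emb q).
Proof.
move=> [r [[hr hq qr] _ [v [vv vs]]]]; exists (emb v).
have pr := (projection_emb r).1 hr; have pq := (projection_emb q).1 hq.
rewrite -emb_star -embM vv; split=> //.
have vse : emb v * (emb v)^† = emb r by rewrite -emb_star -embM vs.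
have rv : emb r * emb v = emb v.
  apply/eqP; rewrite -subr_eq0; apply/eqP; rewrite -[LHS]starK.
  have -> : emb r * emb v - emb v = (emb r - 1) * emb v by rewrite mulrBl mul1r.
  suff -> : ((emb r - 1) * emb v)^† = 0 by rewrite star0.
  apply: starM_eq0; rewrite starK starM mulrA -(mulrA _ (emb v)) vse.
  by rewrite mulrBl mul1r pr.2 subrr mul0r.
by rewrite -rv (mulrA (emb q)) -[emb q * emb r]embM qr.
Qed.

Lemma left_unit_unital (u : A) : (forall b, u · b = b) -> unital A.
Proof.
move=> hu; have hs b : b · u^† = b by rewrite -[LHS]astarK astarM astarK hu astarK.
have uE : u^† = u by rewrite -[LHS]hu hs.
by exists u => b; split; [|rewrite -[X in _ · X]uE].
Qed.

Lemma lact_embE (x : cuz A) b : emb (lact x b) = x * emb b.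
Proof.
by congr pair; rewrite /= ?mulr0 // scale0r addr0.
Qed.

(** If the scalar part of x exceeded the operator norm, y = x / x.2 = 1 - e, with e in A, would act
    on A as a strict contraction. Then l = sum y^n e belongs to A and is a left unit, because b - l
    b is fixed by y. Hence without a unit [cnrm] is the operator norm. *)
Lemma scalar_le_unitization (x : cuz A) : ~ unital A ->
  rnorm x.2 <= unitization_norm x.
Proof.
move=> nu; rewrite leNgt; apply/negP => hx; apply: nu.
have x20 : 0 < rnorm x.2 by exact: le_lt_trans (unitization_norm_ge0 x) hx.
have x2n : x.2 != 0.
  by apply: contraTneq x20 => ->; rewrite rnorm0 ltxx.
pose y : cuz A := x.2^-1 *: x.
pose q := unitization_norm x / rnorm x.2.
have q0 : 0 <= q by rewrite divr_ge0 ?rnorm_ge0 ?unitization_norm_ge0.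
have q1 : q < 1 by rewrite ltr_pdivrMr // mul1r.
have y2 : y.2 = 1 by exact: (mulVf x2n).
have ly b : rnorm (lact y b) <= q * rnorm b.
  rewrite lactZ rnormZ /q mulrAC [leRHS]mulrC.
  have -> : rnorm x.2^-1 = (rnorm x.2)^-1.
    apply: (mulfI (lt0r_neq0 x20)); rewrite -rnormM divff // rnorm1 divff //.
    exact: lt0r_neq0.
  by rewrite ler_wpM2l ?invr_ge0 ?(ltW x20) // lact_op_norm.
have lyn n b : rnorm (lact (y ^+ n) b) <= q ^+ n * rnorm b.
  elim: n => [|n IH]; first by rewrite !expr0 lact1 mul1r.
  rewrite exprS lactM (le_trans (ly _)) // exprS -mulrA ler_wpM2l //.
pose e : cuz A := 1 - y.
have ie : in_base e.
  by have : e.2 = 1 - y.2 by []; rewrite y2 subrr.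
pose v n : cuz A := y ^+ n * e.
have iv n : in_base (v n) by exact: (idealMl alg_star_ideal).
have nv n : nrm (v n) <= nrm e * q ^+ n.
  rewrite (in_baseP (iv n)) nrm_emb mulrC.
  have -> : alg_part (v n) = lact (y ^+ n) (alg_part e).
    by apply: emb_inj; rewrite -in_baseP // lact_embE -in_baseP.
  by rewrite (in_baseP ie) nrm_emb; exact: lyn.
have sb n : \sum_(i < n) nrm e * q ^+ i <= nrm e * (1 - q)^-1.
  by rewrite -mulr_sumr ler_wpM2l ?nrm_ge0 // sum_geo_le.
have [l hl] := nsum_cvg (x := v) (c := fun n => nrm e * q ^+ n) nv sb.
have il : in_base l.
  by apply: (ideal_lim alg_star_ideal hl) => n; apply: (ideal_sum alg_star_ideal).
have lE : l = e + y * l.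
  apply: (nlim_uniq (nlim_shift hl)); apply: nlim_ext (nlimD (nlim_cst e) (nlimMl y hl)) => n.
  rewrite big_ord_recl /v expr0 mul1r mulr_sumr; congr (_ + _).
  by apply: eq_bigr => i _; rewrite exprS mulrA.
apply: (@left_unit_unital (alg_part l)) => b; pose c := b - alg_part l · b.
have cE : emb c = emb b - l * emb b by rewrite embB embM -in_baseP.
have yc : lact y c = c.
  apply: emb_inj; rewrite lact_embE cE {2}lE /e; nring.
apply/esym/eqP; rewrite -subr_eq0 -/c; apply/eqP/rnorm_eq0/eqP.
have := ly c; rewrite yc; have := rnorm_ge0 c; nra.
Qed.

(** Without a unit the two norms agree by [scalar_le_unitization]. If A has a unit u, the
    unitization is the direct sum of A and the scalars on 1 - u: the first component is approximated
    by hypothesis and the scalar is moved off 0. *)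
Lemma alg_rank0 : real_rank_zero A -> @rank0 R (cuz A).
Proof.
move=> [hu hn] x d sx d0.
have sx1 : (x.1 : A)^† = x.1 by have := congr1 fst sx.
have sx2 : conjc x.2 = x.2 by have := congr1 snd sx.
have x2R : x.2 = (complex.Re x.2)%:C.
  by move: sx2; case: (x.2) => k l [h]; congr (_ +i* _)%C => /=; lra.
have d2 : 0 < d / 2 by rewrite divr_gt0.
have [[u uu]|nu] := pselect (unital A); last first.
  have [y [sy [z [yz zy]]] ny] := hn nu x sx d d0.
  exists (y : cuz A), (z : cuz A); split=> //.
  have ny' : unitization_norm (x - y : cuz A) <= d by exact: ltW.
  by rewrite ge_max ny' (le_trans (scalar_le_unitization _ nu)).
have us : u^† = u.
  have h := (uu u^†).1; have : u^†^† = u^† by rewrite -{1}h astarM astarK h.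
  by rewrite astarK.
pose b : A := x.1 + x.2 *: u.
have sb : selfadjoint b.
  by rewrite /selfadjoint astarD astarZ sx1 us; congr (_ + _ *: _); exact: sx2.
have [b' [sb' [c [bc cb]]] nb] := hu u uu b sb (d / 2) d2.
have [l [l0 nl]] : exists l : R, l != 0 /\ `|complex.Re x.2 - l| <= d / 2.
  have [e|e] := eqVneq (complex.Re x.2) 0.
    by exists (d / 2); rewrite gt_eqF // e sub0r normrN gtr0_norm.
  by exists (complex.Re x.2); rewrite subrr normr0 ltW.
have lC : l%:C != 0 :> R[i] by rewrite fmorph_eq0.
pose y : cuz A := emb b' + l%:C *: (1 - emb u).
pose g : cuz A := emb c + (l%:C)^-1 *: (1 - emb u).
have ul z : emb u * emb z = emb z by rewrite -embM; case: (uu z) => ->.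
have ur z : emb z * emb u = emb z by rewrite -embM; case: (uu z) => _ ->.
have sU : selfadjoint (emb u) by rewrite /selfadjoint -emb_star us.
exists y, g; split.
- apply: saD; first by rewrite /selfadjoint -emb_star sb'.
  by apply: saZ; apply: saB => //; exact: sa1.
- have E b1 c1 (k1 k2 : R[i]) : k1 * k2 = 1 -> b1 · c1 = u ->
      (emb b1 + k1 *: (1 - emb u)) * (emb c1 + k2 *: (1 - emb u)) = 1.
    move=> kk bc1; rewrite mulrDl !mulrDr -embM bc1 -!scalerAl -!scalerAr scalerA kk scale1r.
    rewrite !mulrBr !mulrBl !mulr1 !mul1r ur !ul !subrr !scaler0 subr0 addr0 add0r.
    by rewrite addrC subrK.
  by split; apply: E; rewrite ?mulfV ?mulVf.
have xE : x = emb b + x.2 *: (1 - emb u).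
  apply: (etrans (surjective_pairing x)); apply: (congr2 pair).
    transitivity (b + x.2 *: (0 - u)); last by [].
    by rewrite sub0r scalerN addrK.
  transitivity (0 + x.2 * (1 - 0)); last by [].
  by rewrite subr0 mulr1 add0r.
have -> : x - y = emb (b - b') + (x.2 - l%:C) *: (1 - emb u).
  by rewrite {1}xE /y embB scalerBl opprD addrACA.
have pu : proj (1 - emb u) by apply: projC; split=> //; exact: ul.
rewrite [leRHS]splitr (le_trans (nrmD _ _)) // lerD //; first by rewrite nrm_emb ltW.
rewrite nrmZ x2R -rmorphB rnormC -[leRHS]mulr1 ler_pM ?nrm_ge0 //.
exact: proj_nrm.
Qed.

(** The elements of A approximable by sums of x r y, with coefficients in the unitization, form a
    closed ideal that contains r; by simplicity it is all of A. *)
Lemma alg_generates : simple_cstar A -> forall r, proj r -> in_base r -> r != 0 ->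
  generates in_base r.
Proof.
move=> [_ hs] r hr ir r0.
pose J : set A := [set a | forall d : R, 0 < d -> exists n (x y : nat -> cuz A),
   nrm (emb a - \sum_(i < n) x i * r * y i) <= d].
have JD a b : J a -> J b -> J (a + b).
  move=> ha hb d d0; have d2 : 0 < d / 2 by rewrite divr_gt0.
  have [n [x [y h1]]] := ha _ d2; have [m [x' [y' h2]]] := hb _ d2.
  exists (n + m)%N, (fun i => if (i < n)%N then x i else x' (i - n)%N),
    (fun i => if (i < n)%N then y i else y' (i - n)%N).
  rewrite big_split_ord /=.
  under eq_bigr => i _ do rewrite ltn_ord.
  under [X in _ - (_ + X)]eq_bigr => i _ do rewrite ltnNge leq_addr /= addKn.
  rewrite embD opprD addrACA (le_trans (nrmD _ _)) // [leRHS]splitr lerD //.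
have JM (x0 y0 : cuz A) a : J a -> J (alg_part (x0 * emb a * y0)).
  move=> ha d d0; pose K := nrm x0 * nrm y0 + 1.
  have K0 : 0 < K by rewrite ltr_wpDl // mulr_ge0 ?nrm_ge0.
  have [n [x [y h]]] := ha (d / K) (divr_gt0 d0 K0).
  exists n, (fun i => x0 * x i), (fun i => y i * y0).
  rewrite -in_baseP; last by apply: (idealMr alg_star_ideal); exact: (idealMl alg_star_ideal).
  have -> : \sum_(i < n) x0 * x i * r * (y i * y0) = x0 * (\sum_(i < n) x i * r * y i) * y0.
    by rewrite mulr_sumr mulr_suml; apply: eq_bigr => i _; rewrite !mulrA.
  rewrite -mulrBl -mulrBr (le_trans (nrmM _ _)) //.
  rewrite (le_trans (ler_wpM2r (nrm_ge0 _) (nrmM _ _))) // mulrAC.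
  move: h; rewrite ler_pdivlMr // mulrC; apply: le_trans.
  by rewrite ler_wpM2r ?nrm_ge0 // lerDl.
have J0 : J 0.
  move=> d d0; exists 0%N, (fun=> 0), (fun=> 0).
  by rewrite big_ord0 subr0 emb0 nrm0 ltW.
have [] := hs J.
- split=> //.
  + move=> a ha d d0; have d2 : 0 < d / 2 by rewrite divr_gt0.
    have dC : 0 < (d / 2)%:C :> R[i] by rewrite ltcR.
    have [b [hb]] := ha _ (nbhsx_ballx a _ dC).
    rewrite -ball_normE /ball_ /= rnormE ltcR => ab.
    have [n [x [y h]]] := hb _ d2; exists n, x, y.
    rewrite (le_trans (nrm_tri (emb b) _ _)) // [leRHS]splitr lerD //.
    by rewrite -embB nrm_emb ltW.
  + move=> k x hx; have := JM (k *: 1) 1 x hx.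
    by rewrite mulr1 -scalerAl mul1r -embZ.
  + move=> b x hx; split.
      by have := JM (emb b) 1 x hx; rewrite mulr1 -embM.
    by have := JM 1 (emb b) x hx; rewrite mul1r -embM.
- move=> JE; case/eqP: r0; rewrite (in_baseP ir).
  have : J (alg_part r).
    move=> d d0; exists 1%N, (fun=> 1), (fun=> 1).
    by rewrite big_ord1 mul1r mulr1 -in_baseP // subrr nrm0 ltW.
  by rewrite JE => /= ->.
move=> JE a d ia d0; have : J (alg_part a) by rewrite JE.
by move=> /(_ d d0)[n [x [y h]]]; exists n, x, y; rewrite -(in_baseP ia) in h.
Qed.

End Embedding.

(** * Limits of bounded real families along an ultrafilter *)

Section GeneralizedLimit.
Context {R : realType} {T : Type}.
Implicit Types (u v : T -> R).

Definition rbounded u := exists C, forall n, `|u n| <= C.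

(* The limit along an ultrafilter. *)
Lemma generalized_limit (F : set_system T) : ProperFilter F -> exists L : (T -> R) -> R,
  [/\ forall u v, rbounded u -> rbounded v -> L (fun n => u n + v n) = L u + L v,
      forall c u, rbounded u -> L (fun n => c * u n) = c * L u
    & forall u c, rbounded u -> F [set n | u n <= c] -> L u <= c].
Proof.
move=> FP; have [G [GU sG]] := ultraFilterLemma FP.
have GP : ProperFilter G by case: GU.
pose is_lim u l := forall d, 0 < d -> G [set n | `|u n - l| <= d].
have ex u : rbounded u -> exists l, is_lim u l.
  (* The limit is the supremum of the x that lie below u on a set of the ultrafilter; above it the
     ultrafilter contains the complementary set. *)
  move=> [C hC]; pose S := [set x | G [set n | x <= u n]].
  have hS : has_sup S.
    split; first by exists (- C); apply: filterS filterT => n _ /=; move: (hC n); rewrite ler_norml => /andP[].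
    exists C => x Sx; have [n /= xn] := filter_ex Sx.
    by rewrite (le_trans xn) // (le_trans (ler_norm _)).
  exists (sup S) => d d0.
  have [x Sx hx] := sup_adherent d0 hS.
  have nS : ~ S (sup S + d).
    by move=> h; have := ub_le_sup hS.2 h; rewrite leNgt ltrDl d0.
  have [//|h] := in_ultra_setVsetC [set n | sup S + d <= u n] GU.
  apply: filterS (filterI Sx h) => n /= [h1 /negP]; rewrite -ltNge => h2.
  by rewrite ler_norml; apply/andP; split; lra.
have ex' u : exists l, rbounded u -> is_lim u l.
  by have [/ex[l hl]|h] := pselect (rbounded u); [exists l | exists 0].
have [L hL] := choice ex'.
have uniq u l1 l2 : is_lim u l1 -> is_lim u l2 -> l1 = l2.
  move=> h1 h2; apply/eqP; rewrite -subr_eq0 -normr_le0; apply/ler_addgt0Pr => d d0.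
  have d2 : 0 < d / 2 by rewrite divr_gt0.
  have [n /= [e1 e2]] := filter_ex (filterI (h1 _ d2) (h2 _ d2)).
  rewrite add0r (_ : l1 - l2 = (u n - l2) - (u n - l1)); last by ring.
  by rewrite (le_trans (ler_normB _ _)) // [leRHS]splitr lerD.
exists L; split.
- move=> u v hu hv; have huv : rbounded (fun n => u n + v n).
    have [C hC] := hu; have [C' hC'] := hv; exists (C + C') => n.
    by rewrite (le_trans (ler_normD _ _)) // lerD.
  apply: (uniq (fun n => u n + v n)); first exact: hL.
  move=> d d0; have d2 : 0 < d / 2 by rewrite divr_gt0.
  apply: filterS (filterI (hL u hu _ d2) (hL v hv _ d2)) => n /= [e1 e2].
  by rewrite opprD addrACA (le_trans (ler_normD _ _)) // [leRHS]splitr lerD.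
- move=> c u hu; have huc : rbounded (fun n => c * u n).
    by have [C hC] := hu; exists (`|c| * C) => n; rewrite normrM ler_wpM2l.
  apply: (uniq (fun n => c * u n)); first exact: hL.
  move=> d d0; have c0 : 0 < `|c| + 1 by rewrite ltr_wpDl.
  apply: (filterS _ (hL u hu _ (divr_gt0 d0 c0))) => n /=.
  rewrite ler_pdivlMr // -mulrBr normrM mulrDr mulr1 mulrC; apply: le_trans.
  by rewrite lerDl.
- move=> u c hu /sG h; apply/ler_addgt0Pr => d d0.
  have [n /= [e1 e2]] := filter_ex (filterI h (hL u hu _ d0)).
  by move: e1 e2; rewrite ler_norml => ? /andP[? ?]; lra.
Qed.

End GeneralizedLimit.

Lemma ge0_realC {R : realType} (t : R) : (0 <= t%:C :> R[i]) = (0 <= t).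
Proof. by rewrite -[RHS]lecR rmorph0. Qed.

(** * Tracial states of a corner: compactness and extreme points *)

Section States.
Context {R : realType} (A : cstarAlgType R) (e : A).
Implicit Types (phi psi : A -> R[i]) (x y : cuz A) (a b : A).
Hypothesis he : projection e.
Notation E := (emb e).
Local Notation T := (tracial_states e).

Lemma emb_e_proj : proj E. Proof. exact/projection_emb. Qed.

Lemma cornerP a : corner e a <-> cor E (emb a).
Proof.
have [se ee] := emb_e_proj; split=> [h|[h1 h2]].
  have hE : emb a = E * emb a * E by rewrite -!embM h.
  by split; rewrite hE; [rewrite !mulrA ee | rewrite -(mulrA (E * emb a)) ee].
by apply: emb_inj; rewrite !embM h1 h2.
Qed.

Lemma cor_in_base x : cor E x -> in_base x.
Proof. by move=> [h _]; rewrite -h; exact: (idealMr (alg_star_ideal A)). Qed.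

Definition compress x : A := alg_part (E * x * E).
Lemma compressK x : emb (compress x) = E * x * E.
Proof. by rewrite -in_baseP //; apply: cor_in_base; exact: cor_conj emb_e_proj. Qed.
Lemma compress_corner x : corner e (compress x).
Proof. by apply/cornerP; rewrite compressK; exact: cor_conj emb_e_proj. Qed.
Lemma compress_emb a : corner e a -> compress (emb a) = a.
Proof. by move=> /cornerP[h1 h2]; apply: emb_inj; rewrite compressK h1 h2. Qed.

(** phi extended from the corner to the whole unitization by x |-> phi(e x e), so that the order and
    the norm there apply to it. *)
Definition ev phi x : R[i] := phi (compress x).

Section OneState.
Variable phi : A -> R[i].
Hypothesis hphi : T phi.

Lemma ev_lin k x y : ev phi (k *: x + y) = k * ev phi x + ev phi y.
Proof.
have [_ h _ _ _] := hphi; rewrite /ev -h; try exact: compress_corner.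
by congr (phi _); apply: emb_inj; rewrite compressK embD embZ !compressK mulrDr mulrDl -scalerAr -scalerAl.
Qed.
Lemma evD x y : ev phi (x + y) = ev phi x + ev phi y.
Proof. by rewrite -[x]scale1r ev_lin mul1r scale1r. Qed.
Lemma ev0 : ev phi 0 = 0.
Proof. by apply: (addrI (ev phi 0)); rewrite -evD !addr0. Qed.
Lemma evZ k x : ev phi (k *: x) = k * ev phi x.
Proof. by rewrite -[k *: x]addr0 ev_lin ev0 addr0. Qed.
Lemma evN x : ev phi (- x) = - ev phi x.
Proof. by rewrite -scaleN1r evZ mulN1r. Qed.
Lemma evB x y : ev phi (x - y) = ev phi x - ev phi y.
Proof. by rewrite evD evN. Qed.
Lemma ev1 : ev phi 1 = 1.
Proof.
have [_ _ _ <- _] := hphi; congr (phi _); apply: emb_inj.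
by rewrite compressK mulr1 emb_e_proj.2.
Qed.
Lemma ev_emb a : corner e a -> ev phi (emb a) = phi a.
Proof. by move=> ha; rewrite /ev compress_emb. Qed.
Lemma ev_pos x : pos x -> 0 <= ev phi x.
Proof.
move=> px; have pe := emb_e_proj.
have pE : pos (E * x * E) by rewrite -{1}pe.1; exact: pos_conj.
have [h [ph hE _]] := pos_sqrt pE.
have ch := pos_sqrt_cor pe (cor_conj x pe) ph hE.
have hc : corner e (alg_part h) by apply/cornerP; rewrite -in_baseP //; exact: cor_in_base.
have [_ _ hp _ _] := hphi; have := hp _ hc; congr (0 <= phi _).
apply: emb_inj; rewrite compressK hE embM emb_star -in_baseP; last exact: cor_in_base.
by rewrite (pos_sa ph).
Qed.
Lemma ev_real x : selfadjoint x -> ev phi x = (complex.Re (ev phi x))%:C.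
Proof.
move=> sx; have h := sa_ule_nrm sx (lexx _).
have p1 : pos ((nrm x)%:C *: 1 : cuz A) by apply: posZ; [exact: nrm_ge0 | exact: pos1].
have e1 := ev_pos h; have e2 := ev_pos p1.
have E1 : ev phi x = ev phi ((nrm x)%:C *: 1) - ev phi ((nrm x)%:C *: 1 - x).
  by rewrite -evB subKr.
rewrite RRe_real // E1; apply: rpredB; exact: ger0_real.
Qed.
Lemma ev_star x : ev phi x^† = conjc (ev phi x).
Proof.
have [x1 [x2 [_ s1 _ s2 ->]]] := cor_real_imag (@proj1 _ (cuz A)) (cor1 x).
rewrite starD starZ s1 s2 !evD !evZ (ev_real s1) (ev_real s2).
move: (complex.Re _) (complex.Re _) => p q.
by apply/eqP; rewrite eq_complex /=; apply/andP; split; apply/eqP; lra.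
Qed.
Lemma ev_bound x : `|complex.Re (ev phi x)| <= nrm x.
Proof.
have sa_b y : selfadjoint y -> complex.Re (ev phi y) <= nrm y.
  move=> sy; have := ev_pos (sa_ule_nrm sy (lexx _)).
  by rewrite evB evZ ev1 mulr1 (ev_real sy) -rmorphB ge0_realC subr_ge0.
have half y : complex.Re (ev phi y) <= nrm y.
  pose z : cuz A := (2^-1)%:C *: (y + y^†).
  have sz : selfadjoint z by apply: saZ; rewrite /selfadjoint starD starK addrC.
  have -> : complex.Re (ev phi y) = complex.Re (ev phi z).
    by rewrite evZ evD ev_star; case: (ev phi y) => p q /=; lra.
  rewrite (le_trans (sa_b z sz)) // nrmZr ?invr_ge0 // ler_pdivrMl //.
  by rewrite (le_trans (nrmD _ _)) // nrm_star; lra.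
rewrite ler_norml half andbT lerNl.
have -> : - complex.Re (ev phi x) = complex.Re (ev phi (- x)).
  by rewrite evN; case: (ev phi x).
by rewrite -[leRHS]nrmN.
Qed.
(** The extension need not be a trace; the trace property survives with e between the factors, since
    it then is that of phi on the compressions. *)
Lemma ev_trace x y : ev phi (x * E * y) = ev phi (y * E * x).
Proof.
have [_ _ _ _ ht] := hphi; have [_ ee] := emb_e_proj.
have := ht _ _ (compress_corner x) (compress_corner y).
have F u v : phi (compress u · compress v) = ev phi (u * E * v).
  congr (phi _); apply: emb_inj; rewrite embM !compressK.
  by rewrite -!mulrA (mulrA E E) ee !mulrA.
by rewrite !F.
Qed.
Lemma ev_compress x : ev phi (E * x * E) = ev phi x.
Proof.
by congr (phi _); apply: emb_inj; rewrite !compressK !mulrA emb_e_proj.2 -mulrA emb_e_proj.2.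
Qed.
End OneState.

Lemma tracial_state_ext phi psi : T phi -> T psi ->
  (forall x, complex.Re (ev phi x) = complex.Re (ev psi x)) -> phi = psi.
Proof.
move=> hp hs h; have full x : ev phi x = ev psi x.
  apply/eqP; rewrite eq_complex h eqxx /=; apply/eqP.
  have := h (- 'i%C *: x); rewrite !evZ //.
  by case: (ev phi x) (ev psi x) => p q [p' q'] /=; lra.
apply/funext => a; have [ca|nca] := pselect (corner e a).
  by rewrite -(ev_emb phi ca) -(ev_emb psi ca).
by have [h1 _ _ _ _] := hp; have [h2 _ _ _ _] := hs; rewrite h1 ?h2.
Qed.

(** Weak* compactness of the tracial states, in the form of a generalized limit of sequences: bounds
    on the real parts that hold eventually pass to the limit. *)
Lemma tracial_states_limit : exists Lim : (nat -> A -> R[i]) -> A -> R[i],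
  forall u : nat -> A -> R[i], (forall n, T (u n)) -> T (Lim u) /\
   forall x c N, (forall n, (N <= n)%N -> complex.Re (ev (u n) x) <= c) ->
    complex.Re (ev (Lim u) x) <= c.
Proof.
have [L [LD LZ Lle']] := @generalized_limit R nat _ eventually_filter.
have Lle (u : nat -> R) c N : rbounded u -> (forall n, (N <= n)%N -> u n <= c) -> L u <= c.
  by move=> hu h; apply: Lle' => //; exists N.
pose f (u : nat -> A -> R[i]) x := L (fun n => complex.Re (ev (u n) x)).
(* A complex functional is recovered from its real part f as f(a) - i f(i a); off the corner the
   value is 0 by convention. *)
exists (fun u a => if `[< corner e a >] then f u (emb a) +i* - f u ('i%C *: emb a) else 0)%C.
move=> u hu.
have bu x : rbounded (fun n => complex.Re (ev (u n) x)).
  by exists (nrm x) => n; exact: ev_bound.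
have fD x y : f u (x + y) = f u x + f u y.
  rewrite /f -LD //; congr L; apply/funext => n; rewrite evD //.
  by case: (ev (u n) x) (ev (u n) y) => ? ? [].
have fZ c x : f u (c%:C *: x) = c * f u x.
  rewrite /f -LZ //; congr L; apply/funext => n; rewrite evZ //.
  by case: (ev (u n) x) => ? ? /=; rewrite mul0r subr0.
have f_le x c N : (forall n, (N <= n)%N -> complex.Re (ev (u n) x) <= c) -> f u x <= c.
  exact: Lle.
have fN x : f u (- x) = - f u x.
  by have := fZ (-1) x; rewrite rmorphN1 scaleN1r mulN1r.
have f_ge x c : (forall n, c <= complex.Re (ev (u n) x)) -> c <= f u x.
  move=> h; rewrite -lerN2 -fN; apply: (f_le _ _ 0%N) => n _; rewrite evN //.
  by move: (h n); case: (ev (u n) x) => ? ? /=; rewrite lerN2.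
have f_eq x c : (forall n, complex.Re (ev (u n) x) = c) -> f u x = c.
  move=> h; apply: le_anti; rewrite (f_le _ _ 0%N) ?f_ge // => n; by rewrite h.
have fC x y : (forall n, complex.Re (ev (u n) x) = complex.Re (ev (u n) y)) -> f u x = f u y.
  by move=> h; rewrite /f; congr L; apply/funext.
clearbody f; set Phi := (X in T X).
have PhiE a : corner e a -> Phi a = (f u (emb a) +i* - f u ('i%C *: emb a))%C.
  by move=> ca; rewrite /Phi asboolT.
have PhiL k x y : (f u (k *: x + y) +i* - f u ('i%C *: (k *: x + y)))%C =
   k * (f u x +i* - f u ('i%C *: x))%C + (f u y +i* - f u ('i%C *: y))%C.
  have kE : k = (complex.Re k)%:C + 'i%C * (complex.Im k)%:C.
    by case: k => p q; apply/eqP; rewrite eq_complex /=; apply/andP; split; apply/eqP; lra.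
  have fk z : f u (k *: z) = complex.Re k * f u z + complex.Im k * f u ('i%C *: z).
    by rewrite {1}kE scalerDl fD fZ [_ * (complex.Im k)%:C]mulrC -scalerA fZ.
  rewrite scalerDr !fD (fk x) scalerA ['i%C * k]mulrC -scalerA fk scalerA mulii scaleN1r fN.
  by case: k {kE fk} => p q; apply/eqP; rewrite eq_complex /=; apply/andP; split; apply/eqP; lra.
have PT : T Phi.
  split.
  - by move=> a nca; rewrite /Phi asboolF.
  - move=> k a b ca cb; rewrite !PhiE //; first by rewrite embD embZ PhiL.
    by apply/cornerP; rewrite embD embZ; apply: corD; [apply: corZ|]; exact/cornerP.
  - move=> a ca; have ca' : cor E (emb a) by exact/cornerP.
    have cc : corner e (a^† · a).
      by apply/cornerP; rewrite embM emb_star; apply: corM => //; apply: cor_star => //; exact: emb_e_proj.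
    rewrite PhiE // embM emb_star.
    have px := pos_starM (emb a); set x := _ * _ in px *.
    have pr n := ev_real (hu n) (pos_sa px).
    have -> : f u ('i%C *: x) = 0.
      by apply: f_eq => n; rewrite evZ // pr /=; lra.
    rewrite oppr0 ge0_realC ?f_ge // => n.
    by have := ev_pos (hu n) px; rewrite pr ge0_realC.
  - have cE : corner e e by apply/cornerP; exact: cor_id emb_e_proj.
    have ee n : ev (u n) E = 1 by rewrite ev_emb //; case: (hu n).
    rewrite PhiE // (f_eq E 1) => [|n]; last by rewrite ee.
    rewrite (f_eq _ 0) ?oppr0 // => n; rewrite evZ // ee /=; lra.
  - move=> a b ca cb.
    have ca' : cor E (emb a) by exact/cornerP.
    have cb' : cor E (emb b) by exact/cornerP.
    have c1 : corner e (a · b) by apply/cornerP; rewrite embM; exact: corM.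
    have c2 : corner e (b · a) by apply/cornerP; rewrite embM; exact: corM.
    have tr n : ev (u n) (emb a * emb b) = ev (u n) (emb b * emb a).
      by have := ev_trace (hu n) (emb a) (emb b); rewrite ca'.2 cb'.2.
    rewrite !PhiE // !embM; congr (_ +i* - _)%C; apply: fC => n; rewrite ?evZ ?tr //.
split=> // x c N h; have -> : complex.Re (ev Phi x) = f u x; last exact: f_le h.
rewrite /ev PhiE; last exact: compress_corner.
rewrite /= compressK; apply: fC => n; exact: congr1 (ev_compress _ _).
Qed.

(** The value at b is minimized among all tracial states, then successively the values at a dense
    sequence among the states that remain. A single state is left, and it is extreme: if it is a
    proper convex combination, both components minimize at every stage as well. *)
Lemma extreme_state_le (b : cuz A) phi0 : separable A -> T phi0 ->
  exists2 phi, extreme_points T phi &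
    complex.Re (ev phi b) <= complex.Re (ev phi0 b).
Proof.
move=> [D [cD dD]] h0; have [Lim hLim] := tracial_states_limit.
have [f hf] : exists f : A -> nat, {in D &, injective f} by exact/countable_injP.
(* Enumerates the countable dense set through an injection f into the natural numbers, with 0 at
   indices outside the image. *)
pose s n : A := xget 0 [set a | D a /\ f a = n].
have sD a : D a -> s (f a) = a.
  move=> Da; rewrite /s; case: xgetP => [c _ [Dc fc]|]; last by move=> /(_ a); case.
  by apply: hf => //; rewrite inE.
pose d n : cuz A := if n is m.+1 then emb (s m) else b.
pose v phi n := complex.Re (ev phi (d n)).
(* The decreasing sequence of faces: [F n] consists of the states that minimize lexicographically at
   d_0 = b, d_1, ..., d_{n-1}. *)
pose F := fix F n phi := if n is m.+1 then F m phi /\ forall psi, F m psi -> v phi m <= v psi m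
  else T phi.
have FT n phi : F n phi -> T phi by elim: n => // n IH [/IH].
have FS n m phi : (m <= n)%N -> F n phi -> F m phi.
  elim: n => [|n IH]; first by rewrite leqn0 => /eqP ->.
  by rewrite leq_eqVlt => /predU1P[-> //|]; rewrite ltnS => /IH h [/h].
have Fcl n (u : nat -> A -> R[i]) N : (forall k, T (u k)) ->
    (forall k, (N <= k)%N -> F n (u k)) -> F n (Lim u).
  move=> uT; elim: n => [_|n IH h]; first by case: (hLim u uT).
  split; first by apply: IH => k /h[].
  move=> psi hpsi; have [_ hl] := hLim u uT; apply: (hl _ _ N) => k Nk.
  by have [_] := h k Nk; exact.
have Fne n : exists phi, F n phi.
  elim: n => [|n [phi1 h1]]; first by exists phi0.
  pose S := [set r : R | exists2 phi, F n phi & r = - v phi n].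
  have hS : has_sup S.
    split; first by exists (- v phi1 n); exists phi1.
    exists (nrm (d n)) => _ [phi /FT hphi ->].
    by have := ev_bound hphi (d n); rewrite ler_norml -/(v phi n) => /andP[]; rewrite lerNl.
  have hk k : exists phi, F n phi /\ v phi n <= - sup S + k.+1%:R^-1.
    have k0 : 0 < k.+1%:R^-1 :> R by rewrite invr_gt0.
    have [_ [phi hphi ->] h] := sup_adherent k0 hS.
    exists phi; split=> //; move: h; move: (v phi n) (sup S) (k.+1%:R^-1) => p q c h.
    by lra.
  have [u hu] := choice hk; have uT k : T (u k) by apply: FT; exact: (hu k).1.
  exists (Lim u); split; first by apply: (Fcl _ _ 0%N) => // k _; exact: (hu k).1.
  move=> psi hpsi; apply/ler_addgt0Pr => r r0.
  have [k hk'] := invS_small r0.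
  have [_ hl] := hLim u uT; apply: (hl _ _ k) => j kj; apply: le_trans (hu j).2 _.
  apply: lerD; last exact: hk' kj.
  rewrite lerNl; apply: ub_le_sup; first exact: hS.2.
  by exists psi.
have [u hu] := choice Fne; have uT k : T (u k) by exact: (FT k).
pose phi := Lim u; have Fphi n : F n phi.
  by apply: (Fcl _ _ n) => // k nk; exact: (FS _ _ _ nk (hu k)).
have Tphi := FT _ _ (Fphi 0%N).
exists phi; last by have [_ /(_ phi0 h0)] := Fphi 1%N.
split=> // phi1 phi2 t T1 T2 t01 E1.
have [t0 t1] := andP t01; have vE n : v phi n = t * v phi1 n + (1 - t) * v phi2 n.
  have h : phi (compress (d n)) =
      t%:C * phi1 (compress (d n)) + (1 - t)%:C * phi2 (compress (d n)) by rewrite [in LHS]E1.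
  rewrite /v /ev h.
  by move: (phi1 _) (phi2 _) => [p q] [p' q'] /=; lra.
have Fi n : [/\ F n phi1, F n phi2, v phi1 n = v phi n & v phi2 n = v phi n].
  elim: n => [|n [F1 F2 e1 e2]].
    have [_ h] := Fphi 1%N; have := h _ T1; have := h _ T2; have := vE 0%N.
    by split=> //; nra.
  have F1' : F n.+1 phi1 by split=> // psi hpsi; rewrite e1; have [_] := Fphi n.+1; apply.
  have F2' : F n.+1 phi2 by split=> // psi hpsi; rewrite e2; have [_] := Fphi n.+1; apply.
  have [_ h] := Fphi n.+2; have := h _ F1'; have := h _ F2'; have := vE n.+1.
  by split=> //; nra.
have key psi : T psi -> (forall n, v psi n = v phi n) -> psi = phi.
  move=> Tpsi h; apply: tracial_state_ext => // x.
  rewrite -(ev_compress psi) -(ev_compress phi) -compressK; set a := compress x.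
  apply/eqP; rewrite -subr_eq0 -normr_le0; apply/ler_addgt0Pr => r r0; rewrite add0r.
  have r2 : 0 < r / 2 by rewrite divr_gt0.
  have rC : 0 < (r / 2)%:C :> R[i] by rewrite ltcR.
  have [c [cb Dc]] : ball a (r / 2)%:C `&` D !=set0.
    apply: dD; last exact: ball_open.
    by exists a; exact: ballxx.
  have nc : nrm (emb a - emb c) <= r / 2.
    by move: cb; rewrite -ball_normE /ball_ /= rnormE ltcR -embB nrm_emb => /ltW.
  have hc := h (f c).+1; rewrite /v /= sD // in hc.
  have b1 := ev_bound Tpsi (emb a - emb c); have b2 := ev_bound Tphi (emb a - emb c).
  rewrite !evB // in b1 b2; move: b1 b2 hc.
  move: (ev psi _) (ev phi _) (ev psi _) (ev phi _) => [p1 q1] [p2 q2] [p3 q3] [p4 q4] /=.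
  rewrite !ler_norml => /andP[? ?] /andP[? ?] ?; apply/andP; split; lra.
by split; apply: key => // n; case: (Fi n).
Qed.

End States.

(** * Approximate units of projections *)

Section ApproximateUnit.
Context {R : realType} (A : cstarAlgType R).
Implicit Types (x y p : cuz A).
Hypothesis rr0 : @rank0 R (cuz A).
Let hI := alg_star_ideal A.

(** [range_cutoff] absorbs (1 - p) u_n into a larger projection up to 1 / (n + 1); so the increasing
    projections act as a unit on the u_n in the limit, hence on every x = lim u_n x. *)
Lemma approx_unit_proj : sigma_unital A -> exists P : nat -> cuz A,
  [/\ P 0%N = 0, forall n, proj (P n) /\ in_base (P n),
      forall n, P n.+1 * P n = P n
    & forall x, in_base x -> nlim (fun n => P n * x) x].
Proof.
move=> [u [hu _ ulim]].
pose good p := proj p /\ in_base p.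
have step n p : good p -> exists p', good p' /\
    p' * p = p /\ nrm ((1 - p') * emb (u n)) <= n.+1%:R^-1.
  move=> [hp ip]; have d0 : 0 < n.+1%:R^-1 :> R by rewrite invr_gt0.
  have [f [w [hf fE nf]]] := range_cutoff rr0 ((1 - p) * emb (u n)) d0.
  have pf : p * f = 0 by rewrite fE !mulrA (proj_mulpC hp) !mul0r.
  have fp := proj_mulC0 hp hf pf.
  have if_ : in_base f.
    rewrite fE; apply: (idealMl hI); apply: (idealMl hI); apply: (ideal_star hI).
    exact: (idealMl hI).
  exists (p + f); split; first by split; [exact: projD | exact: (idealD hI)].
  split; first by rewrite mulrDl hp.2 fp addr0.
  move: nf; rewrite mulrA (_ : (1 - f) * (1 - p) = 1 - (p + f)) //.
  by rewrite mulrBr mulr1 mulrBl mul1r fp; nring.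
have g0 : good 0 by split; [exact: proj0 | exact: (ideal0 hI)].
have [P [P0 hP]] := dependent_sequence g0 step.
exists P; split=> // [n|n|x ix]; first by case: (hP n).
  by case: (hP n) => _ [].
have PP n m : (n <= m)%N -> P m * P n = P n.
  elim: m => [|m IH]; first by rewrite leqn0 => /eqP ->; case: (hP 0%N) => [[[]]].
  rewrite leq_eqVlt => /predU1P[->|]; first by case: (hP m.+1) => [[[]]].
  by rewrite ltnS => /IH h; rewrite -h mulrA; case: (hP m) => _ [-> _].
move=> d d0.
pose K := nrm x + 1; have K0 : 0 < K by rewrite ltr_wpDl ?nrm_ge0.
have d2 : 0 < d / 2 by rewrite divr_gt0.
have d3 : 0 < d / 2 / K by rewrite divr_gt0.
have [n1 hn1] : exists n1, forall n, (n1 <= n)%N -> nrm (x - emb (u n) * x) <= d / 2.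
  have [h _] := ulim (alg_part x).
  have dC : 0 < (d / 2)%:C :> R[i] by rewrite ltcR.
  have [n1 _ hn] := (cvgrPdist_le _ _).1 h _ dC.
  exists n1 => n n1n; have := hn n n1n.
  by rewrite /= rnormE lecR -nrm_emb embB embM -in_baseP.
have [n2 hn2] := invS_small d3.
pose n := maxn n1 n2; exists n.+1 => m nm.
have [[hPm _] _] := hP m.
have E : (1 - P m) * (1 - P n.+1) = 1 - P m.
  by rewrite mulrBr mulr1 mulrBl mul1r PP // subrr subr0.
rewrite nrmC -{1}(mul1r x) -mulrBl.
have -> : (1 - P m) * x = (1 - P m) * (x - emb (u n) * x) +
    (1 - P m) * ((1 - P n.+1) * emb (u n)) * x.
  by rewrite (mulrA _ (1 - P n.+1)) E mulrBr -!mulrA subrK.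
rewrite [leRHS]splitr (le_trans (nrmD _ _)) // lerD //.
  apply: le_trans (nrmM _ _) _; rewrite -[leRHS]mul1r ler_pM ?nrm_ge0 ?hn1 ?leq_maxl //.
  exact: proj_nrm (projC hPm).
apply: le_trans (nrmM _ _) _.
have h : nrm ((1 - P m) * ((1 - P n.+1) * emb (u n))) <= d / 2 / K.
  apply: le_trans (nrmM _ _) _; rewrite -[leRHS]mul1r ler_pM ?nrm_ge0 //.
    exact: proj_nrm (projC hPm).
  by case: (hP n) => _ [_ h]; rewrite (le_trans h) // hn2 // leq_maxr.
apply: le_trans (ler_wpM2r (nrm_ge0 x) h) _.
by rewrite mulrAC ler_pdivrMr // ler_wpM2l ?(ltW d2) // lerDl.
Qed.

(** e is full by simplicity, so each increment P_{k+1} - P_k is a finite sum of z^† z with z = e z.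
    This frame carries a trace on eAe over to A as x |-> sum phi(z x z^† ). *)
Lemma corner_frame (e : A) : sigma_unital A -> simple_cstar A -> projection e -> e != 0 ->
  exists (P : nat -> cuz A) (N : nat -> nat) (z : nat -> nat -> cuz A),
  [/\ forall n, proj (P n) /\ in_base (P n),
      forall x, in_base x -> nlim (fun n => P n * x) x,
      forall n, P n.+1 * P n = P n, forall k i, emb e * z k i = z k i
    & forall n, P n = \sum_(k < n) \sum_(i < N k) (z k i)^† * z k i].
Proof.
move=> hs hsim he e0; have [P [P0 hP PS Plim]] := approx_unit_proj hs.
have hE := (projection_emb e).1 he.
have E0 : emb e != 0 by apply: contra_neq e0 => h; exact: (@emb_inj _ A e 0 h).
have hz k : exists Nz : nat * (nat -> cuz A), (forall i, emb e * Nz.2 i = Nz.2 i) /\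
    P k.+1 - P k = \sum_(i < Nz.1) (Nz.2 i)^† * Nz.2 i.
  have [h1 i1] := hP k; have [h2 i2] := hP k.+1.
  have hq := proj_compl h1 h2 (PS k).
  have [n [z [h3 h4]]] := fullness hE (in_base_emb e) (alg_generates hsim hE (in_base_emb e) E0)
    hq (idealB hI i2 i1).
  by exists (n, z); split=> // i; case: (h3 i).
have [Nz hNz] := choice hz.
exists P, (fun k => (Nz k).1), (fun k => (Nz k).2); split=> //.
  by move=> k i; case: (hNz k) => ->.
elim=> [|n IH]; first by rewrite big_ord0 P0.
by rewrite big_ord_recr /= -IH; case: (hNz n) => _ <-; rewrite addrC subrK.
Qed.

End ApproximateUnit.

(** * Weights as suprema of increasing functionals *)

Section SupWeight.
Context {R : realType} {V : starLmodType R[i]}.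
Implicit Types (x y : V) (S : nat -> V -> R).

Definition sup_weight S x : \bar R :=
  if `[< positive x >] then ereal_sup (range (fun n => (S n x)%:E)) else 0%E.

Variable S : nat -> V -> R.
Hypothesis S_ge0 : forall n x, positive x -> 0 <= S n x.
Hypothesis S_mono : forall n x, positive x -> S n x <= S n.+1 x.

Lemma sup_weightE x : positive x -> sup_weight S x = ereal_sup (range (fun n => (S n x)%:E)).
Proof. by move=> px; rewrite /sup_weight asboolT. Qed.

Lemma sup_weight_ub n x : positive x -> ((S n x)%:E <= sup_weight S x)%E.
Proof. by move=> px; rewrite sup_weightE //; apply: ereal_sup_ubound; exists n. Qed.

Lemma sup_weight_le x c : positive x -> (forall n, ((S n x)%:E <= c)%E) ->
  (sup_weight S x <= c)%E.
Proof. by move=> px h; rewrite sup_weightE //; apply: ge_ereal_sup => _ [n _ <-]. Qed.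

Lemma S_le n m x : positive x -> (n <= m)%N -> S n x <= S m x.
Proof.
move=> px; elim: m => [|m IH]; first by rewrite leqn0 => /eqP ->.
rewrite leq_eqVlt => /predU1P[-> //|]; rewrite ltnS => /IH h.
exact: le_trans h (S_mono m px).
Qed.

Lemma sup_weight_cvg x : positive x ->
  (fun n => (S n x)%:E) @ \oo --> sup_weight S x.
Proof.
move=> px; rewrite sup_weightE //; apply: ereal_nondecreasing_cvgn => n m nm.
by rewrite lee_fin S_le.
Qed.

Hypothesis posD : forall x y, positive x -> positive y -> positive (x + y).
Hypothesis posZ : forall (t : R) x, 0 <= t -> positive x -> positive (t%:C *: x).
Hypothesis pos_mulstar : forall x, positive (x · x^†) /\ positive (x^† · x).
Hypothesis S_D : forall n x y, S n (x + y) = S n x + S n y.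
Hypothesis S_Z : forall n (t : R) x, S n (t%:C *: x) = t * S n x.
Hypothesis S_trace : forall n x d, 0 < d ->
  (exists m, S n (x · x^†) <= S m (x^† · x) + d) /\
  (exists m, S n (x^† · x) <= S m (x · x^†) + d).

(** Additivity and homogeneity pass to the limit of an increasing sequence. The trace identity is
    only required up to d and a change of index, both of which disappear in the supremum. *)
Lemma sup_weight_tracial : tracial_weight (sup_weight S).
Proof.
split.
- move=> x px; apply: le_trans (sup_weight_ub 0 px); rewrite lee_fin; exact: S_ge0.
- by move=> x npx; rewrite /sup_weight asboolF.
- move=> x y px py; have pxy := posD px py.
  have h1 := sup_weight_cvg pxy.
  have h2 : (fun n => (S n (x + y))%:E) @ \oo --> (sup_weight S x + sup_weight S y)%E.
    rewrite (_ : (fun n => _) = (fun n => ((S n x)%:E + (S n y)%:E)%E)).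
      apply: cvgeD; [apply: ge0_adde_def|exact: sup_weight_cvg|exact: sup_weight_cvg].
        rewrite inE; apply: le_trans (sup_weight_ub 0 px); rewrite lee_fin; exact: S_ge0.
      rewrite inE; apply: le_trans (sup_weight_ub 0 py); rewrite lee_fin; exact: S_ge0.
    by apply/funext => n; rewrite S_D EFinD.
  exact: cvg_unique h1 h2.
- move=> t x t0 px; have ptx := posZ t0 px.
  have h1 := sup_weight_cvg ptx.
  have h2 : (fun n => (S n (t%:C *: x))%:E) @ \oo --> (t%:E * sup_weight S x)%E.
    rewrite (_ : (fun n => _) = (fun n => (t%:E * (S n x)%:E)%E)).
      by apply: cvgeZl => //; exact: sup_weight_cvg.
    by apply/funext => n; rewrite S_Z EFinM.
  exact: cvg_unique h1 h2.
- move=> x; have [p1 p2] := pos_mulstar x; apply: le_anti; apply/andP; split.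
    apply: sup_weight_le => // n; apply/lee_addgt0Pr => d d0.
    have [[m hm] _] := S_trace n x d0.
    apply: le_trans (_ : _ <= (S m (x^† · x) + d)%:E)%E _; first by rewrite lee_fin.
    by rewrite EFinD leeD2r // sup_weight_ub.
  apply: sup_weight_le => // n; apply/lee_addgt0Pr => d d0.
  have [_ [m hm]] := S_trace n x d0.
  apply: le_trans (_ : _ <= (S m (x · x^†) + d)%:E)%E _; first by rewrite lee_fin.
  by rewrite EFinD leeD2r // sup_weight_ub.
Qed.

End SupWeight.

(** * The extension of a tracial state to a weight *)

Section TraceWeight.
Context {R : realType} (A : cstarAlgType R) (e : A).
Implicit Types (phi psi : A -> R[i]) (x y w : cuz A) (a b p q : A).
Hypothesis he : projection e.
Notation E := (emb e).
Local Notation T := (tracial_states e).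
Let hI := alg_star_ideal A.

Definition re phi x : R := complex.Re (ev e phi x).

Section OneState.
Variable phi : A -> R[i].
Hypothesis hphi : T phi.
Local Notation f := (re phi).

Lemma reD x y : f (x + y) = f x + f y.
Proof. by rewrite /re evD //; case: (ev e phi x) (ev e phi y) => ? ? []. Qed.
Lemma reZ (t : R) x : f (t%:C *: x) = t * f x.
Proof. by rewrite /re evZ //; case: (ev e phi x) => ? ? /=; rewrite mul0r subr0. Qed.
Lemma re0 : f 0 = 0. Proof. by rewrite /re ev0. Qed.
Lemma reN x : f (- x) = - f x.
Proof. by rewrite /re evN //; case: (ev e phi x). Qed.
Lemma reB x y : f (x - y) = f x - f y. Proof. by rewrite reD reN. Qed.
Lemma re_sum (J : Type) (r : seq J) (P : pred J) (F : J -> cuz A) :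
  f (\sum_(i <- r | P i) F i) = \sum_(i <- r | P i) f (F i).
Proof. by apply: (big_morph f); [exact: reD | exact: re0]. Qed.
Lemma re_pos x : pos x -> 0 <= f x.
Proof.
move=> px; have := ev_pos he hphi px.
by rewrite (ev_real he hphi (pos_sa px)) ge0_realC.
Qed.
Lemma re_mono x y : x ⊑ y -> f x <= f y.
Proof. by move=> h; rewrite -subr_ge0 -reB; exact: re_pos. Qed.
Lemma re_trace x y : f (x * E * y) = f (y * E * x).
Proof. by rewrite /re ev_trace. Qed.
Lemma re_bound x : `|f x| <= nrm x. Proof. exact: ev_bound. Qed.
Lemma re_corner a : corner e a -> f (emb a) = complex.Re (phi a).
Proof. by move=> ca; rewrite /re ev_emb. Qed.
Lemma re_one : f E = 1.
Proof.
have ce : corner e e by apply/(cornerP he); exact: cor_id (emb_e_proj he).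
by rewrite re_corner //; case: hphi => _ _ _ -> _.
Qed.

Variables (P : nat -> cuz A) (N : nat -> nat) (z : nat -> nat -> cuz A).
Hypothesis hP : forall n, proj (P n) /\ in_base (P n).
Hypothesis Plim : forall x, in_base x -> nlim (fun n => P n * x) x.
Hypothesis hz : forall k i, E * z k i = z k i.
Hypothesis PE : forall n, P n = \sum_(k < n) \sum_(i < N k) (z k i)^† * z k i.

(** For the trace tau to be constructed, tau(z x z^† ) = tau(x z^† z), so heuristically this is
    tau(x P_n). *)
Definition psum n x : R := \sum_(k < n) \sum_(i < N k) f (z k i * x * (z k i)^†).

Lemma psumD n x y : psum n (x + y) = psum n x + psum n y.
Proof.
rewrite /psum -big_split; apply: eq_bigr => k _ /=; rewrite -big_split; apply: eq_bigr => i _ /=.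
by rewrite mulrDr mulrDl reD.
Qed.
Lemma psumZ n (t : R) x : psum n (t%:C *: x) = t * psum n x.
Proof.
rewrite /psum mulr_sumr; apply: eq_bigr => k _; rewrite mulr_sumr; apply: eq_bigr => i _.
by rewrite -scalerAr -scalerAl reZ.
Qed.
Lemma psum0 n : psum n 0 = 0.
Proof. by rewrite -(scale0r (0 : cuz A)) -[X in X *: _](rmorph0 (real_complex R)) psumZ mul0r. Qed.
Lemma psumB n x y : psum n (x - y) = psum n x - psum n y.
Proof. by rewrite psumD -scaleN1r -(rmorphN1 (real_complex R)) psumZ mulN1r. Qed.
Lemma psum_sum n (J : Type) (r : seq J) (Q : pred J) (F : J -> cuz A) :
  psum n (\sum_(i <- r | Q i) F i) = \sum_(i <- r | Q i) psum n (F i).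
Proof. by apply: (big_morph (psum n)); [exact: psumD | exact: psum0]. Qed.
Lemma psum_pos n x : pos x -> 0 <= psum n x.
Proof.
move=> px; rewrite sumr_ge0 // => k _; rewrite sumr_ge0 // => i _.
by apply: re_pos; rewrite -{1}[z k i]starK; exact: pos_conj.
Qed.
Lemma psum_le n x y : x ⊑ y -> psum n x <= psum n y.
Proof. by move=> h; rewrite -subr_ge0 -psumB; exact: psum_pos. Qed.
Lemma psum_mono n x : pos x -> psum n x <= psum n.+1 x.
Proof.
move=> px; rewrite /psum big_ord_recr /= lerDl sumr_ge0 // => i _.
by apply: re_pos; rewrite -{1}[z n i]starK; exact: pos_conj.
Qed.
Lemma psum_bound n : exists2 C, 0 <= C & forall x, `|psum n x| <= C * nrm x.
Proof.
exists (\sum_(k < n) \sum_(i < N k) nrm (z k i) ^+ 2).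
  by apply: sumr_ge0 => k _; apply: sumr_ge0 => i _; exact: sqr_ge0.
move=> x; apply: le_trans (ler_norm_sum _ _ _) _; rewrite mulr_suml; apply: ler_sum => k _.
apply: le_trans (ler_norm_sum _ _ _) _; rewrite mulr_suml; apply: ler_sum => i _.
apply: le_trans (re_bound _) _; apply: le_trans (nrmM _ _) _; rewrite nrm_star expr2 mulrAC.
by rewrite ler_wpM2r ?nrm_ge0 // nrmM.
Qed.

Lemma psum_swap1 n w x y : E * w = w ->
  psum n (x * (w^† * w) * y) = f (w * (y * P n * x) * w^†).
Proof.
move=> Ew; have wE := star_absorb (emb_e_proj he) Ew.
rewrite PE !mulr_sumr !mulr_suml !mulr_sumr mulr_suml re_sum; apply: eq_bigr => k _.
rewrite !mulr_sumr !mulr_suml !mulr_sumr mulr_suml re_sum; apply: eq_bigr => i _.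
have zE := star_absorb (emb_e_proj he) (hz k i).
transitivity (f ((z k i * x * w^†) * E * (w * y * (z k i)^†))).
  by congr f; rewrite -[w^† in RHS]wE -!mulrA (mulrA E E) (emb_e_proj he).2 (mulrA E w) Ew.
rewrite re_trace; congr f.
by rewrite -!mulrA (mulrA E (z k i)) hz.
Qed.

Lemma psum_family n n0 (y : nat -> cuz A) x x' : (forall i, E * y i = y i) ->
  psum n (x * (\sum_(i < n0) (y i)^† * y i) * x') =
  \sum_(i < n0) f (y i * (x' * P n * x) * (y i)^†).
Proof.
move=> hy; rewrite mulr_sumr mulr_suml psum_sum; apply: eq_bigr => i _.
exact: psum_swap1.
Qed.

(** Heuristically tau(x P_m y P_n) = tau(y P_n x P_m): the trace property in a form that holds
    exactly, since with projections of the frame between the factors both sides are the same finite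
    sum of values of phi. *)
Lemma psum_swap n m x y : psum n (x * P m * y) = psum m (y * P n * x).
Proof.
rewrite PE mulr_sumr mulr_suml psum_sum; apply: eq_bigr => k _.
exact: (psum_family n (N k) x y (hz k)).
Qed.

Lemma P_conj_le n x : x^† * P n * x ⊑ x^† * x.
Proof.
have [hp _] := hP n.
by have := ule_conj x (proj_le1 hp); rewrite mulr1.
Qed.

Lemma P_conj_lim x : in_base x -> nlim (fun n => x^† * P n * x) (x^† * x).
Proof. by move=> ix; apply: nlim_ext (nlimMl x^† (Plim ix)) => n; rewrite mulrA. Qed.

Definition trace_weight : A -> \bar R := sup_weight (fun n a => psum n (emb a)).

Let S_ge0 n a : positive a -> 0 <= psum n (emb a).
Proof. by move=> /positive_emb; exact: psum_pos. Qed.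
Let S_mono n a : positive a -> psum n (emb a) <= psum n.+1 (emb a).
Proof. by move=> /positive_emb; exact: psum_mono. Qed.

Lemma trace_weight_ub n a : positive a -> ((psum n (emb a))%:E <= trace_weight a)%E.
Proof. exact: sup_weight_ub. Qed.
Lemma trace_weight_le a c : positive a -> (forall n, ((psum n (emb a))%:E <= c)%E) ->
  (trace_weight a <= c)%E.
Proof. exact: sup_weight_le. Qed.

(** P_m is inserted between x and x^† at the cost of d; then [psum_swap] turns x P_m x^† into x^†
    P_n x, which is at most x^† x. *)
Lemma psum_trace_le n x d : in_base x -> 0 < d ->
  exists m, psum n (x * x^†) <= psum m (x^† * x) + d.
Proof.
move=> ix d0; have [C C0 hC] := psum_bound n.
have C1 : 0 < C + 1 by rewrite ltr_wpDl.
have [m hm] := P_conj_lim (ideal_star hI ix) (divr_gt0 d0 C1).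
rewrite starK in hm; have {hm} := hm m (leqnn m); rewrite nrmC => hm.
exists m.
have h1 : psum n (x * x^†) - psum n (x * P m * x^†) <= d.
  rewrite -psumB (le_trans (ler_norm _)) // (le_trans (hC _)) //.
  apply: le_trans (ler_wpM2l C0 hm) _; rewrite mulrCA ler_piMr ?(ltW d0) //.
  by rewrite ler_pdivrMr // mul1r lerDl.
have h2 : psum n (x * P m * x^†) <= psum m (x^† * x).
  by rewrite psum_swap; apply: psum_le; exact: P_conj_le.
by move: h1 h2; lra.
Qed.

Lemma trace_weight_tracial : tracial_weight trace_weight.
Proof.
apply: (sup_weight_tracial S_ge0 S_mono).
- by move=> a b /positive_emb pa /positive_emb pb; apply/positive_emb; rewrite embD; exact: posD.
- by move=> t a t0 /positive_emb pa; apply/positive_emb; rewrite embZ; exact: posZ.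
- by move=> a; split; [exists a^†; rewrite astarK | exists a].
- by move=> n a b; rewrite embD psumD.
- by move=> n t a; rewrite embZ psumZ.
move=> n a d d0; rewrite !embM emb_star; split; first exact: psum_trace_le.
have := psum_trace_le n (ideal_star hI (in_base_emb a)) d0.
by rewrite starK.
Qed.

(** Evaluates the weight by finitely many values of phi. Applied to a decomposition of a projection
    Q, which x may absorb, it shows that the weight is finite on the corner of Q. *)
Lemma trace_weight_family n0 (y : nat -> cuz A) x : in_base x -> (forall i, E * y i = y i) ->
  (forall i, in_base (y i)) ->
  trace_weight (alg_part (x * (\sum_(i < n0) (y i)^† * y i) * x^†)) =
  (\sum_(i < n0) f (y i * (x^† * x) * (y i)^†))%:E.
Proof.
move=> ix hy iy; set K := \sum_(i < n0) _; set a := alg_part _.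
have iK : in_base (x * K * x^†) by apply: (idealMr hI); exact: (idealMr hI).
have aE : emb a = x * K * x^† by rewrite -in_baseP.
have pa : positive a.
  apply/positive_emb; rewrite aE -{1}[x]starK; apply: pos_conj; apply: pos_sum => i _.
  exact: pos_starM.
apply: le_anti; apply/andP; split.
  apply: trace_weight_le => // n; rewrite lee_fin aE psum_family //; apply: ler_sum => i _.
  apply: re_mono; have := ule_conj (y i)^† (P_conj_le n x); by rewrite starK.
apply/lee_addgt0Pr => d d0.
pose c : R := \sum_(i < n0) nrm (y i) ^+ 2.
have c0 : 0 <= c by apply: sumr_ge0 => i _; exact: sqr_ge0.
have c1 : 0 < c + 1 by rewrite ltr_wpDl.
have [n hn] := P_conj_lim ix (divr_gt0 d0 c1); have {hn} := hn n (leqnn n); rewrite nrmC => hn.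
apply: le_trans (_ : _ <= (psum n (emb a) + d)%:E)%E _; last first.
  by rewrite EFinD leeD2r // trace_weight_ub.
rewrite lee_fin aE psum_family // -lerBlDl -sumrB.
apply: le_trans (_ : \sum_(i < n0) nrm (y i) ^+ 2 * (d / (c + 1)) <= _).
  apply: ler_sum => i _; rewrite -reB -mulrBl -mulrBr (le_trans (ler_norm _)) //.
  apply: le_trans (re_bound _) _; apply: le_trans (nrmM _ _) _; rewrite nrm_star expr2 mulrAC.
  rewrite ler_wpM2r ?nrm_ge0 //; apply: le_trans (nrmM _ _) _.
  by rewrite ler_wpM2l ?nrm_ge0.
rewrite -mulr_suml -/c mulrCA ler_piMr ?(ltW d0) // ler_pdivrMr // mul1r lerDl.
exact: ler01.
Qed.

Lemma trace_weight_corner a : corner e a -> positive a ->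
  trace_weight a = (complex.Re (phi a))%:E.
Proof.
move=> ca pa; have cE := (cornerP he a).1 ca.
have [h [ph hE _]] := pos_sqrt ((positive_emb a).1 pa).
have ch := pos_sqrt_cor (emb_e_proj he) cE ph hE; have ih := cor_in_base ch.
have := @trace_weight_family 1 (fun=> E) h ih (fun=> (emb_e_proj he).2) (fun=> in_base_emb e).
rewrite !big_ord1 (emb_e_proj he).1 (emb_e_proj he).2 (pos_sa ph) ch.2 -hE alg_partK => ->.
by rewrite cE.1 cE.2 re_corner.
Qed.

(** The weight is lower semicontinuous as a supremum of norm-continuous functionals, and semifinite
    because the elements x P_n have finite weight and are dense. *)
Lemma trace_weight_semifinite : semifinite_tracial_weights trace_weight.
Proof.
have ce : corner e e by apply/(cornerP he); exact: cor_id (emb_e_proj he).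
have pe : positive e by apply/positive_emb; apply: proj_pos; exact: emb_e_proj.
split.
- exact: trace_weight_tracial.
- exists e => //; rewrite trace_weight_corner //.
  by case: hphi => _ _ _ -> _; rewrite /= eqe oner_eq0.
- move=> x c cx.
  (* Off the cone the point is isolated in the subspace topology, so the singleton is a
     neighbourhood. *)
  have [px|npx] := pselect (positive (x : A)); last first.
    exists [set x]; last by move=> _ ->.
    have -> : nbhs x = globally [set x] by exact: (esym (nbhs_subspace_out (A := (positive : set A)) npx)).
    by move=> _ ->.
  have [n hn] : exists n, c < psum n (emb (x : A)).
    apply: contrapT => h; move: cx; rewrite ltNge => /negP; apply.
    apply: trace_weight_le => // n; rewrite lee_fin leNgt; apply/negP => h'.
    by apply: h; exists n.
  have [C C0 hC] := psum_bound n.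
  have C1 : 0 < C + 1 by rewrite ltr_wpDl.
  pose d := (psum n (emb (x : A)) - c) / (C + 1).
  have d0 : 0 < d by rewrite divr_gt0 // subr_gt0.
  have dC : 0 < d%:C :> R[i] by rewrite ltcR.
  exists (ball (x : A) d%:C `&` positive).
    have -> : nbhs x = within positive (nbhs (x : A)) by rewrite nbhs_subspace_in.
    rewrite /within /=; apply: filterS (nbhsx_ballx (x : A) _ dC) => y hy py; split=> //.
  move=> y [+ py]; rewrite -ball_normE /ball_ /= rnormE ltcR => xy.
  apply: lt_le_trans (trace_weight_ub n py); rewrite lte_fin.
  have := hC (emb (x : A) - emb y); rewrite -embB nrm_emb => h1.
  have h2 : C * rnorm (x - y : A) <= C * d by rewrite ler_wpM2l // ltW.
  have h3 : C * d < psum n (emb (x : A)) - c.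
    rewrite /d mulrA ltr_pdivrMr // mulrC ltr_pM2l ?subr_gt0 // ltrDl.
    exact: ltr01.
  have h4 := le_trans (ler_norm _) h1; rewrite embB psumB in h4.
  by move: h4 h2 h3; lra.
- move=> O [x Ox] oO.
  have [d d0 hd] : exists2 d : R, 0 < d & ball x d%:C `<=` O.
    have /nbhs_ballP[d d0 hd] := open_nbhs_nbhs (conj oO Ox).
    have [dE dR] := complexR_gt0 d0.
    by exists (complex.Re d) => //; rewrite -dE.
  have ixs : in_base (emb x)^† by exact: (ideal_star hI).
  have d2 : 0 < d / 2 by rewrite divr_gt0.
  have [n hn] := Plim ixs d2; have {hn} hn := hn n (leqnn n).
  have [[sp pp] ip] := hP n.
  exists (alg_part (emb x * P n)).
  have aE : emb (alg_part (emb x * P n)) = emb x * P n.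
    by rewrite -in_baseP //; exact: (idealMl hI).
  split.
    apply: hd; rewrite -ball_normE /ball_ /= rnormE ltcR -nrm_emb embB aE.
    rewrite -nrm_star starB starM sp nrmC (le_lt_trans hn) //.
    by rewrite ltr_pdivrMr // ltr_pMr // ltr1n.
  set a := alg_part _ in aE *.
  apply: le_lt_trans (_ : ((nrm (emb x) ^+ 2 * psum n 1)%:E < +oo)%E); last exact: ltry.
  apply: trace_weight_le; first by exists a.
  move=> m; rewrite lee_fin embM emb_star aE starM sp.
  apply: le_trans (_ : psum m ((nrm (emb x) ^+ 2)%:C *: P n) <= _).
    apply: psum_le.
    have h : (emb x)^† * emb x ⊑ (nrm (emb x) ^+ 2)%:C *: 1.
      by apply: sa_ule_nrm; [exact: pos_sa (pos_starM _) | rewrite nrm_starM].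
    have := ule_conj (P n) h; rewrite sp -!scalerAr mulr1 -scalerAl pp.
    by rewrite !mulrA.
  rewrite psumZ ler_wpM2l ?sqr_ge0 //.
  (* [psum m (P n)] equals [psum n (P m)], which is at most [psum n 1]: a bound independent of m. *)
  have := psum_swap m n 1 1; rewrite !mul1r !mulr1 => ->.
  apply: psum_le; exact: (proj_le1 (hP m).1).
Qed.

(** With h the root of a, h P_n h is a finite sum of F^† F with F = z h, and F F^† lies in the
    corner, so tau(h P_n h) is determined by phi and equals the n-th partial sum. Monotonicity and
    lower semicontinuity identify tau(a) with the supremum. *)
Lemma trace_weight_unique (tau : A -> \bar R) : semifinite_tracial_weights tau ->
  (forall a, corner e a -> positive a -> tau a = (complex.Re (phi a))%:E) ->
  tau = trace_weight.
Proof.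
move=> [[t_ge0 t_off tD tZ tC] _ lsc _] hc; apply/funext => a.
have [pa|npa] := pselect (positive a); last by rewrite t_off // /trace_weight /sup_weight asboolF.
have p0 : positive (0 : A) by apply/positive_emb; rewrite emb0; exact: pos0.
have t0 : tau 0 = 0%E.
  by have := tZ 0 0 (lexx _) p0; rewrite scaler0 mul0e.
have tsum (J : Type) (r : seq J) (F : J -> A) :
    tau (\sum_(i <- r) (F i)^† · F i) = (\sum_(i <- r) tau (F i · (F i)^†))%E /\
    positive (\sum_(i <- r) (F i)^† · F i).
  elim: r => [|i r [IH IP]]; first by rewrite !big_nil t0.
  have pi : positive ((F i)^† · F i) by exists (F i).
  rewrite !big_cons tD // IH -tC; split=> //.
  by apply/positive_emb; rewrite embD; apply: posD; apply/positive_emb.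
have tmono a1 a2 : positive a1 -> positive a2 -> emb a1 ⊑ emb a2 -> (tau a1 <= tau a2)%E.
  move=> p1 p2 h; have pb : positive (a2 - a1) by apply/positive_emb; rewrite embB.
  rewrite -(subrK a1 a2) tD // leeDr //; exact: t_ge0.
have [h [ph hE _]] := pos_sqrt ((positive_emb a).1 pa).
have sh := pos_sa ph.
have ih : in_base h.
  have : in_base (h * h) by rewrite -hE.
  by rewrite /in_base /= => /eqP; rewrite mulf_eq0 orbb => /eqP.
pose s n := alg_part (h * P n * h).
have sE n : emb (s n) = h * P n * h by rewrite -in_baseP //; exact: (idealMl hI).
have ps n : positive (s n).
  by apply/positive_emb; rewrite sE -{1}sh; apply: pos_conj; exact: (proj_pos (hP n).1).
have ts n : tau (s n) = (psum n (emb a))%:E.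
  pose J := [seq (k, i) | k <- iota 0 n, i <- iota 0 (N k)].
  have sumJ (W : zmodType) (G : nat -> nat -> W) :
      \sum_(j <- J) G j.1 j.2 = \sum_(k < n) \sum_(i < N k) G k i.
    rewrite big_allpairs_dep /= -{1}(subn0 n) -/(index_iota 0 n) big_mkord.
    by apply: eq_bigr => k _; rewrite -{1}(subn0 (N k)) -/(index_iota 0 (N k)) big_mkord.
  pose F (j : nat * nat) : A := alg_part (z j.1 j.2 * h).
  have FE j : emb (F j) = z j.1 j.2 * h by rewrite -in_baseP //; exact: (idealMl hI).
  have -> : s n = \sum_(j <- J) (F j)^† · F j.
    apply: emb_inj; rewrite sE emb_sum.
    rewrite (eq_bigr (fun j => h * ((z j.1 j.2)^† * z j.1 j.2) * h)).
      rewrite (sumJ _ (fun k i => h * ((z k i)^† * z k i) * h)) PE mulr_sumr mulr_suml.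
      by apply: eq_bigr => k _; rewrite mulr_sumr mulr_suml.
    by move=> j _; rewrite embM emb_star FE starM sh !mulrA.
  rewrite (tsum _ J F).1 (eq_bigr (fun j => (f (z j.1 j.2 * emb a * (z j.1 j.2)^†))%:E)).
    by rewrite sumEFin (sumJ _ (fun k i => f (z k i * emb a * (z k i)^†))).
  move=> j _; have zE := star_absorb (emb_e_proj he) (hz j.1 j.2).
  have E1 : emb (F j · (F j)^†) = z j.1 j.2 * emb a * (z j.1 j.2)^†.
    by rewrite embM emb_star FE starM sh hE !mulrA.
  have cF : corner e (F j · (F j)^†).
    apply/(cornerP he); rewrite E1; split; first by rewrite !mulrA hz.
    by rewrite -[LHS]mulrA zE.
  by rewrite hc //; [rewrite -E1 re_corner | exists (F j)^†; rewrite astarK].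
have slim : nlim (fun n => emb (s n)) (emb a).
  by rewrite hE -{1}sh; apply: nlim_ext (P_conj_lim ih) => n; rewrite sh sE.
apply: le_anti; apply/andP; split; last first.
  apply: trace_weight_le => // n; rewrite -ts; apply: tmono => //.
  by rewrite sE hE -{1 3}sh; exact: P_conj_le.
rewrite leNgt; apply/negP => hlt.
have [c cE] : exists c : R, trace_weight a = c%:E.
  case: (trace_weight a) hlt (trace_weight_ub 0 pa) => [c _ _|hy _|_].
  - by exists c.
  - by move: hy; rewrite ltNge leey.
  - by rewrite leeNy_eq.
rewrite cE in hlt; have [V hV ltV] := lsc a c hlt.
have : nbhs (a : subspace (positive : set A)) = within positive (nbhs a).
  by rewrite nbhs_subspace_in.
move=> nE; rewrite nE /within /= in hV; move/nbhs_ballP: hV => [d d0 hd].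
have [dE dR] := complexR_gt0 d0.
have d2 : 0 < complex.Re d / 2 by rewrite divr_gt0.
have [n hn] := slim _ d2; have {hn} := hn n (leqnn n); rewrite nrmC -embB nrm_emb => hn.
have : V (s n).
  apply: hd => //; rewrite -ball_normE /ball_ /= rnormE dE ltcR (le_lt_trans hn) //.
  by rewrite ltr_pdivrMr // ltr_pMr // ltr1n.
by move=> /ltV; rewrite ts ltNge -cE trace_weight_ub.
Qed.

Lemma weight_ofE : weight_of e phi = trace_weight.
Proof.
rewrite /weight_of; case: xgetP => [tau -> [h1 h2]|]; first exact: trace_weight_unique.
move=> /(_ trace_weight); case; split; first exact: trace_weight_semifinite.
exact: trace_weight_corner.
Qed.

End OneState.
End TraceWeight.

(** * Comparison by extreme traces, and elements with range of finite trace *)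

Section Comparison.
Context {R : realType} (A : cstarAlgType R) (e : A).
Implicit Types (phi psi : A -> R[i]) (x y v w g r : cuz A) (a b : A) (p q : cuz A).
Hypothesis rr0 : @rank0 R (cuz A).
Hypothesis hsimple : simple_cstar A.
Hypothesis hsep : separable A.
Hypothesis he : projection e.
Hypothesis e0 : e != 0.
Notation E := (emb e).
Local Notation T := (tracial_states e).
Let hI := alg_star_ideal A.
Hypothesis hcomp : strict_comparison e.
Hypothesis hfin : finite_set (extreme_points T).
Variables (P : nat -> cuz A) (N : nat -> nat) (z : nat -> nat -> cuz A).
Hypothesis hP : forall n, proj (P n) /\ in_base (P n).
Hypothesis Plim : forall x, in_base x -> nlim (fun n => P n * x) x.
Hypothesis hz : forall k i, E * z k i = z k i.
Hypothesis PE : forall n, P n = \sum_(k < n) \sum_(i < N k) (z k i)^† * z k i.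

Definition tau phi p : R := fine (trace_weight e phi N z (alg_part p)).

Lemma alg_gen r : proj r -> in_base r -> r != 0 -> generates (@in_base R A) r.
Proof. exact: alg_generates. Qed.

Lemma E_gen : generates (@in_base R A) E.
Proof.
apply: alg_gen; [exact: emb_e_proj | exact: in_base_emb |].
by apply: contra_neq e0 => h; exact: (@emb_inj _ A e 0 h).
Qed.

Lemma corner_decomp Q : proj Q -> in_base Q -> exists n (y : nat -> cuz A),
  (forall i, [/\ E * y i = y i, y i * Q = y i & in_base (y i)]) /\
  Q = \sum_(i < n) (y i)^† * y i.
Proof.
move=> hQ iQ; have [n [y [hy QE]]] := fullness (emb_e_proj he) (in_base_emb e) E_gen hQ iQ.
exists n, y; split=> // i; have [h1 h2] := hy i; split=> //.
by rewrite -h2; exact: (idealMl hI).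
Qed.

Section CornerTrace.
Variables (Q : cuz A) (n : nat) (y : nat -> cuz A).
Hypothesis hQ : proj Q.
Hypothesis iQ : in_base Q.
Hypothesis Q0 : Q != 0.
Hypothesis hy : forall i, [/\ E * y i = y i, y i * Q = y i & in_base (y i)].
Hypothesis QE : Q = \sum_(i < n) (y i)^† * y i.

(** The weight on the corner of Q = sum y_i^† y_i, as a finite sum and hence a real-linear
    functional defined on all elements, not only on positive ones. *)
Definition ctrace phi x : R := \sum_(i < n) re e phi (y i * x * (y i)^†).

Lemma ctrace_weight phi x : T phi -> cor Q x -> pos x ->
  trace_weight e phi N z (alg_part x) = (ctrace phi x)%:E.
Proof.
move=> Tphi cx px; have [h [ph hE _]] := pos_sqrt px.
have ch := pos_sqrt_cor hQ cx ph hE.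
have ih : in_base h by rewrite -ch.1; exact: (idealMr hI).
have h1 i : E * y i = y i by case: (hy i).
have h2 i : in_base (y i) by case: (hy i).
have := trace_weight_family he Tphi hP Plim hz PE n ih h1 h2.
by rewrite -QE ch.2 (pos_sa ph) -hE.
Qed.

(** For the trace identity Q = sum y_j^† y_j is inserted between the factors, which gives a double
    sum symmetric under [re_trace]. Strict positivity: e lies in the ideal generated by Q, so a
    vanishing trace of Q would force phi(e) = 0. *)
Lemma ctrace_corner phi : T phi -> corner_trace Q (ctrace phi).
Proof.
move=> Tphi; have [sE ee] := emb_e_proj he.
have yE i : E * y i = y i by case: (hy i).
have yQ i : y i * Q = y i by case: (hy i).
have ysE i : (y i)^† * E = (y i)^† by exact: star_absorb (emb_e_proj he) (yE i).
have ysw i j u v : re e phi (y i * u * (y j)^† * y j * v * (y i)^†) =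
    re e phi (y j * v * (y i)^† * y i * u * (y j)^†).
  have h := re_trace he Tphi (y i * u * (y j)^†) (y j * v * (y i)^†).
  transitivity (re e phi (y i * u * (y j)^† * E * (y j * v * (y i)^†))).
    by congr (re _ _ _); rewrite -!mulrA (mulrA E (y j)) yE.
  by rewrite h; congr (re _ _ _); rewrite -!mulrA (mulrA E (y i)) yE.
split.
- move=> u v _ _; rewrite /ctrace -big_split; apply: eq_bigr => i _ /=.
  by rewrite mulrDr mulrDl (reD he Tphi).
- move=> k u _; rewrite /ctrace mulr_sumr; apply: eq_bigr => i _.
  by rewrite -scalerAr -scalerAl (reZ he Tphi).
- move=> u _; apply: sumr_ge0 => i _; apply: (re_pos he Tphi).
  by rewrite -{1}[y i]starK; apply: pos_conj; exact: pos_starM.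
- move=> u v cu cv; have ins w1 w2 : cor Q w1 -> ctrace phi (w1 * w2) =
      \sum_(i < n) \sum_(j < n) re e phi (y i * w1 * (y j)^† * y j * w2 * (y i)^†).
    move=> cw; apply: eq_bigr => i _; rewrite -(re_sum he Tphi); congr (re _ _ _).
    rewrite -{1}cw.2 {1}QE !mulr_sumr !mulr_suml !mulr_sumr mulr_suml.
    by apply: eq_bigr => j _; rewrite !mulrA.
  rewrite !ins // exchange_big /=; apply: eq_bigr => j _; apply: eq_bigr => i _.
  exact: ysw.
- have pQ j : pos (y j * Q * (y j)^†) by rewrite -{1}[y j]starK; apply: pos_conj; exact: proj_pos.
  rewrite lt_neqAle sumr_ge0 ?andbT; last by move=> i _; apply: (re_pos he Tphi).
  apply/eqP => /esym tQ0.
  have [n' [v [hv EE]]] := fullness hQ iQ (alg_gen hQ iQ Q0) (emb_e_proj he) (in_base_emb e).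
  have z0 j : (j < n)%N -> re e phi (y j * Q * (y j)^†) = 0.
    move=> jn; apply/eqP; move: tQ0 => /eqP; rewrite psumr_eq0; last by move=> i _; apply: (re_pos he Tphi).
    by move=> /allP/(_ (Ordinal jn) (mem_index_enum _)).
  have := re_one he Tphi; rewrite EE (re_sum he Tphi) big1; first by move/eqP; rewrite eq_sym oner_eq0.
  move=> l _; apply/eqP; rewrite eq_le (re_pos he Tphi) ?andbT; last exact: pos_starM.
  have [Qv vE] := hv l; rewrite -{2}Qv QE mulr_suml mulr_sumr (re_sum he Tphi).
  apply: sumr_le0 => j _.
  have -> : re e phi ((v l)^† * ((y j)^† * y j * v l)) = re e phi (y j * v l * (v l)^† * (y j)^†).
    have h := re_trace he Tphi ((v l)^† * (y j)^†) (y j * v l).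
    transitivity (re e phi ((v l)^† * (y j)^† * E * (y j * v l))).
      by congr (re _ _ _); rewrite -!mulrA (mulrA E) yE.
    have Ev : E * (v l)^† = (v l)^† by rewrite -[in LHS]sE -starM vE.
    by rewrite h; congr (re _ _ _); rewrite -!mulrA (mulrA E) Ev.
  have cv : cor Q (v l * (v l)^†).
    by split; [rewrite mulrA Qv | rewrite -mulrA (star_absorb hQ Qv)].
  have := cor_ule hQ cv (pos_sa (pos_mulstar _)) (lexx _).
  move=> /(ule_conj (y j)^†); rewrite starK => /(re_mono he Tphi).
  rewrite -scalerAr -scalerAl (reZ he Tphi) z0 // mulr0 !mulrA; apply.
Qed.

End CornerTrace.

Lemma tau_family Q : proj Q -> in_base Q -> exists n (y : nat -> cuz A),
  [/\ Q = \sum_(i < n) (y i)^† * y i,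
   forall phi x, T phi -> cor Q x -> pos x ->
     trace_weight e phi N z (alg_part x) = (ctrace n y phi x)%:E
   & Q != 0 -> forall phi, T phi -> corner_trace Q (ctrace n y phi)].
Proof.
move=> hQ iQ; have [n [y [hy QE]]] := corner_decomp hQ iQ; exists n, y; split=> //.
  by move=> phi x; apply: (ctrace_weight hQ).
by move=> Q0 phi; exact: (ctrace_corner hQ iQ Q0 hy QE).
Qed.

Lemma tauE phi p : T phi -> proj p -> in_base p ->
  trace_weight e phi N z (alg_part p) = (tau phi p)%:E.
Proof.
move=> Tphi hp ip; have [n [y [_ h _]]] := tau_family hp ip.
by rewrite /tau h //; [exact: cor_id | exact: proj_pos].
Qed.

Lemma tau_functional p : proj p -> in_base p -> exists b : cuz A, forall phi, T phi ->
  tau phi p = re e phi b.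
Proof.
move=> hp ip; have [n [y [_ h _]]] := tau_family hp ip.
exists (\sum_(i < n) y i * p * (y i)^†) => phi Tphi.
by rewrite /tau h ?(re_sum he Tphi) //; [exact: cor_id | exact: proj_pos].
Qed.

Lemma tau_gt0 phi p : T phi -> proj p -> in_base p -> p != 0 -> 0 < tau phi p.
Proof.
move=> Tphi hp ip p0; have [n [y [_ h1 h2]]] := tau_family hp ip.
by rewrite /tau h1 /=; [exact: trace_gt0 (h2 p0 phi Tphi) | | exact: cor_id | exact: proj_pos].
Qed.

Lemma tau_ge0 phi p : T phi -> proj p -> in_base p -> 0 <= tau phi p.
Proof.
move=> Tphi hp ip; rewrite -lee_fin -tauE //.
have [h _ _ _ _] := trace_weight_tracial he Tphi hP Plim hz PE; apply: h.
by apply/positive_emb; rewrite -in_baseP //; exact: proj_pos.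
Qed.

Lemma tauD phi p q : T phi -> proj p -> proj q -> in_base p -> in_base q -> p * q = 0 ->
  tau phi (p + q) = tau phi p + tau phi q.
Proof.
move=> Tphi hp hq ip iq pq; apply: EFin_inj; rewrite EFinD -!tauE //; last 2 first.
- exact: projD.
- exact: (idealD hI).
have [_ _ hD _ _] := trace_weight_tracial he Tphi hP Plim hz PE.
rewrite -hD; [by [] | |]; apply/positive_emb; rewrite -in_baseP //; exact: proj_pos.
Qed.

Lemma tauB phi p q : T phi -> proj p -> proj q -> in_base p -> in_base q -> q * p = p ->
  tau phi (q - p) = tau phi q - tau phi p.
Proof.
move=> Tphi hp hq ip iq qp; apply: (addrI (tau phi p)); rewrite -tauD //.
- by rewrite addrC subrK addrC subrK.
- exact: proj_compl.
- exact: (idealB hI).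
- by rewrite mulrBr (subproj_sym hp hq qp) hp.2 subrr.
Qed.

Lemma tau_sum phi n (r : nat -> cuz A) : T phi -> (forall k, proj (r k) /\ in_base (r k)) ->
  (forall i j, i != j -> r i * r j = 0) ->
  tau phi (\sum_(k < n) r k) = \sum_(k < n) tau phi (r k).
Proof.
move=> Tphi hr or; elim: n => [|n IH].
  rewrite !big_ord0 /tau.
  have [_ _ _ hZ _] := trace_weight_tracial he Tphi hP Plim hz PE.
  have p0 : positive (0 : A) by apply/positive_emb; exact: pos0.
  by have := hZ 0 0 (lexx _) p0; rewrite scaler0 mul0e => ->.
rewrite !big_ord_recr /= tauD ?IH //; try by case: (hr n).
- by apply: proj_sum_nat => // k; case: (hr k).
- by apply: (ideal_sum hI) => k _; case: (hr k).
- by rewrite mulr_suml big1 // => k _; rewrite or // neq_ltn ltn_ord.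
Qed.

Lemma tau_mulstar phi p v : T phi -> proj p -> in_base p -> in_base v -> v^† * v = p ->
  [/\ proj (v * v^†), in_base (v * v^†) & tau phi (v * v^†) = tau phi p].
Proof.
move=> Tphi hp ip iv vv; have vp := msub_pcor hp vv; split.
- split; first by rewrite /selfadjoint starM starK.
  by rewrite mulrA -(mulrA v) vv vp.
- exact: (idealMr hI).
have [_ _ _ _ hC] := trace_weight_tracial he Tphi hP Plim hz PE.
have F x : in_base x -> in_base x^† -> alg_part (x * x^†) = alg_part x · (alg_part x)^†.
  move=> ix ixs; apply: emb_inj; rewrite embM emb_star -!in_baseP //.
  exact: (idealMr hI).
have ivs := ideal_star hI iv; rewrite /tau -vv F // -[in RHS](starK v) [v^†^†^†]starK F ?starK //.
congr fine; have := hC (alg_part v); congr (_ = trace_weight _ _ _ _ _).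
by congr (_ · _); apply: emb_inj; rewrite emb_star -!in_baseP // starK.
Qed.

(** The difference of the traces of q and p is the value of phi at a fixed element, and for each phi
    some extreme state takes a value there that is no larger. *)
Lemma extreme_compare p q : proj p -> in_base p -> proj q -> in_base q ->
  (forall phi, extreme_points T phi -> tau phi p < tau phi q) -> msub p q.
Proof.
move=> hp ip hq iq h.
have [bp hbp] := tau_functional hp ip; have [bq hbq] := tau_functional hq iq.
rewrite (in_baseP ip) (in_baseP iq); apply: mvn_prec_msub; apply: hcomp.2.
- by apply/projection_emb; rewrite -in_baseP.
- by apply/projection_emb; rewrite -in_baseP.
move=> phi Tphi; rewrite !(weight_ofE he Tphi hP Plim hz PE) !tauE // lte_fin.
rewrite ltNge; apply/negP => hle.
have [psi epsi] := extreme_state_le he (bq - bp) hsep Tphi.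
have Tpsi : T psi by case: epsi.
rewrite -/(re e psi _) -/(re e phi _) (reB he Tpsi) (reB he Tphi) -!hbp // -!hbq //.
by have := h psi epsi; move: hle; lra.
Qed.

(** [corner_span] for the finite list of extreme states; a tracial state exists, hence an extreme
    one, which provides the index j0. *)
Lemma corner_in_span Q x : proj Q -> in_base Q -> cor Q x -> span (@in_base R A) x.
Proof.
move=> hQ iQ cx; have [Q0|Q0] := eqVneq Q 0.
  by rewrite -cx.1 Q0 mul0r; exact: span0.
have [s sE] := (finite_seqP _).1 hfin.
have sT (j : 'I_(size s)) : extreme_points T (tnth (in_tuple s) j).
  by rewrite sE /=; exact: mem_tnth.
have [phi0 T0] := hcomp.1.
have [psi epsi _] := extreme_state_le he 0 hsep T0.
have : psi \in s by have := epsi; rewrite sE.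
move=> /(@seq_tnthP _ s)[j0 _].
have [n [y [_ h1 h2]]] := tau_family hQ iQ.
apply: (corner_span rr0 hI hQ (t := fun j => ctrace n y (tnth (in_tuple s) j)) _ iQ _ alg_gen j0 cx).
  by move=> j; apply: h2 => //; case: (sT j).
move=> p q hp hq cp cq hpq.
have ip : in_base p by rewrite -cp.1; exact: (idealMr hI).
have iq : in_base q by rewrite -cq.1; exact: (idealMr hI).
apply: extreme_compare => // phi ephi; have : phi \in s by have := ephi; rewrite sE.
move=> /(@seq_tnthP _ s)[j phiE]; have Tphi : T phi by case: ephi.
have [pp pq] := (proj_pos hp, proj_pos hq).
by have := hpq j; rewrite -phiE /tau !h1.
Qed.

Lemma pow4_small (d : R) : 0 < d -> exists n, forall m, (n <= m)%N -> 4^-1 ^+ m <= d.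
Proof.
move=> d0; have [n hn] := invS_small d0; exists n => m nm; apply: le_trans (hn m nm).
by rewrite exprVn lef_pV2 ?posrE ?exprn_gt0 ?ltr0n // -natrX ler_nat ltn_expl.
Qed.

(* A tail of the range sequence of a is smaller in trace than a finite part of
   it, and can be moved under that finite part. *)
Lemma finite_trace_in_span a :
  (forall phi, extreme_points T phi -> exists C, forall p, proj p -> in_base p ->
     (exists y, p = emb a * y) -> tau phi p <= C) ->
  span (@in_base R A) (emb a).
Proof.
move=> hC; have ia := in_base_emb a.
have d0 n : 0 < 4^-1 ^+ n :> R by rewrite exprn_gt0 // invr_gt0.
have [r [hr or nr]] := range_sequence rr0 hI ia d0.
have pr k : proj (r k) by case: (hr k).
have ir k : in_base (r k) by case: (hr k).
have [allz|] := pselect (forall k, r k = 0).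
  have : nrm (emb a) <= 0.
    apply/ler_addgt0Pr => d dp; rewrite add0r; have [n hn] := pow4_small dp.
    have := nr n; rewrite big1 // subr0 mul1r => /le_trans; apply; exact: hn.
  by rewrite le_eqVlt ltNge nrm_ge0 orbF => /eqP/nrm_eq0 ->; exact: span0.
move=> /existsNP[k0 /eqP rk0].
pose S M : cuz A := \sum_(k < M) r k.
have pS M : proj (S M) by apply: proj_sum_nat.
have iS M : in_base (S M) by apply: (ideal_sum hI).
have [s sE] := (finite_seqP _).1 hfin.
(* The traces of the partial sums are bounded, so beyond some M the tail has at most half the trace
   of r_k0, while S_M contains r_k0. As there are finitely many extreme states, one M serves all of
   them. *)
have hM : exists M, [/\ (k0 < M)%N, (0 < M)%N & forall phi n, extreme_points T phi ->
    \sum_(i < n) tau phi (r (M + i)%N) < tau phi (S M)].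
  pose t phi n := \sum_(k < n) tau phi (r k).
  have sT (j : 'I_(size s)) : extreme_points T (tnth (in_tuple s) j).
    by rewrite sE /=; exact: mem_tnth.
  have tS phi n : T phi -> tau phi (S n) = t phi n.
    by move=> Tphi; exact: tau_sum.
  have tmono phi n : T phi -> t phi n <= t phi n.+1.
    by move=> Tphi; rewrite /t big_ord_recr /= lerDl tau_ge0.
  have tle phi n m : T phi -> (n <= m)%N -> t phi n <= t phi m.
    move=> Tphi; elim: m => [|m IH]; first by rewrite leqn0 => /eqP ->.
    rewrite leq_eqVlt => /predU1P[-> //|]; rewrite ltnS => /IH h.
    exact: le_trans h (tmono _ _ Tphi).
  have hn (j : 'I_(size s)) : exists n, forall m, (n <= m)%N ->
      t (tnth (in_tuple s) j) m - t (tnth (in_tuple s) j) n <= tau (tnth (in_tuple s) j) (r k0) / 2.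
    have ej := sT j; have Tj : T (tnth (in_tuple s) j) by case: ej.
    have [C hCj] := hC _ ej.
    apply: (@monotone_cauchy _ (t (tnth (in_tuple s) j)) C).
    - by move=> n; exact: tmono.
    - move=> n; rewrite -tS //; apply: hCj => //.
      have [y hy] := choice (fun k => let: And3 _ _ (ex_intro2 y _ h) := hr k in ex_intro (fun y => r k = emb a * y) y h).
      exists (\sum_(k < n) y k); rewrite mulr_sumr; apply: eq_bigr => k _; exact: hy.
    - by rewrite divr_gt0 // tau_gt0.
  have [nj hnj] := choice hn.
  exists (\max_j nj j + k0).+1; split=> // [|phi n ephi]; first by rewrite ltnS leq_addl.
  set M := (\max_j nj j + k0).+1.
  have Tphi : T phi by case: ephi.
  have : phi \in s by have := ephi; rewrite sE.
  move=> /(@seq_tnthP _ s)[j phiE]; have nM : (nj j <= M)%N.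
    by rewrite ltnW // ltnS (leq_trans (leq_bigmax j)) // leq_addr.
  rewrite tS //; have h1 := hnj j (M + n)%N (leq_trans nM (leq_addr _ _)).
  rewrite -phiE in h1; have h2 := tle phi _ _ Tphi nM.
  have d1 : 0 < tau phi (r k0) by apply: tau_gt0.
  have h3 : tau phi (r k0) <= t phi M.
    have k0M : (k0 < M)%N by rewrite ltnS leq_addl.
    by rewrite /t (bigD1 (Ordinal k0M)) //= lerDl sumr_ge0 // => i _; exact: tau_ge0.
  have h4 : t phi (M + n)%N = t phi M + \sum_(i < n) tau phi (r (M + i)%N).
    by rewrite /t big_split_ord.
  by move: h1 h2 h3; rewrite h4; lra.
have [M [k0M M0 hMt]] := hM.
pose f k := r (M + k)%N.
(* [g.2] is the part of S_M still free after the first [g.1] projections of the tail have been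
   placed; the rest of the tail remains smaller in every extreme trace. *)
pose good (g : nat * cuz A) := [/\ proj g.2, in_base g.2, S M * g.2 = g.2 &
  forall phi n, extreme_points T phi -> \sum_(i < n) tau phi (f (g.1 + i)%N) < tau phi g.2].
pose step (g g' : nat * cuz A) (v : cuz A) := [/\ g'.1 = g.1.+1, v^† * v = f g.1, g.2 * v = v
  & g'.2 = g.2 - v * v^†].
have hstep (n : nat) (g : nat * cuz A) : good g -> exists g' : nat * cuz A, good g' /\ exists v : cuz A, step g g' v.
  case: g => k g [/= hg ig Sg hgt].
  have [|v [vv gv]] := extreme_compare (pr (M + k)%N) (ir _) hg ig.
    by move=> phi ephi; have := hgt phi 1%N ephi; rewrite big_ord1 addn0.
  have iv : in_base v by rewrite -gv; exact: (idealMr hI).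
  have gvv : g * (v * v^†) = v * v^† by rewrite mulrA gv.
  have pvv : proj (v * v^†).
    split; first by rewrite /selfadjoint starM starK.
    by rewrite mulrA -(mulrA v) vv (msub_pcor (pr _) vv).
  have ivv : in_base (v * v^†) by exact: (idealMr hI).
  exists (k.+1, g - v * v^†); split; last by exists v.
  split=> /=.
  - exact: proj_compl.
  - exact: (idealB hI).
  - have Sv : S M * v = v by rewrite -gv mulrA Sg.
    by rewrite mulrBr Sg mulrA Sv.
  move=> phi l ephi; have Tphi : T phi by case: ephi.
  have [_ _ tv] := tau_mulstar Tphi (pr (M + k)%N) (ir _) iv vv.
  rewrite tauB // tv; have := hgt phi l.+1 ephi; rewrite big_ord_recl /= addn0 -/(f k) => h.
  have E1 : \sum_(i < l) tau phi (f (k.+1 + i)%N) = \sum_(i < l) tau phi (f (k + lift ord0 i)%N).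
    by apply: eq_bigr => i _; rewrite lift0 addSnnS.
  by rewrite E1 ltrBrDl.
have g0 : good (0%N, S M).
  by split=> //=; exact: (pS M).2.
have [g [gE hg]] := dependent_sequence g0 hstep.
have [w hw] := choice (fun k => (hg k).2).
have g1 k : (g k).1 = k.
  by elim: k => [|k IH]; [rewrite gE | have [-> _ _ _] := hw k; rewrite IH].
have pf k : proj (f k) by exact: pr.
have ww k : (w k)^† * w k = f k by have [_ -> _ _] := hw k; rewrite g1.
have wf k : w k * f k = w k by exact: msub_pcor (pf k) (ww k).
have gw k : (g k).2 * w k = w k by have [_ _ -> _] := hw k.
have gg k j : (j <= k)%N -> (g j).2 * (g k).2 = (g k).2.
  elim: k => [|k IH]; first by rewrite leqn0 => /eqP ->; case: (hg 0%N) => [[[]]].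
  rewrite leq_eqVlt => /predU1P[->|]; first by case: (hg k.+1) => [[[]]].
  rewrite ltnS => /IH h; have [_ _ _ ->] := hw k.
  have gjw : (g j).2 * w k = w k by rewrite -gw mulrA h.
  by rewrite mulrBr h mulrA gjw.
have wo i j : (i < j)%N -> (w i)^† * w j = 0.
  move=> ij; rewrite -[w j]gw -(gg _ _ ij).
  have -> : (w i)^† * ((g i.+1).2 * (g j).2 * w j) = ((w i)^† * (g i.+1).2) * ((g j).2 * w j).
    by rewrite !mulrA.
  have [_ _ _ ->] := hw i; have [[hgi _ _ _] _] := hg i.
  have fw : f i * (w i)^† = (w i)^† by rewrite -[in LHS](pf i).1 -starM wf.
  by rewrite mulrBr (star_absorb hgi (gw i)) (mulrA (w i)^†) ww fw subrr mul0r.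
have Sw k : S M * w k = w k.
  have [[_ _ h _] _] := hg k; by rewrite -gw mulrA h.
have pM k : (k <= (M + k).-1)%N by case: (M) M0 => // M1 _; rewrite addSn /= leq_addl.
have [||||||b [cb ib sb]] := @relocate_tail _ _ _ hI (S M) (emb a) f w (pS M) (iS M) ia.
- move=> k; rewrite -Sw; exact: (idealMr hI).
- by [].
- move=> k; split=> //; rewrite /S mulr_suml big1 // => i _; apply: or.
  by rewrite neq_ltn (leq_trans (ltn_ord i)) // leq_addr.
- move=> i j; rewrite neq_ltn => /orP[/wo //|/wo h].
  by rewrite -[LHS]starK starM starK h star0.
- move=> d dp; have [n hn] := pow4_small dp; exists n => m nm.
  have -> : \sum_(k < m) f k * emb a - (1 - S M) * emb a = - ((1 - S (M + m)%N) * emb a).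
    have SE : S (M + m)%N = S M + \sum_(k < m) f k by rewrite /S big_split_ord.
    rewrite SE -mulr_suml; move: (\sum_(k < m) f k) (S M) (emb a) => F0 S0 u0.
    by nring.
  (* [nr] at n estimates the complement of n + 1 projections, hence the predecessor of M + m; M > 0
     makes it meaningful. *)
  rewrite nrmN -(prednK (ltn_addr m M0)); apply: le_trans (nr _) (hn _ _).
  exact: leq_trans nm (pM m).
- move=> k; have -> : f k * emb a = f k * ((1 - S (M + k)%N) * emb a).
    have -> : f k * ((1 - S (M + k)%N) * emb a) = f k * emb a - f k * S (M + k)%N * emb a.
      by nring.
    rewrite mulr_sumr big1 ?mul0r ?subr0 // => i _; apply: or.
    by rewrite neq_ltn ltn_ord orbT.
  apply: le_trans (nrmM _ _) _; rewrite -[leRHS]mul1r ler_pM ?nrm_ge0 ?proj_nrm //.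
  have q1 : 4^-1 <= 1 :> R by rewrite invf_le1 // ler1n.
  rewrite -(prednK (ltn_addr k M0)) (le_trans (nr _)) //.
  by apply: ler_wiXn2l => //; rewrite ?invr_ge0.
rewrite -(subrK b (emb a)); apply: spanD => //.
exact: corner_in_span (pS M) (iS M) cb.
Qed.

End Comparison.

(** * The second dual *)

Section HahnBanach.
Context {R : realType} {V : lmodType R[i]}.
Implicit Types (x y v : V) (p q : V -> R) (s t l : R).

Definition sublinear p := (forall x y, p (x + y) <= p x + p y) /\
  (forall t x, 0 < t -> p (t%:C *: x) <= t * p x).

Lemma sublinear0 p : sublinear p -> p 0 = 0.
Proof.
move=> [pD pZ]; have h1 := pD 0 0; rewrite addr0 in h1.
have := pZ 2^-1 0; rewrite invr_gt0 ltr0n scaler0 => /(_ isT); lra.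
Qed.

Lemma sublinearZ p t x : sublinear p -> 0 < t -> p (t%:C *: x) = t * p x.
Proof.
move=> sp t0; have [pD pZ] := sp; apply: le_anti; rewrite pZ //=.
have ti : 0 < t^-1 by rewrite invr_gt0.
have := pZ t^-1 (t%:C *: x) ti; rewrite scalerA -rmorphM mulVf ?gt_eqF // scale1r.
by rewrite ler_pdivlMl.
Qed.

Lemma sublinear_ge p x : sublinear p -> - p (- x) <= p x.
Proof.
move=> sp; have [pD _] := sp; have := pD x (- x); rewrite subrr sublinear0 //; lra.
Qed.

(** Used for the lower bound of a chain in Zorn's lemma, and for the one-parameter perturbation that
    shows a minimal sublinear functional to be additive. *)
Lemma inf_sublinear (J : Type) (j0 : J) (W : J -> V -> R) (b : V -> R) :
  (forall j x, b x <= W j x) ->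
  (forall i j x y, exists k, W k (x + y) <= W i x + W j y) ->
  (forall i t x, 0 < t -> exists k, W k (t%:C *: x) <= t * W i x) ->
  let f x := inf [set W j x | j in setT] in
  sublinear f /\ forall j x, f x <= W j x.
Proof.
move=> hb hD hZ f.
have hi x : has_inf [set W j x | j in setT].
  by split; [exists (W j0 x), j0 | exists (b x) => _ [j _ <-]].
have f_le j x : f x <= W j x by apply: ge_inf; [exact: (hi x).2 | exists j].
have f_ge x l : (forall j, l <= W j x) -> l <= f x.
  by move=> h; apply: lb_le_inf; [exact: (hi x).1 | move=> _ [j _ <-]].
split=> //; split.
  move=> x y; rewrite -lerBlDr; apply: (f_ge) => i; rewrite lerBlDr -lerBlDl.
  apply: (f_ge) => j; rewrite lerBlDl; have [k hk] := hD i j x y.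
  exact: le_trans (f_le k _) hk.
move=> t x t0; rewrite -ler_pdivrMl //; apply: (f_ge) => i; rewrite ler_pdivrMl //.
by have [k hk] := hZ i t x t0; exact: le_trans (f_le k _) hk.
Qed.

(* A minimal sublinear functional is linear. *)
Lemma minimal_sublinear_linear p : sublinear p ->
  (forall q, sublinear q -> (forall x, q x <= p x) -> q = p) ->
  (forall x y, p (x + y) = p x + p y) /\ (forall t x, p (t%:C *: x) = t * p x).
Proof.
move=> sp pmin; have [pD pZ] := sp.
have hD x y : p (x + y) = p x + p y.
  apply: le_anti; rewrite pD /=.
  pose J := {t : R | 0 <= t}.
  (* The infimum of p(v + t y) - t p(y) over t >= 0 is sublinear and below p, hence equal to p by
     minimality; t = 1 then gives p(x) + p(y) <= p(x + y). *)
  pose W (j : J) v := p (v + (sval j)%:C *: y) - sval j * p y.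
  have Wb (j : J) v : - p (- v) <= W j v.
    case: j => t t0; rewrite /W /=.
    have [->|tn] := eqVneq t 0; first by rewrite scale0r addr0 mul0r subr0; exact: sublinear_ge.
    have tp : 0 < t by rewrite lt_neqAle eq_sym tn.
    have := pD (v + t%:C *: y) (- v).
    have -> : v + t%:C *: y + - v = t%:C *: y by rewrite addrAC subrr add0r.
    by rewrite sublinearZ //; lra.
  have WD (i j : J) v w : exists k, W k (v + w) <= W i v + W j w.
    case: i j => [s s0] [t t0]; exists (exist _ (s + t) (addr_ge0 s0 t0)); rewrite /W /=.
    have := pD (v + s%:C *: y) (w + t%:C *: y); rewrite addrACA -scalerDl -rmorphD mulrDl /=; lra.
  have WZ (i : J) t v : 0 < t -> exists k, W k (t%:C *: v) <= t * W i v.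
    case: i => [s s0] t0; exists (exist _ (t * s) (mulr_ge0 (ltW t0) s0)); rewrite /W /=.
    have := pZ t (v + s%:C *: y) t0; rewrite scalerDr scalerA -rmorphM mulrBr mulrA; lra.
  have [sf fle] := inf_sublinear (exist _ 0 (lexx 0) : J) Wb WD WZ.
  have fp := pmin _ sf (fun v => _ : _ <= p v).
  have {}fp : (fun x => inf [set W j x | j in setT]) = p.
    apply: fp => v; apply: le_trans (fle (exist _ 0 (lexx 0)) v) _.
    by rewrite /W /= scale0r addr0 mul0r subr0.
  have := fle (exist _ 1 ler01) x; have -> : inf [set W j x | j in setT] = p x.
    by rewrite -[in RHS]fp.
  by rewrite /W /= scale1r mul1r; lra.
have pN x : p (- x) = - p x.
  by apply/eqP; rewrite -addr_eq0 -hD addNr sublinear0.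
split=> // t x; have [t0|t0|t0] := ltgtP 0 t.
- exact: sublinearZ.
- have : p ((- t)%:C *: x) = - t * p x by apply: sublinearZ => //; rewrite oppr_gt0.
  by rewrite rmorphN scaleNr pN mulNr => /oppr_inj.
- by rewrite -t0 scale0r mul0r sublinear0.
Qed.

Lemma sublinear_dominates_linear q : sublinear q -> exists f : V -> R,
  [/\ forall x y, f (x + y) = f x + f y, forall t x, f (t%:C *: x) = t * f x
    & forall x, f x <= q x].
Proof.
move=> sq; pose T := {p : V -> R | sublinear p /\ forall x, p x <= q x}.
(* The reverse order, so that a maximal element is a minimal sublinear functional. *)
pose Le (p p' : T) := `[< forall x, sval p' x <= sval p x >].
have Tq : T by exists q.
have [||||p pmax] := @Zorn T Le.
- by move=> p; apply/asboolP.
- by move=> p1 p2 p3 /asboolP h1 /asboolP h2; apply/asboolP => x; exact: le_trans (h2 x) (h1 x).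
- move=> [p1 h1] [p2 h2] /asboolP l1 /asboolP l2; apply: eq_exist => /=; apply/funext => x.
  by apply: le_anti; rewrite l1 l2.
- move=> S tot; have [[[p0 hp0] Sp0]|hn] := pselect (exists p : T, S p); last first.
    by exists Tq => s Ss; case: hn; exists s.
  pose J := {p : T | S p}; pose W (j : J) := sval (sval j).
  have Wb (j : J) x : - q (- x) <= W j x.
    case: j => [[p [sp pq]] Sp]; rewrite /W /=.
    by apply: le_trans (sublinear_ge x sp); rewrite lerN2.
  have WD (i j : J) x y : exists k, W k (x + y) <= W i x + W j y.
    case: i j => [p Sp] [p' Sp']; have [h|h] : (forall x, sval p' x <= sval p x) \/ (forall x, sval p x <= sval p' x).
      by case: (tot _ _ Sp Sp') => /asboolP; [left | right].
      exists (exist _ p' Sp'); rewrite /W /=; case: p' Sp' h => [p' [[hD hZ] pq]] Sp' h /=.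
      by apply: le_trans (hD x y) _; rewrite lerD2r; exact: h.
    exists (exist _ p Sp); rewrite /W /=; case: p Sp h => [p [[hD hZ] pq]] Sp h /=.
    by apply: le_trans (hD x y) _; rewrite lerD2l; exact: h.
  have WZ (i : J) t x : 0 < t -> exists k, W k (t%:C *: x) <= t * W i x.
    by move=> t0; exists i; case: i => [[p [[hD hZ] pq]] Sp]; exact: (hZ _ _ t0).
  have [sf fle] := inf_sublinear (exist _ _ Sp0 : J) Wb WD WZ.
  have fq x : inf [set W j x | j in setT] <= q x.
    by apply: le_trans (fle (exist _ _ Sp0) x) _; case: hp0 Sp0 => h1 h2 Sp0; exact: h2.
  exists (exist (fun p => sublinear p /\ forall x, p x <= q x) _ (conj sf fq)) => s Ss; apply/asboolP => x /=.
  exact: (fle (exist _ s Ss)).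
case: p pmax => [p [sp pq]] pmax.
have [|hD hZ] := minimal_sublinear_linear sp.
  move=> p' sp' p'p; have h x : p' x <= q x by exact: le_trans (p'p x) (pq x).
  by have := pmax (exist _ p' (conj sp' h)) (asboolT p'p) => /(congr1 sval).
by exists p.
Qed.

(** [K x l] reads as the demand f(x) <= l. The infimum of such l is sublinear, and it is finite
    because K 0 l forces l >= 0. *)
Lemma cone_dominates_linear (K : V -> R -> Prop) :
  (forall x y l m, K x l -> K y m -> K (x + y) (l + m)) ->
  (forall t x l, 0 < t -> K x l -> K (t%:C *: x) (t * l)) ->
  (forall x, exists l, K x l) -> (forall l, K 0 l -> 0 <= l) ->
  exists f : V -> R,
  [/\ forall x y, f (x + y) = f x + f y, forall t x, f (t%:C *: x) = t * f x
    & forall x l, K x l -> f x <= l].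
Proof.
move=> KD KZ Kex K0; pose q x := inf [set l | K x l].
have hi x : has_inf [set l | K x l].
  split; first exact: Kex.
  have [m hm] := Kex (- x); exists (- m) => l hl.
  by have := K0 (l + m); rewrite -(subrr x) => /(_ (KD _ _ _ _ hl hm)); lra.
have q_le x l : K x l -> q x <= l by move=> h; apply: ge_inf => //; exact: (hi x).2.
have q_ge x l : (forall m, K x m -> l <= m) -> l <= q x.
  by move=> h; apply: lb_le_inf; [exact: (hi x).1 | exact: h].
have sq : sublinear q.
  split.
    move=> x y; rewrite -lerBlDr; apply: (q_ge) => l hl; rewrite lerBlDr -lerBlDl.
    by apply: (q_ge) => m hm; rewrite lerBlDl; apply: (q_le); exact: KD.
  move=> t x t0; rewrite -ler_pdivrMl //; apply: (q_ge) => l hl; rewrite ler_pdivrMl //.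
  by apply: (q_le); exact: KZ.
have [f [fD fZ fq]] := sublinear_dominates_linear sq.
exists f; split=> // x l hl; exact: le_trans (fq x) (q_le _ _ hl).
Qed.

End HahnBanach.

(** * Jordan decomposition of hermitian functionals *)

Section Jordan.
Context {R : realType} (U : ucstarType R).
Implicit Types (x y z : U) (g : U -> R).

(** A Hahn-Banach argument on pairs, with F(x, y) = f1(x) + f2(y). One demands F(z, - z) <= g(z),
    which forces equality by linearity, and a bound by C s where the real parts of both entries are
    at most s. The second demand yields positivity and the norm bound together. *)
Lemma real_jordan g (C : R) : (forall x y, g (x + y) = g x + g y) ->
  (forall (t : R) x, g (t%:C *: x) = t * g x) -> (forall x, g x^† = g x) ->
  (forall x, g x <= C * nrm x) ->
  exists f1 f2 : U -> R,
   (forall f, f = f1 \/ f = f2 -> [/\ forall x y, f (x + y) = f x + f y,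
      forall (t : R) x, f (t%:C *: x) = t * f x, forall x, f x^† = f x,
      forall x, pos x -> 0 <= f x & forall x, `|f x| <= C * nrm x]) /\
   forall x, g x = f1 x - f2 x.
Proof.
move=> gD gZ gs gC.
have g0 : g 0 = 0 by have := gZ 0 0; rewrite scaler0 mul0r.
have gN x : g (- x) = - g x by apply/eqP; rewrite -addr_eq0 -gD addNr g0.
pose H x := x + x^†.
have HD x y : H (x + y) = H x + H y by rewrite /H starD; nring.
have HZ (t : R) x : H (t%:C *: x) = t%:C *: H x by rewrite /H starZr scalerDr.
have HN x : H (- x) = - H x by rewrite /H starN opprD.
have H0 : H 0 = 0 by rewrite /H star0 addr0.
have Hsa x : selfadjoint (H x) by rewrite /selfadjoint /H starD starK addrC.
have nH x : nrm (H x) <= 2 * nrm x by rewrite /H (le_trans (nrmD _ _)) // nrm_star; lra.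
have C0 : 0 <= C.
  have h1 := gC 1; have := gC (- 1); rewrite gN nrmN => h2.
  have : 0 <= C * nrm (1 : U) by lra.
  rewrite pmulr_lge0 // lt_neqAle nrm_ge0 andbT eq_sym; apply/eqP => /nrm_eq0/eqP.
  by rewrite oner_eq0.
pose one s : U := (2 * s)%:C *: 1.
have oneD s t : one (s + t) = one s + one t by rewrite /one mulrDr rmorphD scalerDl.
have one0 : one 0 = 0 by rewrite /one mulr0 scale0r.
(* Combines both demands: v is (z, - z) plus a pair whose real parts are at most s. H is twice the
   real part, hence the 2 s in [one s]. *)
pose K (v : U * U) (l : R) := exists z s, [/\ 0 <= s, H (v.1 - z) ⊑ one s, H (v.2 + z) ⊑ one s
  & l = C * s + g z].
have [||||F [FD FZ FK]] := @cone_dominates_linear R (U * U)%type K.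
- move=> v w _ _ [z [s [s0 h1 h2 ->]]] [z' [s' [s0' h1' h2' ->]]].
  exists (z + z'), (s + s'); split; first exact: addr_ge0.
  + have := uleD h1 h1'; rewrite oneD -HD; congr (H _ ⊑ _) => /=; nring.
  + have := uleD h2 h2'; rewrite oneD -HD; congr (H _ ⊑ _) => /=; nring.
  + by rewrite gD; lra.
- move=> t v _ t0 [z [s [s0 h1 h2 ->]]]; have t0' := ltW t0.
  exists (t%:C *: z), (t * s); split; first exact: mulr_ge0.
  + have := uleZ t0' h1; rewrite -HZ scalerBr /one scalerA -rmorphM mulrCA; exact.
  + have := uleZ t0' h2; rewrite -HZ scalerDr /one scalerA -rmorphM mulrCA; exact.
  + by rewrite gZ; lra.
- move=> v; exists (C * (nrm v.1 + nrm v.2) + g 0), 0, (nrm v.1 + nrm v.2).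
  have h x s : nrm x <= s -> H x ⊑ one s.
    by move=> xs; apply: sa_ule_nrm => //; rewrite (le_trans (nH x)) // ler_wpM2l.
  split; [by rewrite addr_ge0 ?nrm_ge0 | | |by []].
    by rewrite subr0; apply: h; rewrite lerDl nrm_ge0.
  by rewrite addr0; apply: h; rewrite lerDr nrm_ge0.
(* Consistency: at (0, 0) the conditions say that H z lies between - 2 s and 2 s, so g(z) >= - C
   s. *)
- move=> _ [z [s [s0 h1 h2 ->]]]; rewrite /= sub0r HN in h1; rewrite /= add0r in h2.
  have s2 : 0 <= 2 * s by rewrite mulr_ge0.
  have nz : nrm (H z) <= 2 * s by apply: sa_nrm_le => //; rewrite -/(one s); move: h1; apply: eq_pos; nring.
  have gH : g (H z) = 2 * g z by rewrite /H gD gs; lra.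
  have := gC (- H z); rewrite gN gH nrmN => h3.
  have := ler_wpM2l C0 nz; lra.
have F0 : F 0 = 0 by have := FZ 0 0; rewrite scaler0 mul0r.
have FN v : F (- v) = - F v by apply/eqP; rewrite -addr_eq0 -FD addNr F0.
have one_pos s : 0 <= s -> 0 ⊑ one s.
  by move=> s0; rewrite subr0; apply: posZ; [rewrite mulr_ge0 | exact: pos1].
have main (f : U -> R) : (forall x y, f (x + y) = f x + f y) ->
   (forall (t : R) x, f (t%:C *: x) = t * f x) ->
   (forall x s, 0 <= s -> H x ⊑ one s -> f x <= C * s) ->
   [/\ forall x y, f (x + y) = f x + f y,
      forall (t : R) x, f (t%:C *: x) = t * f x, forall x, f x^† = f x,
      forall x, pos x -> 0 <= f x & forall x, `|f x| <= C * nrm x].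
  move=> fD fZ fH; have f0 : f 0 = 0 by have := fZ 0 0; rewrite scaler0 mul0r.
  have fN x : f (- x) = - f x by apply/eqP; rewrite -addr_eq0 -fD addNr f0.
  have half x : f x <= C * nrm x.
    apply: (fH); first exact: nrm_ge0.
    by apply: sa_ule_nrm => //; exact: nH.
  split=> //.
  - have h x : f (x^† - x) <= 0.
      rewrite -(mulr0 C); apply: (fH) => //; rewrite one0 /H starB starK.
      have -> : x^† - x + (x - x^†) = 0 by nring.
      by rewrite subr0; exact: pos0.
    move=> x; have := h x; have := h x^†; rewrite starK !fD !fN; lra.
  - move=> x px; rewrite -oppr_le0 -fN -(mulr0 C); apply: (fH) => //.
    rewrite one0 HN /H (pos_sa px); apply: eq_pos (posD px px).
    by nring.
  - by move=> x; rewrite ler_norml half andbT lerNl -fN; have := half (- x); rewrite nrmN.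
exists (fun x => F (x, 0)), (fun y => F (0, y)); split.
  move=> f [->|->]; apply: main.
  - by move=> x y; rewrite -FD; congr F; congr pair; rewrite addr0.
  - by move=> t x; rewrite -FZ; congr F; congr pair; rewrite scaler0.
  - move=> x s s0 hx; apply: (FK); exists 0, s; rewrite /= g0 !addr0 subr0 H0.
    by split=> //; exact: one_pos.
  - by move=> x y; rewrite -FD; congr F; congr pair; rewrite addr0.
  - by move=> t x; rewrite -FZ; congr F; congr pair; rewrite scaler0.
  - move=> x s s0 hx; apply: (FK); exists 0, s; rewrite /= g0 !addr0 subr0 H0.
    by split=> //; exact: one_pos.
have le1 z : F (z, - z) <= g z.
  apply: (FK); exists z, 0; rewrite /= subrr addNr H0 mulr0 add0r; split=> //; exact: one_pos.
have eq1 z : F (z, - z) = g z.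
  apply: le_anti; rewrite le1 /=; have := le1 (- z); rewrite gN opprK.
  have -> : (- z, z) = - ((z, - z) : U * U) by congr pair; rewrite /= opprK.
  by rewrite FN lerN2.
move=> x; rewrite -eq1.
have -> : (x, - x) = (x, 0) - ((0, x) : U * U) by congr pair; rewrite /= ?subr0 ?sub0r.
by rewrite FD FN.
Qed.

End Jordan.

(** * The Arens product and positive functionals *)

Section BidualProduct.
Context {R : realType} {A : cstarAlgType R}.
Implicit Types (a b c d : A) (f g h : dual A) (F G H K : bidual A).

Lemma rnorm_small_eq (x y : R[i]) : (forall d : R, 0 < d -> rnorm (x - y) <= d) -> x = y.
Proof.
move=> h; apply/eqP; rewrite -subr_eq0; apply/eqP/(@rnorm_eq0 R (R[i] : normedZmodType _)).
by apply/le_anti; rewrite rnorm_ge0 andbT; apply/ler_addgt0Pr => d d0; rewrite add0r h.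
Qed.

Lemma dual_norm_ge0 f : 0 <= dual_norm f. Proof. exact: op_norm_ge0. Qed.

Lemma op_norm_bound (V : lmodType R[i]) (N : V -> R) (f : functional N) x :
  (forall x, 0 <= N x) -> (forall (t : R) x, 0 <= t -> N (t%:C *: x) = t * N x) ->
  rnorm (f x) <= op_norm N f * N x.
Proof.
move=> N0 NZ; have [M M0 hM] := functional_bound N0 f.
have [x0|x0] := eqVneq (N x) 0.
  by rewrite x0 mulr0; have := hM x; rewrite x0 mulr0.
have xp : 0 < N x by rewrite lt_neqAle eq_sym x0 N0.
have := @op_norm_ub _ _ N N0 f ((N x)^-1%:C *: x); rewrite NZ ?invr_ge0 // mulVf // lexx.
move=> /(_ isT); rewrite functionalZ rnormM rnormC_ge0 ?invr_ge0 //.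
by rewrite ler_pdivrMl // mulrC.
Qed.

Lemma dual_bound f a : rnorm (f a) <= dual_norm f * rnorm a.
Proof.
apply: op_norm_bound; first exact: rnorm_ge0.
by move=> t x t0; rewrite rnormZ rnormC_ge0.
Qed.

Lemma dual_norm_le f C : 0 <= C -> (forall a, rnorm (f a) <= C * rnorm a) -> dual_norm f <= C.
Proof.
move=> C0 h; apply: op_norm_le => // a a1; apply: le_trans (h a) _.
by rewrite -[leRHS]mulr1 ler_wpM2l.
Qed.

Lemma dual_normZ (k : R[i]) f : dual_norm (k *: f) = rnorm k * dual_norm f.
Proof.
have le (l : R[i]) g : dual_norm (l *: g) <= rnorm l * dual_norm g.
  apply: dual_norm_le => [|a]; first by rewrite mulr_ge0 ?rnorm_ge0 ?dual_norm_ge0.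
  by rewrite functional_scaleE rnormM -mulrA ler_wpM2l ?rnorm_ge0 ?dual_bound.
apply: le_anti; rewrite le /=.
have [->|k0] := eqVneq k 0; first by rewrite rnorm0 mul0r dual_norm_ge0.
have kp : 0 < rnorm k by rewrite lt_neqAle rnorm_ge0 andbT eq_sym; apply/eqP => /rnorm_eq0; exact/eqP.
have := le k^-1 (k *: f); rewrite scalerA mulVf // scale1r => h.
have kk : rnorm k * rnorm k^-1 = 1 by rewrite -rnormM divff // rnorm1.
apply: le_trans (ler_wpM2l (rnorm_ge0 k) h) _.
by rewrite mulrA kk mul1r.
Qed.

Definition binorm F : R := op_norm (@dual_norm R A) F.
Lemma binorm_ge0 F : 0 <= binorm F. Proof. exact: op_norm_ge0. Qed.
Lemma bidual_bound F f : rnorm (F f) <= binorm F * dual_norm f.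
Proof.
apply: op_norm_bound; first exact: dual_norm_ge0.
by move=> t x t0; rewrite dual_normZ rnormC_ge0.
Qed.
Lemma binorm_le F C : 0 <= C -> (forall f, rnorm (F f) <= C * dual_norm f) -> binorm F <= C.
Proof.
move=> C0 h; apply: op_norm_le => // f f1; apply: le_trans (h f) _.
by rewrite -[leRHS]mulr1 ler_wpM2l.
Qed.

Lemma bidual_ext F G : (forall f, F f = G f) -> F = G.
Proof. by move=> h; apply/val_inj/funext. Qed.
Lemma dual_ext f g : (forall a, f a = g a) -> f = g.
Proof. by move=> h; apply/val_inj/funext. Qed.

Lemma dualB f a b : f (a - b) = f a - f b.
Proof. by rewrite functionalD -scaleN1r functionalZ mulN1r. Qed.
Lemma bidualB F f g : F (f - g) = F f - F g.
Proof. by rewrite functionalD -scaleN1r functionalZ mulN1r. Qed.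

Lemma aduE (f : dual A) a b : dual_mulr f a b = f (a · b). Proof. by []. Qed.
Lemma dual_norm_mulr f a : dual_norm (dual_mulr f a) <= dual_norm f * rnorm a.
Proof.
apply: dual_norm_le => [|b]; first by rewrite mulr_ge0 ?dual_norm_ge0 ?rnorm_ge0.
by rewrite aduE (le_trans (dual_bound _ _)) // -mulrA ler_wpM2l ?dual_norm_ge0 ?amul_rnormM.
Qed.
Lemma dual_norm_act G f : dual_norm (bidual_act G f) <= binorm G * dual_norm f.
Proof.
apply: dual_norm_le => [|a]; first by rewrite mulr_ge0 ?dual_norm_ge0 ?binorm_ge0.
rewrite (le_trans (bidual_bound _ _)) // -mulrA ler_wpM2l ?binorm_ge0 //.
exact: dual_norm_mulr.
Qed.
Lemma dual_mulrA f a b : dual_mulr (dual_mulr f a) b = dual_mulr f (a · b).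
Proof. by apply: dual_ext => c; rewrite /= amulA. Qed.
Lemma bidual_act_mulr G f a : bidual_act G (dual_mulr f a) = dual_mulr (bidual_act G f) a.
Proof. by apply: dual_ext => b; rewrite /= dual_mulrA. Qed.
Lemma bidual_actM F G f : bidual_act (F · G) f = bidual_act F (bidual_act G f).
Proof. by apply: dual_ext => a; rewrite /= bidual_act_mulr. Qed.
Lemma arensE F G f : (F · G) f = F (bidual_act G f). Proof. by []. Qed.
Lemma arensA F G H : F · (G · H) = (F · G) · H.
Proof. by apply: bidual_ext => f; rewrite !arensE bidual_actM. Qed.
Lemma bidual_act_addl F G f : bidual_act (F + G) f = bidual_act F f + bidual_act G f.
Proof. exact: dual_ext. Qed.
Lemma bidual_act_scalel k G f : bidual_act (k *: G) f = k *: bidual_act G f.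
Proof. exact: dual_ext. Qed.
Lemma arensDl F G H : (F + G) · H = F · H + G · H. Proof. exact: bidual_ext. Qed.
Lemma arensDr F G H : F · (G + H) = F · G + F · H.
Proof. by apply: bidual_ext => f; rewrite arensE bidual_act_addl functionalD. Qed.
Lemma arensZl k F G : (k *: F) · G = k *: (F · G). Proof. exact: bidual_ext. Qed.
Lemma arensZr k F G : F · (k *: G) = k *: (F · G).
Proof. by apply: bidual_ext => f; rewrite arensE bidual_act_scalel functionalZ. Qed.

Lemma dual_starK f : dual_star (dual_star f) = f.
Proof. by apply: dual_ext => a; rewrite /= astarK conjcK. Qed.
Lemma bidual_starE F f : F^† f = conjc (F (dual_star f)). Proof. by []. Qed.
Lemma bidual_starK F : F^†^† = F.
Proof. by apply: bidual_ext => f; rewrite !bidual_starE dual_starK conjcK. Qed.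
Lemma bidual_starD F G : (F + G)^† = F^† + G^†.
Proof. by apply: bidual_ext => f; rewrite functional_addE !bidual_starE functional_addE rmorphD. Qed.
Lemma bidual_starZ k F : (k *: F)^† = conjc k *: F^†.
Proof. by apply: bidual_ext => f; rewrite functional_scaleE !bidual_starE functional_scaleE rmorphM. Qed.
Lemma dual_norm_star f : dual_norm (dual_star f) = dual_norm f.
Proof.
have le g : dual_norm (dual_star g) <= dual_norm g.
  apply: dual_norm_le => [|a]; first exact: dual_norm_ge0.
  rewrite [leLHS](_ : _ = rnorm (g a^†)); last exact: rnorm_conj.
  by rewrite (le_trans (dual_bound _ _)) // ler_wpM2l ?dual_norm_ge0 ?astar_rnorm.
by apply: le_anti; rewrite le -{1}(dual_starK f) le.
Qed.

Definition pfun f := forall a, 0 <= f (a^† · a).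
Definition nform f a : R := complex.Re (f (a^† · a)).

Section PositiveFunctional.
Variable f : dual A.
Hypothesis pf : pfun f.
Local Notation N := (nform f).
Local Notation B b c := (complex.Re (f (b^† · c))).

Lemma nform_ge0 a : 0 <= N a.
Proof. by have := pf a; rewrite /nform; case: (f _) => p q; rewrite lecE => /andP[]. Qed.
Lemma pfunE a : f (a^† · a) = (N a)%:C.
Proof.
by have := pf a; rewrite /nform; case: (f _) => p q; rewrite lecE /= => /andP[/eqP -> _].
Qed.
Lemma pfun_expand b c (k : R[i]) : f ((b + k *: c)^† · (b + k *: c)) =
  f (b^† · b) + (k * f (b^† · c) + conjc k * f (c^† · b)) + (conjc k * k) * f (c^† · c).
Proof.
have -> : (b + k *: c)^† = b^† + conjc k *: c^† by rewrite astarD astarZ.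
rewrite amulDl !amulDr !amulZl !amulZr !functionalD !functionalZ.
by ring.
Qed.
Lemma pfun_herm b c : f (c^† · b) = conjc (f (b^† · c)).
Proof.
have h k : complex.Im (k * f (b^† · c) + conjc k * f (c^† · b)) = 0.
  have := pfunE (b + k *: c); rewrite pfun_expand !pfunE => /(congr1 (@complex.Im R)).
  case: k => p q; case: (f (b^† · c)) => r s; case: (f (c^† · b)) => r' s' /=; lra.
have h1 := h 1; have h2 := h 'i%C; move: h1 h2.
case: (f (b^† · c)) => r s; case: (f (c^† · b)) => r' s' /= h1 h2.
by apply/eqP; rewrite eq_complex /=; apply/andP; split; apply/eqP; lra.
Qed.
Lemma nform_line b c (t : R) : N (b + t%:C *: c) = N b + 2 * t * B b c + t ^+ 2 * N c.
Proof.
apply: complexI; rewrite -pfunE pfun_expand (pfun_herm b c) !pfunE.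
case: (f (b^† · c)) => r s; apply/eqP; rewrite eq_complex /=; apply/andP; split; apply/eqP; lra.
Qed.

Lemma discriminant (x y l : R) : 0 <= x -> 0 <= l ->
  (forall t : R, 0 <= x * t ^+ 2 + 2 * t * y + l) -> y ^+ 2 <= x * l.
Proof.
move=> x0 l0 h; have [xe|xn] := eqVneq x 0.
  have [->|y0] := eqVneq y 0; first by rewrite expr0n mulr_ge0.
  have := h (- (l + 1) / (2 * y)); rewrite xe mul0r add0r.
  have -> : 2 * (- (l + 1) / (2 * y)) * y = - (l + 1) by field.
  lra.
have xp : 0 < x by rewrite lt_neqAle eq_sym xn.
have := h (- y / x).
have -> : x * (- y / x) ^+ 2 + 2 * (- y / x) * y + l = (x * l - y ^+ 2) / x by field.
by rewrite pmulr_lge0 ?invr_gt0 // subr_ge0.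
Qed.

Lemma re_CS b c : B b c ^+ 2 <= N b * N c.
Proof.
rewrite mulrC; apply: discriminant; try exact: nform_ge0.
move=> t; have := nform_ge0 (b + t%:C *: c); rewrite nform_line; lra.
Qed.

Lemma sqr_le_sqrt (x y : R) : 0 <= y -> x ^+ 2 <= y -> `|x| <= Num.sqrt y.
Proof. by move=> y0 h; rewrite -sqrtr_sqr ler_wsqrtr. Qed.

(** Cauchy-Schwarz for the real part and, with i b in place of b, for the imaginary part. The
    resulting factor 2 only affects constants. *)
Lemma pfun_CS b c : rnorm (f (b^† · c)) <= 2 * (Num.sqrt (N b) * Num.sqrt (N c)).
Proof.
rewrite -sqrtrM ?nform_ge0 // (le_trans (rnorm_le_ReIm _)) // mulrDl mul1r.
have NN : 0 <= N b * N c by rewrite mulr_ge0 ?nform_ge0.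
apply: lerD; first exact: sqr_le_sqrt (re_CS b c).
have Ni : N ('i%C *: b) = N b.
  apply: complexI; rewrite -!pfunE astarZ amulZl amulZr scalerA functionalZ.
  rewrite [X in X * _](_ : _ = 1) ?mul1r //.
  by apply/eqP; rewrite eq_complex /=; apply/andP; split; apply/eqP; lra.
have E : f (('i%C *: b)^† · c) = conjc 'i%C * f (b^† · c) by rewrite astarZ amulZl functionalZ.
have h := re_CS ('i%C *: b) c; rewrite Ni E in h; have := sqr_le_sqrt NN h.
by case: (f (b^† · c)) => p q /=; congr (`|_| <= _); lra.
Qed.

Lemma nform_le a : N a <= dual_norm f * rnorm a ^+ 2.
Proof.
apply: le_trans (ler_norm _) _; apply: le_trans (normr_Re_le _) _.
by apply: le_trans (dual_bound _ _) _; rewrite rnorm_starM.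
Qed.

Lemma sqrt_nform_le a : Num.sqrt (N a) <= Num.sqrt (dual_norm f) * rnorm a.
Proof.
apply: le_trans (ler_wsqrtr (nform_le a)) _.
by rewrite sqrtrM ?dual_norm_ge0 // sqrtr_sqr ger0_norm ?rnorm_ge0.
Qed.

(** The vector of c represents the functional induced by G up to e, in the seminorm of the form
    f(b^† c): an approximate Riesz representation in the GNS space, without its completion. *)
Definition approx (e : R) G c := forall b,
  rnorm (f (b^† · c) - G (dual_mulr f b^†)) <= e * Num.sqrt (N b).

Lemma act_bound G b : rnorm (G (dual_mulr f b^†)) <=
  2 * binorm G * Num.sqrt (dual_norm f) * Num.sqrt (N b).
Proof.
apply: le_trans (bidual_bound _ _) _.
have -> : 2 * binorm G * Num.sqrt (dual_norm f) * Num.sqrt (N b) =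
  binorm G * (2 * (Num.sqrt (N b) * Num.sqrt (dual_norm f))) by ring.
rewrite ler_wpM2l ?binorm_ge0 //.
apply: dual_norm_le => [|a]; first by rewrite !mulr_ge0 ?sqrtr_ge0.
rewrite aduE; apply: le_trans (pfun_CS b a) _.
have := sqrt_nform_le a; have h := sqrtr_ge0 (N b).
move=> /(ler_wpM2l h); lra.
Qed.

(* A near minimizer of c |-> f(c^† c) - 2 Re G(f c^†) represents G up to e. *)
Lemma riesz_approx G (e : R) : 0 < e -> exists c, approx e G c.
Proof.
move=> e0; pose q c := N c - 2 * complex.Re (G (dual_mulr f c^†)).
pose k := 2 * binorm G * Num.sqrt (dual_norm f).
have qb c : - k ^+ 2 <= q c.
  have := le_trans (normr_Re_le _) (act_bound G c); rewrite -/k ler_norml => /andP[_ h].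
  have := sqr_sqrtr (nform_ge0 c); rewrite /q => <-.
  have := sqr_ge0 (Num.sqrt (N c) - k); move: h; move: (Num.sqrt _) => s; nra.
have hS : has_sup [set - q c | c in setT].
  by split; [exists (- q 0), 0 | exists (k ^+ 2) => _ [c _ <-]; rewrite lerNl].
have eta0 : 0 < (e / 2) ^+ 2 by rewrite exprn_gt0 // divr_gt0.
have [_ [c _ <-] hc] := sup_adherent eta0 hS.
have cmin d : q c - (e / 2) ^+ 2 <= q d.
  have : - q d <= sup [set - q c | c in setT] by apply: ub_le_sup; [exact: hS.2 | exists d].
  by move: hc; lra.
have GZ (t : R) b : G (dual_mulr f (c + t%:C *: b)^†) = G (dual_mulr f c^†) + t%:C * G (dual_mulr f b^†).
  rewrite -functionalZ -functionalD; congr (G _); apply: dual_ext => x.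
  rewrite functional_addE functional_scaleE /= astarD astarZ amulDl amulZl functionalD functionalZ.
  by congr (_ + _ * _); exact: conjc_real.
have reb b : `|B b c - complex.Re (G (dual_mulr f b^†))| <= e / 2 * Num.sqrt (N b).
  have -> : e / 2 = Num.sqrt ((e / 2) ^+ 2) by rewrite sqrtr_sqr gtr0_norm // divr_gt0.
  rewrite -sqrtrM ?sqr_ge0 // mulrC; apply: sqr_le_sqrt; first by rewrite mulr_ge0 ?nform_ge0 ?sqr_ge0.
  apply: discriminant; [exact: nform_ge0 | exact: sqr_ge0 | move=> t].
  have := cmin (c + t%:C *: b); rewrite /q nform_line GZ.
  have -> : B c b = B b c by rewrite (pfun_herm b c); case: (f _).
  by case: (G _) => p1 p2; case: (G _) => r1 r2 /=; lra.
exists c => b; apply: le_trans (rnorm_le_ReIm _) _.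
have -> : e * Num.sqrt (N b) = e / 2 * Num.sqrt (N b) + e / 2 * Num.sqrt (N b) by lra.
apply: lerD; first by have := reb b; case: (f _) => p1 p2; case: (G _) => r1 r2.
have Ni : N ('i%C *: b) = N b.
  apply: complexI; rewrite -!pfunE astarZ amulZl amulZr scalerA functionalZ.
  rewrite [X in X * _](_ : _ = 1) ?mul1r //.
  by apply/eqP; rewrite eq_complex /=; apply/andP; split; apply/eqP; lra.
have := reb ('i%C *: b); rewrite Ni.
have -> : G (dual_mulr f ('i%C *: b)^†) = conjc 'i%C * G (dual_mulr f b^†).
  rewrite -functionalZ; congr (G _); apply: dual_ext => x.
  by rewrite functional_scaleE /= astarZ amulZl functionalZ.
have -> : f (('i%C *: b)^† · c) = conjc 'i%C * f (b^† · c).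
  by rewrite astarZ amulZl functionalZ.
case: (f _) => p1 p2; case: (G _) => r1 r2 /=.
by congr (`|_| <= _); lra.
Qed.

Lemma approx_sqrt G e c : 0 <= e -> approx e G c ->
  Num.sqrt (N c) <= 2 * binorm G * Num.sqrt (dual_norm f) + e.
Proof.
move=> e0 hc; set s := Num.sqrt (N c); have s0 : 0 <= s := sqrtr_ge0 _.
have : s ^+ 2 <= (2 * binorm G * Num.sqrt (dual_norm f) + e) * s.
  rewrite sqr_sqrtr ?nform_ge0 // mulrDl.
  have h1 := hc c; have h2 := act_bound G c; rewrite pfunE in h1.
  have : rnorm (N c)%:C <= rnorm ((N c)%:C - G (dual_mulr f c^†)) + rnorm (G (dual_mulr f c^†)).
    by rewrite -{1}(subrK (G (dual_mulr f c^†)) (N c)%:C); exact: rnormD.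
  rewrite rnormC_ge0 ?nform_ge0 // -/s in h1 h2 *; lra.
have k0 : 0 <= 2 * binorm G * Num.sqrt (dual_norm f).
  by rewrite !mulr_ge0 ?binorm_ge0 ?sqrtr_ge0.
have [->|sn] := eqVneq s 0; first by move=> _; rewrite addr_ge0.
by rewrite expr2 ler_pM2r // lt_neqAle eq_sym sn.
Qed.

Hypothesis f_star : dual_star f = f.

(* If c and d represent G and F^†, then (F G)(f) is nearly f(d^† c). *)
Lemma product_approx F G e c d : 0 <= e -> approx e G c -> approx e F^† d ->
  rnorm ((F · G) f - f (d^† · c)) <=
  e * (binorm F * Num.sqrt (dual_norm f) + (2 * binorm G * Num.sqrt (dual_norm f) + e)).
Proof.
move=> e0 hc hd.
have fs a : f a^† = conjc (f a).
  by have := congr1 (fun g : dual A => g a^†) f_star; rewrite /= astarK => <-.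
have cf_sub : (fun b => f (b · c)) \in bounded_functional_pred (@rnorm R A).
  apply/asboolP; split=> [k x y|]; first by rewrite amulDl amulZl functionalD functionalZ.
  exists (dual_norm f * rnorm c) => x; apply: le_trans (dual_bound _ _) _.
  by rewrite -mulrA ler_wpM2l ?dual_norm_ge0 // mulrC amul_rnormM.
pose cf : dual A := Functional cf_sub.
have h1 : rnorm (F (bidual_act G f) - F cf) <= binorm F * (e * Num.sqrt (dual_norm f)).
  rewrite -bidualB; apply: le_trans (bidual_bound _ _) _; rewrite ler_wpM2l ?binorm_ge0 //.
  apply: dual_norm_le => [|a]; first by rewrite mulr_ge0 ?sqrtr_ge0.
  have := hc a^†; rewrite astarK => h; rewrite [X in rnorm X](_ : _ = G (dual_mulr f a) - f (a · c)); last by [].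
  rewrite rnormB (le_trans h) // -mulrA ler_wpM2l // (le_trans (sqrt_nform_le _)) //.
  by rewrite astar_rnormE.
have h2 : rnorm (F cf - f (d^† · c)) <= e * (2 * binorm G * Num.sqrt (dual_norm f) + e).
  have := hd c; rewrite bidual_starE.
  have -> : dual_star (dual_mulr f c^†) = cf.
    by apply: dual_ext => a; rewrite /= -fs astarM !astarK.
  have -> : f (c^† · d) - conjc (F cf) = conjc (f (d^† · c) - F cf).
    by rewrite rmorphB /= (pfun_herm d c).
  rewrite rnorm_conj rnormB => h; apply: le_trans h _; rewrite ler_wpM2l //.
  exact: approx_sqrt.
have -> : (F · G) f - f (d^† · c) = (F (bidual_act G f) - F cf) + (F cf - f (d^† · c)).
  by rewrite addrA subrK.
by apply: le_trans (rnormD _ _) _; move: h1 h2; lra.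
Qed.

Lemma approx_choose (k : R) : 0 <= k -> forall d : R, 0 < d -> exists2 e : R, 0 < e & e * (k + e) <= d.
Proof.
move=> k0 d d0; have h : 0 < d / (k + 1 + d) by rewrite divr_gt0 //; lra.
exists (d / (k + 1 + d)) => //.
have h2 : d / (k + 1 + d) <= 1 by rewrite ler_pdivrMr; lra.
rewrite mulrAC ler_pdivrMr; last by lra.
by rewrite ler_pM2l //; lra.
Qed.

(** If c represents G, then [product_approx] with d = c exhibits the value as a limit of the numbers
    f(c^† c) >= 0. *)
Lemma arens_pos G : 0 <= (G^† · G) f.
Proof.
pose k := binorm G^† * Num.sqrt (dual_norm f) + 2 * binorm G * Num.sqrt (dual_norm f).
have k0 : 0 <= k by rewrite addr_ge0 ?mulr_ge0 ?binorm_ge0 ?sqrtr_ge0.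
have h (d : R) : 0 < d -> exists2 t : R, 0 <= t & rnorm ((G^† · G) f - t%:C) <= d.
  move=> d0; have [e e0 he] := approx_choose k0 d0; have [c hc] := riesz_approx G e0.
  exists (N c); first exact: nform_ge0.
  rewrite -pfunE; apply: le_trans (product_approx (ltW e0) hc _) _; first by rewrite bidual_starK.
  by rewrite addrA.
move: h; case: ((G^† · G) f) => p q h; rewrite lecE /=; apply/andP; split.
  apply/eqP/le_anti; have hq (d : R) : 0 < d -> `|q| <= d.
    move=> /h[t t0 hd]; apply: le_trans (_ : _ <= rnorm ((p +i* q)%C - t%:C)) hd.
    by apply: le_trans _ (normr_Im_le _); rewrite /= subr0.
  have : `|q| <= 0 by apply/ler_addgt0Pr => d d0; rewrite add0r hq.
  by rewrite ler_norml oppr0 andbC.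
apply/ler_addgt0Pr => d d0; have [t t0 hd] := h d d0.
have := le_trans (normr_Re_le _) hd; rewrite /= ler_norml => /andP[h1 h2]; lra.
Qed.

(** Both sides are approximated with the same c and d: (F G)(f) by f(d^† c) and (G^† F^† )(f) by
    f(c^† d), which are conjugate. *)
Lemma arens_starM_pfun F G : ((F · G)^†) f = (G^† · F^†) f.
Proof.
apply: rnorm_small_eq => dd dd0; have d2 : 0 < dd / 2 by rewrite divr_gt0.
pose k := binorm F * Num.sqrt (dual_norm f) + 2 * binorm G * Num.sqrt (dual_norm f) +
  (binorm G^† * Num.sqrt (dual_norm f) + 2 * binorm F^† * Num.sqrt (dual_norm f)).
have p1 (K : bidual A) : 0 <= binorm K * Num.sqrt (dual_norm f).
  by rewrite mulr_ge0 ?binorm_ge0 ?sqrtr_ge0.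
have k0 : 0 <= k by rewrite /k; have := p1 F; have := p1 G; have := p1 G^†; have := p1 F^†; lra.
have [e e0 he] := approx_choose k0 d2.
have [c hc] := riesz_approx G e0; have [d hd] := riesz_approx F^† e0.
have h1 := product_approx (ltW e0) hc hd.
have hc' : approx e G^†^† c by rewrite bidual_starK.
have h2 := product_approx (ltW e0) hd hc'.
have le1 : rnorm ((F · G) f - f (d^† · c)) <= dd / 2.
  apply: le_trans h1 (le_trans _ he); rewrite ler_pM2l // /k.
  by have := p1 F; have := p1 G; have := p1 G^†; have := p1 F^†; lra.
have le2 : rnorm ((G^† · F^†) f - f (c^† · d)) <= dd / 2.
  apply: le_trans h2 (le_trans _ he); rewrite ler_pM2l // /k.
  by have := p1 F; have := p1 G; have := p1 G^†; have := p1 F^†; lra.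
rewrite bidual_starE f_star.
have -> : conjc ((F · G) f) - (G^† · F^†) f =
   conjc ((F · G) f - f (d^† · c)) - ((G^† · F^†) f - f (c^† · d)).
  by rewrite rmorphB /= (pfun_herm d c); ring.
rewrite (le_trans (rnormD _ _)) // rnormN [leRHS]splitr lerD //.
by rewrite rnorm_conj.
Qed.

End PositiveFunctional.
End BidualProduct.

(** * Positive functionals span the dual; the norm of the second dual *)

Section DualJordan.
Context {R : realType} {A : cstarAlgType R}.
Implicit Types (a b c : A) (f g h : dual A) (F G H K : bidual A).

Definition posfun f := pfun f /\ dual_star f = f.

(** The complex functional with real part r is r(a) - i r(i a). On a^† a its imaginary part vanishes
    by invariance of r under the star, and bounding the two parts separately costs the factor 2. *)
Lemma complexify (r : cuz A -> R) (C : R) : (forall x y, r (x + y) = r x + r y) ->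
  (forall (t : R) x, r (t%:C *: x) = t * r x) -> (forall x, r x^† = r x) ->
  (forall x, pos x -> 0 <= r x) -> (forall x, `|r x| <= C * nrm x) ->
  exists f : dual A, [/\ posfun f, forall a, f a = (r (emb a) +i* - r ('i%C *: emb a))%C
    & dual_norm f <= 2 * C].
Proof.
move=> rD rZ rs rp rC.
have r0 : r 0 = 0 by have := rZ 0 0; rewrite scaler0 mul0r.
have rN x : r (- x) = - r x by apply/eqP; rewrite -addr_eq0 -rD addNr r0.
pose f a := (r (emb a) +i* - r ('i%C *: emb a))%C.
have fL k a b : f (k *: a + b) = k * f a + f b.
  have kE : k = (complex.Re k)%:C + 'i%C * (complex.Im k)%:C.
    by case: k => p q; apply/eqP; rewrite eq_complex /=; apply/andP; split; apply/eqP; lra.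
  have rk z : r (k *: z) = complex.Re k * r z + complex.Im k * r ('i%C *: z).
    by rewrite {1}kE scalerDl rD rZ [_ * (complex.Im k)%:C]mulrC -scalerA rZ.
  rewrite /f embD embZ scalerDr !rD (rk (emb a)) scalerA ['i%C * k]mulrC -scalerA rk scalerA mulii scaleN1r rN.
  by case: k {kE rk} => p q; apply/eqP; rewrite eq_complex /=; apply/andP; split; apply/eqP; lra.
have C0 : 0 <= C * nrm (1 : cuz A) by apply: le_trans (rC 1).
have fb a : rnorm (f a) <= 2 * C * rnorm a.
  apply: le_trans (rnorm_le_ReIm _) _; rewrite -mulrA mulrDl mul1r; apply: lerD.
    by rewrite -nrm_emb; exact: rC.
  rewrite /= normrN; apply: le_trans (rC _) _.
  by rewrite nrmZ rnorm_i mul1r nrm_emb.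
have fsub : f \in bounded_functional_pred (@rnorm R A).
  by apply/asboolP; split; [exact: fL | exists (2 * C)].
have C2 : 0 <= C.
  rewrite leNgt; apply/negP => Cn; have := rC 1; have := nrm_ge0 (1 : cuz A) => n1.
  have : nrm (1 : cuz A) != 0 by apply/eqP => /nrm_eq0/eqP; rewrite oner_eq0.
  move=> n0 h; have n1' : 0 < nrm (1 : cuz A) by rewrite lt_neqAle eq_sym n0.
  by have := normr_ge0 (r 1); nra.
exists (Functional fsub); split.
- split.
    move=> a; rewrite /= /f embM emb_star.
    have px := pos_starM (emb a); set x := _ * _ in px *.
    have ix : r ('i%C *: x) = 0.
      have := rs ('i%C *: x); rewrite starZ (pos_sa px) conj_i scaleNr rN; lra.
    by rewrite ix oppr0 ge0_realC rp.
  apply: dual_ext => a; rewrite /= /f emb_star rs.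
  have -> : r ('i%C *: (emb a)^†) = - r ('i%C *: emb a).
    by rewrite -rs starZ starK conj_i scaleNr rN.
  by rewrite opprK.
- by [].
- by apply: dual_norm_le => //; rewrite mulr_ge0.
Qed.

(** [real_jordan] is applied to Re f and Im f composed with s, the selfadjoint part of the component
    in A. That component is bounded by 3 [cnrm], and [complexify] doubles the bound, hence 6. *)
Lemma dual_jordan f : exists f1 f2 f3 f4, 
  [/\ posfun f1, posfun f2, posfun f3 & posfun f4] /\
  [/\ dual_norm f1 <= 6 * dual_norm f, dual_norm f2 <= 6 * dual_norm f,
      dual_norm f3 <= 6 * dual_norm f & dual_norm f4 <= 6 * dual_norm f] /\
  f = (f1 - f2) + 'i%C *: (f3 - f4).
Proof.
pose s (x : cuz A) : A := (2^-1)%:C *: (x.1 + x.1^†).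
have sD x y : s (x + y) = s x + s y.
  by rewrite /s /= astarD -scalerDr; congr (_ *: _); rewrite addrACA.
have sZ (t : R) x : s (t%:C *: x) = t%:C *: s x.
  have E : (t%:C *: (x.1 : A))^† = t%:C *: (x.1 : A)^†.
    by rewrite astarZ; congr (_ *: _); exact: conjc_real.
  by rewrite /s /= E -scalerDr !scalerA mulrC.
have ss x : s x^† = s x by rewrite /s /= astarK addrC.
have ns x : rnorm (s x) <= 3 * nrm x.
  rewrite rnormZ rnormC_ge0 ?invr_ge0 // ler_pdivrMl //.
  apply: le_trans (rnormD _ _) _; rewrite astar_rnormE.
  have : rnorm (x.1 : A) <= 3 * nrm x.
    by apply: le_trans (l1_le_cnrm x); rewrite lerDl rnorm_ge0.
  lra.
have bnd (p : R[i] -> R) : (forall z, `|p z| <= rnorm z) -> forall x, p (f (s x)) <= 3 * dual_norm f * nrm x.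
  move=> hp x; apply: le_trans (ler_norm _) _; apply: le_trans (hp _) _.
  apply: le_trans (dual_bound _ _) _; have := ler_wpM2l (dual_norm_ge0 f) (ns x); lra.
have [|||| g1 [g2 [hg gE]]] := @real_jordan R (cuz A) (fun x => complex.Re (f (s x))) (3 * dual_norm f).
- by move=> x y; rewrite sD functionalD; case: (f _) (f _) => ? ? [].
- by move=> t x; rewrite sZ functionalZ; case: (f _) => ? ? /=; rewrite mul0r subr0.
- by move=> x; rewrite ss.
- by apply: bnd; exact: normr_Re_le.
have [|||| g3 [g4 [hg' gE']]] := @real_jordan R (cuz A) (fun x => complex.Im (f (s x))) (3 * dual_norm f).
- by move=> x y; rewrite sD functionalD; case: (f _) (f _) => ? ? [].
- by move=> t x; rewrite sZ functionalZ; case: (f _) => ? ? /=; rewrite mul0r addr0.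
- by move=> x; rewrite ss.
- by apply: bnd; exact: normr_Im_le.
have [a1 b1 c1 d1 e1] := hg g1 (or_introl erefl); have [a2 b2 c2 d2 e2] := hg g2 (or_intror erefl).
have [a3 b3 c3 d3 e3] := hg' g3 (or_introl erefl); have [a4 b4 c4 d4 e4] := hg' g4 (or_intror erefl).
have [f1 [p1 E1 n1]] := complexify a1 b1 c1 d1 e1; have [f2 [p2 E2 n2]] := complexify a2 b2 c2 d2 e2.
have [f3 [p3 E3 n3]] := complexify a3 b3 c3 d3 e3; have [f4 [p4 E4 n4]] := complexify a4 b4 c4 d4 e4.
have six : 2 * (3 * dual_norm f) = 6 * dual_norm f by ring.
rewrite six in n1 n2 n3 n4.
exists f1, f2, f3, f4; split=> //; split=> //.
apply: dual_ext => a; rewrite functional_addE functional_scaleE.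
have -> : (f1 - f2) a = f1 a - f2 a by [].
have -> : (f3 - f4) a = f3 a - f4 a by [].
rewrite E1 E2 E3 E4; have := gE (emb a); have := gE ('i%C *: emb a).
have := gE' (emb a); have := gE' ('i%C *: emb a).
have -> : s (emb a) = (2^-1)%:C *: (a + a^†) by [].
have -> : s ('i%C *: emb a) = (2^-1)%:C *: ('i%C *: a + (- 'i%C) *: a^†).
  rewrite /s /= astarZ; congr (_ *: (_ + _ *: _)); exact: conj_i.
rewrite !functionalZ !functionalD !functionalZ.
move: (g1 _) (g2 _) (g3 _) (g4 _) (g1 _) (g2 _) (g3 _) (g4 _) => x1 x2 x3 x4 y1 y2 y3 y4.
case: (f a) => p q; case: (f a^†) => p' q' /= h1 h2 h3 h4.
by apply/eqP; rewrite eq_complex /=; apply/andP; split; apply/eqP; lra.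
Qed.

Lemma bidual_ext_pos F G : (forall f, posfun f -> F f = G f) -> F = G.
Proof.
move=> h; apply: bidual_ext => f; have [f1 [f2 [f3 [f4 [[h1 h2 h3 h4] [_ ->]]]]]] := dual_jordan f.
have e g k : posfun g -> posfun k -> F (g - k) = G (g - k) by move=> hg hk; rewrite !bidualB !h.
by rewrite (functionalD F) (functionalD G) !functionalZ !e.
Qed.

Lemma arens_starM F G : (F · G)^† = G^† · F^†.
Proof. by apply: bidual_ext_pos => f [h1 h2]; exact: arens_starM_pfun. Qed.

Lemma bidual_complete (u : nat -> bidual A) :
  (forall e, 0 < e -> exists n, forall m, (n <= m)%N -> binorm (u m - u n) <= e) ->
  exists l, forall e, 0 < e -> exists n, forall m, (n <= m)%N -> binorm (u m - l) <= e.
Proof.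
move=> hu; have sub F G f : (F - G) f = F f - G f by [].
have hc f : exists l : R[i], forall e, 0 < e -> exists n, forall m, (n <= m)%N -> rnorm (u m f - l) <= e.
  apply: complex_complete => e e0.
  have k0 : 0 < dual_norm f + 1 by rewrite ltr_wpDl ?dual_norm_ge0.
  have [n hn] := hu _ (divr_gt0 e0 k0); exists n => m nm; rewrite -sub.
  apply: le_trans (bidual_bound _ _) _; apply: le_trans (ler_wpM2r (dual_norm_ge0 f) (hn m nm)) _.
  by rewrite mulrAC ler_pdivrMr // ler_wpM2l ?(ltW e0) // lerDl.
have [l hl] := choice hc.
have unif e n : 0 < e -> (forall m, (n <= m)%N -> binorm (u m - u n) <= e) ->
    forall f, rnorm (u n f - l f) <= e * dual_norm f.
  move=> e0 hn f; apply/ler_addgt0Pr => d d0; have [m hm] := hl f d d0.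
  have M := leq_maxl m n; have := hm _ M; have := hn _ (leq_maxr m n).
  set k := maxn m n => h1 h2.
  rewrite (_ : u n f - l f = (u k f - l f) - (u k - u n) f); last by rewrite sub; ring.
  rewrite (le_trans (rnormD _ _)) // rnormN addrC lerD //.
  by apply: le_trans (bidual_bound _ _) _; rewrite ler_wpM2r ?dual_norm_ge0.
have lsub : l \in bounded_functional_pred (@dual_norm R A).
  apply/asboolP; split.
    move=> k f g; apply: rnorm_small_eq => d d0.
    have k1 : 0 < rnorm k + 2 by rewrite ltr_wpDl ?rnorm_ge0.
    have d1 := divr_gt0 d0 k1.
    have [n1 h1] := hl f _ d1; have [n2 h2] := hl g _ d1; have [n3 h3] := hl (k *: f + g) _ d1.
    pose m := maxn n1 (maxn n2 n3).
    have e1 := h1 m (leq_maxl _ _).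
    have e2 := h2 m (leq_trans (leq_maxl n2 n3) (leq_maxr n1 _)).
    have e3 := h3 m (leq_trans (leq_maxr n2 n3) (leq_maxr n1 _)).
    have -> : l (k *: f + g) - (k * l f + l g) =
      k * (u m f - l f) + (u m g - l g) - (u m (k *: f + g) - l (k *: f + g)).
      by rewrite functionalD functionalZ; ring.
    apply: le_trans (rnormD _ _) _; rewrite rnormN.
    apply: le_trans (lerD (rnormD _ _) e3) _; rewrite rnormM.
    apply: le_trans (lerD (lerD (ler_wpM2l (rnorm_ge0 k) e1) e2) (lexx _)) _.
    have : d / (rnorm k + 2) * (rnorm k + 2) = d by rewrite divfK // gt_eqF.
    by move: (d / _) => x; lra.
  have [n hn] := hu 1 ltr01; exists (binorm (u n) + 1) => f.
  rewrite (_ : l f = u n f - (u n f - l f)); last by rewrite subKr.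
  rewrite (le_trans (rnormD _ _)) // rnormN mulrDl lerD ?bidual_bound //.
  exact: unif.
exists (Functional lsub) => e e0; have e2 : 0 < e / 2 by rewrite divr_gt0.
have [n hn] := hu _ e2; exists n => m nm; apply: binorm_le; first exact: ltW.
move=> f; rewrite [X in rnorm X](_ : _ = (u m - u n) f + (u n f - l f)); last first.
  by rewrite sub addrA subrK.
rewrite (le_trans (rnormD _ _)) // [X in _ <= X * _]splitr mulrDl lerD //; last exact: unif.
by apply: le_trans (bidual_bound _ _) _; rewrite ler_wpM2r ?dual_norm_ge0 ?hn.
Qed.

Lemma binorm_eq0 F : binorm F = 0 -> F = 0.
Proof.
move=> h; apply: bidual_ext => f; apply: rnorm_small_eq => d d0.
rewrite subr0; apply: le_trans (bidual_bound _ _) _; rewrite h mul0r; exact: ltW.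
Qed.
Lemma binormD F G : binorm (F + G) <= binorm F + binorm G.
Proof.
apply: binorm_le => [|f]; first by rewrite addr_ge0 ?binorm_ge0.
by rewrite functional_addE (le_trans (rnormD _ _)) // mulrDl lerD ?bidual_bound.
Qed.
Lemma binormZ (k : R[i]) F : binorm (k *: F) = rnorm k * binorm F.
Proof.
have le (l : R[i]) G : binorm (l *: G) <= rnorm l * binorm G.
  apply: binorm_le => [|f]; first by rewrite mulr_ge0 ?rnorm_ge0 ?binorm_ge0.
  by rewrite functional_scaleE rnormM -mulrA ler_wpM2l ?rnorm_ge0 ?bidual_bound.
apply: le_anti; rewrite le /=.
have [->|k0] := eqVneq k 0; first by rewrite rnorm0 mul0r binorm_ge0.
have := le k^-1 (k *: F); rewrite scalerA mulVf // scale1r => h.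
have kk : rnorm k * rnorm k^-1 = 1 by rewrite -rnormM divff // rnorm1.
by apply: le_trans (ler_wpM2l (rnorm_ge0 k) h) _; rewrite mulrA kk mul1r.
Qed.
Lemma binormM F G : binorm (F · G) <= binorm F * binorm G.
Proof.
apply: binorm_le => [|f]; first by rewrite mulr_ge0 ?binorm_ge0.
rewrite arensE (le_trans (bidual_bound _ _)) // -mulrA ler_wpM2l ?binorm_ge0 //.
exact: dual_norm_act.
Qed.
Lemma binorm_star F : binorm F^† = binorm F.
Proof.
have le G : binorm G^† <= binorm G.
  apply: binorm_le => [|f]; first exact: binorm_ge0.
  by rewrite bidual_starE rnorm_conj -(dual_norm_star f) bidual_bound.
by apply: le_anti; rewrite le -{1}(bidual_starK F) le.
Qed.

End DualJordan.

(** * Regularity and weak* limits of bounded families *)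

Section BidualLimit.
Context {R : realType} {A : cstarAlgType R}.
Implicit Types (a b c : A) (f g h : dual A) (F G H K : bidual A).

Lemma bidual_ext_re F G : (forall f, complex.Re (F f) = complex.Re (G f)) -> F = G.
Proof.
move=> h; apply: bidual_ext => f; have := h f; have := h ('i%C *: f); rewrite !functionalZ.
by case: (F f) (G f) => p q [p' q'] /= h1 h2; apply/eqP; rewrite eq_complex /=; apply/andP; split; apply/eqP; lra.
Qed.

(* By regularity, F |-> (G F)(f) is evaluation at an element of the dual. *)
Definition dual_actr G f : dual A := dual_star (bidual_act G^† (dual_star f)).
Lemma dual_actrE F G f : (G · F) f = F (dual_actr G f).
Proof. by rewrite -[G · F]bidual_starK arens_starM bidual_starE arensE bidual_starE conjcK. Qed.

Lemma posfun_im F f : F^† = F -> posfun f -> complex.Im (F f) = 0.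
Proof. by move=> hF [_ hf]; have := bidual_starE F f; rewrite hF hf; case: (F f) => p q [] /=; lra. Qed.

(** f has four positive parts, each of norm at most 6 ‖f‖. *)
Lemma posfun_binorm (C : R) F : 0 <= C ->
  (forall f, posfun f -> rnorm (F f) <= C * dual_norm f) -> binorm F <= 24 * C.
Proof.
move=> C0 h; apply: binorm_le => [|f]; first by rewrite mulr_ge0.
have [f1 [f2 [f3 [f4 [[p1 p2 p3 p4] [[n1 n2 n3 n4] fE]]]]]] := dual_jordan f.
rewrite {1}fE functionalD functionalZ !bidualB.
apply: le_trans (rnormD _ _) _; rewrite rnormM rnorm_i mul1r.
apply: le_trans (lerD (rnormD _ _) (rnormD _ _)) _; rewrite !rnormN.
have b g : posfun g -> dual_norm g <= 6 * dual_norm f -> rnorm (F g) <= C * (6 * dual_norm f).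
  by move=> pg ng; apply: le_trans (h g pg) _; rewrite ler_wpM2l.
by move: (b _ p1 n1) (b _ p2 n2) (b _ p3 n3) (b _ p4 n4); lra.
Qed.

(** The functional F |-> (G^† F G)(f), which by regularity is evaluation at an element of the
    dual. *)
Definition dual_conj G f : dual A := dual_actr G^† (bidual_act G f).
Lemma dual_conjE G F f : (G^† · (F · G)) f = F (dual_conj G f).
Proof. by rewrite /dual_conj -dual_actrE arensA. Qed.

Lemma posfun_conj G f : posfun f -> posfun (dual_conj G f).
Proof.
move=> [pf sf]; have e a : dual_conj G f a = (G^† · (bidual_embed a · G)) f by rewrite dual_conjE.
split=> [a|].
  by rewrite e bidual_embedM bidual_embed_star -arensA arensA -arens_starM; exact: arens_pos.
apply: dual_ext => a; rewrite -[LHS]/(conjc (dual_conj G f a^†)) !e.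
by rewrite -{1}sf -bidual_starE !arens_starM bidual_starK -bidual_embed_star astarK -arensA.
Qed.

Section Limit.
Context {T : Type} (B : set_system T) (BP : ProperFilter B).
Variables (v : T -> bidual A) (C : R).
Hypothesis v_bound : forall t, binorm (v t) <= C.
Let L : (T -> R) -> R := projT1 (cid (generalized_limit (R := R) BP)).
Let LD u w : rbounded u -> rbounded w -> L (fun t => u t + w t) = L u + L w.
Proof. by have [h _ _] := projT2 (cid (generalized_limit (R := R) BP)); exact: h. Qed.
Let LZ (c : R) u : rbounded u -> L (fun t => c * u t) = c * L u.
Proof. by have [_ h _] := projT2 (cid (generalized_limit (R := R) BP)); exact: h. Qed.
Let Lle u (c : R) : rbounded u -> B [set t | u t <= c] -> L u <= c.
Proof. by have [_ _ h] := projT2 (cid (generalized_limit (R := R) BP)); exact: h. Qed.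
Let re f t := complex.Re (v t f).

Let re_bound f : rbounded (re f).
Proof.
exists (C * dual_norm f) => t; apply: le_trans (normr_Re_le _) _.
by apply: le_trans (bidual_bound _ _) _; rewrite ler_wpM2r ?dual_norm_ge0.
Qed.
Let l f : R[i] := (L (re f) +i* - L (re ('i%C *: f)))%C.

Let ReZ (p q : R) f : L (re ((p +i* q)%C *: f)) = p * L (re f) + q * L (re ('i%C *: f)).
Proof.
have bZ (c : R) u : rbounded u -> rbounded (fun t : T => c * u t).
  by move=> [K hK]; exists (`|c| * K) => t; rewrite normrM ler_wpM2l.
have -> : re ((p +i* q)%C *: f) = (fun t => p * re f t + q * re ('i%C *: f) t).
  by apply/funext => t; rewrite /re !functionalZ; case: (v t f) => r s /=; lra.
by rewrite (LD (bZ p _ (re_bound _)) (bZ q _ (re_bound _))) !LZ //; exact: re_bound.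
Qed.

Let ReD f g : L (re (f + g)) = L (re f) + L (re g).
Proof.
rewrite -(LD (re_bound f) (re_bound g)); congr (L _); apply/funext => t; rewrite /re functionalD.
by case: (v t f) (v t g) => ? ? [].
Qed.

Let l_lin k f g : l (k *: f + g) = k * l f + l g.
Proof.
rewrite /l scalerDr !ReD scalerA; case: k => p q.
rewrite (_ : 'i%C * (p +i* q)%C = (- q +i* p)%C); last by apply/eqP; rewrite eq_complex /=; apply/andP; split; apply/eqP; lra.
by rewrite (ReZ p q) (ReZ (- q) p); apply/eqP; rewrite eq_complex /=; apply/andP; split; apply/eqP; lra.
Qed.

Let l_le (c : R) f : B [set t | complex.Re (v t f) <= c] -> complex.Re (l f) <= c.
Proof. exact: Lle (re_bound f). Qed.

Let l_bound f : rnorm (l f) <= 2 * C * dual_norm f.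
Proof.
have re_le g : L (re g) <= C * dual_norm g.
  apply: (Lle (re_bound g)); apply: filterS filterT => t _ /=.
  apply: le_trans (ler_norm _) _; apply: le_trans (normr_Re_le _) _.
  by apply: le_trans (bidual_bound _ _) _; rewrite ler_wpM2r ?dual_norm_ge0.
have re_abs g : `|L (re g)| <= C * dual_norm g.
  rewrite ler_norml re_le andbT lerNl -mulN1r -(rnorm1 (R := R)) -rnormN.
  have := re_le (-1 *: g); rewrite dual_normZ rnormN rnorm1 mul1r => h; apply: le_trans h.
  by have := ReZ (-1) 0 g; rewrite mul0r addr0 => <-; rewrite (_ : (-1 +i* 0)%C = -1) //; apply/eqP; rewrite eq_complex /= oppr0 !eqxx.
apply: le_trans (rnorm_le_ReIm _) _; rewrite /= normrN -mulrA mulrDl mul1r lerD //.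
by have := re_abs ('i%C *: f); rewrite dual_normZ rnorm_i mul1r.
Qed.

Let l_sub : l \in bounded_functional_pred (@dual_norm R A).
Proof. by apply/asboolP; split; [exact: l_lin | exists (2 * C); exact: l_bound]. Qed.

(** A weak* cluster point of the bounded family [v] along [B], rebuilt from real parts since the
    generalized limit is real. *)
Definition blim : bidual A := Functional l_sub.

Lemma blim_le (c : R) f : B [set t | complex.Re (v t f) <= c] -> complex.Re (blim f) <= c.
Proof. exact: l_le. Qed.

Lemma blim_ge (c : R) f : B [set t | c <= complex.Re (v t f)] -> c <= complex.Re (blim f).
Proof.
move=> h; rewrite -lerN2; have -> : - complex.Re (blim f) = complex.Re (blim (-1 *: f)).
  by rewrite functionalZ mulN1r; case: (blim f).
apply: blim_le; apply: filterS h => t /=; rewrite functionalZ mulN1r.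
by case: (v t f) => ? ?; rewrite /= lerN2.
Qed.

Lemma blim_lim f (x : R[i]) : (forall d : R, 0 < d -> B [set t | rnorm (v t f - x) <= d]) ->
  blim f = x.
Proof.
move=> h; have key (k : R[i]) : complex.Re (k * blim f) = complex.Re (k * x).
  have e (d : R) : 0 < d -> B [set t | `|complex.Re (v t (k *: f)) - complex.Re (k * x)| <= d].
    move=> d0; have k0 : 0 < rnorm k + 1 by rewrite ltr_wpDl ?rnorm_ge0.
    apply: filterS (h _ (divr_gt0 d0 k0)) => t /= ht; rewrite functionalZ.
    have -> : complex.Re (k * v t f) - complex.Re (k * x) = complex.Re (k * (v t f - x)).
      by case: k {k0} (v t f) x {h ht} => ? ? [? ?] [? ?] /=; lra.
    apply: le_trans (normr_Re_le _) _; rewrite rnormM.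
    apply: le_trans (ler_wpM2l (rnorm_ge0 k) ht) _.
    by rewrite mulrCA ler_piMr ?(ltW d0) // ler_pdivrMr // mul1r lerDl.
  rewrite -functionalZ; apply: le_anti; apply/andP; split; apply/ler_addgt0Pr => d d0.
    by apply: blim_le; apply: filterS (e d d0) => t /=; rewrite ler_norml => /andP[_]; lra.
  by rewrite -lerBlDr; apply: blim_ge; apply: filterS (e d d0) => t /=; rewrite ler_norml => /andP[]; lra.
have := key 1; have := key 'i%C; case: (blim f) x {h key} => p q [p' q'] /= h1 h2.
by apply/eqP; rewrite eq_complex /=; apply/andP; split; apply/eqP; lra.
Qed.

Lemma blim_cst f (x : R[i]) : B [set t | v t f = x] -> blim f = x.
Proof.
by move=> h; apply: blim_lim => d d0; apply: filterS h => t /= ->; rewrite subrr rnorm0 ltW.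
Qed.

Lemma blim_eq f g : B [set t | v t f = v t g] -> blim f = blim g.
Proof.
move=> h; apply/eqP; rewrite -subr_eq0 -bidualB; apply/eqP/blim_cst.
by apply: filterS h => t /= h; rewrite bidualB h subrr.
Qed.

Lemma blim_star : (forall t, (v t)^† = v t) -> blim^† = blim.
Proof.
move=> h; have e g t : v t (dual_star g) = conjc (v t g).
  by rewrite -[v t in LHS]h bidual_starE dual_starK.
have re_e g : complex.Re (blim (dual_star g)) = complex.Re (blim g).
  by congr (L _); apply/funext => t; rewrite /re e; case: (v t g).
by apply: bidual_ext_re => f; rewrite bidual_starE -[in RHS]re_e; case: (blim _).
Qed.

(** Multiplying f by the conjugate of the value makes the value real, which improves the constant 2
    C of the construction to C; the unit of the second dual thereby gets norm at most 1. *)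
Lemma blim_binorm : binorm blim <= C.
Proof.
have [t0 _] := filter_ex (@filterT _ B _).
have C0 : 0 <= C := le_trans (binorm_ge0 (v t0)) (v_bound t0).
apply: binorm_le => // f; have [->|h0] := eqVneq (blim f) 0.
  by rewrite rnorm0 mulr_ge0 ?dual_norm_ge0.
have hp : 0 < rnorm (blim f).
  by rewrite lt_neqAle rnorm_ge0 andbT eq_sym; apply/eqP => /rnorm_eq0; exact/eqP.
pose k := conjc (blim f).
have kE : complex.Re (k * blim f) = rnorm (blim f) ^+ 2.
  rewrite /rnorm /k normc_def; case: (blim f) => p q /=.
  by rewrite sqr_sqrtr ?addr_ge0 ?sqr_ge0 //; ring.
have := @blim_le (C * dual_norm (k *: f)) (k *: f).
have nk : rnorm k = rnorm (blim f) := rnorm_conj (blim f).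
rewrite (functionalZ blim) kE dual_normZ nk expr2 mulrCA ler_pM2l //; apply.
apply: filterS filterT => t _ /=; apply: le_trans (ler_norm _) _; apply: le_trans (normr_Re_le _) _.
rewrite functionalZ rnormM nk ler_wpM2l ?rnorm_ge0 //.
by apply: le_trans (bidual_bound _ _) _; rewrite ler_wpM2r ?dual_norm_ge0.
Qed.

End Limit.
End BidualLimit.

(** * Limits of increasing projections, and the unit of the second dual *)

Section ProjectionChain.
Context {R : realType} {A : cstarAlgType R}.
Implicit Types (a b c : A) (f g h : dual A) (F G H K : bidual A).
Local Notation "a ^^" := (bidual_embed a) (at level 2, format "a ^^").

Lemma embed_bound a : binorm a^^ <= rnorm a.
Proof. by apply: binorm_le => [|f]; [exact: rnorm_ge0 | rewrite mulrC; exact: dual_bound]. Qed.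

Definition proj_chain (v : nat -> A) :=
  (forall n, projection (v n)) /\ (forall n, v n.+1 · v n = v n).

Lemma chain_le v n m : proj_chain v -> (n <= m)%N -> v m · v n = v n.
Proof.
move=> [hv vS]; elim: m => [|m IH]; first by rewrite leqn0 => /eqP ->; exact: (hv 0%N).2.
rewrite leq_eqVlt => /predU1P[->|]; first exact: (hv m.+1).2.
by rewrite ltnS => /IH h; rewrite -h amulA vS.
Qed.

Lemma chain_bound v n : proj_chain v -> binorm (v n)^^ <= 1.
Proof.
move=> [hv _]; apply: le_trans (embed_bound _) _.
have := rnorm_starM (v n); rewrite (hv n).1 (hv n).2 => h.
have [->|n0] := eqVneq (rnorm (v n)) 0; first exact: ler01.
have : rnorm (v n) = 1 by apply: (mulfI n0); rewrite mulr1 {3}h expr2.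
by move=> ->.
Qed.

Section ChainLimit.
Variables (v : nat -> A) (hv : proj_chain v).

Definition chain_lim : bidual A := blim eventually_filter (fun n => chain_bound n hv).

Lemma chain_limM a : (forall d : R, 0 < d -> exists n, forall m, (n <= m)%N -> rnorm (v m · a - a) <= d) ->
  chain_lim · a^^ = a^^.
Proof.
move=> h; apply: bidual_ext => f; rewrite arensE; apply: blim_lim => d d0.
have f1 : 0 < dual_norm f + 1 by rewrite ltr_wpDl ?dual_norm_ge0.
have [n hn] := h _ (divr_gt0 d0 f1); exists n => // m /hn {}hn /=.
rewrite -dualB; apply: le_trans (dual_bound _ _) _.
apply: le_trans (ler_wpM2l (dual_norm_ge0 f) hn) _.
by rewrite mulrCA ler_piMr ?(ltW d0) // ler_pdivrMr // mul1r lerDl.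
Qed.

Lemma chain_lim_star : chain_lim^† = chain_lim.
Proof. by apply: blim_star => n; rewrite -bidual_embed_star (hv.1 n).1. Qed.

(** Left multiplication by G is weak*-continuous by [dual_actrE], so the absorption of the v_n
    passes to the limit. *)
Lemma chain_lim_absorb G : (forall n, G · (v n)^^ = (v n)^^) -> G · chain_lim = chain_lim.
Proof.
move=> h; apply: bidual_ext => f; rewrite dual_actrE; apply: blim_eq; apply: filterS filterT => n _.
have e : (v n)^^ (dual_actr G f) = (v n)^^ f by rewrite -dual_actrE h.
exact: e.
Qed.

Lemma chain_lim_ge n : chain_lim · (v n)^^ = (v n)^^.
Proof.
apply: bidual_ext => f; rewrite arensE; apply: blim_cst; exists n => // m nm.
have e : (v m)^^ (bidual_act (v n)^^ f) = (v n)^^ f by rewrite -arensE -bidual_embedM (chain_le hv nm).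
exact: e.
Qed.

Lemma chain_lim_proj : projection chain_lim.
Proof. by split; [exact: chain_lim_star | apply: chain_lim_absorb => n; exact: chain_lim_ge]. Qed.

End ChainLimit.

(** The last three fields witness that the second dual is nonzero, as its ring structure
    requires. *)
Record approx_unit := ApproxUnit {
  au : nat -> A;
  au_chain : proj_chain au;
  au_lim : forall a (d : R), 0 < d -> exists n, forall m, (n <= m)%N -> rnorm (au m · a - a) <= d;
  au_functional : dual A;
  au_elt : A;
  au_neq0 : au_functional au_elt != 0 }.

Section Unit.
Variable D : approx_unit.
Definition bidual_one : bidual A := chain_lim (au_chain D).

Lemma bidual_one_embed a : bidual_one · a^^ = a^^.
Proof. exact/chain_limM/au_lim. Qed.

Lemma arens1r F : F · bidual_one = F.
Proof.
apply: bidual_ext => f; rewrite arensE; congr (F _); apply: dual_ext => a.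
have e : a^^ · bidual_one = a^^.
  rewrite -[LHS]bidual_starK arens_starM -bidual_embed_star.
  by rewrite chain_lim_star bidual_one_embed -bidual_embed_star astarK.
exact: (congr1 (fun F : bidual A => F f) e).
Qed.

Lemma arens1l F : bidual_one · F = F.
Proof.
by rewrite -[LHS]bidual_starK arens_starM chain_lim_star arens1r bidual_starK.
Qed.

Lemma bidual_one_neq0 : bidual_one != 0.
Proof.
apply/eqP => h; case/eqP: (au_neq0 D); have := bidual_one_embed (au_elt D).
by rewrite h => /(congr1 (fun F : bidual A => F (au_functional D))); rewrite arensE => /= <-.
Qed.

Lemma root_bound (s t : R) : 0 <= s -> 0 <= t -> t ^+ 2 <= 2 * s * t -> t ^+ 2 <= 4 * s ^+ 2.
Proof.
move=> s0 t0 h; have st : t <= 2 * s.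
  have [te|tn] := eqVneq t 0; first by rewrite te mulr_ge0.
  have tp : 0 < t by rewrite lt_neqAle eq_sym tn.
  by rewrite -(ler_pM2r tp) -expr2.
by have := ler_pM t0 t0 st st; rewrite -!expr2 exprMn -natrX.
Qed.

(** f(a) is the limit of f(u_n a), and Cauchy-Schwarz bounds it by 2 sqrt(f(1)) sqrt(‖f‖) ‖a‖. So
    ‖f‖ <= 2 sqrt(f(1) ‖f‖), which gives the constant 4. *)
Lemma posfun_norm_le f : posfun f -> dual_norm f <= 4 * complex.Re (bidual_one f).
Proof.
move=> [pf sf]; have [hv vS] := au_chain D.
have ge n : complex.Re (f (au D n)) <= complex.Re (bidual_one f).
  apply: blim_ge; exists n => // m nm /=; have vnm := chain_le (au_chain D) nm.
  have E : au D m - au D n = (au D m - au D n)^† · (au D m - au D n).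
    have subl x y z : (x - y) · z = x · z - y · z :> A by rewrite amulDl -scaleN1r amulZl scaleN1r.
    have subr x y z : z · (x - y) = z · x - z · y :> A by rewrite amulDr -scaleN1r amulZr scaleN1r.
    have vmn : au D n · au D m = au D n by rewrite -{1}(hv n).1 -(hv m).1 -astarM vnm (hv n).1.
    have sE : (au D m - au D n)^† = au D m - au D n.
      by rewrite astarD -scaleN1r astarZ rmorphN1 (hv m).1 (hv n).1.
    rewrite sE subl !subr !(hv _).2 vnm vmn.
    by rewrite subrr subr0.
  have := nform_ge0 pf (au D m - au D n); rewrite /nform -E dualB.
  by case: (f (au D m)) (f (au D n)) => ? ? [? ?] /=; lra.
set k := complex.Re _ in ge *.
have k0 : 0 <= k.
  apply: le_trans (ge 0%N); have := nform_ge0 pf (au D 0%N).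
  by rewrite /nform (hv _).1 (hv _).2.
have h : dual_norm f <= 2 * Num.sqrt k * Num.sqrt (dual_norm f).
  apply: dual_norm_le; first by rewrite !mulr_ge0 ?sqrtr_ge0.
  move=> a; apply/ler_addgt0Pr => d d0.
  have f1 : 0 < dual_norm f + 1 by rewrite ltr_wpDl ?dual_norm_ge0.
  have [n hn] := au_lim D a (divr_gt0 d0 f1).
  have -> : f a = f ((au D n)^† · a) - f (au D n · a - a) by rewrite dualB (hv _).1 subKr.
  apply: le_trans (rnormD _ _) _; rewrite rnormN; apply: lerD.
    apply: le_trans (pfun_CS pf _ _) _; rewrite -!mulrA ler_wpM2l //.
    apply: ler_pM; rewrite ?sqrtr_ge0 ?sqrt_nform_le //.
    by apply: ler_wsqrtr; rewrite /nform (hv _).1 (hv _).2.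
  apply: le_trans (dual_bound _ _) _; apply: le_trans (ler_wpM2l (dual_norm_ge0 f) (hn n (leqnn n))) _.
  by rewrite mulrCA ler_piMr ?(ltW d0) // ler_pdivrMr // mul1r lerDl.
have := root_bound (sqrtr_ge0 k) (sqrtr_ge0 (dual_norm f)).
by rewrite (sqr_sqrtr k0) (sqr_sqrtr (dual_norm_ge0 f)); apply.
Qed.

End Unit.
End ProjectionChain.
Arguments approx_unit {R} A.

(** An alias carrying [D], because the unit of the ring is built from the approximate unit. *)
Definition bidual_ring {R : realType} (A : cstarAlgType R) (D : approx_unit A) := bidual A.

(** * The second dual as a unital ring, and square roots in it *)

Section BidualRing.
Context {R : realType} {A : cstarAlgType R} (D : approx_unit A).
Local Notation B := (bidual_ring D).

HB.instance Definition _ := StarLmodule.copy B (bidual A).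

Let arens_mul (F G : B) : B := (F : bidual A) · G.
Let mA : associative arens_mul. Proof. exact: arensA. Qed.
Let m1l : left_id (bidual_one D : B) arens_mul. Proof. exact: arens1l. Qed.
Let m1r : right_id (bidual_one D : B) arens_mul. Proof. exact: arens1r. Qed.
Let mDl : left_distributive arens_mul +%R. Proof. by move=> F G H; exact: arensDl. Qed.
Let mDr : right_distributive arens_mul +%R. Proof. by move=> F G H; exact: arensDr. Qed.
HB.instance Definition _ := GRing.Zmodule_isNzRing.Build B mA m1l m1r mDl mDr (bidual_one_neq0 D).

Let mZl (k : R[i]) (x y : B) : k *: (x * y) = (k *: x) * y.
Proof. by apply/esym; exact: arensZl. Qed.
HB.instance Definition _ := GRing.Lmodule_isLalgebra.Build R[i] B mZl.
Let mZr (k : R[i]) (x y : B) : k *: (x * y) = x * (k *: y).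
Proof. by apply/esym; exact: arensZr. Qed.
HB.instance Definition _ := GRing.Lalgebra_isAlgebra.Build R[i] B mZr.

Let n1 : binorm (1 : B) <= 1. Proof. exact: blim_binorm. Qed.
HB.instance Definition _ := isUnitalBanach.Build R B
  (@binorm_eq0 R A) (@binormD R A) (@binormZ R A) (@binormM R A) n1 (@bidual_complete R A).

Implicit Types (F G H x y : B) (f : dual A).
Lemma bring_starM x y : (x * y)^† = y^† * x^†. Proof. exact: arens_starM. Qed.
Lemma bring_starD x y : (x + y)^† = x^† + y^†. Proof. exact: bidual_starD. Qed.
Lemma bring_starZ (t : R) x : (t%:C *: x)^† = t%:C *: x^†.
Proof. by rewrite -[X in _ = X *: _]conjcR; exact: bidual_starZ. Qed.
Lemma bring_starN x : (- x)^† = - x^†.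
Proof. by rewrite -scaleN1r -(rmorphN1 (real_complex R)) bring_starZ rmorphN1 scaleN1r. Qed.
Lemma bring_valB x y f : (x - y) f = x f - y f. Proof. by []. Qed.
Lemma bring_star1 : (1 : B)^† = 1. Proof. exact: chain_lim_star. Qed.

Lemma sqrt_poly_star H n : H^† = H -> (real_eval H (sqrt_poly n))^† = real_eval H (sqrt_poly n).
Proof.
move=> hH; elim: n => [|n IH].
  rewrite /= -polyC0 real_evalC (_ : (0 : R)%:C = 0) // scale0r.
  by rewrite -{1}(scale0r (1 : B)) -[X in X *: _](rmorph0 (real_complex R)) bring_starZ rmorph0 scale0r.
by rewrite real_eval_sqrt_poly bring_starZ bring_starD bring_starM hH IH.
Qed.

Definition bge0 x := forall f, posfun f -> 0 <= complex.Re (x f).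

Lemma bge0_conj x y : x^† = x -> bge0 y -> bge0 (x * y * x).
Proof.
move=> hx hy f pf; have -> : (x * y * x) f = y (dual_conj x f).
  by rewrite -mulrA -{1}hx; exact: dual_conjE.
exact/hy/posfun_conj.
Qed.
Lemma bge0D x y : bge0 x -> bge0 y -> bge0 (x + y).
Proof.
by move=> hx hy f pf; have := hx f pf; have := hy f pf; rewrite functional_addE; case: (x f) (y f) => ? ? [? ?] /=; lra.
Qed.

(* Where 0 <= x <= 1, the powers of 1 - x decrease, so that sqrt_iteration applies. *)
Lemma contraction_sqrt x : x^† = x -> bge0 x -> bge0 (1 - x) -> exists2 y : B, y^† = y & x = y * y.
Proof.
move=> sx hx hH; pose H := 1 - x.
have sH : H^† = H.
  by rewrite /H bring_starD bring_star1 bring_starN sx.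
have xH : x * H = H * x by rewrite /H mulrBr mulrBl mulr1 mul1r.
(* Induction in steps of two, since conjugation by H preserves positivity. *)
have pow y n : y * H = H * y -> bge0 y -> bge0 (H * y) -> bge0 (H ^+ n * y).
  move=> yH h0 h1; suff : bge0 (H ^+ n * y) /\ bge0 (H ^+ n.+1 * y) by case.
  elim: n => [|n [IH1 IH2]]; first by rewrite expr0 mul1r expr1.
  split=> //; have -> : H ^+ n.+2 * y = H * (H ^+ n * y) * H by rewrite exprS exprSr -!mulrA yH.
  exact: bge0_conj.
have p1 : bge0 1 by have := bge0D hH hx; rewrite subrK.
have pH n : bge0 (H ^+ n) by have := pow 1 n; rewrite mulr1 mul1r !mulr1; apply.
have px n : bge0 (H ^+ n * x).
  (* Uses x + H = 1 to write H x as a sum of two conjugates. *)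
  apply: pow => //; have -> : H * x = H * x * H + x * H * x.
    by rewrite xH -mulrDr /H subrK mulr1.
  by apply: bge0D; exact: bge0_conj.
(* On a positive f the powers of H decrease, so their values lie between 0 and f(1); [posfun_binorm]
   turns this into a uniform norm bound. *)
have bnd n : nrm (H ^+ n) <= 24 * 1.
  apply: posfun_binorm => // f pf.
  have le : complex.Re ((H ^+ n : B) f) <= complex.Re ((1 : B) f).
    elim: n => [|n IH]; first by rewrite expr0.
    apply: le_trans IH; have := px n f pf; have -> : H ^+ n * x = H ^+ n - H ^+ n.+1.
      by rewrite exprSr /H mulrBr mulr1 subKr.
    by rewrite bring_valB; case: ((H ^+ n) f) ((H ^+ n.+1) f) => ? ? [? ?] /=; lra.
  have sHn : (H ^+ n)^† = H ^+ n.
    by elim: n {le} => [|n IH]; [exact: bring_star1 | rewrite {1}exprS bring_starM IH sH -exprSr].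
  apply: le_trans (rnorm_le_ReIm _) _; rewrite (posfun_im sHn pf) normr0 addr0 ger0_norm; last exact: pH.
  apply: le_trans le _; apply: le_trans (ler_norm _) _; apply: le_trans (normr_Re_le _) _.
  by apply: le_trans (bidual_bound _ _) _; rewrite ler_wpM2r ?dual_norm_ge0 ?nrm1.
have [y ylim yE] := sqrt_iteration bnd.
have sy : y^† = y.
  apply: (nlim_uniq (u := fun n => real_eval H (sqrt_poly n))) => // d /ylim[n hn].
  exists n => m /hn; congr (_ <= _); rewrite -[LHS]binorm_star; congr binorm.
  by rewrite -[RHS]/(real_eval H (sqrt_poly m) - y^†) -bring_starN -{2}(sqrt_poly_star m sH) -bring_starD.
exists (1 - y).
  by rewrite bring_starD bring_star1 bring_starN sy.
apply/eqP; rewrite -subr_eq0; apply/eqP.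
have -> : x - (1 - y) * (1 - y) = (y + y) - ((1 - x) + y * y) by nring.
by rewrite -/H -yE subrr.
Qed.

End BidualRing.

Section BidualPositive.
Context {R : realType} {A : cstarAlgType R} (D : approx_unit A).
Implicit Types (F G H : bidual A) (f : dual A).

(** Dividing F by 4 ‖F‖ + 1 brings it below the unit, as F(f) <= ‖F‖ ‖f‖ <= 4 ‖F‖ f(1); then
    [contraction_sqrt] applies. *)
Lemma bidual_positive F : F^† = F -> (forall f, posfun f -> 0 <= complex.Re (F f)) -> positive F.
Proof.
move=> sF hF; pose c := (4 * binorm F + 1)^-1.
have k0 : 0 < 4 * binorm F + 1 by rewrite ltr_wpDl // mulr_ge0 ?binorm_ge0.
have c0 : 0 < c by rewrite invr_gt0.
pose x : bidual_ring D := c%:C *: F.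
have xE f : complex.Re ((x : bidual A) f) = c * complex.Re (F f).
  by rewrite functional_scaleE; case: (F f) => p q /=; rewrite mul0r subr0.
have [||| y sy yE] := @contraction_sqrt R A D x.
- by rewrite bring_starZ sF.
- by move=> f pf; rewrite xE mulr_ge0 ?(ltW c0) ?hF.
- move=> f pf; rewrite bring_valB.
  have h1 := posfun_norm_le D pf; have h2 := bidual_bound F f.
  have h3 := le_trans (ler_norm _) (normr_Re_le (F f)).
  have h4 : c * complex.Re (F f) <= complex.Re (bidual_one D f).
    rewrite ler_pdivrMl //; apply: le_trans h3 _; apply: le_trans h2 _.
    have := ler_wpM2l (binorm_ge0 F) h1; have := dual_norm_ge0 f; move: h1; nra.
  rewrite -[(1 : bidual_ring D) f]/(bidual_one D f).
  by move: h4; rewrite -xE; case: (bidual_one D f) (x f) => ? ? [? ?] /=; lra.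
exists ((Num.sqrt (4 * binorm F + 1))%:C *: (y : bidual A)).
have sy' : (y : bidual A)^† = y by [].
rewrite bidual_starZ sy' conjcR arensZl arensZr scalerA -rmorphM /= sqrt_mul ?(ltW k0) //.
have <- : x = (y : bidual A) · y := yE.
by rewrite /x scalerA -rmorphM /= mulfV ?gt_eqF // scale1r.
Qed.

End BidualPositive.

(** * Order, range projections and suprema in the second dual *)

Section RangeAndOrder.
Context {R : realType} {A : cstarAlgType R} (D : approx_unit A).
Implicit Types (a b c : A) (f g : dual A) (F G H p q : bidual A).
Local Notation "a ^^" := (bidual_embed a) (at level 2, format "a ^^").

Lemma positive_val F f : positive F -> posfun f -> 0 <= F f.
Proof. by move=> [y ->] [pf sf]; exact: arens_pos. Qed.
Lemma positive_re F f : positive F -> posfun f -> 0 <= complex.Re (F f).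
Proof. by move=> h /(positive_val h); case: (F f) => ? ?; rewrite lecE => /andP[]. Qed.
Lemma positive_star F : positive F -> F^† = F.
Proof. by move=> [y ->]; rewrite arens_starM bidual_starK. Qed.
Lemma bidualN_val F G f : (F - G) f = F f - G f. Proof. by []. Qed.
Lemma bidual_starB F G : (F - G)^† = F^† - G^†.
Proof.
apply: bidual_ext => f; rewrite bidual_starE !bidualN_val !bidual_starE.
by case: (F _) (G _) => ? ? [? ?]; apply/eqP; rewrite eq_complex /=; apply/andP; split; apply/eqP; lra.
Qed.
Lemma aleE F G : ale F G -> forall f, posfun f -> complex.Re (F f) <= complex.Re (G f).
Proof.
move=> h f /(positive_re h); rewrite bidualN_val.
by case: (F f) (G f) => ? ? [? ?] /=; lra.
Qed.
Lemma aleI F G : F^† = F -> G^† = G ->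
  (forall f, posfun f -> complex.Re (F f) <= complex.Re (G f)) -> ale F G.
Proof.
move=> sF sG h; apply: (bidual_positive D); first by rewrite bidual_starB sF sG.
move=> f /h; rewrite bidualN_val; case: (F f) (G f) => ? ? [? ?] /=; lra.
Qed.
Lemma bidual_posD F G : positive F -> positive G -> positive (F + G).
Proof.
move=> hF hG; apply: (bidual_positive D); first by rewrite bidual_starD !positive_star.
move=> f pf; have := positive_re hF pf; have := positive_re hG pf; rewrite functional_addE.
by case: (F f) (G f) => ? ? [? ?] /=; lra.
Qed.
Lemma ale_proj p q : projection p -> projection q -> q · p = p -> ale p q.
Proof.
move=> [sp pp] [sq qq] qp; have pq : p · q = p by rewrite -[LHS]bidual_starK arens_starM sp sq qp sp.
have subl x y z : (x - y) · z = x · z - y · z :> bidual A by rewrite -scaleN1r arensDl arensZl scaleN1r.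
have subr x y z : z · (x - y) = z · x - z · y :> bidual A by rewrite -scaleN1r arensDr arensZr scaleN1r.
by exists (q - p); rewrite bidual_starB sp sq subl !subr pp qq qp pq subrr subr0.
Qed.

Section Range.
Variables (a : A) (v y : nat -> A).
Hypotheses (hv : proj_chain v) (vy : forall n, v n = a · y n).
Hypothesis v_lim : forall d : R, 0 < d -> exists n, forall m, (n <= m)%N -> rnorm (v m · a - a) <= d.

Lemma chain_lim_range : is_range_projection a^^ (chain_lim hv).
Proof.
split; [exact: chain_lim_proj | exact: chain_limM |].
move=> q hq qa; split=> //; first exact: chain_lim_proj.
by apply: chain_lim_absorb => n; rewrite vy bidual_embedM arensA qa.
Qed.

Lemma embed_proj b : projection b -> projection b^^.
Proof. by move=> [sb bb]; split; rewrite -?bidual_embed_star -?bidual_embedM ?sb ?bb. Qed.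

Lemma chain_lim_lub : is_lub (range (fun n => (v n)^^)) (chain_lim hv).
Proof.
split.
  move=> _ [n _ <-]; apply: ale_proj; [exact/embed_proj/hv.1 | exact: chain_lim_proj | exact: chain_lim_ge].
move=> F hF; have h n : ale (v n)^^ F by apply: hF; exists n.
apply: aleI; first exact: chain_lim_star.
  have := positive_star (h 0%N); rewrite bidual_starB (embed_proj (hv.1 0%N)).1.
  exact: addIr.
by move=> f pf; apply: blim_le; apply: filterS filterT => n _; exact: aleE (h n) f pf.
Qed.
End Range.

(* The pointwise limit of the net S is an upper bound, hence above its supremum. *)
Lemma lub_pointwise (S : set (bidual A)) F f (c : R) : S !=set0 -> S `<=` positive ->
  up_directed S -> is_lub S F -> posfun f -> (forall G, S G -> complex.Re (G f) <= c) ->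
  complex.Re (F f) <= c.
Proof.
move=> [G0 SG0] Spos Sdir [Fub Flub] pf hc.
have ale_refl G : ale G G by exists 0; rewrite subrr -[in X in _ · X](scale0r (0 : bidual A)) arensZr scale0r.
have ale_trans G H K : ale G H -> ale H K -> ale G K.
  by move=> h1 h2; rewrite /ale -(subrK H K) -addrA; exact: bidual_posD.
pose B : set_system (bidual A) := fun P => exists2 G, S G & forall H, S H -> ale G H -> P H.
have BP : ProperFilter B.
  split; first by move=> [G SG h]; exact: h G SG (ale_refl G).
  split; first by exists G0.
  - move=> P Q [G SG hG] [H SH hH]; have [K [SK GK HK]] := Sdir G H SG SH.
    by exists K => // J SJ KJ; split; [apply: hG | apply: hH] => //; exact: ale_trans KJ.
  - by move=> P Q PQ [G SG hG]; exists G => // H SH GH; exact/PQ/hG.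
(* The value 0 outside S keeps the family bounded; the filter B of tails of S does not see it. *)
pose v G : bidual A := if `[< S G >] then G else 0.
have vS G : S G -> v G = G by move=> h; rewrite /v asboolT.
have vb G : binorm (v G) <= 24 * binorm F.
  apply: posfun_binorm => [|g pg]; first exact: binorm_ge0.
  rewrite /v; case: asboolP => SG; last by rewrite rnorm0 mulr_ge0 ?binorm_ge0 ?dual_norm_ge0.
  apply: le_trans _ (bidual_bound F g); apply: le_trans _ (normr_Re_le _).
  apply: le_trans _ (ler_norm _); apply: le_trans _ (aleE (Fub G SG) pg).
  apply: le_trans (rnorm_le_ReIm _) _; rewrite (posfun_im (positive_star (Spos G SG)) pg) normr0 addr0.
  by rewrite ger0_norm // positive_re //; exact: Spos.
pose L := blim BP vb.
have sL : L^† = L.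
  apply: blim_star => G; rewrite /v; case: asboolP => [/Spos/positive_star //|_].
  by apply: bidual_ext => g; rewrite bidual_starE; exact: conjc0.
have : ale F L.
  apply: Flub => G SG; apply: aleI => //; first exact/positive_star/Spos.
  move=> g pg; apply: blim_ge; exists G => // H SH GH; rewrite /= vS //; exact: aleE.
move=> /aleE/(_ f pf)/le_trans; apply; apply: blim_le; exists G0 => // G SG _.
by rewrite /= vS //; exact: hc.
Qed.

End RangeAndOrder.

(** * The normal extension of a trace *)

Section NormalWeight.
Context {R : realType} {A : cstarAlgType R} (D : approx_unit A).
Implicit Types (a b c : A) (f g : dual A) (F G X Y : bidual A).
Local Notation "a ^^" := (bidual_embed a) (at level 2, format "a ^^").
Local Notation u := (au D).

Lemma dual_actr_embed c f a : dual_actr c^^ f a = f (c · a).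
Proof. by rewrite -[LHS]/(a^^ (dual_actr c^^ f)) -dual_actrE -bidual_embedM. Qed.

Variable psi : nat -> dual A.
Hypothesis psi_pos : forall n, posfun (psi n).
Hypothesis psi_mono : forall n, posfun (psi n.+1 - psi n).
Hypothesis psi_swap : forall n m a b, psi n (a · u m · b) = psi m (b · u n · a).

(* Both sides are evaluations at elements of the dual, first in X, then in Y. *)
Lemma bidual_swap n m X Y : (X · (u m)^^ · Y) (psi n) = (Y · (u n)^^ · X) (psi m).
Proof.
have half b : (X · (u m)^^ · b^^) (psi n) = (b^^ · (u n)^^ · X) (psi m).
  rewrite -arensA -!bidual_embedM (arensE X) (dual_actrE X (b · u n)^^); congr (X _); apply: dual_ext => a.
  rewrite -[LHS]/(psi n (a · (u m · b))).
  by rewrite dual_actr_embed -psi_swap amulA.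
rewrite dual_actrE -arensA arensE; congr (Y _); apply: dual_ext => b.
by rewrite -[LHS]/(b^^ (dual_actr _ _)) -dual_actrE half -arensA.
Qed.

Definition normal_sup_weight := sup_weight (fun n F => complex.Re (F (psi n))).

Let S_ge0 n F : positive F -> 0 <= complex.Re (F (psi n)).
Proof. by move=> pF; exact: positive_re. Qed.
Let S_mono n F : positive F -> complex.Re (F (psi n)) <= complex.Re (F (psi n.+1)).
Proof.
move=> pF; have := positive_re pF (psi_mono n); rewrite bidualB.
by case: (F _) (F _) => ? ? [? ?] /=; lra.
Qed.

(** (X u_m X^† )(psi_n) = (X^† u_n X)(psi_m) <= (X^† X)(psi_m). If all the right-hand sides stayed
    below (X X^† )(psi_n) - d, so would the limit over m of the left-hand sides, which is (X X^†
    )(psi_n) itself. *)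
Lemma bidual_trace n X d : 0 < d -> exists m, 
  complex.Re ((X · X^†) (psi n)) <= complex.Re ((X^† · X) (psi m)) + d.
Proof.
move=> d0; apply: contrapT => /forallNP h.
suff : complex.Re ((X · X^†) (psi n)) <= complex.Re ((X · X^†) (psi n)) - d by lra.
have E F : (X · (F · X^†)) (psi n) = F (dual_conj X^† (psi n)) by rewrite -dual_conjE bidual_starK.
have le m : complex.Re ((u n)^^ (dual_conj X (psi m))) <= complex.Re ((X^† · X) (psi m)).
  have <- : X^† · (bidual_one D · X) = X^† · X by rewrite arens1l.
  rewrite dual_conjE; apply: aleE; last exact: posfun_conj.
  by apply: ale_proj; [exact/embed_proj/(au_chain D).1 | exact: chain_lim_proj | exact: chain_lim_ge].
have val m : complex.Re ((u m)^^ (dual_conj X^† (psi n))) <= complex.Re ((X · X^†) (psi n)) - d.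
  have := le m; rewrite -E arensA bidual_swap -arensA dual_conjE.
  by have /negP := h m; rewrite -ltNge; lra.
have {1}<- : X · (bidual_one D · X^†) = X · X^† by rewrite arens1l.
by rewrite E; apply: blim_le; apply: filterS filterT => m _; exact: val.
Qed.

Lemma normal_sup_weight_tracial : tracial_weight normal_sup_weight.
Proof.
apply: (sup_weight_tracial S_ge0 S_mono).
- exact: bidual_posD.
- move=> t F t0 [y ->]; exists ((Num.sqrt t)%:C *: y).
  by rewrite bidual_starZ conjcR arensZl arensZr scalerA -rmorphM /= sqrt_mul.
- by move=> X; split; [exists X^†; rewrite bidual_starK | exists X].
- by move=> n F G; rewrite functional_addE; case: (F _) (G _) => ? ? [].
- by move=> n t F; rewrite functional_scaleE; case: (F _) => ? ? /=; rewrite mul0r subr0.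
- move=> n X d d0; split; first exact: bidual_trace.
  by have := bidual_trace n X^† d0; rewrite bidual_starK.
Qed.

(** Each psi_n preserves suprema of directed sets by [lub_pointwise], and the weight is the supremum
    of the psi_n. *)
Lemma normal_sup_weight_normal : normal_weight normal_sup_weight.
Proof.
move=> S F S0 Spos Sdir lubF; have [Fub _] := lubF; have [G0 SG0] := S0.
have [w0 _ wD _ _] := normal_sup_weight_tracial.
have pF : positive F by rewrite -(subrK G0 F); apply: (bidual_posD D); [exact: Fub | exact: Spos].
set s := ereal_sup _; have sub G : S G -> (normal_sup_weight G <= s)%E.
  by move=> SG; apply: ereal_sup_ubound; exists G.
apply/le_anti/andP; split.
  apply: sup_weight_le => // n; have : (0 <= s)%E by exact: le_trans (w0 _ (Spos _ SG0)) (sub _ SG0).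
  move: sub; case: s => [r| |] // sub _; last by rewrite leey.
  rewrite lee_fin; apply: (lub_pointwise D S0 Spos Sdir lubF (psi_pos n)) => G SG.
  by rewrite -lee_fin; apply: le_trans (sub G SG); apply: sup_weight_ub; exact: Spos.
apply: ge_ereal_sup => _ [G SG <-]; rewrite -[X in (_ <= normal_sup_weight X)%E](subrK G) addrC.
rewrite wD; [exact: leeDl (w0 _ (Fub G SG)) | exact: Spos | exact: Fub].
Qed.

End NormalWeight.

(** * The trace of a range projection, and the characterization *)

Section RangeTrace.
Context {R : realType} (A : cstarAlgType R) (e : A).
Implicit Types (phi : A -> R[i]) (x y v w g : cuz A) (a b : A) (p q f : cuz A).
Hypothesis rr0 : @rank0 R (cuz A).
Hypothesis hsimple : simple_cstar A.
Hypothesis he : projection e.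
Hypothesis e0 : e != 0.
Local Notation T := (tracial_states e).
Local Notation "a ^^" := (bidual_embed a) (at level 2, format "a ^^").
Let hI := alg_star_ideal A.
Variables (P : nat -> cuz A) (N : nat -> nat) (z : nat -> nat -> cuz A).
Hypothesis hP : forall n, proj (P n) /\ in_base (P n).
Hypothesis Plim : forall x, in_base x -> nlim (fun n => P n * x) x.
Hypothesis PS : forall n, P n.+1 * P n = P n.
Hypothesis hz : forall k i, emb e * z k i = z k i.
Hypothesis PE : forall n, P n = \sum_(k < n) \sum_(i < N k) (z k i)^† * z k i.
Variable phi : A -> R[i].
Hypothesis hphi : T phi.
Local Notation t := (tau e N z phi).

Lemma tau_le_mono p q : proj p -> in_base p -> proj q -> in_base q -> q * p = p -> t p <= t q.
Proof.
move=> hp ip hq iq qp; rewrite -subr_ge0 -(tauB hsimple he e0 hP Plim hz PE) //.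
by apply: (tau_ge0 hsimple he e0 hP Plim hz PE) => //; [exact: proj_compl | exact: (idealB hI)].
Qed.

Lemma tau_msub p q : proj p -> in_base p -> proj q -> in_base q -> msub p q -> t p <= t q.
Proof.
move=> hp ip hq iq [v [vv qv]]; have iv : in_base v by rewrite -qv; exact: (idealMr hI).
have [h1 h2 <-] := tau_mulstar he hP Plim hz PE hphi hp ip iv vv.
by apply: tau_le_mono => //; rewrite mulrA qv.
Qed.

(* Cutting p by the range of p q leaves a projection that q almost annihilates,
   and a Neumann series removes the remaining term. *)
Lemma tau_span_bound x : span (@in_base R A) x -> exists C, forall p, proj p -> in_base p ->
  (exists y, p = p * x * y) -> t p <= C.
Proof.
elim=> [|k q x' hq iq _ [C hC]].
  by exists (t 0) => p _ _ [y ->]; rewrite mulr0 mul0r.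
exists (t q + C) => p hp ip [y pE].
pose y1 := k *: y; have y10 : 0 < nrm y1 + 1 by rewrite ltr_wpDl ?nrm_ge0.
(* Small enough that H below has norm less than 1. *)
have d0 : 0 < 2^-1 / (nrm y1 + 1) by rewrite divr_gt0 ?invr_gt0.
have [f [w [hf fE nf]]] := range_cutoff rr0 (p * q) d0.
have pf : p * f = f by rewrite fE !mulrA hp.2.
have fpq : f = p * q * w * (q * p) by rewrite fE starM hp.1 hq.1 mulrA.
have fi : in_base f by rewrite -pf; exact: (idealMr hI).
have hf' : proj (p - f) := proj_compl hf hp pf.
have fq : msub f q by apply: (msub_factor hf fpq); rewrite mulrA hq.2.
have -> : t p = t f + t (p - f).
  by rewrite (tauB hsimple he e0 hP Plim hz PE) // addrC subrK.
apply: lerD; first exact: tau_msub.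
apply: hC => //; first exact: (idealB hI).
have fp : f * p = f by rewrite -{1}hf.1 -hp.1 -starM pf hf.1.
pose H := (p - f) * q * y1.
have nH : nrm H < 1.
  have E : (p - f) * q = (1 - f) * (p * q) by rewrite mulrBl mulrBl mul1r !mulrA fp.
  rewrite /H E; apply: le_lt_trans (nrmM _ _) _; apply: le_lt_trans (ler_wpM2r (nrm_ge0 _) nf) _.
  rewrite mulrAC ltr_pdivrMr // mul1r; have := nrm_ge0 y1; lra.
have [g [hg _]] := neumann nH.
have pfp : (p - f) * p = p - f by rewrite mulrBl hp.2 fp.
(* p = p (k q + x') y is multiplied by p - f on the left and on the right, and the term with q,
   which is H, is moved to the left-hand side. *)
have E : (p - f) * (1 - H) = (p - f) * x' * y.
  have : (p - f) * p = (p - f) * (p * (k *: q + x') * y) by rewrite -pE.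
  rewrite !mulrA pfp mulrDr mulrDl => E.
  rewrite mulrBr mulr1 /H !mulrA hf'.2 {1}E /y1 -scalerAr -scalerAr -scalerAl.
  by rewrite addrC addKr.
exists (y * g); rewrite mulrA -E -mulrA hg mulr1 //.
Qed.

Lemma frame_unit : exists D : approx_unit A, forall n, emb (au D n) = P n.
Proof.
have EP n : emb (alg_part (P n)) = P n by rewrite -in_baseP //; case: (hP n).
have chain : proj_chain (fun n => alg_part (P n)).
  split=> n; first by apply/projection_emb; rewrite EP; case: (hP n).
  by apply: emb_inj; rewrite embM !EP PS.
have lim a (d : R) : 0 < d -> exists n, forall m, (n <= m)%N -> rnorm (alg_part (P m) · a - a) <= d.
  move=> d0; have [n hn] := Plim (in_base_emb a) d0; exists n => m /hn.
  by rewrite -nrm_emb embB embM EP.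
have [|||||f [_ fE _]] := @complexify R A (re e phi) 1.
- exact: reD.
- exact: reZ.
- by move=> x; rewrite /re ev_star //; case: (ev _ _ _).
- exact: re_pos.
- by move=> x; rewrite mul1r; exact: re_bound.
have fe : f e != 0.
  by rewrite fE re_one //; apply/eqP => /(congr1 (@complex.Re R))/= /eqP; rewrite oner_eq0.
by exists (ApproxUnit chain lim fe).
Qed.

Lemma psum_functional : exists psi : nat -> dual A, (forall n, posfun (psi n)) /\
  forall n a, psi n a = (psum e phi N z n (emb a) +i* - psum e phi N z n ('i%C *: emb a))%C.
Proof.
have h n : exists f : dual A, posfun f /\
   forall a, f a = (psum e phi N z n (emb a) +i* - psum e phi N z n ('i%C *: emb a))%C.
  have [C _ hC] := psum_bound he hphi N z n.
  have [|||||f [pf fE _]] := @complexify R A (psum e phi N z n) C; last by exists f.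
  - exact: psumD.
  - exact: psumZ.
  - move=> x; apply: eq_bigr => k _; apply: eq_bigr => i _.
    by rewrite -[in RHS](starK (z k i)) -{1}(starK (z k i)) -!starM -mulrA /re ev_star // starK; case: (ev _ _ _).
  - exact: psum_pos.
  - exact: hC.
by have [psi hpsi] := choice h; exists psi; split=> n; have [] := hpsi n.
Qed.

(** [normal_extension] is defined by choice, so it suffices to exhibit one weight with these
    properties; it is the one given by the functionals of the partial sums [psum]. *)
Lemma normal_extensionP : let W := normal_extension (weight_of e phi) in
  [/\ tracial_weight W, normal_weight W & forall a, positive a -> W a^^ = trace_weight e phi N z a].
Proof.
move=> W; have [D DP] := frame_unit; have [psi [pp psiE]] := psum_functional.
rewrite -(weight_ofE he hphi hP Plim hz PE).
suff ex : exists w : bidual A -> \bar R, [/\ tracial_weight w, normal_weight w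
  & forall a, positive a -> w a^^ = weight_of e phi a] by exact: (xgetPex (fun=> 0%E) ex).
have psi_mono n : posfun (psi n.+1 - psi n).
  split=> [a|]; last first.
    apply: dual_ext => a; have [_ h1] := pp n.+1; have [_ h2] := pp n.
    rewrite -[in RHS]h1 -[in RHS]h2 -[LHS]/(conjc (psi n.+1 a^† - psi n a^†)).
    by rewrite -[RHS]/(conjc (psi n.+1 a^†) - conjc (psi n a^†)) rmorphB.
  have [h1 _] := pp n.+1; have [h2 _] := pp n.
  have E (f : dual A) : pfun f -> f (a^† · a) = (complex.Re (f (a^† · a)))%:C by move=> pf; exact: pfunE.
  rewrite -[X in _ <= X]/(psi n.+1 (a^† · a) - psi n (a^† · a)) E // (E (psi n)) // !psiE /=.
  rewrite -rmorphB ge0_realC subr_ge0; apply: psum_mono => //.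
  by apply/positive_emb; exists a.
have psi_swap n m a b : psi n (a · au D m · b) = psi m (b · au D n · a).
  have E x y : psum e phi N z n (x * P m * y) = psum e phi N z m (y * P n * x) := psum_swap he hphi hz PE n m x y.
  by rewrite !psiE !embM !DP (E (emb a)) !scalerAl (E ('i%C *: emb a)) -scalerAr !scalerAl.
exists (normal_sup_weight psi); split.
- exact: (normal_sup_weight_tracial pp psi_mono psi_swap).
- exact: (normal_sup_weight_normal pp psi_mono psi_swap).
move=> a pa; have pE : positive a^^.
  by case: pa => y ->; exists y^^; rewrite bidual_embedM bidual_embed_star.
rewrite (weight_ofE he hphi hP Plim hz PE) /normal_sup_weight /trace_weight !sup_weightE //.
by rewrite (_ : (fun n => _) = (fun n => (psum e phi N z n (emb a))%:E)) //; apply/funext => n; rewrite /= psiE.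
Qed.

Lemma trace_weight_embed p : proj p -> in_base p ->
  normal_extension (weight_of e phi) (alg_part p)^^ = (t p)%:E.
Proof.
move=> hp ip; have [_ _ ->] := normal_extensionP; first exact: (tauE hsimple he e0 hP Plim hz PE).
by apply/positive_emb; rewrite -in_baseP //; exact: proj_pos.
Qed.

Lemma normal_extension_le (F G : bidual A) : positive F -> ale F G ->
  (normal_extension (weight_of e phi) F <= normal_extension (weight_of e phi) G)%E.
Proof.
move=> pF FG; have [[w0 _ wD _ _] _ _] := normal_extensionP.
by rewrite -[X in (_ <= normal_extension _ X)%E](subrK F) addrC wD //; exact: leeDl (w0 _ FG).
Qed.

Lemma range_chain a : exists (v y : nat -> A) (hv : proj_chain v),
  (forall n, v n = a · y n) /\ is_range_projection a^^ (chain_lim hv).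
Proof.
have d0 n : 0 < 4^-1 ^+ n :> R by rewrite exprn_gt0 // invr_gt0.
have [r [hr or nr]] := range_sequence rr0 hI (in_base_emb a) d0.
pose Q n := \sum_(k < n) r k.
have hQ n : proj (Q n) by apply: proj_sum_nat => // k; case: (hr k).
have iQ n : in_base (Q n) by apply: (ideal_sum hI) => k _; case: (hr k).
have EQ n : emb (alg_part (Q n)) = Q n by rewrite -in_baseP.
have QS n : Q n.+1 * Q n = Q n.
  rewrite /Q big_ord_recr /= mulrDl (hQ n).2 -[RHS]addr0; congr (_ + _).
  by rewrite mulr_sumr big1 // => k _; rewrite or // eq_sym neq_ltn ltn_ord.
have hv : proj_chain (fun n => alg_part (Q n)).
  split=> n; first by apply/projection_emb; rewrite EQ.
  by apply: emb_inj; rewrite embM !EQ QS.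
have hy n : exists y : A, alg_part (Q n) = a · y.
  elim: n => [|n [y IH]]; first by exists 0; apply: emb_inj; rewrite EQ embM emb0 mulr0 /Q big_ord0.
  have [_ _ [y' iy' rE]] := hr n; exists (y + alg_part y'); apply: emb_inj.
  by rewrite embM embD mulrDr -embM -IH !EQ -in_baseP // /Q big_ord_recr /= rE.
have [y yE] := choice hy; exists (fun n => alg_part (Q n)), y, hv; split=> //.
(* [nr m] concerns the complement of m + 1 projections, that is of Q (m + 1); hence the shift. *)
apply: chain_lim_range yE _ => d /pow4_small[n hn]; exists n.+1 => -[|m] // nm.
have E : emb (alg_part (Q m.+1) · a - a) = - ((1 - Q m.+1) * emb a).
  by rewrite embB embM EQ mulrBl mul1r opprB.
rewrite -nrm_emb E nrmN; apply: le_trans (nr m) _; exact: hn.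
Qed.

Lemma range_trace_ge a p : proj p -> in_base p -> (exists y, p = emb a * y) ->
  ((t p)%:E <= normal_extension (weight_of e phi) (range_projection a))%E.
Proof.
move=> hp ip [y pE]; have [v [y' [hv [_ hr]]]] := range_chain a.
have [D _] := frame_unit.
have [hR Ra _] : is_range_projection a^^ (range_projection a) by apply: xgetPex; exists (chain_lim hv).
have hp' : projection (alg_part p) by apply/projection_emb; rewrite -in_baseP.
have pE' : alg_part p = a · alg_part (y * p).
  apply: emb_inj; rewrite embM -!in_baseP //; last exact: (idealMl hI).
  by rewrite mulrA -pE hp.2.
rewrite -trace_weight_embed //; apply: normal_extension_le.
  by have [h1 h2] := embed_proj hp'; exists (alg_part p)^^; rewrite h1 h2.
by apply: ale_proj => //; [exact: embed_proj | rewrite pE' bidual_embedM arensA Ra].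
Qed.

Lemma range_trace_le a (C : R) : (forall p, proj p -> in_base p -> (exists y, p = emb a * y) -> t p <= C) ->
  (normal_extension (weight_of e phi) (range_projection a) <= C%:E)%E.
Proof.
move=> hC; have [v [y [hv [vE hr]]]] := range_chain a; have [D _] := frame_unit.
have [hR Ra Rmin] : is_range_projection a^^ (range_projection a) by apply: xgetPex; exists (chain_lim hv).
have [hr1 hr2 _] := hr; have [_ _ rR] := Rmin _ hr1 hr2.
have [_ wN wE] := normal_extensionP.
have pproj (q : bidual A) : projection q -> positive q by move=> [h1 h2]; exists q; rewrite h1 h2.
apply: le_trans (normal_extension_le (pproj _ hR) (ale_proj hR hr1 rR)) _.
rewrite (wN (range (fun n => (v n)^^))).
- apply: ge_ereal_sup => _ [_ [n _ <-] <-].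
  have := @trace_weight_embed (emb (v n)); rewrite alg_partK => -> //; last exact/projection_emb/hv.1.
  by rewrite lee_fin; apply: hC => //; [exact/projection_emb/hv.1 | exists (emb (y n)); rewrite -embM vE].
- by exists (v 0%N)^^; exists 0%N.
- by move=> _ [n _ <-]; apply/pproj/embed_proj/hv.1.
- move=> _ _ [n _ <-] [m _ <-]; have le i j : (i <= j)%N -> ale (v i)^^ (v j)^^.
    by move=> ij; apply: ale_proj; try exact/embed_proj/hv.1; rewrite -bidual_embedM (chain_le hv).
  by exists (v (maxn n m))^^; split; [exists (maxn n m) | apply/le/leq_maxl | apply/le/leq_maxr].
- exact: (chain_lim_lub D).
Qed.

End RangeTrace.

Theorem corollary6p6 (R : realType) (A : cstarAlgType R) (e : A)
    (hsigma : sigma_unital A) (hsimple : simple_cstar A)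
    (hsep : separable A) (hrr : real_rank_zero A) (hsr : stable_rank_one A)
    (he : reference_projection e) (hcomp : strict_comparison e)
    (hfin : finite_set (extreme_points (tracial_states e))) (a : A) :
  combination_of_projections a <->
  forall phi : A -> R[i], tracial_states e phi ->
    (normal_extension (weight_of e phi) (range_projection a) < +oo)%E.
Proof.
have [hE e0 _] := he; have rr0 := alg_rank0 hrr.
have [P [N [z [hP Plim PS hz PE]]]] := corner_frame rr0 hsigma hsimple hE e0.
rewrite combination_emb; split=> [sa phi hphi|h].
  have [C hC] := tau_span_bound rr0 hsimple hE e0 hP Plim hz PE hphi sa.
  apply: le_lt_trans (ltry C).
  apply: (range_trace_le rr0 hsimple hE e0 hP Plim PS hz PE hphi) => p hp ip [y pE].
  by apply: hC => //; exists y; rewrite -mulrA -pE hp.2.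
apply: (finite_trace_in_span rr0 hsimple hsep hE e0 hcomp hfin hP Plim hz PE) => phi [hphi _].
(* The hypothesis excludes +oo and the lower bound from [range_trace_ge] excludes -oo, so [fine]
   returns the value itself. *)
exists (fine (normal_extension (weight_of e phi) (range_projection a))) => p hp ip pE.
have le := range_trace_ge rr0 hsimple hE e0 hP Plim PS hz PE hphi hp ip pE.
by move: (h phi hphi) le; case: (normal_extension _ _) => [r||] //=; rewrite ?lee_fin // leNgt ltNyr.
Qed.
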